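(* Let $\mathbf{X}:M\to\mathbb{E}^3$ be a non-flat minimal immersion of an oriented surface $M$. Then for every point $p$ in the complement $M'$ of the umbilic locus there exist a neighbourhood $U_p$ of $p$ and a sequence of minimal immersions $\mathbf{X}_n:U_p\to\mathbb{E}^3$, with $\mathbf{X}_n$ having degree $n$, so that $\lim_{n\to\infty}\Vert\mathbf{X}_n-\mathbf{X}\Vert_{g_{Eucl}}=0$ locally uniformly, where $\Vert\cdot\Vert_{g_{Eucl}}$ is the Euclidean norm.
   Context: Surfaces are smooth; $\mathbb{E}^3$ is Euclidean $3$-space. Let $\mathbf{X}:M\to\mathbb{E}^3$ be a minimal immersion of an oriented surface, with induced metric $g=d\mathbf{X}\cdot d\mathbf{X}$, Gauss curvature $K\leqslant 0$, and orientation-compatible Gauss map $\mathbf{N}=(\mathbf{N}^1,\mathbf{N}^2,\mathbf{N}^3):M\to S^2$. ''Non-flat'' means $K\not\equiv 0$. $M$ carries the complex structure determined by $g$ and the orientation. The umbilic locus is the set of points where both principal curvatures vanish, equivalently where $K=0$; $M'$ denotes its complement. The stereographically projected Gauss map $G=(\mathbf{N}^1+i\mathbf{N}^2)/(1-\mathbf{N}^3):M\to\hat{\mathbb{C}}=\mathbb{C}\cup\{\infty\}$ is meromorphic, and locally injective on $M'$. On $M'$ the metric $g_0=\sqrt{-K}\,g$ is flat. Entropy differentials. Let $L$ be the canonical bundle of $M$, and let $\nabla$ be the Levi-Civita connection of $g_0$. In a local holomorphic coordinate $z$ on $M'$ write $\nabla_{\partial_z}\partial_z=\gamma\,\partial_z$.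 For a section $\sigma=s\,dz^\ell$ of $L^\ell$ let $\sigma'=(\partial_z s-\ell\gamma s)\,dz^{\ell+1}$, a section of $L^{\ell+1}$ (independent of the coordinate); for functions this is $f'=\partial f$. For a locally injective meromorphic function $f$ set $$\mathrm{S}^\nabla_2(f)=\frac{f'''}{f'}-\frac32\left(\frac{f''}{f'}\right)^2=\left(\{f,z\}+\tfrac12\gamma^2-\partial_z\gamma\right)dz^2,\qquad \{f,z\}=\frac{\partial_z^3f}{\partial_z f}-\frac32\left(\frac{\partial_z^2 f}{\partial_z f}\right)^2,$$ where $\{f,z\}$ is the classical Schwarzian derivative, extended to poles of $f$ in the usual way by $\{f,z\}=\{1/f,z\}$, and $\mathrm{S}^\nabla_{\ell+1}(f)=(\mathrm{S}^\nabla_\ell(f))'$ for $\ell\geqslant 2$. The entropy differentials of $\mathbf{X}$ are $P_\ell=\mathrm{S}^\nabla_\ell(G)$, $\ell\geqslant 2$, on $M'$; they are holomorphic on $M'$ and extend meromorphically to $M$. Degree. For a non-flat minimal immersion with entropy differentials $(P_\ell)_{\ell\geqslant 2}$ and an integer $n\geqslant 2$, consider the condition that $P_n$ vanishes identically or that $P_n=\psi_n(P_2,\ldots,P_{n-1})$ for some polynomial $\psi_n:\mathbb{C}^{n-2}\to\mathbb{C}$ that is weighted-homogeneous of degree $n$ with weights $(2,3,\ldots,n-1)$, i.e. $\psi_n$ is not identically zero and $\psi_n(\lambda^2z_1,\lambda^3z_2,\ldots,\lambda^{n-1}z_{n-2})=\lambda^n\psi_n(z_1,\ldots,z_{n-2})$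 for all $\lambda\neq 0$; products of differentials are tensor products. If the condition holds for $n$, it holds for all $m\geqslant n$. The immersion is said to have degree $n$ if $n$ is the smallest integer for which this condition holds. *)

(* Defs.v *)
From HB Require Import structures.
From mathcomp Require Import all_boot all_order all_algebra.
From mathcomp Require Import all_classical all_reals all_analysis.
From mathcomp Require Import complex.
From mathcomp Require mpoly.

Set Implicit Arguments.
Unset Strict Implicit.
Unset Printing Implicit Defensive.

Import Order.TTheory GRing.Theory Num.Theory.
Import numFieldNormedType.Exports.

Local Open Scope classical_set_scope.
Local Open Scope ring_scope.
Local Open Scope complex_scope.

(* The coordinate plane is 'rV[R]_2, with z = w 0 0 + iunit * w 0 1. *)
Section PlaneCalculus.
Context {R : realType}.

(* Num.imaginary, also written 'i, is only some square root of -1. *)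
Definition iunit : R[i] := 0 +i* 1.

Definition partial (i : 'I_2) (f : 'rV[R]_2 -> R) : 'rV[R]_2 -> R :=
  fun w => 'D_(delta_mx 0 i) f w.

Definition iter_partial (s : seq 'I_2) (f : 'rV[R]_2 -> R) : 'rV[R]_2 -> R :=
  foldr partial f s.

(* C^oo on O: all iterated partial derivatives exist and are continuous at the
   points of O, which is meant to be open. *)
Definition smooth_on (O : set 'rV[R]_2) (f : 'rV[R]_2 -> R) : Prop :=
  forall (s : seq 'I_2) (w : 'rV[R]_2), O w ->
    {for w, continuous (iter_partial s f)} /\
    forall i : 'I_2, derivable (iter_partial s f) w (delta_mx 0 i).

Definition smooth_map_on (k : nat) (O : set 'rV[R]_2)
    (F : 'rV[R]_2 -> 'rV[R]_k) : Prop :=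
  forall j : 'I_k, smooth_on O (fun w => F w 0 j).

(* Row i is the i-th partial derivative of F (transpose of the usual Jacobian
   matrix). *)
Definition jacobian (k : nat) (F : 'rV[R]_2 -> 'rV[R]_k) (w : 'rV[R]_2) :
    'M[R]_(2, k) :=
  \matrix_(i, j) partial i (fun u => F u 0 j) w.

Definition cpartial (i : 'I_2) (f : 'rV[R]_2 -> R[i]) : 'rV[R]_2 -> R[i] :=
  fun w => partial i (fun u => complex.Re (f u)) w +i*
           partial i (fun u => complex.Im (f u)) w.

(* The Wirtinger derivative. *)
Definition dz (f : 'rV[R]_2 -> R[i]) : 'rV[R]_2 -> R[i] :=
  fun w => (cpartial 0 f w - iunit * cpartial 1 f w) / 2%:R.

Definition christoffel (h : 'rV[R]_2 -> 'M[R]_2) (k i j : 'I_2)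
    (w : 'rV[R]_2) : R :=
  2%:R^-1 * \sum_l invmx (h w) k l *
    (partial i (fun u => h u j l) w + partial j (fun u => h u i l) w
     - partial l (fun u => h u i j) w).

(* Component along the coordinate field k of the covariant derivative of
   d/dz along d/dz, for the complex-bilinear extension of the Levi-Civita
   connection of h. *)
Definition nabla_dz_dz (h : 'rV[R]_2 -> 'M[R]_2) (w : 'rV[R]_2) (k : 'I_2) :
    R[i] :=
  let a (i : 'I_2) : R[i] := if i == 0 then 2%:R^-1 else - (iunit / 2%:R) in
  \sum_i \sum_j a i * a j * (christoffel h k i j w)%:C.

(* A complexified tangent vector a d/dx + b d/dy has d/dz-component a + i b;
   its d/d(zbar)-component a - i b vanishes here when h is conformal. *)
Definition connection_coeff (h : 'rV[R]_2 -> 'M[R]_2) (w : 'rV[R]_2) : R[i] :=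
  nabla_dz_dz h w 0 + iunit * nabla_dz_dz h w 1.

(* The Riemann sphere is option R[i], with None for the point at infinity. *)
Definition recip (x : option R[i]) : option R[i] :=
  match x with
  | None => Some 0
  | Some c => if c == 0 then None else Some c^-1
  end.

(* Only used near points where x is finite. *)
Definition finite_part (x : option R[i]) : R[i] := odflt 0 x.

Definition schwarzian_fin (f : 'rV[R]_2 -> R[i]) (w : 'rV[R]_2) : R[i] :=
  dz (dz (dz f)) w / dz f w - 3%:R / 2%:R * (dz (dz f) w / dz f w) ^+ 2.

Definition schwarzian (f : 'rV[R]_2 -> option R[i]) (w : 'rV[R]_2) : R[i] :=
  if f w is None then schwarzian_fin (fun u => finite_part (recip (f u))) w
  else schwarzian_fin (fun u => finite_part (f u)) w.

(* schwarz_diff gamma f k is the coefficient of dz^(k+2) in S^nabla_(k+2)(f),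
   in a coordinate in which the connection has coefficient gamma. *)
Fixpoint schwarz_diff (gamma : 'rV[R]_2 -> R[i]) (f : 'rV[R]_2 -> option R[i])
    (k : nat) : 'rV[R]_2 -> R[i] :=
  if k is k'.+1 then
    fun w => dz (schwarz_diff gamma f k') w
             - k'.+2%:R * gamma w * schwarz_diff gamma f k' w
  else
    fun w => schwarzian f w + gamma w ^+ 2 / 2%:R - dz gamma w.

End PlaneCalculus.

Section EuclideanSpace.
Context {R : realType}.

(* The norm of the normed module 'rV[R]_3 is the sup norm. *)
Definition eucl_norm (v : 'rV[R]_3) : R := Num.sqrt (\sum_j v 0 j ^+ 2).

Definition cross (u v : 'rV[R]_3) : 'rV[R]_3 :=
  \row_(j < 3) (u 0 (j + 1) * v 0 (j + 2) - u 0 (j + 2) * v 0 (j + 1)).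

Implicit Types (Y : 'rV[R]_2 -> 'rV[R]_3) (w : 'rV[R]_2).

Definition first_form Y w : 'M[R]_2 := jacobian Y w *m (jacobian Y w)^T.

Definition unit_normal Y w : 'rV[R]_3 :=
  let c := cross (row 0 (jacobian Y w)) (row 1 (jacobian Y w)) in
  (eucl_norm c)^-1 *: c.

Definition second_form Y w : 'M[R]_2 :=
  \matrix_(i, j) \sum_k
    partial i (partial j (fun u => Y u 0 k)) w * unit_normal Y w 0 k.

Definition shape_op Y w : 'M[R]_2 :=
  second_form Y w *m invmx (first_form Y w).

End EuclideanSpace.

Record chart (R : realType) (M : topologicalType) := Chart {
  cdom : set M;
  ccod : set 'rV[R]_2;
  cmap : M -> 'rV[R]_2;
  cinv : 'rV[R]_2 -> M;
  cdom_open : open cdom;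
  ccod_open : open ccod;
  cmap_cod : forall p, cdom p -> ccod (cmap p);
  cinv_dom : forall w, ccod w -> cdom (cinv w);
  cmapK : forall p, cdom p -> cinv (cmap p) = p;
  cinvK : forall w, ccod w -> cmap (cinv w) = w;
  cmap_cts : forall p, cdom p -> {for p, continuous cmap};
  cinv_cts : forall w, ccod w -> {for w, continuous cinv}
}.

Definition oriented_transition (R : realType) (M : topologicalType)
    (c d : chart R M) : Prop :=
  let O := ccod c `&` cinv c @^-1` cdom d in
  let t := fun w => cmap d (cinv c w) in
  smooth_map_on O t /\ forall w, O w -> 0 < \det (jacobian t w).

Record oriented_surface (R : realType) := OrientedSurface {
  carrier :> topologicalType;
  surface_hausdorff : hausdorff_space carrier;
  surface_countable : @second_countable carrier;
  atlas : set (chart R carrier);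
  atlas_cover : forall p : carrier, exists c, atlas c /\ cdom c p;
  atlas_compat : forall c d, atlas c -> atlas d -> oriented_transition c d
}.

(* In what follows an open set U of M is regarded as a surface in its own
   right, and a map defined on U is represented by a function on M, of which
   only the values on U matter. *)
Section Surfaces.
Context {R : realType} {M : oriented_surface R}.
Implicit Types (U : set M) (X : M -> 'rV[R]_3) (c : chart R M) (p : M).

Definition admissible c : Prop :=
  forall d, atlas d -> oriented_transition c d /\ oriented_transition d c.

Definition chart_at p : chart R M := projT1 (cid (atlas_cover p)).

Definition in_chart X c : 'rV[R]_2 -> 'rV[R]_3 := fun w => X (cinv c w).

(* At points where X is an immersion, the next four notions do not depend on
   the oriented chart used. *)
Definition gauss_map X p : 'rV[R]_3 :=
  unit_normal (in_chart X (chart_at p)) (cmap (chart_at p) p).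

Definition gauss_curvature X p : R :=
  \det (shape_op (in_chart X (chart_at p)) (cmap (chart_at p) p)).

Definition mean_curvature X p : R :=
  \tr (shape_op (in_chart X (chart_at p)) (cmap (chart_at p) p)) / 2%:R.

Definition principal_curvature X p (k : R) : Prop :=
  eigenvalue (shape_op (in_chart X (chart_at p)) (cmap (chart_at p) p)) k.

Definition immersion U X : Prop :=
  forall c, atlas c ->
    let O := ccod c `&` cinv c @^-1` U in
    smooth_map_on O (in_chart X c) /\
    forall w, O w -> row_free (jacobian (in_chart X c) w).

Definition minimal_immersion U X : Prop :=
  immersion U X /\ forall p, U p -> mean_curvature X p = 0.

Definition umbilic X p : Prop :=
  forall k : R, principal_curvature X p k -> k = 0.

Definition non_flat U X : Prop := exists p, U p /\ gauss_curvature X p <> 0.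

Definition non_umbilic_locus U X : set M := [set p | U p /\ ~ umbilic X p].

Definition stereo_gauss X p : option R[i] :=
  let N := gauss_map X p in
  if N 0 2 == 1 then None
  else Some (((N 0 0)%:C + iunit * (N 0 1)%:C) / (1 - N 0 2)%:C).

(* For the complex structure on U determined by the orientation and the
   metric induced by X. *)
Definition holomorphic_coordinate U X c : Prop :=
  [/\ admissible c, cdom c `<=` U &
      forall w, ccod c w -> is_scalar_mx (first_form (in_chart X c) w)].

Definition flat_metric X c (w : 'rV[R]_2) : 'M[R]_2 :=
  Num.sqrt (- gauss_curvature X (cinv c w)) *: first_form (in_chart X c) w.

(* Coefficient of dz^l in P_l (for l >= 2), in the coordinate c. *)
Definition entropy_diff X c (l : nat) : 'rV[R]_2 -> R[i] :=
  schwarz_diff (connection_coeff (flat_metric X c))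
               (fun w => stereo_gauss X (cinv c w)) (l - 2).

Definition weighted_homogeneous (n : nat) (psi : mpoly.mpoly (n - 2) R[i]) :
    Prop :=
  (exists v : 'I_(n - 2) -> R[i], mpoly.meval v psi != 0) /\
  forall (a : R[i]) (v : 'I_(n - 2) -> R[i]), a != 0 ->
    mpoly.meval (fun i => a ^+ (i + 2) * v i) psi = a ^+ n * mpoly.meval v psi.

Definition degree_condition U X (n : nat) : Prop :=
  let M' := non_umbilic_locus U X in
  (forall c, holomorphic_coordinate M' X c ->
     forall w, ccod c w -> entropy_diff X c n w = 0) \/
  (exists psi : mpoly.mpoly (n - 2) R[i], weighted_homogeneous psi /\
     forall c, holomorphic_coordinate M' X c ->
       forall w, ccod c w ->
         entropy_diff X c n w =
         mpoly.meval (fun i : 'I_(n - 2) => entropy_diff X c (i + 2) w) psi).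

Definition has_degree U X (n : nat) : Prop :=
  [/\ non_flat U X, (2 <= n)%N, degree_condition U X n &
      forall m, (2 <= m < n)%N -> ~ degree_condition U X m].

Definition converges_locally_uniformly U (Xs : nat -> M -> 'rV[R]_3) X : Prop :=
  forall q, U q -> exists V : set M, nbhs q V /\
    forall e : R, 0 < e -> exists N : nat, forall n, (N <= n)%N ->
      forall p, (U `&` V) p -> eucl_norm (Xs n p - X p) < e.

End Surfaces.

(* Main.v *)
(* Off the umbilics the flat metric sqrt(-K) g is |dz|^2 for a local coordinate z, and
   Phi = X_x - i X_y is then a holomorphic null curve with Phi'.Phi' = 1.  In this
   coordinate P_l = s^(l-2) dz^l with s = Phi''.Phi''/2, so the degree of the immersion is
   read off s, and Phi''' = -2 s Phi' - s' Phi: a suitable initial frame and the function s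
   determine Phi.  Conversely, for a polynomial s, the curve Phi is a quadratic expression
   in the entire solutions of y'' = -(s/2) y, and X is recovered as the real part of its
   primitive.
     If s = (z - z0)^K q with deg q = e < K + 2 and K + e + 3 = n, then s^(n-2) = 0, whereas a
   weighted-homogeneous relation at a level m < n contains only monomials of degree at
   least two, so it would make (z - z0)^(K+2) divide a nonzero polynomial of degree at
   most e; the degree is exactly n.
     For a given X, such polynomials s_n are chosen with K and e about n/2, agreeing with the
   s of X to order e at the point and with geometrically bounded coefficients.  The
   solutions are then uniformly bounded on a fixed disc, and Phi_n - Phi vanishes to order
   e + 2 there, so it tends to 0 by the Cauchy estimates, which are obtained from the
   maximum principle by Bernstein's method.
     The coordinate z comes from the vector-valued form theta = dX - i N x dX, closed because
   the mean curvature vanishes and of type (1,0) in every component.  If rho is a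
   component without zeros near the point and phi = theta/rho, then dz is rho times a fourth
   root of (dphi/rho).(dphi/rho), which is non-zero off the umbilics. *)
Require Import Defs.
From HB Require Import structures.
From mathcomp Require Import all_boot all_order all_algebra.
From mathcomp Require Import all_classical all_reals all_analysis.
From mathcomp Require Import complex ring lra zify.
From mathcomp Require mpoly.

Set Implicit Arguments.
Unset Strict Implicit.
Unset Printing Implicit Defensive.

Import Order.TTheory GRing.Theory Num.Theory.
Import numFieldNormedType.Exports.

Local Open Scope classical_set_scope.
Local Open Scope ring_scope.
Local Open Scope complex_scope.

(** Two demands compete. Approximation prescribes a long Taylor jet of the potential [s], while an
    exact degree asks for a polynomial with a zero of order at least half its degree. They are
    reconciled by sending the zero to infinity: multiplying or dividing by [(1 - z/z0)^K] with [z0]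
    of size [K] changes geometric coefficient bounds by a bounded factor only, so the jet can be
    imposed on the quotient by that power. The linear third-order equation carries the jets to
    [Phi_n], and a bounded holomorphic function that vanishes to order [J] is of size [2^(-J)] near
    the centre. One neighbourhood serves all [n] because the solutions are entire and their bounds
    depend only on the geometric bound of the coefficients of [s_n]. Nullity and normalisation of
    [Phi_n] hold identically, not just at the initial point: they amount to the vanishing of a
    discriminant and to the constancy of a Wronskian. *)

Local Notation jacobian := Defs.jacobian.

(** * Differential calculus in the plane *)

Section PlaneBasics.
Context {R : realType}.
Local Notation V := ('rV[R]_2).
Implicit Types (O : set V) (f g : V -> R) (w u : V).

Definition bvec (i : 'I_2) : V := delta_mx 0 i.

Lemma bvecE i j : bvec i 0 j = (i == j)%:R.
Proof. by rewrite mxE eqxx /= eq_sym. Qed.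

Lemma ord2P (P : 'I_2 -> Prop) : P 0 -> P 1 -> forall i, P i.
Proof.
move=> P0 P1 [[|[|//]] i]; [rewrite (_ : Ordinal i = 0)|rewrite (_ : Ordinal i = 1)] => //; exact: val_inj.
Qed.

Lemma row2P (u w : V) : u 0 0 = w 0 0 -> u 0 1 = w 0 1 -> u = w.
Proof. by move=> h0 h1; apply/rowP; apply: ord2P. Qed.

Lemma norm_row2 (u : V) (r : R) : (`|u| <= r) <-> (0 <= r /\ forall i, `|u 0 i| <= r).
Proof.
rewrite (_ : `|u| = mx_norm u) // mx_normrE; split=> [h|[r0 h]].
  split; first by apply: le_trans h; apply: bigmax_ge_id.
  move=> i; apply: le_trans h; exact: (le_bigmax _ (fun ij => `|u ij.1 ij.2|) (0, i)).
by apply/bigmax_leP; split=> //= -[i j] _ /=; rewrite ord1; apply: h.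
Qed.

Lemma ball_row2 (w : V) (r : R) u : 0 < r ->
  ball w r u <-> forall i, `|u 0 i - w 0 i| < r.
Proof.
move=> r0; rewrite mx_norm_ball /ball_ /= (_ : `|w - u| = mx_norm (w - u)) // mx_normrE; split=> [h i|h].
  rewrite distrC; apply: le_lt_trans h.
  have := le_bigmax 0 (fun ij : 'I_1 * 'I_2 => `|(w - u) ij.1 ij.2|) (0, i).
  by rewrite /= !mxE.
by apply/bigmax_ltP; split=> //= -[i j] _ /=; rewrite ord1 !mxE distrC.
Qed.

Lemma open_box O w : open O -> O w ->
  exists2 r : R, 0 < r & forall u, (forall i, `|u 0 i - w 0 i| < r) -> O u.
Proof.
move=> oO Ow; have /nbhs_ballP[r /= r0 h] : nbhs w O by exact: open_nbhs_nbhs.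
by exists r => // u hu; apply: h; apply/ball_row2.
Qed.

Lemma is_derive_line (W : normedModType R) (f : V -> W) w v (t : R) :
  derivable f (w + t *: v) v ->
  is_derive t 1 (fun s : R => f (w + s *: v)) ('D_v f (w + t *: v)).
Proof.
have E : (fun h : R => h^-1 *: (((fun s : R => f (w + s *: v)) \o shift t) (h *: 1) -
    f (w + t *: v))) =
  (fun h : R => h^-1 *: ((f \o shift (w + t *: v)) (h *: v) - f (w + t *: v))).
  apply/funext => h /=; congr (_ *: (f _ - _)).
  by rewrite scalerDl addrCA /GRing.scale /= mulr1.
by move=> df; split; rewrite /derivable /derive E.
Qed.

Lemma mvt_line f w v (h : R) :
  (forall t : R, `|t| <= `|h| -> derivable f (w + t *: v) v) ->
  exists2 t : R, `|t| <= `|h| & f (w + h *: v) - f w = h * 'D_v f (w + t *: v).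
Proof.
move=> df; pose g s := f (w + s *: v).
have dg (t : R) : `|t| <= `|h| -> is_derive t 1 g ('D_v f (w + t *: v)).
  by move=> ht; apply: is_derive_line; apply: df.
have gc (a b : R) : `|a| <= `|h| -> `|b| <= `|h| -> {within `[a, b], continuous g}.
  move=> ha hb; apply: derivable_within_continuous => x.
  rewrite in_itv /= => /andP[ax xb].
  have hx : `|x| <= `|h|.
    rewrite ler_norml; apply/andP; split.
      by apply: le_trans ax; move: ha; rewrite ler_norml => /andP[].
    by apply: (le_trans xb); move: hb; rewrite ler_norml => /andP[].
  by case: (dg x hx).
have [h0|h0] := leP 0 h.
  have [|t|c] := @MVT_segment R g (fun t => 'D_v f (w + t *: v)) 0 h h0.
  - move=> t; rewrite in_itv /= => /andP[t0 th]; apply: dg.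
    by rewrite !ger0_norm // ltW.
  - by apply: gc; rewrite ?normr0.
  rewrite in_itv /= => /andP[c0 ch] E; exists c; first by rewrite !ger0_norm.
  by move: E; rewrite /g scale0r addr0 subr0 mulrC.
have [|t|c] := @MVT_segment R g (fun t => 'D_v f (w + t *: v)) h 0 (ltW h0).
- move=> t; rewrite in_itv /= => /andP[t0 th]; apply: dg.
  by rewrite !ltr0_norm // lerN2 ltW.
- by apply: gc; rewrite ?normr0.
rewrite in_itv /= => /andP[c0 ch] E; exists c.
  by rewrite (ltr0_norm h0) (ler0_norm ch) lerN2.
move: E; rewrite /g scale0r addr0 sub0r mulrN => /(congr1 -%R).
by rewrite opprB opprK mulrC.
Qed.

Definition lin2 (a b : R) (h : V) : R := a * h 0 0 + b * h 0 1.
Fact lin2_linear a b : linear (lin2 a b).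
Proof. by move=> k u v; rewrite /lin2 !mxE /GRing.scale /=; ring. Qed.
HB.instance Definition _ a b :=
  @GRing.isLinear.Build R V R *:%R (lin2 a b) (lin2_linear a b).

Lemma lin2_continuous a b : continuous (lin2 a b).
Proof.
have c i : continuous (fun h : V => h 0 i) by exact: coord_continuous.
move=> h; exact: (cvgD (cvgM (cvg_cst a) (c 0 h)) (cvgM (cvg_cst b) (c 1 h))).
Qed.

Lemma row2_decomp (h : V) : h = h 0 0 *: bvec 0 + h 0 1 *: bvec 1.
Proof. by apply: row2P; rewrite !mxE /= ?mulr1 ?mulr0 ?addr0 ?add0r. Qed.

(** The increment is split into a horizontal and a vertical leg and the mean value theorem is
    applied to each; continuity of the partial derivatives at [w] controls the error. This turns
    [smooth_on], which speaks of partial derivatives only, into Frechet differentiability and so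
    gives the chain rule. *)
Lemma differentiable_partial O f w : open O -> O w ->
  (forall i u, O u -> derivable f u (bvec i)) ->
  (forall i, {for w, continuous (partial i f)}) -> differentiable f w.
Proof.
move=> oO Ow df cf.
have key : f \o shift w = cst (f w) + lin2 (partial 0 f w) (partial 1 f w) +o_ (0:V) id.
  apply/eqaddoP => eps eps0.
  have [r r0 hr] := open_box oO Ow.
  have e20 : 0 < eps / 2 by rewrite divr_gt0.
  have /= h0 := cf 0; have /= h1 := cf 1.
  have /nbhs_ballP[r1 /= r10 H0] : \forall u \near w, `|partial 0 f w - partial 0 f u| < eps / 2.
    by move/cvgrPdist_lt : h0 => /(_ _ e20).
  have /nbhs_ballP[r2 /= r20 H1] : \forall u \near w, `|partial 1 f w - partial 1 f u| < eps / 2.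
    by move/cvgrPdist_lt : h1 => /(_ _ e20).
  pose d := Num.min r (Num.min r1 r2).
  have d0 : 0 < d by rewrite !lt_min r0 r10 r20.
  apply/nbhs_ballP; exists d => //= h; rewrite ball_row2 // => hd.
  have {}hd i : `|h 0 i| < d by have := hd i; rewrite mxE subr0.
  have nh i : `|h 0 i| <= `|h| by have [/(_ (lexx _))[_ +] _] := norm_row2 h `|h|; apply.
  have dr : [/\ d <= r, d <= r1 & d <= r2].
    by split; rewrite /d !ge_min lexx ?orbT.
  case: dr => dr dr1 dr2.
  have B (a b : R) : `|a| <= `|h 0 0| -> `|b| <= `|h 0 1| -> forall i,
      `|(w + a *: bvec 0 + b *: bvec 1) 0 i - w 0 i| < d.
    move=> ha hb; apply: ord2P; rewrite !mxE /= ?mulr1 ?mulr0 ?addr0 ?add0r addrC addKr.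
      exact: le_lt_trans ha (hd 0).
    exact: le_lt_trans hb (hd 1).
  have [|t0 ht0 E0] := @mvt_line f w (bvec 0) (h 0 0).
    move=> t ht; apply: df; apply: hr => i; rewrite -[w + _]addr0 -(scale0r (bvec 1)).
    by apply: lt_le_trans dr; apply: B; rewrite ?normr0.
  have [|t1 ht1 E1] := @mvt_line f (w + h 0 0 *: bvec 0) (bvec 1) (h 0 1).
    by move=> t ht; apply: df; apply: hr => i; apply: lt_le_trans dr; apply: B.
  have -> : (f \o shift w - (cst (f w) + lin2 (partial 0 f w) (partial 1 f w))) h =
     h 0 0 * (partial 0 f (w + t0 *: bvec 0) - partial 0 f w) +
     h 0 1 * (partial 1 f (w + h 0 0 *: bvec 0 + t1 *: bvec 1) - partial 1 f w).
    rewrite !fctE /= /lin2 {1}(row2_decomp h) [_ + w]addrC addrA.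
    rewrite !mulrBr -/(partial _ _ _) -E0 -E1; ring.
  have tri (a b x y : R) : `|a * b + x * y| <= `|a| * `|b| + `|x| * `|y| by rewrite -!normrM ler_normD.
  apply: (le_trans (tri _ _ _ _)).
  rewrite [eps]splitr mulrDl; apply: lerD; rewrite mulrC; apply: ler_pM => //.
    rewrite distrC; apply/ltW; apply: H0; apply/ball_row2 => // i.
    rewrite -[w + _]addr0 -(scale0r (bvec 1)).
    by apply: lt_le_trans dr1; apply: B; rewrite ?normr0.
  rewrite distrC; apply/ltW; apply: H1; apply/ball_row2 => // i.
  by apply: lt_le_trans dr2; apply: B.
have E := @diff_unique R V R f (lin2 (partial 0 f w) (partial 1 f w)) w (@lin2_continuous _ _) key.
apply/diff_locallyP; rewrite E; split=> //; exact: lin2_continuous.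
Qed.

End PlaneBasics.

(** * Smooth functions on open subsets of the plane *)

Section SmoothCalculus.
Context {R : realType}.
Local Notation V := ('rV[R]_2).
Implicit Types (O : set V) (f g : V -> R) (w u : V).

Lemma near_open O w (P : V -> Prop) : open O -> O w -> (forall u, O u -> P u) ->
  \forall u \near w, P u.
Proof. by move=> oO Ow h; apply: filterS h _; exact: open_nbhs_nbhs. Qed.

Lemma eq_partial O f g w i : open O -> O w -> (forall u, O u -> f u = g u) ->
  partial i f w = partial i g w.
Proof. by move=> oO Ow h; apply: near_eq_derive; exact: near_open h. Qed.

Lemma eq_continuous_at O f g w : open O -> O w -> (forall u, O u -> f u = g u) ->
  {for w, continuous f} -> {for w, continuous g}.
Proof.
move=> oO Ow h; have nb : \forall u \near w, f u = g u by exact: near_open h.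
rewrite /prop_for /continuous_at -(h w Ow); apply: cvg_trans.
exact: near_eq_cvg nb.
Qed.

Lemma smooth_differentiable O f w : open O -> smooth_on O f -> O w -> differentiable f w.
Proof.
move=> oO sf Ow; apply: (differentiable_partial oO Ow).
  by move=> i u Ou; case: (sf [::] u Ou) => _ /(_ i).
by move=> i; case: (sf [:: i] w Ow).
Qed.

Lemma smooth_partial O f i : smooth_on O f -> smooth_on O (partial i f).
Proof.
move=> sf s w Ow; have := sf (rcons s i) w Ow.
by rewrite /iter_partial foldr_rcons.
Qed.

(** Serves as a coinduction principle: higher derivatives of products, composites, power series and
    local inverses need never be written down; one class of functions closed under differentiation
    is exhibited instead. *)
Lemma smooth_coind (C : (V -> R) -> Prop) O : open O ->
  (forall f, C f -> (forall w, O w -> differentiable f w) /\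
     forall i, exists2 g, C g & forall w, O w -> partial i f w = g w) ->
  forall f, C f -> smooth_on O f.
Proof.
move=> oO H f Cf s.
have [g Cg gE] : exists2 g, C g & forall w, O w -> iter_partial s f w = g w.
  elim: s => [|i s [g Cg gE]]; first by exists f.
  have [_ /(_ i)[g' Cg' g'E]] := H g Cg; exists g' => // w Ow.
  by rewrite /= (eq_partial i oO Ow gE); apply: g'E.
move=> w Ow; have [dg _] := H g Cg; split.
  apply: (eq_continuous_at oO Ow _ (differentiable_continuous (dg w Ow))) => u Ou.
  by rewrite gE.
move=> i; apply: (@near_eq_derivable _ _ _ g); last by apply: diff_derivable; apply: dg.
by apply: (near_open oO Ow) => u Ou; rewrite gE.
Qed.

Lemma smooth_eq O f g : open O -> (forall u, O u -> f u = g u) ->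
  smooth_on O f -> smooth_on O g.
Proof.
move=> oO h sf s w Ow.
have E u : O u -> iter_partial s f u = iter_partial s g u.
  elim: s u => [|i s IH] u Ou /=; first exact: h.
  by apply: (eq_partial i oO Ou) => v Ov; apply: IH.
have [c d] := sf s w Ow; split.
  exact: (eq_continuous_at oO Ow E c).
move=> i; apply: (@near_eq_derivable _ _ _ (iter_partial s f)); last exact: d.
by apply: (near_open oO Ow) => u Ou; rewrite E.
Qed.

Lemma smooth_subset O O' f : O' `<=` O -> smooth_on O f -> smooth_on O' f.
Proof. by move=> sO sf s w Ow; apply: sf; apply: sO. Qed.

Lemma partialD f g i w : differentiable f w -> differentiable g w ->
  partial i (fun u => f u + g u) w = partial i f w + partial i g w.
Proof. by move=> df dg; rewrite /partial deriveD //; apply: diff_derivable. Qed.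

Lemma partialM f g i w : differentiable f w -> differentiable g w ->
  partial i (fun u => f u * g u) w = partial i f w * g w + f w * partial i g w.
Proof.
move=> df dg; rewrite /partial deriveM; [|exact: diff_derivable..].
by rewrite /GRing.scale /= addrC [g w * _]mulrC.
Qed.

Lemma partial_cst (c : R) i w : partial i (fun=> c) w = 0.
Proof. exact: derive_cst. Qed.

Lemma partialV f i w : f w != 0 -> differentiable f w ->
  partial i (fun u => (f u)^-1) w = - partial i f w / f w ^+ 2.
Proof.
move=> f0 df; rewrite /partial deriveV //; last exact: diff_derivable.
transitivity (- f w ^- 2 * partial i f w) => //; by rewrite !mulNr mulrC.
Qed.

Lemma partial_coord i k w : partial i (fun u : V => u 0 k) w = (i == k)%:R.
Proof.
have c : continuous (fun h : V => h 0 k) by exact: coord_continuous.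
rewrite /partial deriveE; last exact: differentiable_coord.
have lin : linear (fun h : V => h 0 k) by move=> a u v; rewrite !mxE.
pose L := GRing.isLinear.Build R V R *:%R (fun h : V => h 0 k) lin.
pose l : {linear V -> R} := HB.pack (fun h : V => h 0 k) L.
by rewrite (@diff_lin R V R l w c) /= bvecE.
Qed.

Lemma differentiable_row2 (Phi : V -> V) w :
  (forall k, differentiable (fun u => Phi u 0 k) w) -> differentiable Phi w.
Proof.
move=> d; have -> : Phi = (fun u => Phi u 0 0 *: bvec 0) + (fun u => Phi u 0 1 *: bvec 1).
  by apply/funext => u; rewrite fctE -row2_decomp.
by apply: differentiableD; apply: differentiableZl.
Qed.

Lemma differentiable_comp2 g (Phi : V -> V) w :
  differentiable g (Phi w) -> (forall k, differentiable (fun u => Phi u 0 k) w) ->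
  differentiable (g \o Phi) w.
Proof. by move=> dg dP; apply: differentiable_comp => //; apply: differentiable_row2. Qed.

Lemma partial_comp g (Phi : V -> V) i w :
  differentiable g (Phi w) -> (forall k, differentiable (fun u => Phi u 0 k) w) ->
  partial i (g \o Phi) w =
   partial 0 g (Phi w) * partial i (fun u => Phi u 0 0) w +
   partial 1 g (Phi w) * partial i (fun u => Phi u 0 1) w.
Proof.
move=> dg dP; have dPhi := differentiable_row2 dP.
rewrite /partial deriveE; last exact: differentiable_comp.
rewrite diff_comp //= -[X in 'd g _ X]deriveE //.
have -> : 'D_(bvec i) Phi w = partial i (fun u => Phi u 0 0) w *: bvec 0 +
    partial i (fun u => Phi u 0 1) w *: bvec 1.
  rewrite derive_mx; last exact: diff_derivable.
  by apply: row2P; rewrite !mxE /= ?mulr1 ?mulr0 ?addr0 ?add0r.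
rewrite linearD !linearZ /= -!deriveE //.
congr (_ + _); exact: mulrC.
Qed.

Lemma differentiable_sqrt f w : 0 < f w -> differentiable f w ->
  differentiable (fun u => Num.sqrt (f u)) w.
Proof.
move=> f0 df; apply: (@differentiable_comp _ _ _ _ f (@Num.sqrt R)) => //.
by apply/derivable1_diffP; case: (is_derive1_sqrt f0).
Qed.

Lemma partial_sqrt f i w : 0 < f w -> differentiable f w ->
  partial i (fun u => Num.sqrt (f u)) w = partial i f w / (2 * Num.sqrt (f w)).
Proof.
move=> f0 df.
have ds : differentiable (@Num.sqrt R) (f w).
  by apply/derivable1_diffP; case: (is_derive1_sqrt f0).
rewrite /partial deriveE; last exact: differentiable_sqrt.
have lin (x : R) : 'd (@Num.sqrt R) (f w) x = x * 'D_1 (@Num.sqrt R) (f w).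
  by rewrite deriveE // -[in LHS](mulr1 x) [LHS]linearZ.
by rewrite (@diff_comp _ _ _ _ f (@Num.sqrt R)) //= lin derive_sqrt // /partial deriveE.
Qed.

(* Closed under partial derivatives up to equality on [O], so that
   [smooth_coind] applies to it. *)
Inductive smooth_closure O : (V -> R) -> Prop :=
| Sm_base f : smooth_on O f -> smooth_closure O f
| Sm_cst c : smooth_closure O (fun=> c)
| Sm_add f g : smooth_closure O f -> smooth_closure O g ->
    smooth_closure O (fun u => f u + g u)
| Sm_mul f g : smooth_closure O f -> smooth_closure O g ->
    smooth_closure O (fun u => f u * g u)
| Sm_inv f : (forall u, O u -> f u != 0) -> smooth_closure O f ->
    smooth_closure O (fun u => (f u)^-1)
| Sm_sqrt f : (forall u, O u -> 0 < f u) -> smooth_closure O f ->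
    smooth_closure O (fun u => Num.sqrt (f u))
| Sm_comp O' g Phi : open O' -> smooth_on O' g -> (forall u, O u -> O' (Phi u)) ->
    (forall k, smooth_closure O (fun u => Phi u 0 k)) ->
    smooth_closure O (g \o Phi).

Lemma smooth_closure_partial O f : open O -> smooth_closure O f ->
  (forall w, O w -> differentiable f w) /\
  forall i, exists2 g, smooth_closure O g & forall w, O w -> partial i f w = g w.
Proof.
move=> oO; elim=> {f}.
- move=> f sf; split; first by move=> w; apply: smooth_differentiable.
  by move=> i; exists (partial i f) => //; apply: Sm_base; apply: smooth_partial.
- move=> c; split=> [w Ow|i]; first exact: differentiable_cst.
  by exists (fun=> 0); [exact: Sm_cst|move=> w Ow; rewrite partial_cst].
- move=> f g Cf [df pf] Cg [dg pg]; split=> [w Ow|i].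
    by apply: differentiableD; [exact: df|exact: dg].
  have [f' Cf' f'E] := pf i; have [g' Cg' g'E] := pg i.
  exists (fun u => f' u + g' u); first exact: Sm_add.
  by move=> w Ow; rewrite partialD ?f'E ?g'E; auto.
- move=> f g Cf [df pf] Cg [dg pg]; split=> [w Ow|i].
    by apply: differentiableM; [exact: df|exact: dg].
  have [f' Cf' f'E] := pf i; have [g' Cg' g'E] := pg i.
  exists (fun u => f' u * g u + f u * g' u); first by apply: Sm_add; exact: Sm_mul.
  by move=> w Ow; rewrite partialM ?f'E ?g'E; auto.
- move=> f f0 Cf [df pf]; split=> [w Ow|i].
    by apply: differentiableV; [exact: df|exact: f0].
  have [f' Cf' f'E] := pf i.
  exists (fun u => f' u * ((-1) * ((f u)^-1 * (f u)^-1))).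
    by do ?[apply: Sm_mul => //|apply: Sm_inv => //|exact: Sm_cst].
  by move=> w Ow; rewrite partialV ?f'E; auto; rewrite -exprVn; ring.
- move=> f f0 Cf [df pf]; split=> [w Ow|i].
    by apply: differentiable_sqrt; auto.
  have [f' Cf' f'E] := pf i.
  exists (fun u => f' u * (2 * Num.sqrt (f u))^-1).
    apply: Sm_mul => //; apply: Sm_inv; last by apply: Sm_mul; [exact: Sm_cst|exact: Sm_sqrt].
    by move=> u Ou; rewrite mulf_neq0 // ?gt_eqF ?sqrtr_gt0; auto.
  by move=> w Ow; rewrite partial_sqrt ?f'E; auto.
- move=> O' g Phi oO' sg OO' CPhi IH; split=> [w Ow|i].
    apply: differentiable_comp2; first by apply: smooth_differentiable sg _; auto.
    by move=> k; case: (IH k) => + _; apply.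
  have [_ /(_ i)[f0 Cf0 f0E]] := IH 0; have [_ /(_ i)[f1 Cf1 f1E]] := IH 1.
  exists (fun u => (partial 0 g \o Phi) u * f0 u + (partial 1 g \o Phi) u * f1 u).
    apply: Sm_add; apply: Sm_mul; [|exact: Cf0| |exact: Cf1].
      exact: (Sm_comp oO' (smooth_partial 0 sg) OO' CPhi).
    exact: (Sm_comp oO' (smooth_partial 1 sg) OO' CPhi).
  move=> w Ow; rewrite partial_comp ?f0E ?f1E //.
    by apply: smooth_differentiable sg _; auto.
  by move=> k; case: (IH k) => + _; apply.
Qed.

Lemma smooth_closure_smooth O f : open O -> smooth_closure O f -> smooth_on O f.
Proof.
move=> oO; apply: (smooth_coind oO) => g Cg; exact: smooth_closure_partial.
Qed.

Section SmoothOps.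
Variables (O : set V) (oO : open O).

Lemma smooth_cst (c : R) : smooth_on O (fun=> c).
Proof. by apply: smooth_closure_smooth => //; apply: Sm_cst. Qed.

Lemma smoothD f g : smooth_on O f -> smooth_on O g -> smooth_on O (fun u => f u + g u).
Proof. by move=> sf sg; exact: (smooth_closure_smooth oO (Sm_add (Sm_base sf) (Sm_base sg))). Qed.

Lemma smoothM f g : smooth_on O f -> smooth_on O g -> smooth_on O (fun u => f u * g u).
Proof. by move=> sf sg; exact: (smooth_closure_smooth oO (Sm_mul (Sm_base sf) (Sm_base sg))). Qed.

Lemma smoothN f : smooth_on O f -> smooth_on O (fun u => - f u).
Proof.
move=> sf; apply: (smooth_eq oO _ (smoothM (smooth_cst (-1)) sf)) => u _.
by rewrite mulN1r.
Qed.

Lemma smoothB f g : smooth_on O f -> smooth_on O g -> smooth_on O (fun u => f u - g u).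
Proof. by move=> sf sg; exact: smoothD sf (smoothN sg). Qed.

Lemma smoothV f : (forall u, O u -> f u != 0) -> smooth_on O f -> smooth_on O (fun u => (f u)^-1).
Proof. by move=> f0 sf; exact: (smooth_closure_smooth oO (Sm_inv f0 (Sm_base sf))). Qed.

Lemma smooth_sqrt f : (forall u, O u -> 0 < f u) -> smooth_on O f ->
  smooth_on O (fun u => Num.sqrt (f u)).
Proof. by move=> f0 sf; exact: (smooth_closure_smooth oO (Sm_sqrt f0 (Sm_base sf))). Qed.

Lemma smooth_comp O' g (Phi : V -> V) : open O' -> smooth_on O' g ->
  (forall u, O u -> O' (Phi u)) -> smooth_map_on O Phi -> smooth_on O (g \o Phi).
Proof.
move=> oO' sg OO' sP; apply: smooth_closure_smooth => //; apply: (Sm_comp oO' sg OO') => k.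
exact: Sm_base.
Qed.

Lemma smooth_coord k : smooth_on O (fun u : V => u 0 k).
Proof.
pose C f := f = (fun u : V => u 0 k) \/ exists c, f = fun=> c.
apply: (@smooth_coind C) => //; last by left.
move=> f [|[c]] ->; (split=> [w Ow|i]).
- exact: differentiable_coord.
- by exists (fun=> (i == k)%:R); [right; exists (i == k)%:R|move=> w Ow; rewrite partial_coord].
- exact: differentiable_cst.
- by exists (fun=> 0); [right; exists 0|move=> w Ow; rewrite partial_cst].
Qed.

End SmoothOps.

End SmoothCalculus.

(** * Complex-valued functions and the Wirtinger derivative *)

Section ComplexBasics.
Context {R : rcfType}.
Implicit Types x y : R[i].
Local Notation Re := complex.Re.
Local Notation Im := complex.Im.

Lemma complexP x y : Re x = Re y -> Im x = Im y -> x = y.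
Proof. by case: x y => a b [c d] /= -> ->. Qed.
Lemma ReD x y : Re (x + y) = Re x + Re y. Proof. by case: x y => a b []. Qed.
Lemma ImD x y : Im (x + y) = Im x + Im y. Proof. by case: x y => a b []. Qed.
Lemma ReN x : Re (- x) = - Re x. Proof. by case: x. Qed.
Lemma ImN x : Im (- x) = - Im x. Proof. by case: x. Qed.
Lemma ReB x y : Re (x - y) = Re x - Re y. Proof. by rewrite ReD ReN. Qed.
Lemma ImB x y : Im (x - y) = Im x - Im y. Proof. by rewrite ImD ImN. Qed.
Lemma ReM x y : Re (x * y) = Re x * Re y - Im x * Im y. Proof. by case: x y => a b []. Qed.
Lemma ImM x y : Im (x * y) = Re x * Im y + Im x * Re y. Proof. by case: x y => a b []. Qed.
Definition norm2c x : R := Re x ^+ 2 + Im x ^+ 2.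
Lemma ReV x : Re x^-1 = Re x / norm2c x. Proof. by case: x. Qed.
Lemma ImV x : Im x^-1 = - (Im x / norm2c x). Proof. by case: x. Qed.
Lemma norm2c_ge0 x : 0 <= norm2c x. Proof. by rewrite addr_ge0 // sqr_ge0. Qed.
Lemma norm2c_eq0 x : (norm2c x == 0) = (x == 0).
Proof. by case: x => a b; rewrite /norm2c paddr_eq0 ?sqr_ge0 // !sqrf_eq0 eq_complex. Qed.
Lemma norm2c_gt0 x : (0 < norm2c x) = (x != 0).
Proof. by rewrite lt_def norm2c_ge0 norm2c_eq0 andbT. Qed.
Lemma norm2cM x y : norm2c (x * y) = norm2c x * norm2c y.
Proof. by rewrite /norm2c ReM ImM; ring. Qed.
Lemma norm2cE x : (norm2c x)%:C = x * conjc x.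
Proof. by case: x => a b; apply: complexP; rewrite /norm2c /=; ring. Qed.
Lemma ReJ x : Re (conjc x) = Re x. Proof. by case: x. Qed.
Lemma ImJ x : Im (conjc x) = - Im x. Proof. by case: x. Qed.
Lemma ReZ (a : R) x : Re (a%:C * x) = a * Re x. Proof. by rewrite ReM /= mul0r subr0. Qed.
Lemma ImZ (a : R) x : Im (a%:C * x) = a * Im x. Proof. by rewrite ImM /= mul0r addr0. Qed.
Lemma sqr_iunit : (0 +i* 1 : R[i]) * (0 +i* 1) = -1.
Proof. by apply: complexP => /=; ring. Qed.
Lemma Re_nat n : Re (n%:R : R[i]) = n%:R.
Proof. by elim: n => [|n IH] //; rewrite !mulrS ReD IH. Qed.
Lemma Im_nat n : Im (n%:R : R[i]) = 0.
Proof. by elim: n => [|n IH] //; rewrite mulrS ImD IH addr0. Qed.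
Lemma complex_split x : x = Re x +i* Im x. Proof. by case: x. Qed.
End ComplexBasics.

Section ComplexCalculus.
Context {R : realType}.
Local Notation V := ('rV[R]_2).
Local Notation Re := complex.Re.
Local Notation Im := complex.Im.
Local Notation iu := (@iunit R).
Implicit Types (O : set V) (w u : V) (f g : V -> R[i]).

Lemma Re_cpartial i f w : Re (cpartial i f w) = partial i (fun u => Re (f u)) w.
Proof. by []. Qed.
Lemma Im_cpartial i f w : Im (cpartial i f w) = partial i (fun u => Im (f u)) w.
Proof. by []. Qed.
Lemma dz_def f w : dz f w = (cpartial 0 f w - iu * cpartial 1 f w) / 2%:R.
Proof. by []. Qed.
Lemma partial_def (f : V -> R) i w : partial i f w = 'D_(bvec i) f w.
Proof. by []. Qed.

Lemma iunitE : iu * iu = -1. Proof. exact: sqr_iunit. Qed.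

Lemma partialN (f : V -> R) i w : differentiable f w ->
  partial i (fun u => - f u) w = - partial i f w.
Proof. by move=> df; rewrite /partial deriveN //; apply: diff_derivable. Qed.

Lemma partialB (f g : V -> R) i w : differentiable f w -> differentiable g w ->
  partial i (fun u => f u - g u) w = partial i f w - partial i g w.
Proof. by move=> df dg; rewrite /partial deriveB //; apply: diff_derivable. Qed.

Definition csmooth O f := smooth_on O (fun u => Re (f u)) /\ smooth_on O (fun u => Im (f u)).

Lemma csmooth_subset O O' f : O' `<=` O -> csmooth O f -> csmooth O' f.
Proof. by move=> sO [sr si]; split; exact: smooth_subset sO _. Qed.

Section Open.
Variables (O : set V) (oO : open O).

Let dRe f w : csmooth O f -> O w -> differentiable (fun u => Re (f u)) w.
Proof. by move=> [sr si] Ow; exact: smooth_differentiable oO sr Ow. Qed.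
Let dIm f w : csmooth O f -> O w -> differentiable (fun u => Im (f u)) w.
Proof. by move=> [sr si] Ow; exact: smooth_differentiable oO si Ow. Qed.

Lemma csmooth_eq f g : (forall u, O u -> f u = g u) -> csmooth O f -> csmooth O g.
Proof.
by move=> h [sr si]; split; [apply: smooth_eq oO _ sr|apply: smooth_eq oO _ si] => u Ou; rewrite h.
Qed.

Lemma eq_cpartial f g w i : O w -> (forall u, O u -> f u = g u) ->
  cpartial i f w = cpartial i g w.
Proof.
by move=> Ow h; congr (_ +i* _); apply: (eq_partial i oO Ow) => u Ou; rewrite h.
Qed.

Lemma eq_dz f g w : O w -> (forall u, O u -> f u = g u) -> dz f w = dz g w.
Proof. by move=> Ow h; rewrite /dz !(eq_cpartial _ Ow h). Qed.

Lemma csmooth_cst (c : R[i]) : csmooth O (fun=> c).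
Proof. by split; exact: smooth_cst. Qed.

Lemma csmoothD f g : csmooth O f -> csmooth O g -> csmooth O (fun u => f u + g u).
Proof.
move=> [fr fi] [gr gi]; split.
  by apply: (smooth_eq oO _ (smoothD oO fr gr)) => u _; rewrite ReD.
by apply: (smooth_eq oO _ (smoothD oO fi gi)) => u _; rewrite ImD.
Qed.

Lemma csmoothN f : csmooth O f -> csmooth O (fun u => - f u).
Proof.
move=> [fr fi]; split.
  by apply: (smooth_eq oO _ (smoothN oO fr)) => u _; rewrite ReN.
by apply: (smooth_eq oO _ (smoothN oO fi)) => u _; rewrite ImN.
Qed.

Lemma csmoothB f g : csmooth O f -> csmooth O g -> csmooth O (fun u => f u - g u).
Proof. by move=> sf sg; exact: csmoothD sf (csmoothN sg). Qed.

Lemma csmoothM f g : csmooth O f -> csmooth O g -> csmooth O (fun u => f u * g u).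
Proof.
move=> [fr fi] [gr gi]; split.
  by apply: (smooth_eq oO _ (smoothB oO (smoothM oO fr gr) (smoothM oO fi gi))) => u _; rewrite ReM.
by apply: (smooth_eq oO _ (smoothD oO (smoothM oO fr gi) (smoothM oO fi gr))) => u _; rewrite ImM.
Qed.

Lemma smooth_norm2c f : csmooth O f -> smooth_on O (fun u => norm2c (f u)).
Proof.
move=> [fr fi].
apply: (smooth_eq oO _ (smoothD oO (smoothM oO fr fr) (smoothM oO fi fi))) => u _.
by rewrite /norm2c !expr2.
Qed.

Lemma csmoothV f : (forall u, O u -> f u != 0) -> csmooth O f -> csmooth O (fun u => (f u)^-1).
Proof.
move=> f0 sf; have [fr fi] := sf.
have sn : smooth_on O (fun u => (norm2c (f u))^-1).
  apply: (smoothV oO _ (smooth_norm2c sf)) => u Ou; rewrite norm2c_eq0; exact: f0.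
split.
  by apply: (smooth_eq oO _ (smoothM oO fr sn)) => u _; rewrite ReV.
by apply: (smooth_eq oO _ (smoothN oO (smoothM oO fi sn))) => u _; rewrite ImV.
Qed.

Lemma csmooth_div f g : (forall u, O u -> g u != 0) -> csmooth O f -> csmooth O g ->
  csmooth O (fun u => f u / g u).
Proof. by move=> g0 sf sg; exact: csmoothM sf (csmoothV g0 sg). Qed.

Lemma csmooth_conj f : csmooth O f -> csmooth O (fun u => conjc (f u)).
Proof.
move=> [fr fi]; split.
  by apply: (smooth_eq oO _ fr) => u _; rewrite ReJ.
by apply: (smooth_eq oO _ (smoothN oO fi)) => u _; rewrite ImJ.
Qed.

Lemma csmooth_cpartial f i : csmooth O f -> csmooth O (cpartial i f).
Proof. by move=> [fr fi]; split; exact: smooth_partial. Qed.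

Lemma csmooth_comp O' f (T : V -> V) : open O' -> csmooth O' f ->
  (forall u, O u -> O' (T u)) -> smooth_map_on O T -> csmooth O (fun u => f (T u)).
Proof.
by move=> oO' [fr fi] OO' sT; split; [exact: (smooth_comp oO oO' fr OO' sT)|exact: (smooth_comp oO oO' fi OO' sT)].
Qed.

Section Rules.
Variables (f g : V -> R[i]) (sf : csmooth O f) (sg : csmooth O g) (i : 'I_2) (w : V) (Ow : O w).

Lemma cpartialD : cpartial i (fun u => f u + g u) w = cpartial i f w + cpartial i g w.
Proof.
apply: complexP.
  rewrite ReD /= -partialD; [|exact: dRe..].
  by apply: (eq_partial i oO Ow) => u _; rewrite ReD.
rewrite ImD /= -partialD; [|exact: dIm..].
by apply: (eq_partial i oO Ow) => u _; rewrite ImD.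
Qed.

Lemma cpartialN : cpartial i (fun u => - f u) w = - cpartial i f w.
Proof.
apply: complexP.
  rewrite ReN /= -partialN; [|exact: dRe..].
  by apply: (eq_partial i oO Ow) => u _; rewrite ReN.
rewrite ImN /= -partialN; [|exact: dIm..].
by apply: (eq_partial i oO Ow) => u _; rewrite ImN.
Qed.

Lemma cpartialM : cpartial i (fun u => f u * g u) w = cpartial i f w * g w + f w * cpartial i g w.
Proof.
have [fr fi] := sf; have [gr gi] := sg.
have D (h k : V -> R) : smooth_on O h -> smooth_on O k -> differentiable (fun u => h u * k u) w.
  by move=> sh sk; apply: differentiableM; apply: smooth_differentiable oO _ Ow.
apply: complexP.
  have -> : Re (cpartial i (fun u => f u * g u) w) =
      partial i (fun u => Re (f u) * Re (g u) - Im (f u) * Im (g u)) w.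
    by apply: (eq_partial i oO Ow) => u _; exact: ReM.
  rewrite partialB; [|exact: D..].
  rewrite !partialM; [|by [exact: dIm|exact: dRe]..].
  by rewrite ReD !ReM /=; ring.
have -> : Im (cpartial i (fun u => f u * g u) w) =
    partial i (fun u => Re (f u) * Im (g u) + Im (f u) * Re (g u)) w.
  by apply: (eq_partial i oO Ow) => u _; exact: ImM.
rewrite partialD; [|exact: D..].
rewrite !partialM; [|by [exact: dIm|exact: dRe]..].
by rewrite ImD !ImM /=; ring.
Qed.

Lemma cpartial_conj : cpartial i (fun u => conjc (f u)) w = conjc (cpartial i f w).
Proof.
apply: complexP; rewrite ?ReJ ?ImJ /=.
  by apply: (eq_partial i oO Ow) => u _; rewrite ReJ.
rewrite -partialN; last exact: dIm.
by apply: (eq_partial i oO Ow) => u _; rewrite ImJ.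
Qed.

End Rules.

Lemma cpartialB f g i w : csmooth O f -> csmooth O g -> O w ->
  cpartial i (fun u => f u - g u) w = cpartial i f w - cpartial i g w.
Proof.
move=> sf sg Ow; rewrite (cpartialD sf (csmoothN sg)) //; by rewrite cpartialN.
Qed.

Lemma cpartial_cst (c : R[i]) i w : cpartial i (fun=> c) w = 0.
Proof. by rewrite /cpartial !partial_cst. Qed.

Lemma cpartial_real (h : V -> R) i w : cpartial i (fun u => (h u)%:C) w = (partial i h w)%:C.
Proof. by rewrite /cpartial /= partial_cst. Qed.

Lemma cpartialZ (c : R[i]) f i w : csmooth O f -> O w ->
  cpartial i (fun u => c * f u) w = c * cpartial i f w.
Proof.
move=> sf Ow; rewrite (cpartialM (csmooth_cst c) sf) // cpartial_cst.
by rewrite mul0r add0r.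
Qed.

Lemma cpartialV f i w : (forall u, O u -> f u != 0) -> csmooth O f -> O w ->
  cpartial i (fun u => (f u)^-1) w = - cpartial i f w / f w ^+ 2.
Proof.
move=> f0 sf Ow; have f0w := f0 w Ow.
have := cpartialM sf (csmoothV f0 sf) i Ow.
rewrite (@eq_cpartial _ (fun=> 1)) // ?cpartial_cst; last by move=> u Ou; rewrite divff ?f0.
move/eqP; rewrite eq_sym addr_eq0 => /eqP E.
rewrite mulNr -[LHS]mul1r -(mulVf f0w) -mulrA -[f w * _]opprK -E.
by field.
Qed.

Lemma cpartial_comp O' f (T : V -> V) i w : open O' -> csmooth O' f ->
  (forall u, O u -> O' (T u)) -> smooth_map_on O T -> O w ->
  cpartial i (fun u => f (T u)) w =
    cpartial 0 f (T w) * (partial i (fun u => T u 0 0) w)%:C +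
    cpartial 1 f (T w) * (partial i (fun u => T u 0 1) w)%:C.
Proof.
move=> oO' [fr fi] OO' sT Ow.
have dT k : differentiable (fun u => T u 0 k) w by exact: smooth_differentiable oO (sT k) Ow.
have OT := OO' w Ow.
have E (x y : R[i]) (a b : R) : Re (x * a%:C + y * b%:C) = Re x * a + Re y * b /\
    Im (x * a%:C + y * b%:C) = Im x * a + Im y * b.
  by rewrite ReD ImD !(ReM, ImM) /= !mulr0 !subr0 !add0r.
apply: complexP; rewrite ?(proj1 (E _ _ _ _)) ?(proj2 (E _ _ _ _)).
  exact: (partial_comp i (smooth_differentiable oO' fr OT) dT).
exact: (partial_comp i (smooth_differentiable oO' fi OT) dT).
Qed.

Section DzRules.
Variables (f g : V -> R[i]) (sf : csmooth O f) (sg : csmooth O g) (w : V) (Ow : O w).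

Lemma dzD : dz (fun u => f u + g u) w = dz f w + dz g w.
Proof. by rewrite !dz_def (cpartialD sf sg 0 Ow) (cpartialD sf sg 1 Ow); move: (cpartial 0 f w) (cpartial 1 f w) (cpartial 0 g w) (cpartial 1 g w) => *; ring. Qed.
Lemma dzB : dz (fun u => f u - g u) w = dz f w - dz g w.
Proof. by rewrite !dz_def (cpartialB 0 sf sg Ow) (cpartialB 1 sf sg Ow); move: (cpartial 0 f w) (cpartial 1 f w) (cpartial 0 g w) (cpartial 1 g w) => *; ring. Qed.
Lemma dzM : dz (fun u => f u * g u) w = dz f w * g w + f w * dz g w.
Proof.
rewrite !dz_def (cpartialM sf sg 0 Ow) (cpartialM sf sg 1 Ow).
by move: (cpartial 0 f w) (cpartial 1 f w) (cpartial 0 g w) (cpartial 1 g w) (f w) (g w) => *; ring.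
Qed.
Lemma dzZ c : dz (fun u => c * f u) w = c * dz f w.
Proof.
rewrite !dz_def (cpartialZ c 0 sf Ow) (cpartialZ c 1 sf Ow).
by move: (cpartial 0 f w) (cpartial 1 f w) => *; ring.
Qed.
Lemma dzV : (forall u, O u -> f u != 0) -> dz (fun u => (f u)^-1) w = - dz f w / f w ^+ 2.
Proof.
move=> f0; rewrite !dz_def (cpartialV 0 f0 sf Ow) (cpartialV 1 f0 sf Ow).
by move: (cpartial 0 f w) (cpartial 1 f w) (f w) => *; ring.
Qed.
End DzRules.

Lemma dz_cst (c : R[i]) w : dz (fun=> c) w = 0.
Proof. by rewrite /dz !cpartial_cst mulr0 subrr mul0r. Qed.

Lemma dz_div f g w : csmooth O f -> csmooth O g -> (forall u, O u -> g u != 0) -> O w ->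
  dz (fun u => f u / g u) w = (dz f w * g w - f w * dz g w) / g w ^+ 2.
Proof.
move=> sf sg g0 Ow; rewrite (dzM sf (csmoothV g0 sg) Ow) (dzV sg Ow g0).
by field; exact: g0.
Qed.

End Open.
End ComplexCalculus.

#[global] Opaque partial cpartial dz iunit.

(** * Holomorphic functions *)

Section Clairaut.
Context {R : realType}.
Local Notation V := ('rV[R]_2).
Implicit Types (O : set V) (f : V -> R) (w u : V).

Definition box (w : V) (r : R) : set V := [set u | forall i, `|u 0 i - w 0 i| < r].

Lemma box_ball w r : 0 < r -> box w r = ball w r.
Proof. by move=> r0; apply/seteqP; split=> u; rewrite ball_row2. Qed.

Lemma open_box_set w r : open (box w r).
Proof.
have [r0|r0] := ltP 0 r; first by rewrite box_ball //; exact: ball_open.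
rewrite (_ : box w r = set0); first exact: open0.
by apply/seteqP; split=> // u /(_ 0) /(le_lt_trans (normr_ge0 _)) /(le_lt_trans r0); rewrite ltxx.
Qed.

Lemma box_center w r : 0 < r -> box w r w.
Proof. by move=> r0 i; rewrite subrr normr0. Qed.

Lemma box_sub w r r' : r <= r' -> box w r `<=` box w r'.
Proof. by move=> h u hu i; apply: lt_le_trans h. Qed.

Lemma open_boxP O w : open O -> O w -> exists2 r : R, 0 < r & box w r `<=` O.
Proof. by move=> oO Ow; have [r r0 h] := open_box oO Ow; exists r. Qed.

Lemma derivable_shift f (c v : V) w :
  derivable f (w + c) v -> derivable (fun u => f (u + c)) w v.
Proof. by rewrite /derivable /=; under eq_fun do rewrite addrA. Qed.

Lemma derive_shiftE f (c v : V) w : 'D_v (fun u => f (u + c)) w = 'D_v f (w + c).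
Proof.
have E : (fun h : R => h^-1 *: (((fun u => f (u + c)) \o shift w) (h *: v) - f (w + c))) =
  (fun h : R => h^-1 *: ((f \o shift (w + c)) (h *: v) - f (w + c))).
  by apply/funext => h /=; rewrite addrA.
by rewrite /derive E.
Qed.

Lemma box2 (w : V) (t s h r : R) i j : `|t| <= h -> `|s| <= h -> h + h < r ->
  box w r (w + t *: bvec i + s *: bvec j).
Proof.
move=> ht hs hr k.
have -> : (w + t *: bvec i + s *: bvec j) 0 k - w 0 k = t * (i == k)%:R + s * (j == k)%:R.
  by rewrite -!bvecE !mxE; ring.
have b (x : R) (b : bool) : `|x| <= h -> `|x * b%:R| <= h.
  by move=> hx; case: b; rewrite ?mulr1 // mulr0 normr0; apply: le_trans hx.
apply: le_lt_trans (ler_normD _ _) _; apply: le_lt_trans hr.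
by apply: lerD; apply: b.
Qed.

(** The mean value theorem in direction [i] for [u -> f (u + h e_j) - f u], then in direction [j]
    for [partial i f]. The left side is symmetric in [i] and [j], which yields the equality of mixed
    partials; for [i = j] it is the second difference behind the test at a maximum. *)
Lemma second_difference O f w i j (r h : R) : open O -> smooth_on O f ->
  box w r `<=` O -> 0 < h -> h + h < r ->
  exists2 u, box w r u &
   f (w + h *: bvec i + h *: bvec j) - f (w + h *: bvec i) - f (w + h *: bvec j) + f w
    = h * (h * partial j (partial i f) u).
Proof.
move=> oO sf bO h0 hr.
have bO' t s : `|t| <= h -> `|s| <= h -> O (w + t *: bvec i + s *: bvec j).
  by move=> ht hs; apply: bO; apply: box2 ht hs hr.
have hh : `|h| <= h by rewrite ger0_norm // ltW.
have z0 : `|0 : R| <= h by rewrite normr0 ltW.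
pose F u := f (u + h *: bvec j) - f u.
have dF t : `|t| <= h -> derivable (fun u => f (u + h *: bvec j)) (w + t *: bvec i) (bvec i)
   /\ derivable f (w + t *: bvec i) (bvec i).
  move=> ht; split.
    apply: derivable_shift; apply: diff_derivable; apply: smooth_differentiable oO sf _.
    exact: bO'.
  apply: diff_derivable; apply: smooth_differentiable oO sf _.
  by have := bO' t 0 ht z0; rewrite scale0r addr0.
have [|t ht E] := @mvt_line _ F w (bvec i) h.
  move=> t; rewrite (ger0_norm (ltW h0)) => ht; have [d1 d2] := dF t ht.
  exact: (derivableB d1 d2).
move: ht; rewrite (ger0_norm (ltW h0)) => ht.
have [|s hs E'] := @mvt_line _ (partial i f) (w + t *: bvec i) (bvec j) h.
  move=> s; rewrite (ger0_norm (ltW h0)) => hs.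
  apply: diff_derivable; apply: smooth_differentiable oO (smooth_partial i sf) _.
  exact: bO'.
move: hs; rewrite (ger0_norm (ltW h0)) => hs.
exists (w + t *: bvec i + s *: bvec j); first exact: box2 ht hs hr.
rewrite (partial_def (partial i f) j) -E'.
have [d1 d2] := dF t ht.
have {}E : F (w + h *: bvec i) - F w = h * (partial i f (w + t *: bvec i + h *: bvec j) - partial i f (w + t *: bvec i)).
  by rewrite E /F (deriveB d1 d2) derive_shiftE !partial_def.
by rewrite -E /F; ring.
Qed.

Lemma partialC O f w i j : open O -> smooth_on O f -> O w ->
  partial i (partial j f) w = partial j (partial i f) w.
Proof.
move=> oO sf Ow; have [r r0 bO] := open_boxP oO Ow.
apply/eqP; rewrite -subr_eq0 -normr_le0; apply/ler_addgt0Pr => e e0; rewrite add0r.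
have e2 : 0 < e / 2 by rewrite divr_gt0.
have near1 k l : exists2 d : R, 0 < d & forall u, box w d u ->
   `|partial k (partial l f) w - partial k (partial l f) u| < e / 2.
  have c : {for w, continuous (partial k (partial l f))}.
    by have [] := sf [:: k; l] w Ow.
  have /nbhs_ballP[d /= d0 H] : \forall u \near w, `|partial k (partial l f) w - partial k (partial l f) u| < e / 2.
    by move/cvgrPdist_lt : c => /(_ _ e2).
  by exists d => // u; rewrite box_ball //; exact: H.
have [d1 d10 H1] := near1 i j; have [d2 d20 H2] := near1 j i.
pose d := Num.min r (Num.min d1 d2).
have d0 : 0 < d by rewrite !lt_min r0 d10 d20.
have [dr dd1 dd2] : [/\ d <= r, d <= d1 & d <= d2].
  by split; rewrite /d !ge_min lexx ?orbT.
(* The step [d / 3] keeps twice the step below [d], as [second_difference] requires. *)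
have h0 : 0 < d / 3%:R by rewrite divr_gt0.
have hd : d / 3%:R + d / 3%:R < d by move: d0; lra.
have bd : box w d `<=` O by move=> u /(box_sub dr) /bO.
have [u1 bu1 E1] := second_difference j i oO sf bd h0 hd.
have [u2 bu2 E2] := second_difference i j oO sf bd h0 hd.
have E : partial i (partial j f) u1 = partial j (partial i f) u2.
  have eqL : forall a b c d : R, a - b - c + d = a - c - b + d by move=> *; ring.
  move: E1; rewrite eqL [w + _ + _]addrAC => E1.
  by move: (etrans (esym E1) E2) => /(@mulfI R _ (lt0r_neq0 h0))/(@mulfI R _ (lt0r_neq0 h0)).
rewrite -[X in X - _](subrK (partial i (partial j f) u1)) {2}E -addrA.
apply: le_trans (ler_normD _ _) _; rewrite [e]splitr; apply: lerD; apply: ltW.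
  by apply: H1; apply: box_sub bu1.
by rewrite distrC; apply: H2; apply: box_sub bu2.
Qed.

Lemma partial0_const (f : V -> R) w r u : (forall v i, box w r v -> derivable f v (bvec i)) ->
  (forall v i, box w r v -> partial i f v = 0) -> box w r u -> f u = f w.
Proof.
move=> df f0 bu.
pose m := w + (u 0 0 - w 0 0) *: bvec 0.
have um : u = m + (u 0 1 - w 0 1) *: bvec 1.
  by apply: row2P; rewrite !mxE /= ?mulr1 ?mulr0 ?addr0 addrC subrK.
have bm (t : R) : `|t| <= `|u 0 0 - w 0 0| -> box w r (w + t *: bvec 0).
  move=> ht; apply: ord2P; rewrite !mxE /= ?mulr1 ?mulr0 ?addr0; last first.
    by rewrite subrr normr0; apply: le_lt_trans (bu 0).
  by rewrite addrAC subrr add0r; exact: le_lt_trans ht (bu 0).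
have bm' (t : R) : `|t| <= `|u 0 1 - w 0 1| -> box w r (m + t *: bvec 1).
  move=> ht; apply: ord2P; rewrite !mxE /= ?mulr1 ?mulr0 ?addr0.
    by rewrite [w 0 0 + _]addrC subrK; exact: bu.
  by rewrite addrAC subrr add0r; exact: le_lt_trans ht (bu 1).
have [|t ht E] := @mvt_line _ f w (bvec 0) (u 0 0 - w 0 0).
  by move=> t ht; apply: df; exact: bm.
have [|t' ht' E'] := @mvt_line _ f m (bvec 1) (u 0 1 - w 0 1).
  by move=> t' ht'; apply: df; exact: bm'.
move: E E'; rewrite -um -/m.
rewrite -!partial_def (f0 _ _ (bm _ ht)) (f0 _ _ (bm' _ ht')).
by rewrite !mulr0 => /eqP; rewrite subr_eq0 => /eqP <- /eqP; rewrite subr_eq0 => /eqP.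
Qed.

End Clairaut.

Section Holomorphic.
Context {R : realType}.
Local Notation V := ('rV[R]_2).
Local Notation Re := complex.Re.
Local Notation Im := complex.Im.
Local Notation iu := (@iunit R).
Implicit Types (O : set V) (w u : V) (f g : V -> R[i]).

Lemma cpartialC O f w i j : open O -> csmooth O f -> O w ->
  cpartial i (cpartial j f) w = cpartial j (cpartial i f) w.
Proof.
move=> oO [fr fi] Ow.
have Er k l : Re (cpartial k (cpartial l f) w) = partial k (partial l (fun u => Re (f u))) w.
  exact: (etrans (Re_cpartial _ _ _) (eq_partial k oO Ow (fun u _ => Re_cpartial l f u))).
have Ei k l : Im (cpartial k (cpartial l f) w) = partial k (partial l (fun u => Im (f u))) w.
  exact: (etrans (Im_cpartial _ _ _) (eq_partial k oO Ow (fun u _ => Im_cpartial l f u))).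
apply: complexP.
  exact: (etrans (Er i j) (etrans (partialC i j oO fr Ow) (esym (Er j i)))).
exact: (etrans (Ei i j) (etrans (partialC i j oO fi Ow) (esym (Ei j i)))).
Qed.

Lemma iunitC : iu = 'i. Proof. by []. Qed.

Definition zc w : R[i] := w 0 0 +i* w 0 1.
(** Smoothness is built into the notion beside the Cauchy-Riemann equation, so that derivatives of
    every order exist without any integral formula. *)
Definition hol O f := csmooth O f /\ forall w, O w -> cpartial 1 f w = iu * cpartial 0 f w.

Lemma hol_subset O O' f : O' `<=` O -> hol O f -> hol O' f.
Proof. by move=> s [sf cr]; split; [exact: csmooth_subset sf|move=> w /s; exact: cr]. Qed.

Lemma holP O f : csmooth O f -> 
  (exists d : V -> R[i], forall w, O w -> cpartial 0 f w = d w /\ cpartial 1 f w = iu * d w) -> hol O f.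
Proof. by move=> sf [d h]; split=> // w /h[-> ->]. Qed.

Lemma dz_cp0 O f w : hol O f -> O w -> cpartial 0 f w = dz f w.
Proof.
move=> [_ cr] Ow; rewrite dz_def cr // mulrA iunitE mulN1r opprK.
by field.
Qed.

Lemma dz_cp1 O f w : hol O f -> O w -> cpartial 1 f w = iu * dz f w.
Proof. by move=> hf Ow; rewrite -(dz_cp0 hf Ow); case: hf => _; apply. Qed.

Lemma dzE f w d : cpartial 0 f w = d -> cpartial 1 f w = iu * d -> dz f w = d.
Proof. by move=> h0 h1; rewrite dz_def h0 h1 mulrA iunitE; field. Qed.

Lemma dz_zc w : dz zc w = 1.
Proof. by apply: dzE; apply: complexP; rewrite ?ReM ?ImM !(Re_cpartial,Im_cpartial) /= !partial_coord ?iunitC /=; ring. Qed.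

Section Open.
Variables (O : set V) (oO : open O).

Lemma hol_cst (c : R[i]) : hol O (fun=> c).
Proof. by split; [exact: csmooth_cst|move=> w _; rewrite !cpartial_cst mulr0]. Qed.

Lemma hol_eq f g : (forall u, O u -> f u = g u) -> hol O f -> hol O g.
Proof.
move=> h [sf cr]; split; first exact: csmooth_eq h sf.
by move=> w Ow; rewrite -!(eq_cpartial oO _ Ow h) cr.
Qed.

Lemma holD f g : hol O f -> hol O g -> hol O (fun u => f u + g u).
Proof.
move=> [sf cf] [sg cg]; split; first exact: csmoothD.
by move=> w Ow; rewrite !(cpartialD oO) // cf // cg //; ring.
Qed.

Lemma holN f : hol O f -> hol O (fun u => - f u).
Proof.
move=> [sf cf]; split; first exact: csmoothN.
by move=> w Ow; rewrite !(cpartialN oO) // cf //; ring.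
Qed.

Lemma holB f g : hol O f -> hol O g -> hol O (fun u => f u - g u).
Proof. by move=> hf hg; exact: holD hf (holN hg). Qed.

Lemma holM f g : hol O f -> hol O g -> hol O (fun u => f u * g u).
Proof.
move=> [sf cf] [sg cg]; split; first exact: csmoothM.
by move=> w Ow; rewrite !(cpartialM oO) // cf // cg //; ring.
Qed.

Lemma holZ c f : hol O f -> hol O (fun u => c * f u).
Proof. by move=> hf; exact: holM (hol_cst c) hf. Qed.

Lemma holV f : (forall u, O u -> f u != 0) -> hol O f -> hol O (fun u => (f u)^-1).
Proof.
move=> f0 [sf cf]; split; first exact: csmoothV.
by move=> w Ow; rewrite !(cpartialV oO) // cf //; ring.
Qed.

Lemma hol_div f g : (forall u, O u -> g u != 0) -> hol O f -> hol O g -> hol O (fun u => f u / g u).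
Proof. by move=> g0 hf hg; exact: holM hf (holV g0 hg). Qed.

Lemma hol_dz f : hol O f -> hol O (dz f).
Proof.
move=> hf; have [sf cf] := hf; have s0 := csmooth_cpartial 0 sf.
have E u : O u -> cpartial 0 f u = dz f u by move=> Ou; exact: dz_cp0 hf Ou.
apply: (hol_eq E); split=> // w Ow.
rewrite (cpartialC 1 0 oO sf Ow) (eq_cpartial oO 0 Ow cf).
by rewrite (cpartialZ oO _ _ s0).
Qed.

Lemma hol_zc : hol O zc.
Proof.
split; first by split=> /=; exact: smooth_coord.
move=> w _; apply: complexP; rewrite ?ReM ?ImM !(Re_cpartial,Im_cpartial) /= !partial_coord ?iunitC /=; ring.
Qed.

Lemma cpartial_zc (T : V -> V) i w :
  cpartial i (fun u => zc (T u)) w = (partial i (fun u => T u 0 0) w) +i* (partial i (fun u => T u 0 1) w).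
Proof. by []. Qed.

Lemma cpartial_hol_comp O' f (T : V -> V) i w : open O' -> hol O' f ->
  (forall u, O u -> O' (T u)) -> smooth_map_on O T -> O w ->
  cpartial i (fun u => f (T u)) w = dz f (T w) * cpartial i (fun u => zc (T u)) w.
Proof.
move=> oO' hf OO' sT Ow; have [sf cf] := hf.
rewrite (cpartial_comp oO i oO' sf OO' sT Ow) (dz_cp0 hf (OO' w Ow)) (dz_cp1 hf (OO' w Ow)).
rewrite cpartial_zc; move: (dz f (T w)) (partial i _ w) (partial i _ w) => d a b.
rewrite [b +i* a]complexE iunitC /=; ring.
Qed.

Lemma csmooth_zc (T : V -> V) : smooth_map_on O T -> csmooth O (fun u => zc (T u)).
Proof. by move=> sT; split; exact: sT. Qed.

Lemma dz_comp O' f (T : V -> V) w : open O' -> hol O' f ->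
  (forall u, O u -> O' (T u)) -> smooth_map_on O T -> O w ->
  dz (fun u => f (T u)) w = dz f (T w) * dz (fun u => zc (T u)) w.
Proof.
move=> oO' hf OO' sT Ow.
by rewrite [LHS]dz_def [X in _ = _ * X]dz_def !(cpartial_hol_comp _ oO' hf OO' sT Ow); field.
Qed.

Lemma hol_comp O' f (T : V -> V) : open O' -> hol O' f ->
  (forall u, O u -> O' (T u)) -> smooth_map_on O T -> hol O (fun u => zc (T u)) ->
  hol O (fun u => f (T u)).
Proof.
move=> oO' hf OO' sT [_ ct]; split; first by apply: (csmooth_comp oO oO' _ OO' sT); case: hf.
by move=> w Ow; rewrite !(cpartial_hol_comp _ oO' hf OO' sT Ow) ct //; ring.
Qed.

Lemma hol_horner (p : {poly R[i]}) : hol O (fun u => p.[zc u]).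
Proof.
elim/poly_ind: p => [|p c IH].
  by apply: (hol_eq _ (hol_cst 0)) => u _; rewrite horner0.
apply: (hol_eq _ (holD (holM IH hol_zc) (hol_cst c))) => u _.
by rewrite hornerMXaddC.
Qed.

End Open.

Lemma dz_horner (p : {poly R[i]}) w : dz (fun u => p.[zc u]) w = p^`().[zc w].
Proof.
have oT : open [set: V] by exact: openT.
have ht := I : [set: V] w.
elim/poly_ind: p => [|p c IH].
  rewrite (@eq_dz _ _ oT _ (fun=> 0)) // ?dz_cst ?deriv0 ?horner0 // => u _.
  by rewrite horner0.
rewrite (@eq_dz _ _ oT _ (fun u => p.[zc u] * zc u + c)) //; last first.
  by move=> u _; rewrite hornerMXaddC.
have [sp _] := hol_horner oT p; have [sz _] := hol_zc oT.
have sc := csmooth_cst oT c.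
rewrite (dzD oT (csmoothM oT sp sz) sc ht) (dzM oT sp sz ht) dz_cst dz_zc IH.
by rewrite derivD derivC derivM derivX !hornerE.
Qed.

Lemma dz0_const O f w r u : open O -> hol O f -> box w r `<=` O ->
  (forall v, box w r v -> dz f v = 0) -> box w r u -> f u = f w.
Proof.
move=> oO hf bO f0 bu; have [[fr fi] _] := hf.
have h i v : box w r v -> cpartial i f v = 0.
  move=> bv; have Ov := bO v bv; move: i; apply: ord2P.
    by rewrite (dz_cp0 hf Ov) f0.
  by rewrite (dz_cp1 hf Ov) f0 // mulr0.
apply: complexP.
  apply: (@partial0_const _ (fun u => Re (f u)) w r) => // v i bv.
    by apply: diff_derivable; apply: smooth_differentiable oO fr (bO v bv).
  by have := h i v bv => /(congr1 (@complex.Re R)); rewrite Re_cpartial.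
apply: (@partial0_const _ (fun u => Im (f u)) w r) => // v i bv.
  by apply: diff_derivable; apply: smooth_differentiable oO fi (bO v bv).
by have := h i v bv => /(congr1 (@complex.Im R)); rewrite Im_cpartial.
Qed.

End Holomorphic.

(** * Cauchy estimates *)

Section CauchyEstimate.
Context {R : realType}.
Local Notation V := ('rV[R]_2).
Local Notation Re := complex.Re.
Local Notation Im := complex.Im.
Implicit Types (O : set V) (w u : V) (f g : V -> R[i]).

(** If the second derivative were positive at [v], it would be so nearby, and the second difference
    centred at [v], which is [h^2] times such a value, would be positive; but both of its outer
    values are at most [U v]. *)
Lemma max_partial2 O (U : V -> R) v i : open O -> smooth_on O U -> O v ->
  (forall u, O u -> U u <= U v) -> partial i (partial i U) v <= 0.
Proof.
move=> oO sU Ov hmax; rewrite leNgt; apply/negP => pos.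
have c : {for v, continuous (partial i (partial i U))} by have [] := sU [:: i; i] v Ov.
have /nbhs_ballP[d /= d0 Hd] : \forall u \near v, 0 < partial i (partial i U) u.
  by move/cvgr_gt : c; apply.
have [r r0 bO] := open_boxP oO Ov.
pose m := Num.min r d.
have m0 : 0 < m by rewrite lt_min r0 d0.
have [mr md] : m <= r /\ m <= d by split; rewrite /m ge_min lexx ?orbT.
(* The second difference based at [w = v - h e_i] is centred at [v]. The box of radius [3m/4] around
   [w] lies in the box of radius [m] around [v], and its radius exceeds [2h = m/2]. *)
pose h : R := m / 4%:R.
have h0 : 0 < h by rewrite divr_gt0.
pose w := v - h *: bvec i.
have bw u : box w (m / 4%:R * 3%:R) u -> box v m u.
  move=> bu k; have := bu k; rewrite !mxE => b1.
  have b2 : `|h * bvec i 0 k| <= h.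
    by rewrite bvecE; case: (_ == _); rewrite ?mulr1 ?mulr0 ?normr0 ?gtr0_norm // ltW.
  rewrite (_ : u 0 k - v 0 k = u 0 k - (v 0 k - h * bvec i 0 k) - h * bvec i 0 k); last by ring.
  apply: le_lt_trans (ler_normB _ _) _.
  move: b1 b2; rewrite !mxE /h; move: (`|_|) (`|_|) => x y; lra.
have [u bu E] := @second_difference R O U w i i (m / 4%:R * 3%:R) h oO sU
   (fun u b => bO u (box_sub mr (bw u b))) h0 ltac:(rewrite /h; lra).
have e1 : w + h *: bvec i = v by rewrite /w subrK.
have : 0 < h * (h * partial i (partial i U) u).
  have := Hd u; rewrite -(box_ball v d0) => /(_ (box_sub md (bw u bu))) pu.
  exact: (mulr_gt0 h0 (mulr_gt0 h0 pu)).
rewrite -E e1.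
have hm2 : h + h < m by rewrite /h; move: m m0 {mr md h h0 w bw bu E e1}; clear; move=> m m0; lra.
have i1 : U (v + h *: bvec i) <= U v.
  apply: hmax; apply: bO; apply: (box_sub mr); rewrite -[_ + _]addr0 -(scale0r (bvec i)).
  by apply: (@box2 _ v h 0 h); rewrite ?normr0 ?(gtr0_norm h0) ?(ltW h0).
have i2 : U w <= U v.
  apply: hmax; apply: bO; apply: (box_sub mr); rewrite /w -scaleNr -[_ + _]addr0 -(scale0r (bvec i)).
  by apply: (@box2 _ v (- h) 0 h); rewrite ?normr0 ?normrN ?(gtr0_norm h0) ?(ltW h0).
move: i1 i2; move: (U _) (U w) (U v); clear; move=> x y z; lra.
Qed.

(** Differentiability is paired with the value of the derivative, so that the derivative of a long
    polynomial expression is assembled by following its syntax and compared with the expected one by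
    [ring] only at the end. *)
Definition pder i (F : V -> R) u (d : R) := differentiable F u /\ partial i F u = d.

Lemma pderD i (F G : V -> R) u d e : pder i F u d -> pder i G u e ->
  pder i (fun v => F v + G v) u (d + e).
Proof. by move=> [dF <-] [dG <-]; split; [exact: differentiableD|exact: partialD]. Qed.

Lemma pderM i (F G : V -> R) u d e : pder i F u d -> pder i G u e ->
  pder i (fun v => F v * G v) u (d * G u + F u * e).
Proof. by move=> [dF <-] [dG <-]; split; [exact: differentiableM|exact: partialM]. Qed.

Lemma pderB i (F G : V -> R) u d e : pder i F u d -> pder i G u e ->
  pder i (fun v => F v - G v) u (d - e).
Proof. by move=> [dF <-] [dG <-]; split; [exact: differentiableB|exact: partialB]. Qed.

Lemma pder_cst i (c : R) u : pder i (fun=> c) u 0.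
Proof. by split; [exact: differentiable_cst|exact: partial_cst]. Qed.

Lemma pder_eq i (F : V -> R) u d e : pder i F u d -> d = e -> partial i F u = e.
Proof. by move=> [_ <-]. Qed.

(** The second derivative along one coordinate of Bernstein's auxiliary function
    [chi^2 |f'|^2 + 7 r2 |f|^2], where [chi = r2 - X^2 - Y^2] and [f' = p + i q]. Here [Z] is the
    coordinate in question and primes on arguments are derivatives along it; [s] is the real inner
    product of [f'] with its derivative, and [t'] is the derivative of the corresponding product for
    [f]. *)
Definition bernstein_form (r2 X Y p q Z s X' Y' p' q' Z' s' t' : R) : R :=
  - 4%:R * Z' * (r2 - X * X - Y * Y) * (p * p + q * q)
  + 8%:R * Z * (X' * X + Y' * Y) * (p * p + q * q)
  - 8%:R * Z * (r2 - X * X - Y * Y) * (p * p' + q * q')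
  - 8%:R * (X' * X + Y' * Y) * (r2 - X * X - Y * Y) * s
  + 2%:R * ((r2 - X * X - Y * Y) * (r2 - X * X - Y * Y)) * s'
  + 14%:R * r2 * t'.

Lemma bernstein_form_gt0 (r2 x y P Q p q a b c d : R) : 0 < r2 -> 0 < p ^+ 2 + q ^+ 2 ->
  0 < bernstein_form r2 x y p q x (p * a + q * b) 1 0 a b 1
        (a * a + p * c + (b * b + q * d)) (p * p + P * a + (q * q + Q * b))
    + bernstein_form r2 x y p q y (q * a - p * b) 0 1 (- b) a 1
        (a * a + q * - d - (- b * b + p * c)) (p * p + Q * - b - (- q * q + P * a)).
Proof.
move=> r0 n0; rewrite [X in 0 < X](_ : _ = 4%:R * ((r2 - x * x - y * y) * a - 2%:R * (x * p + y * q)) ^+ 2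
  + 4%:R * ((r2 - x * x - y * y) * b - 2%:R * (x * q - y * p)) ^+ 2 + 20%:R * r2 * (p ^+ 2 + q ^+ 2)); last first.
  by rewrite /bernstein_form; ring.
apply: ltr_wpDl; first by rewrite addr_ge0 // mulr_ge0 // sqr_ge0.
by rewrite mulr_gt0 // mulr_gt0.
Qed.

Section BernsteinAlgebra.
Variables (P Q p q X Y : V -> R) (P' Q' p' q' X' Y' r2 : R) (i : 'I_2) (u : V).
Hypotheses (dP : pder i P u P') (dQ : pder i Q u Q') (dp : pder i p u p') (dq : pder i q u q')
  (dX : pder i X u X') (dY : pder i Y u Y').

Lemma bernstein_der1 :
  partial i (fun v => (r2 - X v * X v - Y v * Y v) * (r2 - X v * X v - Y v * Y v) * (p v * p v + q v * q v)
     + 7%:R * r2 * (P v * P v + Q v * Q v)) u =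
  - 4%:R * (X' * X u + Y' * Y u) * (r2 - X u * X u - Y u * Y u) * (p u * p u + q u * q u)
  + 2%:R * ((r2 - X u * X u - Y u * Y u) * (r2 - X u * X u - Y u * Y u)) * (p u * p' + q u * q')
  + 14%:R * r2 * (P u * P' + Q u * Q').
Proof.
apply: pder_eq.
  by do ?[exact: dP|exact: dQ|exact: dp|exact: dq|exact: dX|exact: dY|exact: pder_cst|apply: pderB|apply: pderD|apply: pderM].
by cbv beta; ring.
Qed.

(* [Z] is the coordinate differentiated along, [s], [t] pair [f'] with its derivative. *)
Lemma bernstein_der2 (Z s t : V -> R) (Z' s' t' : R) :
  pder i Z u Z' -> pder i s u s' -> pder i t u t' ->
  partial i (fun v => - 4%:R * Z v * (r2 - X v * X v - Y v * Y v) * (p v * p v + q v * q v)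
     + 2%:R * ((r2 - X v * X v - Y v * Y v) * (r2 - X v * X v - Y v * Y v)) * s v
     + 14%:R * r2 * t v) u =
  bernstein_form r2 (X u) (Y u) (p u) (q u) (Z u) (s u) X' Y' p' q' Z' s' t'.
Proof.
move=> dZ ds dt; rewrite /bernstein_form; apply: pder_eq.
  by do ?[exact: dZ|exact: ds|exact: dt|exact: dp|exact: dq|exact: dX|exact: dY|exact: pder_cst|apply: pderB|apply: pderD|apply: pderM].
by cbv beta; ring.
Qed.

End BernsteinAlgebra.

Definition dist2 u w : R := norm2c (zc u - zc w).

Lemma dist2E u w : dist2 u w = (u 0 0 - w 0 0) ^+ 2 + (u 0 1 - w 0 1) ^+ 2.
Proof. by rewrite /dist2 /norm2c ReB ImB. Qed.

Lemma smooth_dist2 O w : open O -> smooth_on O (fun u => dist2 u w).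
Proof.
move=> oO; apply: (@smooth_norm2c _ O oO (fun u => zc u - zc w)).
by apply: (csmoothB oO); [case: (hol_zc oO)|exact: csmooth_cst].
Qed.

Lemma continuous_dist2 w : continuous (fun u => dist2 u w).
Proof.
move=> u; apply: differentiable_continuous.
exact: (smooth_differentiable openT (smooth_dist2 w openT) I).
Qed.

Lemma compact_disc w (r2 : R) : compact [set u | dist2 u w <= r2].
Proof.
have [r0|r0] := ltP r2 0.
  rewrite (_ : [set u | _] = set0); first exact: compact0.
  apply/seteqP; split=> // u /= /le_lt_trans /(_ r0).
  by rewrite ltNge norm2c_ge0.
have cb := @rV_compact R 2 (fun i => `[w 0 i - (1 + r2), w 0 i + (1 + r2)]%classic) (fun i => @segment_compact R _ _).
apply: subclosed_compact cb _.
  apply: (@closed_comp _ _ (fun u => dist2 u w) [set x | x <= r2]); first by move=> u _; exact: continuous_dist2.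
  exact: closed_le.
(* From [a^2 <= r2] follows [|a| <= 1 + r2], a coarse box that avoids the square root of [r2]. *)
have key (x y z : R) : (y - x) ^+ 2 <= r2 - z ^+ 2 -> x - (1 + r2) <= y <= x + (1 + r2).
  have := sqr_ge0 (y - x - 1); have := sqr_ge0 (y - x + 1); have := sqr_ge0 z.
  by rewrite !expr2 => ? ? ? ?; apply/andP; split; lra.
move=> u /=; rewrite dist2E => hu; apply: ord2P; rewrite in_itv /=.
  by apply: (key _ _ (u 0 1 - w 0 1)); lra.
by apply: (key _ _ (u 0 0 - w 0 0)); lra.
Qed.

Section Bernstein.
Variables (O : set V) (oO : open O) (f : V -> R[i]) (hf : hol O f).
Variables (w : V) (rho : R) (rho0 : 0 < rho) (B : R).
Hypothesis discO : forall u, dist2 u w <= rho ^+ 2 -> O u.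
Hypothesis fB : forall u, dist2 u w <= rho ^+ 2 -> norm2c (f u) <= B.

Let f1 := dz f.
Let f2 := dz f1.
Let f3 := dz f2.
Let h1 : hol O f1 := hol_dz oO hf.
Let h2 : hol O f2 := hol_dz oO h1.
Let h3 : hol O f3 := hol_dz oO h2.

Let der0 g u : hol O g -> O u -> pder 0 (fun v => Re (g v)) u (Re (dz g u))
  /\ pder 0 (fun v => Im (g v)) u (Im (dz g u)).
Proof.
move=> hg Ou; have [[sr si] _] := hg; rewrite -(dz_cp0 hg Ou) Re_cpartial Im_cpartial.
split; split=> //; [exact: (smooth_differentiable oO sr Ou)|exact: (smooth_differentiable oO si Ou)].
Qed.

Let der1 g u : hol O g -> O u -> pder 1 (fun v => Re (g v)) u (- Im (dz g u))
  /\ pder 1 (fun v => Im (g v)) u (Re (dz g u)).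
Proof.
move=> hg Ou; have [[sr si] _] := hg.
have E := dz_cp1 hg Ou.
have -> : - Im (dz g u) = Re (cpartial 1 g u) by rewrite E ReM iunitC /=; ring.
have -> : Re (dz g u) = Im (cpartial 1 g u) by rewrite E ImM iunitC /=; ring.
rewrite Re_cpartial Im_cpartial.
split; split=> //; [exact: (smooth_differentiable oO sr Ou)|exact: (smooth_differentiable oO si Ou)].
Qed.

Let P : V -> R := fun v => Re (f v).
Let Q : V -> R := fun v => Im (f v).
Let p : V -> R := fun v => Re (f1 v).
Let q : V -> R := fun v => Im (f1 v).
Let a : V -> R := fun v => Re (f2 v).
Let b : V -> R := fun v => Im (f2 v).
Let c : V -> R := fun v => Re (f3 v).
Let d : V -> R := fun v => Im (f3 v).
Let X : V -> R := fun v => v 0 0 - w 0 0.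
Let Y : V -> R := fun v => v 0 1 - w 0 1.
Let chi : V -> R := fun v => rho ^+ 2 - X v * X v - Y v * Y v.
Let U : V -> R := fun v => chi v * chi v * (p v * p v + q v * q v) + 7%:R * rho ^+ 2 * (P v * P v + Q v * Q v).
Let U0 : V -> R := fun v => - 4%:R * X v * chi v * (p v * p v + q v * q v)
  + 2%:R * (chi v * chi v) * (p v * a v + q v * b v) + 14%:R * rho ^+ 2 * (P v * p v + Q v * q v).
Let U1 : V -> R := fun v => - 4%:R * Y v * chi v * (p v * p v + q v * q v)
  + 2%:R * (chi v * chi v) * (q v * a v - p v * b v) + 14%:R * rho ^+ 2 * (Q v * p v - P v * q v).

Let sX k (x : R) : smooth_on O (fun v : V => v 0 k - x).
Proof. by apply: (smoothB oO); [exact: smooth_coord|exact: smooth_cst]. Qed.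
Let schi : smooth_on O chi.
Proof.
exact: (smoothB oO (smoothB oO (smooth_cst oO _) (smoothM oO (sX 0 _) (sX 0 _))) (smoothM oO (sX 1 _) (sX 1 _))).
Qed.
Let sre g : hol O g -> smooth_on O (fun v => Re (g v)). Proof. by move=> [[]]. Qed.
Let sim g : hol O g -> smooth_on O (fun v => Im (g v)). Proof. by move=> [[]]. Qed.
Let sU : smooth_on O U.
Proof.
apply: (smoothD oO); apply: (smoothM oO).
- exact: (smoothM oO schi schi).
- exact: (smoothD oO (smoothM oO (sre h1) (sre h1)) (smoothM oO (sim h1) (sim h1))).
- exact: smooth_cst.
- exact: (smoothD oO (smoothM oO (sre hf) (sre hf)) (smoothM oO (sim hf) (sim hf))).
Qed.

Let dcoord i k (x : R) u : pder i (fun v : V => v 0 k - x) u (i == k)%:R.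
Proof.
split; first exact: (smooth_differentiable openT (smoothB openT (smooth_coord openT k) (smooth_cst openT x)) I).
rewrite partialB ?partial_coord ?partial_cst ?subr0 //; exact: differentiable_coord.
Qed.

Let d00 u : pder 0 (fun v : V => v 0 0 - w 0 0) u 1 := dcoord 0 0 (w 0 0) u.
Let d01 u : pder 0 (fun v : V => v 0 1 - w 0 1) u 0 := dcoord 0 1 (w 0 1) u.
Let d10 u : pder 1 (fun v : V => v 0 0 - w 0 0) u 0 := dcoord 1 0 (w 0 0) u.
Let d11 u : pder 1 (fun v : V => v 0 1 - w 0 1) u 1 := dcoord 1 1 (w 0 1) u.

Lemma bernstein_laplacian u : O u -> 0 < norm2c (f1 u) -> 
  0 < partial 0 (partial 0 U) u + partial 1 (partial 1 U) u.
Proof.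
move=> Ou n0.
have E0 v : O v -> partial 0 U v = U0 v.
  move=> Ov; have [dP dQ] := der0 hf Ov; have [dp dq] := der0 h1 Ov.
  rewrite (bernstein_der1 (rho ^+ 2) dP dQ dp dq (d00 v) (d01 v)).
  by rewrite mul1r mul0r addr0.
have E1 v : O v -> partial 1 U v = U1 v.
  move=> Ov; have [dP dQ] := der1 hf Ov; have [dp dq] := der1 h1 Ov.
  rewrite (bernstein_der1 (rho ^+ 2) dP dQ dp dq (d10 v) (d11 v)).
  rewrite mul1r mul0r add0r /U1 /chi -/(X v) -/(Y v) -/(P v) -/(Q v) -/(p v) -/(q v) -/(a v) -/(b v).
  by move: (X v) (Y v) (P v) (Q v) (p v) (q v) (a v) (b v) => *; ring.
rewrite (eq_partial 0 oO Ou E0) (eq_partial 1 oO Ou E1).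
have [dP0 dQ0] := der0 hf Ou; have [dp0 dq0] := der0 h1 Ou; have [da0 db0] := der0 h2 Ou.
have [dP1 dQ1] := der1 hf Ou; have [dp1 dq1] := der1 h1 Ou; have [da1 db1] := der1 h2 Ou.
rewrite (bernstein_der2 (rho ^+ 2) dp0 dq0 (d00 u) (d01 u)
   (d00 u) (pderD (pderM dp0 da0) (pderM dq0 db0)) (pderD (pderM dP0 dp0) (pderM dQ0 dq0))).
rewrite (bernstein_der2 (rho ^+ 2) dp1 dq1 (d10 u) (d11 u)
   (d11 u) (pderB (pderM dq1 da1) (pderM dp1 db1)) (pderB (pderM dQ1 dp1) (pderM dP1 dq1))).
have {}n0 : 0 < p u ^+ 2 + q u ^+ 2 by [].
exact: bernstein_form_gt0 (exprn_gt0 2 rho0) n0.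
Qed.

(** The auxiliary function [U] attains its maximum on the closed disc. At an interior maximum with
    [f' <> 0] both pure second derivatives would be nonpositive, against [bernstein_laplacian]; so
    the cut-off [chi] or [f'] vanishes there and [U] is at most [7 rho^2 B]. At the centre
    [chi = rho^2], which gives the bound on [f']. *)
Lemma cauchy_first : rho ^+ 2 * norm2c (dz f w) <= 7%:R * B.
Proof.
pose K := [set u | dist2 u w <= rho ^+ 2].
have Kw : K w by rewrite /K /= /dist2 subrr /norm2c /= !expr0n /= addr0 exprn_ge0 // ltW.
have cU : {within K, continuous U}.
  apply: continuous_in_subspaceT => u; rewrite inE => Ku.
  by apply: differentiable_continuous; apply: smooth_differentiable oO sU (discO Ku).
have [|||v] := @EVT_max_rV R 2 U K; [by exists w|exact: compact_disc|exact: cU|].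
rewrite inE => Kv vmax.
have main : U v <= 7%:R * rho ^+ 2 * B.
  have base : (chi v = 0 \/ norm2c (f1 v) = 0) -> U v <= 7%:R * rho ^+ 2 * B.
    move=> h; have -> : U v = 7%:R * rho ^+ 2 * norm2c (f v).
      rewrite /U /norm2c -/(P v) -/(Q v) -!expr2.
      by case: h => [->|]; [ring|rewrite /norm2c -/(p v) -/(q v) => ->; ring].
    by rewrite ler_pM2l; [exact: fB|rewrite mulr_gt0 // exprn_gt0].
  have chi0 : 0 <= chi v by move: Kv; rewrite /K /= dist2E /chi -/(X v) -/(Y v); move: (X v) (Y v) => x y; lra.
  have [c0|cpos] := eqVneq (chi v) 0; first by apply: base; left.
  have [n0|npos] := eqVneq (norm2c (f1 v)) 0; first by apply: base; right.
  have {}cpos : 0 < chi v by rewrite lt_def cpos.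
  have {}npos : 0 < norm2c (f1 v) by rewrite lt_def npos norm2c_ge0.
  pose O' := [set u | dist2 u w < rho ^+ 2].
  have oO' : open O'.
    apply: (@open_comp _ _ (fun u => dist2 u w) [set x | x < rho ^+ 2]); first by move=> u _; exact: continuous_dist2.
    exact: open_lt.
  have O'v : O' v by rewrite /O' /= dist2E -/(X v) -/(Y v); move: cpos; rewrite /chi; move: (X v) (Y v) => x y; lra.
  have subO : O' `<=` O by move=> u /= /ltW; exact: discO.
  have mx u : O' u -> U u <= U v by move=> /ltW Ku; apply: vmax; rewrite inE.
  have l0 := max_partial2 0 oO' (smooth_subset subO sU) O'v mx.
  have l1 := max_partial2 1 oO' (smooth_subset subO sU) O'v mx.
  have := @bernstein_laplacian v (discO Kv) npos.
  by move: l0 l1; move: (partial _ _ _) (partial _ _ _) => x y; lra.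
have : U w <= 7%:R * rho ^+ 2 * B.
  by apply: le_trans main; apply: vmax; rewrite inE.
have -> : U w = rho ^+ 2 * (rho ^+ 2 * norm2c (dz f w)) + 7%:R * rho ^+ 2 * norm2c (f w).
  by rewrite /U /chi /X /Y !subrr /norm2c -/f1 /p /q /P /Q; ring.
have r2 : 0 < rho ^+ 2 by rewrite exprn_gt0.
have nf := norm2c_ge0 (f w).
move=> h; rewrite -(ler_pM2l r2); move: h nf; move: (norm2c _) (norm2c _) => x y; nra.
Qed.

End Bernstein.
End CauchyEstimate.

Section ComplexModulus.
Context {R : rcfType}.
Implicit Types x y : R[i].
Local Notation Re := complex.Re.
Local Notation Im := complex.Im.

Definition cabs x : R := Num.sqrt (norm2c x).

Lemma cabs_ge0 x : 0 <= cabs x. Proof. exact: sqrtr_ge0. Qed.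
Lemma sqr_cabs x : cabs x ^+ 2 = norm2c x. Proof. by rewrite sqr_sqrtr // norm2c_ge0. Qed.
Lemma cabs_le x (a : R) : 0 <= a -> (cabs x <= a) = (norm2c x <= a ^+ 2).
Proof. by move=> a0; rewrite -sqr_cabs ler_sqr // nnegrE cabs_ge0. Qed.
Lemma cabsM x y : cabs (x * y) = cabs x * cabs y.
Proof. by rewrite /cabs norm2cM sqrtrM // norm2c_ge0. Qed.
Lemma cabs0 : cabs 0 = 0. Proof. by rewrite /cabs /norm2c /= !expr0n /= addr0 sqrtr0. Qed.
Lemma cabs1 : cabs 1 = 1. Proof. by rewrite /cabs /norm2c /= expr1n expr0n /= addr0 sqrtr1. Qed.
Lemma cabsN x : cabs (- x) = cabs x. Proof. by rewrite /cabs /norm2c ReN ImN !sqrrN. Qed.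
Lemma cabs_eq0 x : (cabs x == 0) = (x == 0).
Proof. by rewrite -norm2c_eq0 -sqr_cabs sqrf_eq0. Qed.
Lemma cabs_gt0 x : (0 < cabs x) = (x != 0).
Proof. by rewrite lt_def cabs_eq0 cabs_ge0 andbT. Qed.
Lemma cabsX x n : cabs (x ^+ n) = cabs x ^+ n.
Proof. by elim: n => [|n IH]; rewrite ?expr0 ?cabs1 // !exprS cabsM IH. Qed.
Lemma cabsV x : cabs x^-1 = (cabs x)^-1.
Proof.
have [->|x0] := eqVneq x 0; first by rewrite invr0 cabs0 invr0.
have c0 : cabs x != 0 by rewrite cabs_eq0.
by apply: (mulfI c0); rewrite -cabsM !divff // cabs1.
Qed.
Lemma norm_Re x : `|Re x| <= cabs x.
Proof. by rewrite -sqrtr_sqr ler_wsqrtr // lerDl sqr_ge0. Qed.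
Lemma norm_Im x : `|Im x| <= cabs x.
Proof. by rewrite -sqrtr_sqr ler_wsqrtr // lerDr sqr_ge0. Qed.
Lemma cabs_real (a : R) : cabs a%:C = `|a|.
Proof. by rewrite /cabs /norm2c /= expr0n addr0 sqrtr_sqr. Qed.
Lemma cabs_nat n : cabs n%:R = n%:R.
Proof. have -> : (n%:R : R[i]) = (n%:R : R)%:C by apply: complexP; rewrite ?Re_nat ?Im_nat.
by rewrite cabs_real ger0_norm. Qed.
Lemma cabsD x y : cabs (x + y) <= cabs x + cabs y.
Proof.
rewrite cabs_le ?addr_ge0 ?cabs_ge0 //.
have h : Re x * Re y + Im x * Im y <= cabs x * cabs y.
  apply: le_trans (ler_norm _) _; rewrite -[leLHS]/(`|_|) -sqrtr_sqr -sqrtrM ?norm2c_ge0 // ler_wsqrtr //.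
  rewrite /norm2c -subr_ge0 [X in 0 <= X](_ : _ = (Re x * Im y - Im x * Re y) ^+ 2) ?sqr_ge0 //; ring.
have -> : norm2c (x + y) = norm2c x + norm2c y + 2%:R * (Re x * Re y + Im x * Im y).
  by rewrite /norm2c ReD ImD; ring.
by rewrite sqrrD !sqr_cabs; move: h (norm2c x) (norm2c y); clear; move=> h a b; lra.
Qed.
Lemma cabsB x y : cabs (x - y) <= cabs x + cabs y.
Proof. by apply: le_trans (cabsD _ _) _; rewrite cabsN. Qed.
Lemma cabs_sum (I : Type) (r : seq I) (P : pred I) (F : I -> R[i]) :
  cabs (\sum_(i <- r | P i) F i) <= \sum_(i <- r | P i) cabs (F i).
Proof.
elim/big_rec2: _ => [|i y x _ h]; first by rewrite cabs0.
by apply: le_trans (cabsD _ _) _; rewrite lerD2l.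
Qed.
End ComplexModulus.

(** The power is at most the falling product [(2k)(2k-1)...(k+1)], which is [binomial(2k, k) k!],
    and the central binomial coefficient is one term of [(1+1)^(2k)]. *)
Lemma expnn_le k : (k ^ k <= 4 ^ k * k`!)%N.
Proof.
have h1 : (k ^ k <= (k + k) ^_ k)%N.
  have gen n m : (m <= n)%N -> ((n - m) ^ m <= n ^_ m)%N.
    elim: m n => [|m IH] [|n] // mn.
    rewrite subSS expnS ffactSS; apply: leq_mul; first exact: leq_trans (leq_subr _ _) _.
    exact: IH.
  by have := gen (k + k)%N k (leq_addr _ _); rewrite addnK.
apply: leq_trans h1 _; rewrite -bin_ffact leq_mul2r; apply/orP; right.
rewrite -[4%N]/(2 ^ 2)%N -expnM mul2n -addnn.
have := @expnDn 1 1 (k + k); rewrite addn1 => ->.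
rewrite (bigD1 (inord k : 'I_(k + k).+1)) //= !exp1n !muln1.
by rewrite inordK ?leq_addr // ltnS leq_addr.
Qed.

Section CauchyIterated.
Context {R : realType}.
Local Notation V := ('rV[R]_2).
Local Notation Re := complex.Re.
Implicit Types (O : set V) (w u v : V) (f g : V -> R[i]).

Definition cdisc w (r : R) : set V := [set u | cabs (zc u - zc w) <= r].
Definition dzn k f := iter k (fun g => dz g) f.

Lemma dznS k f : dzn k.+1 f = dz (dzn k f). Proof. by []. Qed.
Lemma dznSr k f : dzn k.+1 f = dzn k (dz f). Proof. by rewrite /dzn iterSr. Qed.

Lemma hol_dzn O k f : open O -> hol O f -> hol O (dzn k f).
Proof. by move=> oO hf; elim: k => // k IH; exact: (hol_dz oO IH). Qed.

Lemma cdisc_dist2 w (r : R) u : 0 <= r -> cdisc w r u <-> dist2 u w <= r ^+ 2.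
Proof. by move=> r0; rewrite /cdisc /= cabs_le. Qed.

Lemma cdisc_trans w u v (a b : R) : cdisc w a u -> cdisc u b v -> cdisc w (a + b) v.
Proof.
rewrite /cdisc /= => h1 h2.
rewrite (_ : zc v - zc w = (zc v - zc u) + (zc u - zc w)); last by ring.
by apply: le_trans (cabsD _ _) _; rewrite addrC lerD.
Qed.

Lemma cdisc_sub w (r r' : R) : r <= r' -> cdisc w r `<=` cdisc w r'.
Proof. by move=> h u /le_trans; apply. Qed.

Lemma cdisc_center w (r : R) : 0 <= r -> cdisc w r w.
Proof. by move=> r0; rewrite /cdisc /= subrr cabs0. Qed.

(** The constant comes from [sqrt 7 <= 3]. *)
Lemma cauchy_one O f w (r M : R) : open O -> hol O f -> 0 < r -> 0 <= M -> cdisc w r `<=` O ->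
  (forall u, cdisc w r u -> cabs (f u) <= M) -> cabs (dz f w) <= 3%:R / r * M.
Proof.
move=> oO hf r0 M0 dO fM; have r0' := ltW r0.
have := @cauchy_first _ O oO f hf w r r0 (M ^+ 2).
move=> /(_ (fun u h => dO u (proj2 (cdisc_dist2 w u r0') h))).
have h u : dist2 u w <= r ^+ 2 -> norm2c (f u) <= M ^+ 2.
  by move=> /(proj2 (cdisc_dist2 w u r0')) /fM; rewrite cabs_le.
move=> /(_ h); rewrite -sqr_cabs -exprMn => h1.
rewrite mulrAC ler_pdivlMr // mulrC -ler_sqr ?nnegrE ?mulr_ge0 ?cabs_ge0 //.
apply: le_trans h1 _; rewrite exprMn; apply: ler_wpM2r; first exact: sqr_ge0.
by rewrite -natrX ler_nat.
Qed.

(** The first-order estimate is applied [k] times, each time shrinking the radius by [e = r/k]. This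
    yields [(3k/r)^k], and [k^k <= 4^k k!] turns it into [k! (12/r)^k]; the factorial is what makes
    Taylor coefficients geometrically bounded. *)
Lemma cauchy_iter O f w (r M : R) k : open O -> hol O f -> 0 < r -> 0 <= M -> cdisc w r `<=` O ->
  (forall u, cdisc w r u -> cabs (f u) <= M) ->
  cabs (dzn k f w) <= k`!%:R * (12%:R / r) ^+ k * M.
Proof.
move=> oO hf r0 M0 dO fM; case: k => [|k]; first by rewrite !mul1r; apply: fM; apply: cdisc_center; exact: ltW.
set K : R := k.+1%:R; have K0 : 0 < K by rewrite ltr0n.
pose e := r / K; have e0 : 0 < e by rewrite divr_gt0.
have step j : (j <= k.+1)%N -> forall u, cdisc w (e * (k.+1 - j)%:R) u ->
   cabs (dzn j f u) <= (3%:R / e) ^+ j * M.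
  elim: j => [_ u|j IH jk u hu].
    by rewrite subn0 expr0 mul1r /e divfK ?gt_eqF //; exact: fM.
  rewrite dznS exprS -mulrA.
  have sub v : cdisc u e v -> cdisc w (e * (k.+1 - j)%:R) v.
    move=> hv; have := cdisc_trans hu hv.
    by rewrite -[X in _ + X]mulr1 -mulrDr natr1 -subSn // subSS.
  apply: (@cauchy_one O) => //.
  - exact: hol_dzn.
  - by rewrite mulr_ge0 // exprn_ge0 // divr_ge0 // ltW.
  - move=> v /sub hv; apply: dO; apply: cdisc_sub hv.
    by rewrite /e mulrAC ler_pdivrMr // ler_pM2l // ler_nat leq_subr.
  - by move=> v /sub; apply: IH; exact: ltnW.
apply: le_trans (step k.+1 (leqnn _) w _) _.
  by apply: cdisc_center; rewrite mulr_ge0 // ltW.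
apply: ler_wpM2r => //.
rewrite (_ : 3%:R / e = K * (3%:R / r)); last by rewrite /e; field; rewrite !gt_eqF.
rewrite (_ : 12%:R / r = 4%:R * (3%:R / r)); last by field; rewrite gt_eqF.
rewrite (exprMn_comm _ (mulrC _ _)) [X in _ <= _ * X](exprMn_comm _ (mulrC _ _)) mulrA; apply: ler_wpM2r.
  by rewrite exprn_ge0 // divr_ge0 // ltW.
by rewrite -!natrX -natrM ler_nat mulnC; exact: expnn_le.
Qed.

Lemma derive_dir (f : V -> R) u v : differentiable f u ->
  'D_v f u = partial 0 f u * v 0 0 + partial 1 f u * v 0 1.
Proof.
move=> df; rewrite !partial_def !deriveE // {1}(row2_decomp v) linearD !linearZ /=.
by congr (_ + _); exact: mulrC.
Qed.

Lemma derive_line_hol O g w v (t : R) (c : R[i]) : open O -> hol O g -> O (w + t *: v) ->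
  is_derive t 1 (fun s : R => Re (c * g (w + s *: v))) (Re (c * (dz g (w + t *: v) * zc v))).
Proof.
move=> oO hg Ot.
have hcg := holZ oO c hg; have [[sr _] _] := hcg.
have d := smooth_differentiable oO sr Ot.
have := @is_derive_line R R (fun u => Re (c * g u)) w v t (@diff_derivable _ _ _ _ _ v d).
rewrite (derive_dir v d) -!Re_cpartial (dz_cp0 hcg Ot) (dz_cp1 hcg Ot) (dzZ oO _ Ot); last by case: hg.
by rewrite (_ : Re _ * _ + _ = Re (c * (dz g (w + t *: v) * zc v))) // !(ReM,ImM) iunitC /=; ring.
Qed.

(** A mean value inequality for complex values: pairing [g] with the fixed number [conj (g u)] makes
    the function real, with value [|g u|^2] at the endpoint. The comparison function is a primitive
    of the bound [C t^i], whence the gain of [1/(i+1)]. *)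
Lemma mean_value_power O g w u (C : R) i : open O -> hol O g -> g w = 0 -> 0 <= C ->
  (forall t : R, 0 <= t <= 1 -> O (w + t *: (u - w)) /\ cabs (dz g (w + t *: (u - w))) <= C * t ^+ i) ->
  cabs (g u) <= cabs (zc u - zc w) * (C / i.+1%:R).
Proof.
move=> oO hg gw C0 H; set L := cabs (zc u - zc w).
have zv : zc (u - w) = zc u - zc w by apply: complexP; rewrite ?ReB ?ImB /= !mxE.
pose G := cabs (g u).
pose psi := (fun t : R => G * L * (C / i.+1%:R) * t ^+ i.+1) - (fun t : R => Re (conjc (g u) * g (w + t *: (u - w)))).
pose dpsi (t : R) := G * L * (C / i.+1%:R) * (i.+1%:R * t ^+ i) - Re (conjc (g u) * (dz g (w + t *: (u - w)) * zc (u - w))).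
have dd (t : R) : 0 <= t <= 1 -> is_derive t 1 psi (dpsi t).
  move=> /H [Ot _]; have d2 := derive_line_hol (conjc (g u)) oO hg Ot.
  have d1 : is_derive t 1 (fun t : R => G * L * (C / i.+1%:R) * t ^+ i.+1) (G * L * (C / i.+1%:R) * (i.+1%:R * t ^+ i)).
    have dX : is_derive t (1:R) (fun t : R => t ^+ i.+1) (i.+1%:R * t ^+ i).
      by split; [exact: exprn_derivable|rewrite exp_derive /GRing.scale /= mulr1 mulr_natl].
    exact: (@is_deriveZ _ _ _ _ (G * L * (C / i.+1%:R)) t 1 _ dX).
  exact: is_deriveB.
have [t||t] := @MVT_segment R psi dpsi 0 1 ler01.
- by rewrite in_itv /= => /andP[/ltW a /ltW b]; apply: dd; rewrite a b.
- apply: derivable_within_continuous => t; rewrite in_itv /= => h.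
  by case: (dd t h).
rewrite in_itv /= => ht; rewrite subr0 mulr1 => E.
have p0 : 0 <= dpsi t.
  rewrite subr_ge0; have [_ hb] := H t ht.
  apply: le_trans (ler_norm _) _; apply: le_trans (norm_Re _) _.
  rewrite (cabsM (conjc _)) (cabsM (dz _ _)) zv -/L (_ : cabs (conjc (g u)) = G); last by rewrite /G /cabs /norm2c ReJ ImJ sqrrN.
  rewrite (_ : G * L * (C / i.+1%:R) * (i.+1%:R * t ^+ i) = G * (C * t ^+ i * L)); last first.
    have i0 : (i.+1%:R : R) != 0 by rewrite pnatr_eq0.
    by field.
  by apply: ler_wpM2l; [exact: cabs_ge0|apply: ler_wpM2r => //; exact: cabs_ge0].
move: p0; rewrite -E /psi !fctE expr1n expr0n /= !mulr0 scale0r addr0 gw mulr0 !mulr1 subr0.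
rewrite scale1r [w + _]addrC subrK.
have -> : Re (conjc (g u) * g u) = G * G.
  by rewrite -expr2 sqr_cabs /norm2c ReM ReJ ImJ; ring.
rewrite -/G -mulrA -mulrBr ?subr0 => h; have [g0|g0] := eqVneq G 0.
  by rewrite g0; apply: mulr_ge0; [exact: cabs_ge0|rewrite divr_ge0].
by move: h; rewrite pmulr_rge0 ?subr_ge0 // lt_def g0 cabs_ge0.
Qed.

(** The derivative of order [J] is bounded on the half disc by the Cauchy estimate of radius [r/2],
    which turns 12 into 24. Integrating it [J] times from the centre, where the lower derivatives
    vanish, produces [|z|^J / J!], and the factorials cancel. *)
Lemma vanishing_bound O f w (r M : R) J u : open O -> hol O f -> 0 < r -> 0 <= M -> cdisc w r `<=` O ->
  (forall v, cdisc w r v -> cabs (f v) <= M) -> (forall j, (j < J)%N -> dzn j f w = 0) ->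
  cdisc w (r / 2%:R) u -> cabs (f u) <= M * (24%:R * cabs (zc u - zc w) / r) ^+ J.
Proof.
move=> oO hf r0 M0 dO fM f0 hu.
have r20 : 0 < r / 2%:R by rewrite divr_gt0.
pose K := J`!%:R * (24%:R / r) ^+ J * M.
have K0 : 0 <= K by rewrite mulr_ge0 // mulr_ge0 // exprn_ge0 // divr_ge0 // ltW.
have sub v : cdisc w (r / 2%:R) v -> cdisc v (r / 2%:R) `<=` cdisc w r.
  by move=> hv x hx; have := cdisc_trans hv hx; rewrite -splitr.
have top v : cdisc w (r / 2%:R) v -> cabs (dzn J f v) <= K.
  move=> hv; have := @cauchy_iter O f v (r / 2%:R) M J oO hf r20 M0.
  rewrite (_ : 12%:R / (r / 2%:R) = 24%:R / r); last by field; rewrite gt_eqF.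
  by apply=> [x /(sub v hv)/dO|x /(sub v hv)/fM].
have bound i : (i <= J)%N -> forall v, cdisc w (r / 2%:R) v ->
    cabs (dzn (J - i) f v) <= K * cabs (zc v - zc w) ^+ i / i`!%:R.
  elim: i => [_ v hv|i IH iJ v hv]; first by rewrite subn0 expr0 mulr1 divr1; exact: top.
  have JE : (J - i = (J - i.+1).+1)%N by rewrite subnSK.
  have := @mean_value_power O (dzn (J - i.+1) f) w v (K * cabs (zc v - zc w) ^+ i / i`!%:R) i oO.
  move=> /(_ (hol_dzn _ oO hf)) H.
  apply: le_trans (H _ _ _) _.
  - by apply: f0; rewrite -JE leq_subr.
  - by rewrite divr_ge0 // mulr_ge0 // exprn_ge0 // cabs_ge0.
  - move=> t /andP[t0 t1].
    have E : zc (w + t *: (v - w)) - zc w = t%:C * (zc v - zc w).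
      by apply: complexP; rewrite ?ReM ?ImM ?ReB ?ImB /= !mxE; ring.
    have dt : cdisc w (r / 2%:R) (w + t *: (v - w)).
      rewrite /cdisc /= E cabsM cabs_real ger0_norm //.
      by apply: le_trans hv; rewrite ler_piMl ?cabs_ge0.
    split; first by apply: dO; apply: cdisc_sub dt; rewrite ler_pdivrMr // ler_peMr ?ltW // ltr1n.
    have := IH (ltnW iJ) _ dt; rewrite JE dznS E (cabsM t%:C) cabs_real ger0_norm //.
    rewrite exprMn; move=> h; apply: le_trans h _.
    by rewrite [K * _]mulrCA -!mulrA [t ^+ i * _]mulrC -!mulrA.
  - rewrite le_eqVlt; apply/orP; left; apply/eqP.
    have n1 : (i.+1%:R : R) != 0 by rewrite pnatr_eq0.
    have n2 : (i`!%:R : R) != 0 by rewrite pnatr_eq0 -lt0n fact_gt0.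
    rewrite exprS factS natrM; move: (i.+1%:R : R) (i`!%:R : R) n1 n2 (cabs _) => a b a0 b0 x.
    by field; rewrite a0 b0.
have := bound J (leqnn _) u hu; rewrite subnn => h; apply: le_trans h _.
rewrite le_eqVlt; apply/orP; left; apply/eqP; rewrite /K.
have n2 : (J`!%:R : R) != 0 by rewrite pnatr_eq0 -lt0n fact_gt0.
rewrite (_ : 24%:R * cabs (zc u - zc w) / r = (24%:R / r) * cabs (zc u - zc w)); last by rewrite mulrAC.
rewrite [in RHS](exprMn_comm _ (mulrC _ _)); move: (J`!%:R : R) n2 ((24%:R / r) ^+ J) (cabs _ ^+ J); clear.
by move=> a a0 x y; field.
Qed.

End CauchyIterated.

(** * Primitives of closed forms *)

Section Primitive.
Context {R : realType}.
Local Notation V := ('rV[R]_2).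
Implicit Types (O : set V) (w u v : V).

Lemma primitive_line (f : R -> R) (a b c : R) : a < c -> c < b ->
  (forall x, a <= x <= b -> {for x, continuous f}) ->
  exists2 F : R -> R, F c = 0 & forall x, a < x < b -> is_derive x 1 F (f x).
Proof.
move=> ac cb cf.
have fi : (@lebesgue_measure R).-integrable `[a, b] (EFin \o f).
  apply: continuous_compact_integrable; first exact: segment_compact.
  apply: continuous_in_subspaceT => x; rewrite inE /= in_itv /=; exact: cf.
pose I (x : R) := (\int[@lebesgue_measure R]_(t in `[a, x]) (f t))%R.
have dI x : a < x < b -> is_derive x 1 I (f x).
  move=> /andP[ax xb].
  have cx : {for x, continuous f} by apply: cf; rewrite !ltW.
  by have [d e] := continuous_FTC1_closed xb fi ax cx; split; [exact: d|rewrite -derive1E; exact: e].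
exists (fun x => I x - I c); first by rewrite subrr.
move=> x /dI dx; have := is_deriveB dx (is_derive_cst (I c) x 1).
by rewrite subr0.
Qed.

Lemma smooth_of_partials O (f : V -> R) : open O ->
  (forall u i, O u -> derivable f u (bvec i)) ->
  (forall i, exists2 g, smooth_on O g & forall u, O u -> partial i f u = g u) ->
  smooth_on O f.
Proof.
move=> oO df H s; case/lastP: s => [|s i].
  move=> w Ow; split=> [|i]; last exact: df.
  apply: differentiable_continuous; apply: (differentiable_partial oO Ow); first by move=> i u; exact: df.
  move=> i; have [g sg gE] := H i.
  apply: (eq_continuous_at oO Ow (fun u Ou => esym (gE u Ou))).
  by have [] := sg [::] w Ow.
have [g sg gE] := H i.
have := smooth_eq oO (fun u Ou => esym (gE u Ou)) sg s.
by rewrite /iter_partial foldr_rcons.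
Qed.

Lemma box_compact w (r : R) : compact [set u : V | forall i, `|u 0 i - w 0 i| <= r].
Proof.
have cb := @rV_compact R 2 (fun i => `[w 0 i - r, w 0 i + r]%classic) (fun i => @segment_compact R _ _).
congr (compact _) : cb.
by apply/seteqP; split=> u /= hu i; have := hu i; rewrite /= in_itv /= ler_distl.
Qed.

Lemma bounded_on_box O (f : V -> R) w (r : R) : open O -> smooth_on O f ->
  0 <= r -> (forall u, (forall i, `|u 0 i - w 0 i| <= r) -> O u) ->
  exists2 M : R, 0 <= M & forall u, (forall i, `|u 0 i - w 0 i| <= r) -> `|f u| <= M.
Proof.
move=> oO sf r0 bO; pose K := [set u : V | forall i, `|u 0 i - w 0 i| <= r].
have Kw : K w by move=> i; rewrite subrr normr0.
have cU (g : V -> R) : smooth_on O g -> {within K, continuous g}.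
  move=> sg; apply: continuous_in_subspaceT => u; rewrite inE => Ku.
  by apply: differentiable_continuous; apply: (smooth_differentiable oO sg (bO u Ku)).
have [|||v1 _ h1] := @EVT_max_rV R 2 f K; [by exists w|exact: box_compact|exact: cU|].
have [|||v2 _ h2] := @EVT_min_rV R 2 f K; [by exists w|exact: box_compact|exact: cU|].
exists (Num.max `|f v1| `|f v2|); first by rewrite le_max normr_ge0.
move=> u Ku; rewrite le_max; have [f0|f0] := leP 0 (f u).
  apply/orP; left; rewrite ger0_norm //; apply: le_trans (ler_norm _).
  by apply: h1; rewrite inE.
apply/orP; right; rewrite ltr0_norm //; apply: le_trans (_ : - f v2 <= _); last first.
  by rewrite -normrN ler_norm.
by rewrite lerN2; apply: h2; rewrite inE.
Qed.

Definition pt (x y : R) : V := \row_j (if j == 0 then x else y).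
Lemma pt0 x y : pt x y 0 0 = x. Proof. by rewrite mxE. Qed.
Lemma pt1 x y : pt x y 0 1 = y. Proof. by rewrite mxE. Qed.
Lemma ptE u : pt (u 0 0) (u 0 1) = u. Proof. by apply: row2P; rewrite ?pt0 ?pt1. Qed.
Lemma pt_line0 x y (t : R) : pt x y + t *: bvec 0 = pt (x + t) y.
Proof. by apply: row2P; rewrite !mxE /= ?mulr1 ?mulr0 ?addr0. Qed.
Lemma pt_line1 x y (t : R) : pt x y + t *: bvec 1 = pt x (y + t).
Proof. by apply: row2P; rewrite !mxE /= ?mulr1 ?mulr0 ?addr0. Qed.

Lemma is_derive_pt (f : V -> R) (x y : R) (i : 'I_2) : derivable f (pt x y) (bvec i) ->
  is_derive (if i == 0 then x else y) 1 (fun t => f (if i == 0 then pt t y else pt x t)) (partial i f (pt x y)).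
Proof.
rewrite partial_def; move: i; apply: ord2P => /= df.
  have E t : pt t y = pt 0 y + t *: bvec 0 by rewrite pt_line0 add0r.
  under eq_fun do rewrite E.
  by have := @is_derive_line R R f (pt 0 y) (bvec 0) x; rewrite -E; apply.
have E t : pt x t = pt x 0 + t *: bvec 1 by rewrite pt_line1 add0r.
under eq_fun do rewrite E.
by have := @is_derive_line R R f (pt x 0) (bvec 1) y; rewrite -E; apply.
Qed.

Lemma partial_pt (f : V -> R) (x y : R) (i : 'I_2) (d : R) :
  is_derive (if i == 0 then x else y) 1 (fun t => f (if i == 0 then pt t y else pt x t)) d ->
  derivable f (pt x y) (bvec i) /\ partial i f (pt x y) = d.
Proof.
rewrite partial_def; move: i; apply: ord2P => /= -[dd <-]; rewrite /derivable /derive.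
  have E : (fun h : R => h^-1 *: ((f \o shift (pt x y)) (h *: bvec 0) - f (pt x y))) =
    (fun h : R => h^-1 *: (((fun t => f (pt t y)) \o shift x) (h *: 1) - f (pt x y))).
    by apply/funext => h /=; rewrite [h *: _ + _]addrC pt_line0 [h *: 1]mulr1 [h + x]addrC.
  by rewrite E; split.
have E : (fun h : R => h^-1 *: ((f \o shift (pt x y)) (h *: bvec 1) - f (pt x y))) =
  (fun h : R => h^-1 *: (((fun t => f (pt x t)) \o shift y) (h *: 1) - f (pt x y))).
  by apply/funext => h /=; rewrite [h *: _ + _]addrC pt_line1 [h *: 1]mulr1 [h + y]addrC.
by rewrite E; split.
Qed.

(** The error is allowed a part [e] that is only [o(h)], besides the quadratic one. For primitives
    of closed forms [e] comes from the integral along one side; for power series it is zero. *)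
Lemma is_derive_quadratic (f : R -> R) (x d : R) (r : R) (e : R -> R) : 0 < r ->
  is_derive x 1 e 0 -> e x = 0 -> forall M : R, 0 <= M ->
  (forall h, `|h| < r -> `|f (x + h) - f x - h * d - e (x + h)| <= M * h ^+ 2) ->
  is_derive x 1 f d.
Proof.
move=> r0 de ex M M0 H.
have key : (fun h : R => h^-1 *: ((f \o shift x) (h *: 1) - f x)) @ 0^' --> d.
  have [ce e0] := de.
  have {}ce : (fun h : R => h^-1 *: ((e \o shift x) (h *: 1) - e x)) @ 0^' --> 'D_1 e x by exact: ce.
  rewrite e0 in ce; apply/cvgrPdist_lt => eps eps0.
  have eps2 : 0 < eps / 2%:R by rewrite divr_gt0.
  move/cvgrPdist_lt : ce => /(_ _ eps2) He.
  have M1 : 0 < M + 1 by apply: ltr_wpDl.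
  near=> h.
  have h0 : h != 0 by near: h; exact: nbhs_dnbhs_neq.
  have hr : `|h| < r by near: h; exact: dnbhs0_lt.
  have hm : `|h| < eps / 2%:R / (M + 1) by near: h; apply: dnbhs0_lt; rewrite divr_gt0.
  have h3 : `|0 - h^-1 *: ((e \o shift x) (h *: 1) - e x)| < eps / 2%:R by near: h; exact: He.
  rewrite /= [h *: 1]mulr1 [h + x]addrC.
  move: h3; rewrite /= [h *: 1]mulr1 [h + x]addrC ex subr0 sub0r normrN => h3.
  rewrite distrC (_ : h^-1 *: (f (x + h) - f x) - d = h^-1 * (f (x + h) - f x - h * d - e (x + h)) + h^-1 *: e (x + h)); last first.
    by rewrite /GRing.scale /=; field.
  apply: le_lt_trans (ler_normD _ _) _; rewrite [eps]splitr; apply: ltrD => //.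
  rewrite normrM normfV; have nh : 0 < `|h| by rewrite normr_gt0.
  rewrite mulrC ltr_pdivrMr //; apply: le_lt_trans (H h hr) _.
  rewrite -real_normK ?num_real // expr2 mulrA ltr_pM2r //.
  rewrite ltr_pdivlMr // in hm; apply: le_lt_trans hm.
  by rewrite mulrC ler_wpM2l // lerDl.
split; first by apply/cvg_ex; exists d.
exact: cvg_lim key.
Unshelve. all: by end_near.
Qed.

Lemma mvt_near (G dG : R -> R) (c r y : R) : 0 < r -> `|y - c| < r ->
  (forall t, `|t - c| < r -> is_derive t 1 G (dG t)) ->
  exists2 t, `|t - c| < r & G y - G c = dG t * (y - c).
Proof.
move=> r0 hy dd; have hc : `|c - c| < r by rewrite subrr normr0.
have btw (a b t : R) : `|a - c| < r -> `|b - c| < r -> a <= t <= b -> `|t - c| < r.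
  by rewrite !ltr_distl => /andP[a1 a2] /andP[b1 b2] /andP[t1 t2]; rewrite (lt_le_trans a1) //= (le_lt_trans t2).
have gen a b : `|a - c| < r -> `|b - c| < r -> a <= b ->
    exists2 t, `|t - c| < r & G b - G a = dG t * (b - a).
  move=> ha hb ab; have [t||t] := @MVT_segment R G dG a b ab.
  - by rewrite in_itv /= => /andP[/ltW h1 /ltW h2]; apply: dd; apply: btw ha hb _; rewrite h1.
  - apply: derivable_within_continuous => t; rewrite in_itv /= => h.
    by case: (dd t (btw _ _ _ ha hb h)).
  by rewrite in_itv /= => h E; exists t => //; apply: btw ha hb h.
have [cy|yc] := leP c y; first exact: gen.
have [t ht E] := gen y c hy hc (ltW yc).
by exists t => //; rewrite -opprB E -mulrN opprB.
Qed.

(** The primitive integrates [P] along a horizontal side and then [Q] along a vertical one. The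
    derivative in [y] is immediate. The derivative in [x] would ask for differentiation under the
    integral; instead the remainder is estimated by mean values, using closedness. *)
Lemma closed_form_primitive O (P Q : V -> R) w (r : R) : open O -> smooth_on O P -> smooth_on O Q ->
  (forall u, O u -> partial 1 P u = partial 0 Q u) -> 0 < r ->
  (forall u, (forall i, `|u 0 i - w 0 i| <= r) -> O u) ->
  exists F : V -> R, [/\ smooth_on (box w r) F, F w = 0,
    forall u, box w r u -> partial 0 F u = P u & forall u, box w r u -> partial 1 F u = Q u].
Proof.
move=> oO sP sQ PQ r0 bO.
set x0 := w 0 0; set y0 := w 0 1.
have inO x y : `|x - x0| <= r -> `|y - y0| <= r -> O (pt x y).
  by move=> hx hy; apply: bO; apply: ord2P; rewrite ?pt0 ?pt1.
have contR (f : V -> R) u v (t : R) : smooth_on O f -> O (u + t *: v) -> {for t, continuous (fun s : R => f (u + s *: v))}.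
  move=> sf Ot; apply: differentiable_continuous; apply/derivable1_diffP.
  have d := smooth_differentiable oO sf Ot.
  by have [] := @is_derive_line R R f u v t (@diff_derivable _ _ _ _ _ v d).
have itvd (x c : R) : c - r <= x <= c + r -> `|x - c| <= r by rewrite ler_distl.
have r1 (c : R) : c - r < c by rewrite ltrBlDr ltrDl.
have r2 (c : R) : c < c + r by rewrite ltrDl.
have [A A0 dA] : exists2 A : R -> R, A x0 = 0 & forall x, x0 - r < x < x0 + r -> is_derive x 1 A (P (pt x y0)).
  apply: primitive_line => // x hx.
  have E (t : R) : pt t y0 = pt 0 y0 + t *: bvec 0 by rewrite pt_line0 add0r.
  rewrite (_ : (fun x => P (pt x y0)) = (fun t : R => P (pt 0 y0 + t *: bvec 0))); last by apply/funext => t; rewrite E.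
  by apply: contR => //; rewrite -E; apply: inO; [exact: itvd|rewrite subrr normr0 ltW].
have HB x : exists B : R -> R, `|x - x0| <= r -> B y0 = 0 /\ forall y, y0 - r < y < y0 + r -> is_derive y 1 B (Q (pt x y)).
  have [hx|hx] := boolP (`|x - x0| <= r); last by exists (fun=> 0).
  have [B B0 dB] : exists2 B : R -> R, B y0 = 0 & forall y, y0 - r < y < y0 + r -> is_derive y 1 B (Q (pt x y)).
    apply: primitive_line => // y hy.
    have E (t : R) : pt x t = pt x 0 + t *: bvec 1 by rewrite pt_line1 add0r.
    rewrite (_ : (fun y => Q (pt x y)) = (fun t : R => Q (pt x 0 + t *: bvec 1))); last by apply/funext => t; rewrite E.
    by apply: contR => //; rewrite -E; apply: inO => //; exact: itvd.
  by exists B.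
pose B x := projT1 (cid (HB x)).
have BP x : `|x - x0| <= r -> B x y0 = 0 /\ forall y, y0 - r < y < y0 + r -> is_derive y 1 (B x) (Q (pt x y)).
  exact: projT2 (cid (HB x)).
pose F u := A (u 0 0) + B (u 0 0) (u 0 1).
have d1 u : box w r u -> derivable F u (bvec 1) /\ partial 1 F u = Q u.
  move=> bu; rewrite -(ptE u); apply: partial_pt => /=.
  have [_ /(_ (u 0 1)) H] := BP _ (ltW (bu 0)).
  have {}H := H ltac:(by rewrite -ltr_distl; exact: bu).
  have := is_deriveD (is_derive_cst (A (u 0 0)) (u 0 1) 1) H.
  rewrite add0r; congr (is_derive _ _ _ _).
  by apply/funext => t; rewrite /F pt0 pt1.
have [M M0 HM] := bounded_on_box oO (smooth_partial 0 (smooth_partial 0 sQ)) (ltW r0) bO.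
have d0 u : box w r u -> derivable F u (bvec 0) /\ partial 0 F u = P u.
  move=> bu; rewrite -(ptE u); apply: partial_pt => /=.
  set x := u 0 0; set y := u 0 1.
  have hx : `|x - x0| < r by exact: bu.
  have hy : `|y - y0| < r by exact: bu.
  pose d := r - `|x - x0|; have d0 : 0 < d by rewrite subr_gt0.
  have hxh h : `|h| < d -> `|x + h - x0| < r.
    move=> hh; rewrite addrAC; apply: le_lt_trans (ler_normD _ _) _.
    by move: hh; rewrite /d ltrBrDl.
  pose e t := A t - A x - (t - x) * P (pt x y0).
  have de : is_derive x 1 e 0.
    have a1 := dA x ltac:(by rewrite -ltr_distl; exact: bu).
    have a2 := is_deriveB a1 (is_derive_cst (A x) x 1).
    have a3 : is_derive x 1 (fun t : R => (t - x) * P (pt x y0)) (P (pt x y0)).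
      have := is_deriveM (is_deriveB (is_derive_id x (1 : R)) (is_derive_cst x x 1)) (is_derive_cst (P (pt x y0)) x 1).
      by rewrite !fctE subrr subr0 scale0r add0r /GRing.scale /= mulr1; exact.
    by have := is_deriveB a2 a3; rewrite subr0 subrr; exact.
  apply: (@is_derive_quadratic _ x (P (pt x y)) d e d0 de _ (r * M)).
  - by rewrite /e !subrr mul0r subr0.
  - by rewrite mulr_ge0 // ltW.
  move=> h hh.
  (* By closedness [G'(t) = Q(x+h,t) - Q(x,t) - h Q_x(x,t)], which is [O(h^2)] by two mean values in
     [x]. The increment of [G] from [y0] to [y] is the remainder to be estimated, once the
     horizontal part [e] is subtracted. *)
  pose G t := B (x + h) t - B x t - h * P (pt x t).
  have -> : (A (pt (x + h) y 0 0) + B (pt (x + h) y 0 0) (pt (x + h) y 0 1)) - (A (pt x y 0 0) + B (pt x y 0 0) (pt x y 0 1)) - h * P (pt x y) - e (x + h) = G y - G y0.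
    have [B1 _] := BP (x + h) (ltW (hxh h hh)); have [B2 _] := BP x (ltW hx).
    by rewrite !pt0 !pt1 /G B1 B2 /e; ring.
  have dG t : y0 - r < t < y0 + r -> is_derive t 1 G (Q (pt (x + h) t) - Q (pt x t) - h * partial 0 Q (pt x t)).
    move=> ht; have [_ /(_ t ht) b1] := BP (x + h) (ltW (hxh h hh)); have [_ /(_ t ht) b2] := BP x (ltW hx).
    have Ot : O (pt x t) by apply: inO; [exact: ltW|apply: ltW; rewrite ltr_distl].
    have b3 := @is_derive_pt P x t 1 (@diff_derivable _ _ _ _ _ _ (smooth_differentiable oO sP Ot)).
    rewrite PQ // in b3.
    exact: (is_deriveB (is_deriveB b1 b2) (@is_deriveZ _ _ _ _ h t 1 _ b3)).
  have dGb t : y0 - r < t < y0 + r -> `|Q (pt (x + h) t) - Q (pt x t) - h * partial 0 Q (pt x t)| <= M * h ^+ 2.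
    move=> ht; have ht' : `|t - y0| <= r by apply: ltW; rewrite ltr_distl.
    have Ox (s : R) : `|s| <= `|h| -> O (pt (x + s) t).
      by move=> sh; apply: inO => //; apply: ltW; apply: hxh; apply: le_lt_trans hh.
    have Ebox (s : R) : `|s| <= `|h| -> forall i, `|pt (x + s) t 0 i - w 0 i| <= r.
      move=> sh; apply: ord2P; rewrite ?pt0 ?pt1 //.
      by apply: ltW; apply: hxh; apply: le_lt_trans hh.
    have [|s hs E1] := @mvt_line R Q (pt x t) (bvec 0) h.
      move=> s hs; rewrite pt_line0; apply: diff_derivable.
      exact: (smooth_differentiable oO sQ (Ox s hs)).
    rewrite pt_line0 -partial_def in E1; rewrite E1 pt_line0 -mulrBr.
    have [|s' hs' E2] := @mvt_line R (partial 0 Q) (pt x t) (bvec 0) s.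
      move=> s' hs'; rewrite pt_line0; apply: diff_derivable.
      exact: (smooth_differentiable oO (smooth_partial 0 sQ) (Ox s' (le_trans hs' hs))).
    rewrite pt_line0 -partial_def in E2; rewrite E2 pt_line0 !normrM.
    rewrite -[h ^+ 2]real_normK ?num_real // expr2 mulrCA [M * _]mulrC -mulrA.
    apply: ler_pM => //; apply: ler_wpM2l => //; apply: HM; apply: Ebox; exact: le_trans hs' hs.
  have [|t ht ->] := @mvt_near G (fun t => Q (pt (x + h) t) - Q (pt x t) - h * partial 0 Q (pt x t)) y0 r y r0 hy.
    by move=> t; rewrite ltr_distl; exact: dG.
  rewrite normrM [r * M * _]mulrC mulrCA mulrC; apply: ler_pM => //; first exact: ltW.
  by rewrite [h ^+ 2 * M]mulrC; apply: dGb; rewrite -ltr_distl.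
exists F; split.
- apply: smooth_of_partials; first exact: open_box_set.
    by move=> u i bu; move: i; apply: ord2P; [case: (d0 u bu)|case: (d1 u bu)].
  have sub : box w r `<=` O by move=> u bu; apply: bO => i; apply: ltW.
  apply: ord2P; first by exists P; [exact: smooth_subset sub sP|move=> u /d0[]].
  by exists Q; [exact: smooth_subset sub sQ|move=> u /d1[]].
- by rewrite /F -/x0 -/y0 A0; have [-> _] := BP x0 ltac:(by rewrite subrr normr0 ltW); rewrite addr0.
- by move=> u /d0[].
- by move=> u /d1[].
Qed.

End Primitive.

(** * The inverse function theorem *)

Section InverseFunction.
Context {R : realType}.
Local Notation V := ('rV[R]_2).
Implicit Types (O : set V) (w u v y : V).

Definition jac_det (F : V -> V) u : R :=
  partial 0 (fun v => F v 0 0) u * partial 1 (fun v => F v 0 1) u -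
  partial 1 (fun v => F v 0 0) u * partial 0 (fun v => F v 0 1) u.

Definition norm1 u : R := `|u 0 0| + `|u 0 1|.

Lemma norm1_ge0 u : 0 <= norm1 u. Proof. by rewrite addr_ge0. Qed.
Lemma norm1_coord u i : `|u 0 i| <= norm1 u.
Proof. by move: i; apply: ord2P; rewrite /norm1 ?lerDl ?lerDr. Qed.

Lemma smooth_jac_det O F : open O -> smooth_map_on O F -> smooth_on O (jac_det F).
Proof.
move=> oO sF; apply: (smoothB oO); apply: (smoothM oO); apply: smooth_partial; exact: sF.
Qed.

Lemma continuous_box (f : V -> R) w (e : R) : {for w, continuous f} -> 0 < e ->
  exists2 r : R, 0 < r & forall u, box w r u -> `|f u - f w| < e.
Proof.
move=> c e0.
have /nbhs_ballP[d /= d0 H] : \forall u \near w, `|f w - f u| < e by move/cvgrPdist_lt : c => /(_ _ e0).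
by exists d => // u; rewrite box_ball // distrC; exact: H.
Qed.

Lemma continuous_of_box (f : V -> R) w :
  (forall e : R, 0 < e -> exists2 r : R, 0 < r & forall u, box w r u -> `|f u - f w| < e) ->
  {for w, continuous f}.
Proof.
move=> H A /nbhs_ballP[e /= e0 hA]; have [r r0 h] := H e e0.
apply/nbhs_ballP; exists r => // u; rewrite -box_ball // => /h hu.
by apply: hA; rewrite /ball /= distrC.
Qed.

Lemma smooth_continuous O (f : V -> R) w : smooth_on O f -> O w -> {for w, continuous f}.
Proof. by move=> sf Ow; case: (sf [::] w Ow). Qed.

Lemma differentiable_eps (f : V -> R) u (e : R) : differentiable f u -> 0 < e ->
  exists2 d : R, 0 < d & forall h : V, (forall i, `|h 0 i| < d) ->
    `|f (u + h) - f u - (partial 0 f u * h 0 0 + partial 1 f u * h 0 1)| <= e * norm1 h.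
Proof.
move=> df e0; have /diff_locallyP[_ /eqaddoP /(_ e e0)] := df.
move=> /nbhs_ballP[d /= d0 H]; exists d => // h hd.
have := H h; rewrite -box_ball // => /(_ ltac:(by move=> i; rewrite !mxE subr0; exact: hd)).
rewrite !fctE /= [h + u]addrC opprD addrA -(derive_dir h df) deriveE // => hh.
apply: le_trans hh _; apply: ler_wpM2l; first exact: ltW.
by apply/norm_row2; split; [exact: norm1_ge0|exact: norm1_coord].
Qed.

Lemma box_convex w (r t : R) u v : box w r u -> box w r v -> 0 <= t <= 1 -> box w r (u + t *: (v - u)).
Proof.
move=> bu bv /andP[t0 t1] i; rewrite !mxE.
rewrite (_ : _ - w 0 i = (1 - t) * (u 0 i - w 0 i) + t * (v 0 i - w 0 i)); last by ring.
apply: le_lt_trans (ler_normD _ _) _; rewrite !normrM (ger0_norm t0) ger0_norm ?subr_ge0 //.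
have := bu i; have := bv i; move: (`|_|) (`|_|) t0 t1; clear; move=> a b t0 t1 ha hb.
have [->|t'] := eqVneq t 0; first by rewrite subr0 mul1r mul0r addr0.
have tp : 0 < t by rewrite lt_def t'.
nra.
Qed.

Lemma mvt_box (f : V -> R) w (r : R) u v : (forall x, box w r x -> differentiable f x) ->
  box w r u -> box w r v ->
  exists2 x, box w r x & f v - f u = partial 0 f x * (v 0 0 - u 0 0) + partial 1 f x * (v 0 1 - u 0 1).
Proof.
move=> df bu bv.
have dd (t : R) : 0 <= t <= 1 -> is_derive t 1 (fun s : R => f (u + s *: (v - u))) ('D_(v - u) f (u + t *: (v - u))).
  by move=> ht; apply: is_derive_line; apply: diff_derivable; apply: df; exact: box_convex.
have [t||t] := @MVT_segment R (fun s : R => f (u + s *: (v - u))) (fun t => 'D_(v - u) f (u + t *: (v - u))) 0 1 ler01.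
- by rewrite in_itv /= => /andP[/ltW h1 /ltW h2]; apply: dd; rewrite h1.
- by apply: derivable_within_continuous => t; rewrite in_itv /= => /dd[].
rewrite in_itv /= => ht; rewrite scale1r scale0r addr0 [u + _]addrC subrK subr0 mulr1 => ->.
have bx := box_convex bu bv ht; exists (u + t *: (v - u)) => //.
by rewrite (derive_dir _ (df _ bx)) !mxE.
Qed.

(* Cramer's rule, with coefficients known up to [e]. *)
Lemma cramer_perturb (a b c d a' b' c' d' h0 h1 e N : R) :
  N = `|a| + `|c| + (`|b| + `|d|) -> 0 < a * d - b * c -> 0 < e ->
  e * (4%:R * (N + 1)) = a * d - b * c ->
  `|a' - a| < e -> `|c' - c| < e -> `|b' - b| < e -> `|d' - d| < e ->
  (a * d - b * c) * (`|h0| + `|h1|) <=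
  2%:R * (N + 1) * (`|a' * h0 + b' * h1| + `|c' * h0 + d' * h1|).
Proof.
move=> NE D0 e0 eE i1 i2 i3 i4.
have N0 : 0 <= N by rewrite NE !addr_ge0.
set f0 := a' * h0 + b' * h1; set f1 := c' * h0 + d' * h1.
set H := `|h0| + `|h1|.
have H0 : 0 <= H by rewrite addr_ge0.
have e1 : `|a * h0 + b * h1 - f0| <= e * H.
  rewrite (_ : _ - f0 = - ((a' - a) * h0 + (b' - b) * h1)); last by rewrite /f0; ring.
  rewrite normrN; apply: le_trans (ler_normD _ _) _; rewrite !normrM mulrDr.
  by apply: lerD; apply: ler_wpM2r => //; exact: ltW.
have e2 : `|c * h0 + d * h1 - f1| <= e * H.
  rewrite (_ : _ - f1 = - ((c' - c) * h0 + (d' - d) * h1)); last by rewrite /f1; ring.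
  rewrite normrN; apply: le_trans (ler_normD _ _) _; rewrite !normrM mulrDr.
  by apply: lerD; apply: ler_wpM2r => //; exact: ltW.
have tri (x z g : R) : `|z - g| <= e * H -> `|x * z| <= `|x| * (`|g| + e * H).
  move=> hz; rewrite normrM; apply: ler_wpM2l => //.
  by rewrite -[z in leLHS](subrK g) addrC; apply: le_trans (ler_normD _ _) _; rewrite lerD2l.
set D := a * d - b * c.
have k0 : D * `|h0| <= `|d| * (`|f0| + e * H) + `|b| * (`|f1| + e * H).
  rewrite -[D]gtr0_norm // -normrM (_ : D * h0 = d * (a * h0 + b * h1) - b * (c * h0 + d * h1)); last by rewrite /D; ring.
  by apply: le_trans (ler_normB _ _) _; apply: lerD; apply: tri.
have k1 : D * `|h1| <= `|a| * (`|f1| + e * H) + `|c| * (`|f0| + e * H).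
  rewrite -[D]gtr0_norm // -normrM (_ : D * h1 = a * (c * h0 + d * h1) - c * (a * h0 + b * h1)); last by rewrite /D; ring.
  by apply: le_trans (ler_normB _ _) _; apply: lerD; apply: tri.
have k2 : D * H <= N * (`|f0| + `|f1| + 2%:R * (e * H)).
  rewrite /H mulrDr; apply: le_trans (lerD k0 k1) _; rewrite NE.
  rewrite -/H; have eH : 0 <= e * H by rewrite mulr_ge0 // ltW.
  have := mulr_ge0 (normr_ge0 a) (normr_ge0 f0); have := mulr_ge0 (normr_ge0 a) eH.
  have := mulr_ge0 (normr_ge0 b) (normr_ge0 f0); have := mulr_ge0 (normr_ge0 b) eH.
  have := mulr_ge0 (normr_ge0 c) (normr_ge0 f1); have := mulr_ge0 (normr_ge0 c) eH.
  have := mulr_ge0 (normr_ge0 d) (normr_ge0 f1); have := mulr_ge0 (normr_ge0 d) eH.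
  move: (`|a|) (`|b|) (`|c|) (`|d|) (`|f0|) (`|f1|) (e * H); clear; move=> *; nra.
have k3 : 4%:R * (N + 1) * (e * H) = D * H by rewrite mulrA [_ * e]mulrC eE.
have F0 : 0 <= `|f0| + `|f1| by rewrite addr_ge0.
have eH : 0 <= e * H by rewrite mulr_ge0 // ltW.
move: k2 k3 F0 eH; move: (`|f0| + `|f1|) (e * H) (D * H) => x y z k2 k3 F0 eH.
nra.
Qed.

(** For the differentiability of a local inverse: [s] is the size of a step in the image, [g0, g1]
    its direction, and [h0, h1] the resulting increment of the inverse, whose difference quotient is
    compared with the adjugate matrix applied to the direction. *)
Lemma cramer_eps (a b c d h0 h1 s g0 g1 E : R) :
  `|s * g0 - (a * h0 + b * h1)| <= E -> `|s * g1 - (c * h0 + d * h1)| <= E ->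
  `|(a * d - b * c) * h0 - s * (d * g0 - b * g1)| <= (`|a| + `|b| + (`|c| + `|d|)) * E /\
  `|(a * d - b * c) * h1 - s * (a * g1 - c * g0)| <= (`|a| + `|b| + (`|c| + `|d|)) * E.
Proof.
move=> e0 e1; have E0 : 0 <= E by apply: le_trans e0.
have gen x z (t : R) : t = - x * (s * g0 - (a * h0 + b * h1)) + z * (s * g1 - (c * h0 + d * h1)) ->
    `|t| <= (`|x| + `|z|) * E.
  move=> ->; apply: le_trans (ler_normD _ _) _; rewrite mulrDl !normrM normrN.
  by apply: lerD; apply: ler_wpM2l.
split.
  apply: le_trans (gen d b _ _) _; first by ring.
  apply: ler_wpM2r => //; move: (normr_ge0 a) (normr_ge0 c).
  by move: (`|a|) (`|b|) (`|c|) (`|d|); clear; move=> *; lra.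
apply: le_trans (gen (- c) (- a) _ _) _; first by ring.
rewrite !normrN; apply: ler_wpM2r => //; move: (normr_ge0 b) (normr_ge0 d).
by move: (`|a|) (`|b|) (`|c|) (`|d|); clear; move=> *; lra.
Qed.

Lemma sqr_sum_bound (x z d : R) : 0 <= d -> x * x + z * z <= 2%:R * d ^+ 2 -> `|x| <= 2%:R * d.
Proof.
move=> d0 h; have d2 : 0 <= 2%:R * d by rewrite mulr_ge0.
have : `|x| ^+ 2 <= (2%:R * d) ^+ 2; last by rewrite ler_sqr ?nnegrE.
by rewrite real_normK ?num_real //; move: h (sqr_ge0 z) (sqr_ge0 d); rewrite !expr2 => *; nra.
Qed.

Lemma sum_lt8 (a b x y d : R) : a <= 2%:R * d -> b <= 2%:R * d -> x < d -> y < d -> 0 < d ->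
  a + b + (x + y) < 8%:R * d.
Proof. move=> *; lra. Qed.

Lemma cramer_kernel (a b c d x z : R) : a * d - b * c != 0 ->
  2%:R * (a * x + c * z) = 0 -> 2%:R * (b * x + d * z) = 0 -> x = 0 /\ z = 0.
Proof.
move=> D E0 E1; split; apply: (mulfI D); rewrite mulr0.
  rewrite (_ : _ * x = 2%:R^-1 * (d * (2%:R * (a * x + c * z)) - c * (2%:R * (b * x + d * z)))); last by field.
  by rewrite E0 E1 !mulr0 subrr mulr0.
rewrite (_ : _ * z = 2%:R^-1 * (a * (2%:R * (b * x + d * z)) - b * (2%:R * (a * x + c * z)))); last by field.
by rewrite E0 E1 !mulr0 subrr mulr0.
Qed.

Section Inverse.
Variables (O : set V) (oO : open O) (F : V -> V) (sF : smooth_map_on O F).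
Variables (w : V) (Ow : O w) (D0 : 0 < jac_det F w).

Let p i k u := partial i (fun v => F v 0 k) u.
Let N : R := `|p 0 0 w| + `|p 0 1 w| + (`|p 1 0 w| + `|p 1 1 w|).

(** The mean value theorem expresses [F v - F u] through partial derivatives at two points, one per
    component, each within [e] of its value at [w]; the perturbed Cramer rule then bounds [v - u].
    Injectivity of [F] and the Lipschitz bound of its inverse both come from this. *)
Lemma local_expansion : exists r : R, exists2 L : R, 0 < r &
  [/\ 0 < L, box w r `<=` O, (forall u, box w r u -> 0 < jac_det F u) &
   forall u v, box w r u -> box w r v -> norm1 (v - u) <= L * norm1 (F v - F u)].
Proof.
have [r1 r10 b1] := open_boxP oO Ow.
have cd : {for w, continuous (jac_det F)} := smooth_continuous (smooth_jac_det oO sF) Ow.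
have [r2 r20 b2] := continuous_box cd D0.
(* With this [e] the perturbation in Cramer's rule absorbs at most half of the determinant. *)
pose e := jac_det F w / (4%:R * (N + 1)).
have N0 : 0 <= N by rewrite !addr_ge0.
have e0 : 0 < e by rewrite divr_gt0 // mulr_gt0 // ltr_wpDl.
have cont i k : {for w, continuous (p i k)} := smooth_continuous (smooth_partial i (sF k)) Ow.
have [r00 h00 c00] := continuous_box (cont 0 0) e0.
have [r01 h01 c01] := continuous_box (cont 0 1) e0.
have [r10' h10 c10] := continuous_box (cont 1 0) e0.
have [r11 h11 c11] := continuous_box (cont 1 1) e0.
pose r := Num.min r1 (Num.min r2 (Num.min (Num.min r00 r01) (Num.min r10' r11))).
have r0 : 0 < r by rewrite !lt_min r10 r20 h00 h01 h10 h11.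
have /and5P[l1 l2 l3 l4 /andP[l5 l6]] : [&& r <= r1, r <= r2, r <= r00, r <= r01, r <= r10' & r <= r11].
  by rewrite /r !ge_min !lexx ?orbT.
exists r, (2%:R * (N + 1) / jac_det F w) => //; split.
- by rewrite divr_gt0 // mulr_gt0 // ltr_wpDl.
- by move=> u /(box_sub l1) /b1.
- by move=> u /(box_sub l2) /b2; rewrite ltr_distl subrr => /andP[].
move=> u v bu bv.
have dF k x : box w r x -> differentiable (fun v => F v 0 k) x.
  by move=> /(box_sub l1) /b1 Ox; exact: (smooth_differentiable oO (sF k) Ox).
have [x bx Ex] := mvt_box (dF 0) bu bv.
have [z bz Ez] := mvt_box (dF 1) bu bv.
have i00 := c00 x (box_sub l3 bx); have i01 := c01 z (box_sub l4 bz).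
have i10 := c10 x (box_sub l5 bx); have i11 := c11 z (box_sub l6 bz).
have NE : N = `|p 0 0 w| + `|p 0 1 w| + (`|p 1 0 w| + `|p 1 1 w|) by [].
rewrite mulrAC ler_pdivlMr //.
have -> : norm1 (v - u) = `|v 0 0 - u 0 0| + `|v 0 1 - u 0 1| by rewrite /norm1 !mxE.
have -> : norm1 (F v - F u) = `|F v 0 0 - F u 0 0| + `|F v 0 1 - F u 0 1| by rewrite /norm1 !mxE.
rewrite Ex Ez.
have D0' : 0 < p 0 0 w * p 1 1 w - p 1 0 w * p 0 1 w := D0.
have eE : e * (4%:R * (N + 1)) = p 0 0 w * p 1 1 w - p 1 0 w * p 0 1 w.
  by rewrite /e divfK // gt_eqF // mulr_gt0 // ltr_wpDl.
rewrite -/(p 0 0 x) -/(p 1 0 x) -/(p 0 1 z) -/(p 1 1 z) (_ : jac_det F w = p 0 0 w * p 1 1 w - p 1 0 w * p 0 1 w) //.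
rewrite mulrC; exact: (cramer_perturb _ _ NE D0' e0 eE i00 i01 i10 i11).
Qed.

Lemma interior_min (f : V -> R) c (r : R) u i : 0 < r -> (forall x, box c r x -> differentiable f x) ->
  box c r u -> (forall x, box c r x -> f u <= f x) -> partial i f u = 0.
Proof.
move=> r0 df bu fmin.
have [d d0 hd] := open_boxP (@open_box_set R c r) bu.
have bt (t : R) : t \in `]- d, d[ -> box c r (u + t *: bvec i).
  rewrite in_itv /= -ltr_norml => ht; apply: hd => k; rewrite !mxE addrAC subrr add0r.
  by apply: le_lt_trans ht; rewrite normrM ler_piMr //; case: (_ && _); rewrite ?normr1 ?normr0.
have dd (t : R) : t \in `]- d, d[ -> is_derive t 1 (fun s : R => f (u + s *: bvec i)) (partial i f (u + t *: bvec i)).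
  by move=> ht; rewrite partial_def; apply: is_derive_line; apply: diff_derivable; apply: df; exact: bt.
have z : (0 : R) \in `]- d, d[ by rewrite in_itv /= oppr_lt0 d0.
have := @derive1_at_min R (fun s : R => f (u + s *: bvec i)) (- d) d 0.
move=> /(_ (ltW (lt_trans (proj1 (andP z)) d0)) (fun t ht => @ex_derive _ _ _ _ _ _ _ (dd t ht)) z).
have mn t : t \in `]- d, d[ -> f (u + 0 *: bvec i) <= f (u + t *: bvec i).
  by move=> ht; rewrite scale0r addr0; apply: fmin; exact: bt.
move=> /(_ mn) [_ E].
by have := dd 0 z; rewrite scale0r addr0 => -[_ <-].
Qed.

Lemma norm1_add u v : norm1 (u + v) <= norm1 u + norm1 v.
Proof.
rewrite /norm1 !mxE; apply: le_trans (lerD (ler_normD _ _) (ler_normD _ _)) _.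
by rewrite addrACA.
Qed.

(** The squared distance from [F u] to [y] is minimised over the closed box of half radius. The
    Lipschitz bound keeps the minimiser in the interior, where the gradient vanishes, and
    invertibility of the Jacobian forces [F u = y]. *)
Lemma local_surjective (r L : R) : 0 < r -> 0 < L -> box w r `<=` O ->
  (forall u, box w r u -> 0 < jac_det F u) ->
  (forall u v, box w r u -> box w r v -> norm1 (v - u) <= L * norm1 (F v - F u)) ->
  exists2 d : R, 0 < d & forall y, box (F w) d y -> exists2 u, box w r u & F u = y.
Proof.
move=> r0 L0 bO Dr lip.
(* At the minimiser each component of [F u - y] is at most [2d], so [F u - F w] has 1-norm below
   [8d = r/(2L)] and [u] lies within [r/2] of [w]. *)
pose d := r / (16%:R * L).
have d0 : 0 < d by rewrite divr_gt0 // mulr_gt0.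
exists d => // y hy.
have dF k x : box w r x -> differentiable (fun v => F v 0 k) x.
  by move=> bx; exact: (smooth_differentiable oO (sF k) (bO x bx)).
pose phi u := (F u 0 0 - y 0 0) * (F u 0 0 - y 0 0) + (F u 0 1 - y 0 1) * (F u 0 1 - y 0 1).
have sphi : smooth_on O phi.
  have s k : smooth_on O (fun u => F u 0 k - y 0 k) := smoothB oO (sF k) (smooth_cst oO _).
  exact: (smoothD oO (smoothM oO (s 0) (s 0)) (smoothM oO (s 1) (s 1))).
pose K := [set u : V | forall i, `|u 0 i - w 0 i| <= r / 2%:R].
have r2 : r / 2%:R < r by rewrite ltr_pdivrMr // ltr_pMr // ltr1n.
have Kb u : K u -> box w r u by move=> Ku i; apply: le_lt_trans (Ku i) _.
have Kw : K w by move=> i; rewrite subrr normr0 divr_ge0 // ltW.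
have [|||u uK hmin] := @EVT_min_rV R 2 phi K.
- by exists w.
- exact: box_compact.
- apply: continuous_in_subspaceT => u; rewrite inE => Ku.
  by apply: (smooth_continuous sphi); apply: bO; exact: Kb.
have Ku : K u by rewrite inE in uK.
have {}hmin x : K x -> phi u <= phi x by move=> Kx; apply: hmin; rewrite inE.
have bu := Kb u Ku.
have hw : phi u <= 2%:R * d ^+ 2.
  apply: le_trans (hmin w Kw) _.
  have h0 := hy 0; have h1 := hy 1; rewrite /phi.
  rewrite -[F w 0 0 - _]opprB -[F w 0 1 - _]opprB !mulrNN -!expr2.
  have s (x : R) : `|x| < d -> x ^+ 2 <= d ^+ 2.
    by move=> hx; rewrite -[x ^+ 2]real_normK ?num_real // ler_sqr ?nnegrE ?(ltW d0) // ltW.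
  by rewrite mulr_natl mulr2n lerD // s.
have nF : norm1 (F u - F w) < r / (2%:R * L).
  have a0 : `|F u 0 0 - y 0 0| <= 2%:R * d /\ `|F u 0 1 - y 0 1| <= 2%:R * d.
    have s (x z : R) : x * x + z * z <= 2%:R * d ^+ 2 -> `|x| <= 2%:R * d := sqr_sum_bound (ltW d0).
    by split; [exact: s hw|apply: (s _ (F u 0 0 - y 0 0)); rewrite addrC].
  have h0 := hy 0; have h1 := hy 1.
  rewrite (_ : F u - F w = (F u - y) + (y - F w)); last by rewrite addrA subrK.
  apply: le_lt_trans (norm1_add _ _) _; rewrite /norm1 !mxE.
  have -> : r / (2%:R * L) = 8%:R * d by rewrite /d; field; rewrite gt_eqF.
  case: a0 => a0 a1; exact: (sum_lt8 a0 a1 h0 h1 d0).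
have bw := box_center w r0.
have nu : norm1 (u - w) < r / 2%:R.
  apply: le_lt_trans (lip w u bw bu) _.
  rewrite (_ : r / 2%:R = L * (r / (2%:R * L))); last by field; rewrite gt_eqF.
  by rewrite ltr_pM2l.
have bu2 : box w (r / 2%:R) u.
  by move=> i; apply: le_lt_trans nu; have := norm1_coord (u - w) i; rewrite !mxE.
have r20 : 0 < r / 2%:R by rewrite divr_gt0.
have crit i : partial i phi u = 0.
  apply: (interior_min i r20 _ bu2).
    by move=> x /(box_sub (ltW r2)) /bO; exact: (smooth_differentiable oO sphi).
  by move=> x bx; apply: hmin => k; apply: ltW.
have pk i k : pder i (fun u => F u 0 k - y 0 k) u (p i k u).
  rewrite -[p i k u]subr0; apply: pderB; last exact: pder_cst.
  by split=> //; exact: dF.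
have E i : 2%:R * (p i 0 u * (F u 0 0 - y 0 0) + p i 1 u * (F u 0 1 - y 0 1)) = 0.
  rewrite -[RHS](crit i); apply/esym.
  by apply: pder_eq; [exact: (pderD (pderM (pk i 0) (pk i 0)) (pderM (pk i 1) (pk i 1)))|cbv beta; ring].
have Du : p 0 0 u * p 1 1 u - p 1 0 u * p 0 1 u != 0 by rewrite gt_eqF //; exact: Dr.
exists u => //.
have E0 := E 0; have E1 := E 1.
have [z0 z1] := cramer_kernel Du E0 E1.
by apply: row2P; apply/eqP; rewrite -subr_eq0; apply/eqP.
Qed.

(** The Lipschitz bound makes the inverse [T] continuous, and then differentiable with the inverse
    Jacobian as derivative. Smoothness follows by [smooth_coind] on the functions [g o T] with [g]
    smooth on the source box: this class is closed under partial derivatives because the inverse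
    Jacobian is itself a smooth function composed with [T]. *)
Theorem inverse_function : exists (r d : R) (T : V -> V), [/\ 0 < r, 0 < d, box w r `<=` O,
  (forall u, box w r u -> 0 < jac_det F u) &
  [/\ forall y, box (F w) d y -> box w r (T y) /\ F (T y) = y,
     forall u, box w r u -> box (F w) d (F u) -> T (F u) = u &
     smooth_map_on (box (F w) d) T]].
Proof.
have [r [L r0 [L0 bO Dr lip]]] := local_expansion.
have [d d0 surj] := local_surjective r0 L0 bO Dr lip.
have HT y : exists u, box (F w) d y -> box w r u /\ F u = y.
  have [hy|hy] := pselect (box (F w) d y); last by exists w.
  by have [u bu uy] := surj y hy; exists u.
pose T y := projT1 (cid (HT y)).
have TP y : box (F w) d y -> box w r (T y) /\ F (T y) = y := projT2 (cid (HT y)).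
have inj u v : box w r u -> box w r v -> F u = F v -> u = v.
  move=> bu bv uv; have := lip u v bu bv; rewrite uv subrr.
  have -> : norm1 (0 : V) = 0 by rewrite /norm1 !mxE normr0 addr0.
  rewrite mulr0 => h; apply/esym/row2P; apply/eqP; rewrite -subr_eq0 -normr_le0; apply: le_trans h.
    by have := norm1_coord (v - u) 0; rewrite !mxE.
  by have := norm1_coord (v - u) 1; rewrite !mxE.
exists r, d, T; split=> //; split=> //.
  by move=> u bu bFu; have [b e] := TP _ bFu; exact: inj.
have dF k x : box w r x -> differentiable (fun v => F v 0 k) x.
  by move=> bx; exact: (smooth_differentiable oO (sF k) (bO x bx)).
have lipT y y' : box (F w) d y -> box (F w) d y' -> norm1 (T y' - T y) <= L * norm1 (y' - y).
  move=> /TP[b1 e1] /TP[b2 e2]; have := lip _ _ b1 b2; by rewrite e1 e2.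
have contT (g : V -> R) y : (forall u, box w r u -> {for u, continuous g}) -> box (F w) d y -> {for y, continuous (g \o T)}.
  move=> cg by_; have [b1 e1] := TP y by_.
  apply: continuous_of_box => e e0.
  have [r1 r10 h1] := continuous_box (cg _ b1) e0.
  have [r2 r20 h2] := open_boxP (@open_box_set R (F w) d) by_.
  have m0 : 0 < Num.min r2 (r1 / (2%:R * L)) by rewrite lt_min r20 divr_gt0 // mulr_gt0.
  exists (Num.min r2 (r1 / (2%:R * L))) => //= y' hy'; apply: h1 => i.
  have b' : box (F w) d y' by apply: h2; apply: box_sub hy'; rewrite ge_min lexx.
  have := lipT y y' by_ b'; have := norm1_coord (T y' - T y) i; rewrite !mxE => n1 n2.
  apply: le_lt_trans n1 _; apply: le_lt_trans n2 _.
  have : norm1 (y' - y) < r1 / L; last by rewrite ltr_pdivlMr // mulrC.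
  have hh k : `|y' 0 k - y 0 k| < r1 / (2%:R * L).
    by apply: lt_le_trans (hy' k) _; rewrite ge_min lexx orbT.
  rewrite /norm1 !mxE (_ : r1 / L = r1 / (2%:R * L) + r1 / (2%:R * L)); last by field; rewrite gt_eqF.
  by apply: ltrD; exact: hh.
(* The adjugate formula for the [i]-th partial derivative of component [k] of the inverse, as a
   function on the source. *)
pose M (i k : 'I_2) (u : V) : R := (if (i == 0) then (if k == 0 then p 1 1 u else - p 0 1 u)
   else (if k == 0 then - p 1 0 u else p 0 0 u)) / jac_det F u.
have sM i k : smooth_on (box w r) (M i k).
  have oB := @open_box_set R w r.
  have sp i' k' : smooth_on (box w r) (p i' k') := smooth_subset bO (smooth_partial i' (sF k')).
  apply: (smoothM oB); last first.
    apply: (smoothV oB); last exact: (smooth_subset bO (smooth_jac_det oO sF)).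
    by move=> u bu; rewrite gt_eqF // Dr.
  rewrite /M; move: (i) (k); apply: ord2P; apply: ord2P => /=; [exact: sp|exact: (smoothN oB (sp 0 1))|exact: (smoothN oB (sp 1 0))|exact: sp].
have dT i k y : box (F w) d y -> is_derive y (bvec i) (fun y => T y 0 k) (M i k (T y)).
  move=> hy; have [bu Fu] := TP y hy; set u := T y in bu Fu *.
  pose Nu := `|p 0 0 u| + `|p 1 0 u| + (`|p 0 1 u| + `|p 1 1 u|).
  have Nu0 : 0 <= Nu by rewrite !addr_ge0.
  have Du : 0 < jac_det F u := Dr u bu.
  have key : (fun h : R => h^-1 *: (((fun y => T y 0 k) \o shift y) (h *: bvec i) - T y 0 k)) @ 0^' --> M i k u.
    apply/cvgrPdist_le => eps eps0.
    (* Scaled so that the error [Nu e L |s|] in Cramer's rule, divided by the determinant and by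
       [|s|], stays within [eps]. *)
    pose e := eps * jac_det F u / (L * (Nu + 1)).
    have e0 : 0 < e by rewrite divr_gt0 ?mulr_gt0 // ltr_wpDl.
    have [d1 d10 h1] := differentiable_eps (dF 0 u bu) e0.
    have [d2 d20 h2] := differentiable_eps (dF 1 u bu) e0.
    have [r2 r20 b2] := open_boxP (@open_box_set R (F w) d) hy.
    have m0 : 0 < Num.min r2 (Num.min (d1 / L) (d2 / L)) by rewrite !lt_min r20 !divr_gt0.
    near=> s.
    have s0 : s != 0 by near: s; exact: nbhs_dnbhs_neq.
    have sm : `|s| < Num.min r2 (Num.min (d1 / L) (d2 / L)) by near: s; exact: dnbhs0_lt.
    move: sm; rewrite !lt_min => /and3P[s1 s2 s3].
    pose y' := y + s *: bvec i.
    have n1 : norm1 (y' - y) = `|s|.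
      rewrite /y' addrC addKr /norm1 !mxE /= !normrM.
      by move: (i); apply: ord2P; rewrite /= normr1 normr0 ?mulr1 ?mulr0 ?addr0 ?add0r.
    have hy' : box (F w) d y'.
      apply: b2 => j; have := norm1_coord (y' - y) j; rewrite n1 !mxE => hj.
      exact: le_lt_trans hj s1.
    have [bu' Fu'] := TP y' hy'.
    pose h := T y' - u.
    have nh : norm1 h <= L * `|s| by rewrite -n1; exact: lipT.
    have hd (d' : R) : `|s| < d' / L -> forall j, `|h 0 j| < d'.
      move=> sd j; apply: le_lt_trans (norm1_coord h j) _; apply: le_lt_trans nh _.
      by rewrite mulrC -ltr_pdivlMr.
    have uh : u + h = T y' by rewrite /h addrC subrK.
    have yk j : y' 0 j - y 0 j = s * (i == j)%:R.
      by rewrite /y' -bvecE !mxE addrAC subrr add0r.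
    have E1 := h1 h (hd d1 s2); have E2 := h2 h (hd d2 s3).
    rewrite uh Fu' Fu (yk 0) in E1; rewrite uh Fu' Fu (yk 1) in E2.
    have eL : e * norm1 h <= e * (L * `|s|) by rewrite ler_pM2l.
    have [C0 C1] := cramer_eps (le_trans E1 eL) (le_trans E2 eL).
    rewrite -/(jac_det F u) in C0 C1.
    have eN : Nu * (e * (L * `|s|)) <= eps * jac_det F u * `|s|.
      rewrite (_ : Nu * (e * (L * `|s|)) = (Nu / (Nu + 1)) * (eps * jac_det F u * `|s|)); last first.
        by rewrite /e; field; rewrite !gt_eqF // ltr_wpDl.
      rewrite ler_piMl //; first by rewrite !mulr_ge0 // ltW.
      by rewrite ler_pdivrMr ?mul1r ?lerDl // ltr_wpDl.
    have fin (hk g : R) : `|jac_det F u * hk - s * g| <= Nu * (e * (L * `|s|)) -> `|g / jac_det F u - s^-1 *: hk| <= eps.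
      move=> hh; rewrite (_ : g / jac_det F u - s^-1 *: hk = - (jac_det F u * hk - s * g) / (jac_det F u * s)); last first.
        by rewrite /GRing.scale /=; field; rewrite s0 gt_eqF.
      rewrite normrM normfV normrN normrM (gtr0_norm Du) ler_pdivrMr ?mulr_gt0 ?normr_gt0 //.
      by apply: le_trans hh _; apply: le_trans eN _; rewrite mulrA.
    rewrite /= [s *: _ + y]addrC -/y'.
    have -> : T y' 0 k - T y 0 k = h 0 k by rewrite /h !mxE.
    have alg (hk : 'I_2 -> R) (p00 p01 p10 p11 D B : R) :
        `|D * hk 0 - s * (p11 * (i == 0)%:R - p10 * (i == 1)%:R)| <= B ->
        `|D * hk 1 - s * (p00 * (i == 1)%:R - p01 * (i == 0)%:R)| <= B ->
        `|D * hk k - s * (if i == 0 then if k == 0 then p11 else - p01 else if k == 0 then - p10 else p00)| <= B.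
      by move: (i) (k); apply: ord2P; apply: ord2P => /=; rewrite !(mulr1, mulr0, subr0, sub0r).
    exact: fin (alg (fun j => h 0 j) _ _ _ _ _ _ C0 C1).
  by split; [apply/cvg_ex; exists (M i k u)|exact: cvg_lim key].
have oB := @open_box_set R (F w) d.
have cM i k : forall u, box w r u -> {for u, continuous (M i k)} by move=> u; exact: (smooth_continuous (sM i k)).
have difT k y : box (F w) d y -> differentiable (fun y => T y 0 k) y.
  move=> hy; apply: (differentiable_partial oB hy); first by move=> i u /(dT i k)[].
  move=> i.
  have E u : box (F w) d u -> (M i k \o T) u = partial i (fun y => T y 0 k) u.
    by move=> /(dT i k)[_ e]; rewrite partial_def; exact: esym e.
  exact: (eq_continuous_at oB hy E (contT _ _ (cM i k) hy)).
move=> k; apply: (@smooth_coind R (fun h => exists2 g, smooth_on (box w r) g & h = g \o T) _ oB).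
  move=> _ [g sg ->]; have dg u : box w r u -> differentiable g u := smooth_differentiable (@open_box_set R w r) sg.
  split=> [y hy|i]; first by apply: differentiable_comp2; [apply: dg; case: (TP y hy)|move=> j; exact: difT].
  exists ((fun u => partial 0 g u * M i 0 u + partial 1 g u * M i 1 u) \o T).
    exists (fun u => partial 0 g u * M i 0 u + partial 1 g u * M i 1 u); last reflexivity.
    have oBw := @open_box_set R w r.
    exact: (smoothD oBw (smoothM oBw (smooth_partial 0 sg) (sM i 0)) (smoothM oBw (smooth_partial 1 sg) (sM i 1))).
  move=> y hy; rewrite partial_comp /=; [|by apply: dg; case: (TP y hy)|by move=> j; exact: difT].
  by rewrite !partial_def; have [_ ->] := dT i 0 y hy; have [_ ->] := dT i 1 y hy.
by exists (fun u : V => u 0 k) => //; exact: (smooth_coord (@open_box_set R w r)).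
Unshelve. all: by end_near.
Qed.

End Inverse.
End InverseFunction.

(** * Entire series and a linear differential equation *)

Section EntireSeries.
Context {R : realType}.
Local Notation V := ('rV[R]_2).
Local Notation Re := complex.Re.
Local Notation Im := complex.Im.
Local Notation iu := (@iunit R).
Implicit Types (a b : nat -> R[i]) (z h : R[i]).

(** Infinite radius of convergence, phrased as boundedness of [a_k r^k] for every [r]: this form is
    stable under the operations on coefficients used below and compares directly with geometric
    series. *)
Definition entire a := forall r : R, 0 < r -> exists2 C : R, 0 <= C & forall k, cabs (a k) * r ^+ k <= C.
Definition psum a n z : R[i] := \sum_(k < n) a k * z ^+ k.
Definition elim_to a z l := forall e : R, 0 < e -> exists N, forall n, (N <= n)%N -> cabs (psum a n z - l) <= e.

Lemma geom_sum_le (C : R) n : 0 <= C -> \sum_(k < n) C * 2%:R^-1 ^+ k <= 2%:R * C.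
Proof.
move=> C0; rewrite -mulr_sumr mulrC; apply: ler_wpM2r => //.
have h : (1 - 2%:R^-1) * (\sum_(k < n) 2%:R^-1 ^+ k) = 1 - 2%:R^-1 ^+ n :> R.
  rewrite -[X in X - _ ^+ n](expr1n _ n) subrXX; congr (_ * _).
  by apply: eq_bigr => i _; rewrite expr1n mul1r.
have p : 0 <= 2%:R^-1 ^+ n :> R by rewrite exprn_ge0.
move: h p; move: (\sum_(k < n) _) (_ ^+ n) => x y h p; lra.
Qed.

Lemma cabs_ReIm z : cabs z <= `|Re z| + `|Im z|.
Proof.
rewrite cabs_le ?addr_ge0 // /norm2c -[Re z ^+ 2]real_normK ?num_real // -[Im z ^+ 2]real_normK ?num_real //.
by rewrite sqrrD lerD2r lerDl mulrn_wge0 // mulr_ge0.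
Qed.

Lemma elim_unique a z l l' : elim_to a z l -> elim_to a z l' -> l = l'.
Proof.
move=> h h'; apply/eqP; rewrite -subr_eq0 -cabs_eq0 eq_le cabs_ge0 andbT.
apply/ler_addgt0Pr => e e0; rewrite add0r.
have e2 : 0 < e / 2%:R by rewrite divr_gt0.
have [N1 H1] := h _ e2; have [N2 H2] := h' _ e2.
rewrite (_ : l - l' = (psum a (maxn N1 N2) z - l') - (psum a (maxn N1 N2) z - l)); last by ring.
apply: le_trans (cabsB _ _) _; rewrite [e]splitr.
by apply: lerD; [apply: H2; rewrite leq_maxr|apply: H1; rewrite leq_maxl].
Qed.

Lemma real_series_cvg (c : nat -> R) (C : R) : 0 <= C -> (forall k, `|c k| <= C * 2%:R^-1 ^+ k) ->
  exists l : R, forall e : R, 0 < e -> exists N, forall n, (N <= n)%N -> `|\sum_(k < n) c k - l| <= e.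
Proof.
move=> C0 hc.
have cg : cvgn (series (fun k => C * 2%:R^-1 ^+ k)).
  by apply: is_cvg_geometric_series; rewrite ger0_norm ?invr_ge0 // invf_lt1 // ltr1n.
have ca : cvgn (series (fun k => `|c k|)).
  apply: series_le_cvg cg => // k; by rewrite mulr_ge0 // exprn_ge0.
have cc : cvgn (series c) by apply: normed_cvg.
exists (limn (series c)) => e e0.
have [N _ HN] := proj1 (@cvgrPdist_le _ _ _ _ _ (series c) (limn (series c))) cc e e0.
exists N => n Nn; have := HN n Nn; rewrite /= distrC /series /=.
by rewrite big_mkord.
Qed.

Lemma entire_cvg a z : entire a -> exists l, elim_to a z l.
Proof.
move=> ea; have r0 : 0 < 2%:R * (cabs z + 1) by rewrite mulr_gt0 // ltr_wpDl // cabs_ge0.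
have [C C0 HC] := ea _ r0.
have bnd k : cabs (a k * z ^+ k) <= C * 2%:R^-1 ^+ k.
  rewrite cabsM cabsX exprVn ler_pdivlMr ?exprn_gt0 // -mulrA -exprMn.
  apply: le_trans (HC k); apply: ler_wpM2l; first exact: cabs_ge0.
  apply: lerXn2r; rewrite ?nnegrE ?mulr_ge0 ?cabs_ge0 ?addr_ge0 ?cabs_ge0 //.
  by rewrite mulrC ler_pM2l // lerDl.
have [l1 H1] := @real_series_cvg (fun k => Re (a k * z ^+ k)) C C0 (fun k => le_trans (norm_Re _) (bnd k)).
have [l2 H2] := @real_series_cvg (fun k => Im (a k * z ^+ k)) C C0 (fun k => le_trans (norm_Im _) (bnd k)).
exists (l1 +i* l2) => e e0; have e2 : 0 < e / 2%:R by rewrite divr_gt0.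
have [N1 h1] := H1 _ e2; have [N2 h2] := H2 _ e2.
exists (maxn N1 N2) => n; rewrite geq_max => /andP[n1 n2].
apply: le_trans (cabs_ReIm _) _; rewrite [e]splitr; apply: lerD.
  rewrite ReB /=; apply: le_trans (h1 n n1).
  by rewrite /psum (big_morph _ (@ReD R) (erefl _)).
rewrite ImB /=; apply: le_trans (h2 n n2).
by rewrite /psum (big_morph _ (@ImD R) (erefl _)).
Qed.

(** The value 0 stands for divergence, which [entire] sequences exclude. *)
Definition Ef a z : R[i] := if pselect (exists l, elim_to a z l) is left H then projT1 (cid H) else 0.

Lemma EfP a z : entire a -> elim_to a z (Ef a z).
Proof.
move=> ea; rewrite /Ef; case: pselect => [H|[]]; last exact: entire_cvg.
exact: projT2 (cid H).
Qed.

Lemma Ef_eq a z l : entire a -> elim_to a z l -> Ef a z = l.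
Proof. by move=> ea; apply: elim_unique; exact: EfP. Qed.

Lemma Ef_bound a z (B : R) : entire a -> (forall n, cabs (psum a n z) <= B) -> cabs (Ef a z) <= B.
Proof.
move=> ea HB; apply/ler_addgt0Pr => e e0; have [N HN] := EfP z ea e0.
rewrite -[Ef a z](subKr (psum a N z)); apply: le_trans (cabsB _ _) _.
by apply: lerD => //; exact: HN.
Qed.

Lemma entireZ c a : entire a -> entire (fun k => c * a k).
Proof.
move=> ea r r0; have [C C0 HC] := ea r r0; exists (cabs c * C); first by rewrite mulr_ge0 ?cabs_ge0.
by move=> k; rewrite cabsM -mulrA; apply: ler_wpM2l => //; exact: cabs_ge0.
Qed.

Lemma entireD a b : entire a -> entire b -> entire (fun k => a k + b k).
Proof.
move=> ea eb r r0; have [C C0 HC] := ea r r0; have [D D0 HD] := eb r r0.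
exists (C + D); first exact: addr_ge0.
move=> k; apply: le_trans (_ : (cabs (a k) + cabs (b k)) * r ^+ k <= _).
  by apply: ler_wpM2r; [rewrite exprn_ge0 // ltW|exact: cabsD].
by rewrite mulrDl lerD.
Qed.

Definition shift_seq a k := if k is k'.+1 then a k' else 0.
Lemma entire_shift a : entire a -> entire (shift_seq a).
Proof.
move=> ea r r0; have [C C0 HC] := ea r r0; exists (r * C); first by rewrite mulr_ge0 // ltW.
case=> [|k] /=; first by rewrite cabs0 mul0r mulr_ge0 // ltW.
by rewrite exprS mulrCA ler_pM2l.
Qed.

Definition der_seq a k := k.+1%:R * a k.+1.
Lemma le_exp2 k : (k <= 2 ^ k)%N. Proof. exact: ltnW (ltn_expl k (ltnSn 1)). Qed.
Lemma entire_der a : entire a -> entire (der_seq a).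
Proof.
move=> ea r r0; have r2 : 0 < 2%:R * r by rewrite mulr_gt0.
have [C C0 HC] := ea _ r2; exists (C / r); first by rewrite divr_ge0 // ltW.
move=> k; rewrite /der_seq cabsM cabs_nat ler_pdivlMr //; apply: le_trans (HC k.+1).
have -> : k.+1%:R * cabs (a k.+1) * r ^+ k * r = cabs (a k.+1) * (k.+1%:R * r ^+ k.+1).
  by rewrite exprSr; move: (r ^+ k) (cabs _) (k.+1%:R : R) => x y n; ring.
rewrite exprMn; apply: ler_wpM2l; first exact: cabs_ge0.
by apply: ler_wpM2r; [rewrite exprn_ge0 // ltW|rewrite -natrX ler_nat le_exp2].
Qed.

Lemma EfZ c a z : entire a -> Ef (fun k => c * a k) z = c * Ef a z.
Proof.
move=> ea; apply: Ef_eq; first exact: entireZ.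
have [->|c0] := eqVneq c 0.
  move=> e e0; exists 0%N => n _; rewrite /psum mul0r subr0 big1 ?cabs0 ?ltW //.
  by move=> i _; rewrite mul0r mul0r.
move=> e e0; have cc : 0 < cabs c by rewrite cabs_gt0.
have [N HN] := EfP z ea (divr_gt0 e0 cc); exists N => n /HN.
have -> : psum (fun k => c * a k) n z - c * Ef a z = c * (psum a n z - Ef a z).
  by rewrite mulrBr /psum mulr_sumr; congr (_ - _); apply: eq_bigr => i _; rewrite mulrA.
by rewrite ler_pdivlMr // mulrC -cabsM.
Qed.

Lemma EfD a b z : entire a -> entire b -> Ef (fun k => a k + b k) z = Ef a z + Ef b z.
Proof.
move=> ea eb; apply: Ef_eq; first exact: entireD.
move=> e e0; have e2 : 0 < e / 2%:R by rewrite divr_gt0.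
have [N1 H1] := EfP z ea e2; have [N2 H2] := EfP z eb e2.
exists (maxn N1 N2) => n; rewrite geq_max => /andP[n1 n2].
have -> : psum (fun k => a k + b k) n z = psum a n z + psum b n z.
  by rewrite /psum -big_split; apply: eq_bigr => i _; rewrite mulrDl.
rewrite opprD addrACA; apply: le_trans (cabsD _ _) _.
by rewrite [e]splitr; apply: lerD; [exact: H1|exact: H2].
Qed.

Lemma Ef_shift a z : entire a -> Ef (shift_seq a) z = z * Ef a z.
Proof.
move=> ea; apply: Ef_eq; first exact: entire_shift.
move=> e e0; have cc : 0 < cabs z + 1 by rewrite ltr_wpDl // cabs_ge0.
have [N HN] := EfP z ea (divr_gt0 e0 cc); exists N.+1 => -[|n] //; rewrite ltnS => /HN.
rewrite ler_pdivlMr // => h; apply: le_trans h.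
have -> : psum (shift_seq a) n.+1 z = z * psum a n z.
  rewrite /psum big_ord_recl /= mul0r add0r mulr_sumr; apply: eq_bigr => i _.
  by rewrite /= exprS mulrCA.
by rewrite -mulrBr cabsM mulrC; apply: ler_wpM2l; [exact: cabs_ge0|rewrite lerDl].
Qed.

Definition conv_seq (p : {poly R[i]}) a k := \sum_(j < k.+1) p`_j * a (k - j)%N.

Lemma eq_entire a b : a =1 b -> entire a -> entire b.
Proof. by move=> ab ea r r0; have [C C0 HC] := ea r r0; exists C => // k; rewrite -ab. Qed.

Lemma eq_Ef a b z : a =1 b -> Ef a z = Ef b z.
Proof. by move=> ab; congr (Ef _ z); exact/funext. Qed.

Lemma conv_seqE (p : {poly R[i]}) c a k :
  conv_seq (p * 'X + c%:P) a k = shift_seq (conv_seq p a) k + c * a k.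
Proof.
rewrite /conv_seq big_ord_recl /= subn0 coefD coefMX coefC /= add0r addrC; congr (_ + _).
case: k => [|k] /=; first by rewrite big_ord0.
by apply: eq_bigr => i _; rewrite /= coefD coefMX coefC /= addr0 subSS.
Qed.

(** Horner induction on [p] reduces the Cauchy product to multiplication by [z], a shift of the
    coefficients, so that no double series has to be rearranged. *)
Lemma Ef_conv (p : {poly R[i]}) a : entire a ->
  entire (conv_seq p a) /\ forall z, Ef (conv_seq p a) z = p.[z] * Ef a z.
Proof.
move=> ea; elim/poly_ind: p => [|p c [ep Ep]].
  have z0 : (fun k => 0 * a k) =1 conv_seq 0 a.
    by move=> k; rewrite /conv_seq big1 ?mul0r // => i _; rewrite coef0 mul0r.
  split; first exact: eq_entire z0 (entireZ 0 ea).
  by move=> z; rewrite -(eq_Ef z z0) EfZ // horner0 mul0r.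
have E k : shift_seq (conv_seq p a) k + c * a k = conv_seq (p * 'X + c%:P) a k by rewrite conv_seqE.
have es := entire_shift ep; have ec := entireZ c ea.
split; first exact: eq_entire E (entireD es ec).
by move=> z; rewrite -(eq_Ef z E) EfD // Ef_shift // EfZ // Ep hornerMXaddC; ring.
Qed.

(** The recursion multiplies the remainder by [z + h] and adds [k h^2 z^(k-1)], and
    [k^2 + k <= (k+1)^2]. Since [q >= 1], the exponent of [q] may be kept at [k], above the true
    one. *)
Lemma pow_quadratic z h (q : R) k : 1 <= q -> cabs z + cabs h <= q ->
  cabs ((z + h) ^+ k - z ^+ k - k%:R * (h * z ^+ k.-1)) <= k%:R ^+ 2 * (cabs h ^+ 2 * q ^+ k).
Proof.
move=> q1 hq; have q0 : 0 <= q := le_trans ler01 q1.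
have zq : cabs z <= q by apply: le_trans hq; rewrite lerDl cabs_ge0.
elim: k => [|k IH].
  by rewrite !expr0 mul0r subrr subr0 cabs0 expr0n /= mul0r.
have -> : (z + h) ^+ k.+1 - z ^+ k.+1 - k.+1%:R * (h * z ^+ k.+1.-1) =
   (z + h) * ((z + h) ^+ k - z ^+ k - k%:R * (h * z ^+ k.-1)) + k%:R * (h * (h * z ^+ k.-1)).
  case: (k) => [|n]; first by rewrite !expr1 !expr0; ring.
  by rewrite /= !exprS -[n.+2%:R]natr1 -[n.+1%:R]natr1; ring.
apply: le_trans (cabsD _ _) _; rewrite !cabsM cabs_nat cabsX.
have zk : cabs z ^+ k.-1 <= q ^+ k.+1.
  apply: le_trans (_ : q ^+ k.-1 <= _); first by apply: lerXn2r; rewrite ?nnegrE ?cabs_ge0.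
  by rewrite ler_weXn2l // (leq_trans (leq_pred k)).
have zh : cabs (z + h) <= q by apply: le_trans (cabsD _ _) _.
have hk : 0 <= cabs h ^+ 2 * q ^+ k.+1 by rewrite mulr_ge0 // ?exprn_ge0 // cabs_ge0.
apply: le_trans (lerD (ler_pM (cabs_ge0 _) (cabs_ge0 _) zh IH) (_ : _ <= k%:R * (cabs h ^+ 2 * q ^+ k.+1))) _.
  apply: ler_wpM2l => //; rewrite mulrA -expr2; apply: ler_wpM2l => //; exact: exprn_ge0 (cabs_ge0 h).
rewrite (_ : q * _ = k%:R ^+ 2 * (cabs h ^+ 2 * q ^+ k.+1)); last by rewrite [q ^+ k.+1]exprS; ring.
rewrite -mulrDl; apply: ler_wpM2r => //; rewrite -!natrX -natrD ler_nat.
by rewrite -mulnn -[(k.+1 ^ 2)%N]mulnn mulnS mulSn; move: (k * k)%N => m; lia.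
Qed.

Lemma three_eps (P1 P2 P3 E1 E2 E3 h : R[i]) (B e : R) :
  cabs (P1 - P2 - h * P3) <= B -> cabs (P1 - E1) <= e / 3%:R -> cabs (P2 - E2) <= e / 3%:R ->
  cabs (P3 - E3) <= e / 3%:R -> cabs h <= 1 -> cabs (E1 - E2 - h * E3) <= B + e.
Proof.
move=> fin h1 h2 h3 hh.
have -> : E1 - E2 - h * E3 = (P1 - P2 - h * P3) - ((P1 - E1) - (P2 - E2) - h * (P3 - E3)) by ring.
apply: le_trans (cabsB _ _) _; apply: (lerD fin).
apply: le_trans (cabsB _ _) _; have -> : e = e / 3%:R + e / 3%:R + e / 3%:R by field.
apply: (lerD (le_trans (cabsB _ _) (lerD h1 h2))).
rewrite (cabsM h (P3 - E3)) -[leRHS]mul1r; apply: ler_pM => //; exact: cabs_ge0.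
Qed.

Lemma ReBZ (c x y w k : R[i]) (h : R) :
  complex.Re (c * x) - complex.Re (c * y) - h * complex.Re (c * k * w) = complex.Re (c * (x - y - h%:C * k * w)).
Proof.
by rewrite -ReZ -!ReB; congr complex.Re; move: (h%:C) => hc; ring.
Qed.

(** Termwise differentiation in the form that [is_derive_quadratic] consumes. The estimate is proved
    for partial sums, uniformly in their length, and passed to the limit. *)
Lemma Ef_quadratic a (r : R) : entire a -> 0 <= r -> exists2 M : R, 0 <= M &
  forall z h, cabs z <= r -> cabs h <= 1 ->
    cabs (Ef a (z + h) - Ef a z - h * Ef (der_seq a) z) <= M * cabs h ^+ 2.
Proof.
move=> ea r0; pose q := r + 1; have q1 : 1 <= q by rewrite /q lerDr.
have q0 : 0 < q := lt_le_trans ltr01 q1.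
(* At radius [8q] a factor [4^k] pays for the [k^2] of [pow_quadratic] and a factor [2^k] makes the
   sum geometric. *)
have q8 : 0 < 8%:R * q by rewrite mulr_gt0.
have [C C0 HC] := ea _ q8; exists (2%:R * C); first by rewrite mulr_ge0.
move=> z h hz hh; have hq : cabs z + cabs h <= q by rewrite lerD.
have ed := entire_der ea.
have fin n : cabs (psum a n.+1 (z + h) - psum a n.+1 z - h * psum (der_seq a) n z) <= 2%:R * C * cabs h ^+ 2.
  have -> : psum a n.+1 (z + h) - psum a n.+1 z - h * psum (der_seq a) n z =
     \sum_(k < n.+1) a k * ((z + h) ^+ k - z ^+ k - k%:R * (h * z ^+ k.-1)).
    have -> : h * psum (der_seq a) n z = \sum_(k < n.+1) a k * (k%:R * (h * z ^+ k.-1)).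
      rewrite big_ord_recl mul0r mulr0 add0r mulr_sumr; apply: eq_bigr => i _.
      by rewrite !lift0 /der_seq /=; ring.
    by rewrite /psum -!sumrB; apply: eq_bigr => i _; rewrite !mulrBr.
  apply: le_trans (cabs_sum _ _ _) _.
  apply: le_trans (_ : \sum_(k < n.+1) (C * cabs h ^+ 2) * 2%:R^-1 ^+ k <= _).
    apply: ler_sum => k _; rewrite cabsM.
    apply: le_trans (ler_wpM2l (cabs_ge0 _) (pow_quadratic k q1 hq)) _.
    rewrite exprVn ler_pdivlMr ?exprn_gt0 //.
    rewrite (_ : cabs (a k) * (k%:R ^+ 2 * (cabs h ^+ 2 * q ^+ k)) * 2%:R ^+ k = (cabs (a k) * (k%:R ^+ 2 * (2%:R ^+ k * q ^+ k))) * cabs h ^+ 2); last by ring.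
    apply: ler_wpM2r; first exact: exprn_ge0 (cabs_ge0 h).
    apply: le_trans (HC k); apply: ler_wpM2l; first exact: cabs_ge0.
    have -> : (8%:R * q) ^+ k = 4%:R ^+ k * (2%:R ^+ k * q ^+ k) by rewrite -!exprMn; congr (_ ^+ k); ring.
    apply: ler_wpM2r; first by rewrite mulr_ge0 // exprn_ge0 // ltW.
    by rewrite -[4%:R]/(2 ^ 2)%:R natrX exprAC; apply: lerXn2r; rewrite ?nnegrE // -natrX ler_nat le_exp2.
  rewrite -(mulrA _ C); apply: geom_sum_le; by rewrite mulr_ge0 // exprn_ge0 // cabs_ge0.
apply/ler_addgt0Pr => e e0; have e3 : 0 < e / 3%:R by rewrite divr_gt0.
have [N1 H1] := EfP (z + h) ea e3; have [N2 H2] := EfP z ea e3; have [N3 H3] := EfP z ed e3.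
pose n := maxn N1 (maxn N2 N3).
have /and3P[n1 n2 n3] : [&& N1 <= n, N2 <= n & N3 <= n]%N by rewrite /n !leq_max !leqnn !orbT.
have h1 := H1 n.+1 (leqW n1); have h2 := H2 n.+1 (leqW n2); have h3 := H3 n n3.
exact: three_eps (fin n) h1 h2 h3 hh.
Qed.

(** Partial derivatives stay in this family: they replace [a] by its derived sequence and multiply
    [c] by 1 or by the imaginary unit. Real and imaginary parts of a series are the cases [c = 1]
    and [c = - i], so [smooth_coind] treats both. *)
Let f c a (u : V) : R := Re (c * Ef a (zc u)).

Lemma Ef_partial c a u i : entire a -> derivable (f c a) u (bvec i) /\
  partial i (f c a) u = f (c * (if i == 0 then 1 else iu)) (der_seq a) u.
Proof.
move=> ea; rewrite -(ptE u); apply: partial_pt.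
have [M M0 HM] := Ef_quadratic ea (cabs_ge0 (zc u)).
set z := zc u in HM.
have gen (t s : R) (g : R -> R) (k : R[i]) : cabs k = 1 -> (forall h : R, g (s + h) = Re (c * Ef a (z + h%:C * k))) ->
    is_derive s 1 g (Re (c * k * Ef (der_seq a) z)).
  move=> k1 gE.
  have g0 : g s = Re (c * Ef a z) by have := gE 0; rewrite addr0 -[0%:C]/(0 : R[i]) mul0r addr0.
  apply: (@is_derive_quadratic _ g s _ 1 (fun=> 0) ltr01 (is_derive_cst 0 s 1) erefl (cabs c * M)).
    by rewrite mulr_ge0 ?cabs_ge0.
  move=> h h1; have := HM z (h%:C * k) (lexx _); rewrite cabsM k1 mulr1 cabs_real => /(_ (ltW h1)).
  rewrite real_normK ?num_real // => hM; rewrite subr0 g0 gE.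
  have -> : Re (c * Ef a (z + h%:C * k)) - Re (c * Ef a z) - h * Re (c * k * Ef (der_seq a) z) =
    Re (c * (Ef a (z + h%:C * k) - Ef a z - h%:C * k * Ef (der_seq a) z)).
    exact: ReBZ.
  apply: le_trans (norm_Re _) _; rewrite (cabsM c) -[leRHS]mulrA.
  exact: (ler_wpM2l (cabs_ge0 c) hM).
rewrite /f ptE -/z; move: i; apply: ord2P => /=.
  apply: (gen 0) => [|h]; first exact: cabs1.
  by congr (Re (_ * Ef _ _)); rewrite mulr1; apply: complexP; rewrite ?ReD ?ImD /= ?pt0 ?pt1 ?addr0.
apply: (gen 0) => [|h]; first by rewrite /cabs /norm2c iunitC /= expr0n expr1n add0r sqrtr1.
by congr (Re (_ * Ef _ _)); apply: complexP; rewrite ?ReD ?ImD ?ReM ?ImM iunitC /= ?pt0 ?pt1 ?mul0r ?mulr0 ?mulr1 ?subr0 ?addr0.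
Qed.

Lemma Ef_continuous c a u : entire a -> {for u, continuous (f c a)}.
Proof.
move=> ea; have [M M0 HM] := Ef_quadratic ea (cabs_ge0 (zc u)).
set z := zc u in HM.
pose B := cabs c * (cabs (Ef (der_seq a) z) + M).
have B0 : 0 <= B by rewrite mulr_ge0 ?addr_ge0 ?cabs_ge0.
apply: continuous_of_box => e e0.
pose r := Num.min 2%:R^-1 (e / (2%:R * (B + 1))).
have B1 : 0 < B + 1 by rewrite ltr_wpDl.
exists r; first by rewrite lt_min invr_gt0 // ltr0n /= divr_gt0 // mulr_gt0.
move=> v hv; pose h := zc v - z.
have hh : cabs h < 2%:R * r.
  apply: le_lt_trans (cabs_ReIm _) _; rewrite mulr2n mulrDl mul1r /h ReB ImB /=.
  by apply: ltrD; exact: hv.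
have h1 : cabs h <= 1.
  apply: ltW; apply: lt_le_trans hh _; rewrite -ler_pdivlMl // mulr1 /r ge_min lexx //.
have := HM z h (lexx _) h1; rewrite /h [z + _]addrC subrK -/h => E.
rewrite /f -ReB -mulrBr; apply: le_lt_trans (norm_Re _) _; rewrite cabsM.
have E2 : cabs (Ef a (zc v) - Ef a z) <= (cabs (Ef (der_seq a) z) + M) * cabs h.
  rewrite -[_ - _](subrK (h * Ef (der_seq a) z)); apply: le_trans (cabsD _ _) _.
  rewrite (cabsM h) [leRHS]mulrDl [leRHS]addrC; apply: lerD; last by rewrite mulrC.
  apply: le_trans E _; apply: ler_wpM2l => //.
  by rewrite expr2 ler_piMl ?cabs_ge0.
apply: le_lt_trans (ler_wpM2l (cabs_ge0 c) E2) _; rewrite mulrA -/B.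
apply: le_lt_trans (_ : (B + 1) * cabs h < _); first by apply: ler_wpM2r; [exact: cabs_ge0|rewrite lerDl].
rewrite mulrC -ltr_pdivlMr //; apply: lt_le_trans hh _.
rewrite -ler_pdivlMl // /r ge_min; apply/orP; right; rewrite le_eqVlt; apply/orP; left; apply/eqP.
by field; rewrite gt_eqF.
Qed.

Lemma hol_Ef a : entire a -> hol [set: V] (fun u => Ef a (zc u)).
Proof.
move=> ea; have oT : open [set: V] := openT.
have sm c : smooth_on [set: V] (f c a).
  apply: (@smooth_coind R (fun g => exists c' b, entire b /\ g = f c' b) _ oT); last by exists c, a.
  move=> _ [c' [b [eb ->]]]; split.
    move=> u _; apply: (@differentiable_partial R [set: V]) => // [i v _|i].
      by case: (Ef_partial c' v i eb).
    rewrite (_ : partial i (f c' b) = f (c' * (if i == 0 then 1 else iu)) (der_seq b)).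
      exact: Ef_continuous (entire_der eb).
    by apply/funext => v; case: (Ef_partial c' v i eb).
  move=> i; exists (f (c' * (if i == 0 then 1 else iu)) (der_seq b)).
    by exists (c' * (if i == 0 then 1 else iu)), (der_seq b); split=> //; exact: entire_der.
  by move=> u _; case: (Ef_partial c' u i eb).
have ReE u : Re (Ef a (zc u)) = f 1 a u by rewrite /f mul1r.
have ImE u : Im (Ef a (zc u)) = f (- iu) a u by rewrite /f ReM ReN ImN iunitC /=; ring.
split; first by split; [apply: smooth_eq oT _ (sm 1)|apply: smooth_eq oT _ (sm (- iu))] => u _; rewrite ?ReE ?ImE.
move=> u _; have P i c : partial i (f c a) u = f (c * (if i == 0 then 1 else iu)) (der_seq a) u.
  by case: (Ef_partial c u i ea).
have cp i : cpartial i (fun u => Ef a (zc u)) u = (if i == 0 then 1 else iu) * Ef (der_seq a) (zc u).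
  apply: complexP; rewrite ?Re_cpartial ?Im_cpartial.
    rewrite (eq_partial i oT (I : [set: V] u) (fun v _ => ReE v)) P /f mul1r //.
  rewrite (eq_partial i oT (I : [set: V] u) (fun v _ => ImE v)) P /f.
  by rewrite !(ReM,ImM,ReN,ImN) iunitC /=; move: (if _ then _ else _) => x; ring.
by rewrite !cp /= mul1r.
Qed.

Lemma dz_Ef a u : entire a -> dz (fun u => Ef a (zc u)) u = Ef (der_seq a) (zc u).
Proof.
move=> ea; have oT : open [set: V] := openT.
rewrite -(dz_cp0 (hol_Ef ea)) //.
have P i c : partial i (f c a) u = f (c * (if i == 0 then 1 else iu)) (der_seq a) u.
  by case: (Ef_partial c u i ea).
apply: complexP; rewrite ?Re_cpartial ?Im_cpartial.
  rewrite (@eq_partial _ [set: V] _ (f 1 a)) // ?P /f ?mul1r //.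
  by move=> v _; rewrite /f mul1r.
rewrite (@eq_partial _ [set: V] _ (f (- iu) a)) // ?P /f ?mulr1.
  by rewrite ReM ReN ImN iunitC /=; ring.
by move=> v _; rewrite /f ReM ReN ImN iunitC /=; ring.
Qed.

End EntireSeries.

Section LinearODE.
Context {R : realType}.
Local Notation V := ('rV[R]_2).
Implicit Types (p : {poly R[i]}) (a b : R[i]).

(** The recursion [(k+2)(k+1) y_(k+2) = - (1/2) sum_j p_j y_(k-j)] for the power series solution of
    [y'' = - (p/2) y] with [y(0) = a] and [y'(0) = b]. Each coefficient depends on all earlier ones,
    so they are produced as a growing list. *)
Definition ode_next p a b (s : seq R[i]) : R[i] :=
  match size s with
  | 0 => a
  | 1 => b
  | k.+2 => - (\sum_(j < k.+1) p`_j * s`_(k - j)) / (2%:R * k.+2%:R * k.+1%:R)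
  end.
Fixpoint ode_list p a b k : seq R[i] :=
  if k is k'.+1 then rcons (ode_list p a b k') (ode_next p a b (ode_list p a b k')) else [::].
Definition ode_seq p a b k := ode_next p a b (ode_list p a b k).

Lemma size_ode_list p a b k : size (ode_list p a b k) = k.
Proof. by elim: k => //= k IH; rewrite size_rcons IH. Qed.

Lemma nth_ode_list p a b n k : (k < n)%N -> (ode_list p a b n)`_k = ode_seq p a b k.
Proof.
elim: n => //= n IH; rewrite ltnS leq_eqVlt nth_rcons size_ode_list => /predU1P[->|h].
  by rewrite ltnn eqxx.
by rewrite h IH.
Qed.

Lemma ode_seq0 p a b : ode_seq p a b 0 = a. Proof. by []. Qed.
Lemma ode_seq1 p a b : ode_seq p a b 1 = b. Proof. by []. Qed.
Lemma ode_seqS p a b k : ode_seq p a b k.+2 =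
  - conv_seq p (ode_seq p a b) k / (2%:R * k.+2%:R * k.+1%:R).
Proof.
rewrite {1}/ode_seq /ode_next size_ode_list; congr (- _ / _).
apply: eq_bigr => j _; rewrite nth_ode_list //; exact: leq_ltn_trans (leq_subr _ _) _.
Qed.

(** From index [N] on, the division by [2(k+2)(k+1)] outweighs the convolution, which contributes at
    most [2 S B r^2]; so a bound on the first [N] coefficients persists. A large [N] shows that
    every solution is entire, while [N = 2] gives bounds from the initial data alone, uniform in the
    polynomial. *)
Lemma ode_bound p a b (N : nat) (r S B : R) : (2 <= N)%N -> 0 < r -> 0 <= S -> 0 <= B ->
  (forall j, cabs p`_j * r ^+ j <= S * 2%:R^-1 ^+ j) ->
  r ^+ 2 * S <= N%:R -> (forall k, (k < N)%N -> cabs (ode_seq p a b k) * r ^+ k <= B) ->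
  forall k, cabs (ode_seq p a b k) * r ^+ k <= B.
Proof.
move=> N2 r0 S0 B0 hp hr hB k; elim/ltn_ind: k => k IH.
have [/hB//|Nk] := ltnP k N.
case: k => [|[|k]] in IH Nk *; try by move: (leq_trans N2 Nk).
rewrite ode_seqS; set y := ode_seq p a b in IH *.
set d : R := 2%:R * k.+2%:R * k.+1%:R.
have d0 : 0 < d by rewrite !mulr_gt0 // ltr0n.
have cd : cabs (2%:R * k.+2%:R * k.+1%:R : R[i])^-1 = d^-1.
  by rewrite cabsV -!natrM cabs_nat /d -!natrM.
rewrite cabsM cabsN cd.
have hc : cabs (conv_seq p y k) * r ^+ k <= 2%:R * S * B.
  apply: le_trans (_ : (\sum_(j < k.+1) S * 2%:R^-1 ^+ j) * B <= _); last first.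
    by apply: ler_wpM2r => //; apply: geom_sum_le.
  apply: le_trans (ler_wpM2r _ (cabs_sum _ _ _)) _; first by rewrite exprn_ge0 // ltW.
  rewrite !mulr_suml; apply: ler_sum => j _; have jk : (j <= k)%N by rewrite -ltnS.
  have -> : r ^+ k = r ^+ j * r ^+ (k - j) by rewrite -exprD subnKC.
  rewrite cabsM.
  have -> : cabs p`_j * cabs (y (k - j)%N) * (r ^+ j * r ^+ (k - j)) =
     (cabs p`_j * r ^+ j) * (cabs (y (k - j)%N) * r ^+ (k - j)) by ring.
  apply: ler_pM; rewrite ?mulr_ge0 ?cabs_ge0 ?exprn_ge0 ?(ltW r0) //.
  by apply: IH; apply: leq_ltn_trans (leq_subr _ _) _; rewrite ltnS leqnSn.
have hd : r ^+ 2 * S * 2%:R <= d.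
  have -> : d = (k.+2%:R * k.+1%:R) * 2%:R by rewrite /d; ring.
  apply: ler_wpM2r => //; apply: le_trans hr _.
  apply: le_trans (_ : k.+2%:R <= _); first by rewrite ler_nat.
  by rewrite ler_peMr // ler1n.
have -> : cabs (conv_seq p y k) / d * r ^+ k.+2 = (cabs (conv_seq p y k) * r ^+ k) * r ^+ 2 / d.
  by rewrite -addn2 exprD; ring.
rewrite ler_pdivrMr //; apply: le_trans (ler_wpM2r _ hc) _; first exact: sqr_ge0.
have -> : 2%:R * S * B * r ^+ 2 = B * (r ^+ 2 * S * 2%:R) by ring.
exact: ler_wpM2l.
Qed.

Lemma poly_coef_geom p (r : R) : 0 < r ->
  exists2 S : R, 0 <= S & forall j, cabs p`_j * r ^+ j <= S * 2%:R^-1 ^+ j.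
Proof.
move=> r0; have t0 j : 0 <= cabs p`_j * (2%:R * r) ^+ j.
  by rewrite mulr_ge0 ?cabs_ge0 // exprn_ge0 // mulr_ge0 // ltW.
exists (\sum_(j < size p) cabs p`_j * (2%:R * r) ^+ j); first by apply: sumr_ge0.
move=> j; rewrite exprVn ler_pdivlMr ?exprn_gt0 // -mulrA -exprMn [r * _]mulrC.
have [jp|jp] := ltnP j (size p); last by rewrite nth_default // cabs0 mul0r sumr_ge0.
by rewrite (bigD1 (Ordinal jp)) //= lerDl sumr_ge0.
Qed.

Lemma entire_ode p a b : entire (ode_seq p a b).
Proof.
move=> r r0; have [S S0 HS] := poly_coef_geom p r0.
pose N := maxn 2 (Num.bound (r ^+ 2 * S)).
have t0 k : 0 <= cabs (ode_seq p a b k) * r ^+ k.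
  by rewrite mulr_ge0 ?cabs_ge0 // exprn_ge0 // ltW.
pose B : R := \sum_(k < N) cabs (ode_seq p a b k) * r ^+ k.
have B0 : 0 <= B by apply: sumr_ge0.
exists B => //; apply: (@ode_bound p a b N r S B) => //; first by rewrite leq_maxl.
  apply: le_trans (ltW (archi_boundP _)) _; first by rewrite mulr_ge0 // sqr_ge0.
  by rewrite ler_nat leq_maxr.
by move=> k kN; rewrite /B (bigD1 (Ordinal kN)) //= lerDl sumr_ge0.
Qed.

Definition ode_sol p a b (u : V) : R[i] := Ef (ode_seq p a b) (zc u).

Lemma hol_ode_sol p a b : hol [set: V] (ode_sol p a b).
Proof. exact: (hol_Ef (entire_ode p a b)). Qed.

Lemma dz_ode_solE p a b : dz (ode_sol p a b) = fun u => Ef (der_seq (ode_seq p a b)) (zc u).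
Proof. by apply/funext => u; rewrite (dz_Ef _ (entire_ode p a b)). Qed.

Lemma dzdz_ode_sol p a b u : dz (dz (ode_sol p a b)) u = - (p.[zc u] / 2%:R) * ode_sol p a b u.
Proof.
have ey := entire_ode p a b; have ed := entire_der ey; have [ec Ec] := Ef_conv p ey.
rewrite dz_ode_solE (dz_Ef _ ed) (@eq_Ef _ _ (fun k => - 2%:R^-1 * conv_seq p (ode_seq p a b) k)).
  by rewrite EfZ // Ec /ode_sol; ring.
move=> k; rewrite /der_seq ode_seqS; move: (conv_seq _ _ _) => x.
have h1 : k.+1%:R != 0 :> R[i] by rewrite pnatr_eq0.
have h2 : k.+2%:R != 0 :> R[i] by rewrite pnatr_eq0.
by move: h1 h2; move: (k.+1%:R) (k.+2%:R) => m n h1 h2; field; rewrite h1 h2.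
Qed.

Lemma Ef0 (a : nat -> R[i]) : entire a -> Ef a 0 = a 0%N.
Proof.
move=> ea; apply: Ef_eq => // e e0; exists 1%N => -[|n] // _.
rewrite /psum big_ord_recl expr0 mulr1 big1 ?addr0 ?subrr ?cabs0 ?ltW //.
by move=> i _; rewrite expr0n mulr0.
Qed.

Lemma zc0 : zc (0 : V) = 0. Proof. by apply: complexP; rewrite /= mxE. Qed.

Lemma ode_sol0 p a b : ode_sol p a b 0 = a.
Proof. by rewrite /ode_sol zc0 (Ef0 (entire_ode p a b)). Qed.

Lemma dz_ode_sol0 p a b : dz (ode_sol p a b) 0 = b.
Proof.
by rewrite dz_ode_solE zc0 (Ef0 (entire_der (entire_ode p a b))) /der_seq mul1r.
Qed.

Lemma ode_sol_bound p a b (r B : R) u : 0 < r -> 0 <= B ->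
  (forall k, cabs (ode_seq p a b k) * r ^+ k <= B) -> cabs (zc u) <= r / 2%:R ->
  cabs (ode_sol p a b u) <= 2%:R * B.
Proof.
move=> r0 B0 hB hu; apply: Ef_bound; first exact: entire_ode.
move=> n; apply: le_trans (cabs_sum _ _ _) _.
apply: le_trans (_ : \sum_(k < n) B * 2%:R^-1 ^+ k <= _); last exact: geom_sum_le.
apply: ler_sum => k _; rewrite cabsM cabsX.
apply: le_trans (_ : cabs (ode_seq p a b k) * (r / 2%:R) ^+ k <= _).
  apply: ler_wpM2l; first exact: cabs_ge0.
  by apply: lerXn2r; rewrite ?nnegrE ?cabs_ge0 // divr_ge0 // ltW.
by rewrite exprMn mulrA; apply: ler_wpM2r; [rewrite exprn_ge0|].
Qed.

End LinearODE.

(** * Weighted-homogeneous relations between derivatives of a polynomial *)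

Section WeightedHomogeneous.
Import -(notations) mpoly.
Context {F : numFieldType}.
Local Notation "p .@ v" := (mpoly.meval v p) (at level 2).

Lemma poly_eq0_inj (P : {poly F}) (Z : nat -> F) : injective Z -> (forall k, P.[Z k] = 0) -> P = 0.
Proof.
move=> Zi Pz; apply/eqP; apply/negPn/negP => P0.
have u : uniq [seq Z k | k <- iota 0 (size P)] by rewrite map_inj_uniq ?iota_uniq.
have r : all (root P) [seq Z k | k <- iota 0 (size P)].
  by apply/allP => _ /mapP[k _ ->]; apply/rootP.
by have := max_poly_roots P0 r u; rewrite size_map size_iota ltnn.
Qed.

Lemma poly_eq0_neq0 (P : {poly F}) : (forall a, a != 0 -> P.[a] = 0) -> P = 0.
Proof.
move=> h; apply: (@poly_eq0_inj P (fun k => k.+1%:R)) => [i j /eqP|k].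
  by rewrite eqr_nat eqSS => /eqP.
by apply: h; rewrite pnatr_eq0.
Qed.

Lemma msupp_pick k (psi : mpoly.mpoly k F) (m0 : mpoly.multinom k) :
  \sum_(m <- mpoly.msupp psi) mpoly.mcoeff m psi * (m == m0)%:R = mpoly.mcoeff m0 psi.
Proof.
have [h|h] := boolP (m0 \in mpoly.msupp psi).
  rewrite (bigD1_seq m0) ?mpoly.msupp_uniq //= eqxx mulr1 big1 ?addr0 //.
  by move=> m /negPf ->; rewrite mulr0.
rewrite (mpoly.memN_msupp_eq0 h) big_seq big1 // => m hm.
by case: eqP => [E|]; rewrite ?mulr0 //; move: h; rewrite -E hm.
Qed.

Lemma horner_prod_exp k (h : 'I_k -> {poly F}) (m : mpoly.multinom k) a :
  (\prod_j h j ^+ m j).[a] = \prod_j (h j).[a] ^+ m j.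
Proof. by rewrite horner_prod; apply: eq_bigr => j _; rewrite horner_exp. Qed.

Definition mhorner k (h : 'I_k -> {poly F}) (psi : mpoly.mpoly k F) : {poly F} :=
  \sum_(m <- mpoly.msupp psi) (mpoly.mcoeff m psi)%:P * \prod_j h j ^+ m j.

Lemma mhornerE k (h : 'I_k -> {poly F}) (psi : mpoly.mpoly k F) a :
  (mhorner h psi).[a] = psi.@(fun j => (h j).[a]).
Proof.
rewrite /mhorner horner_sum mpoly.mevalE; apply: eq_bigr => m _.
by rewrite hornerM hornerC horner_prod_exp.
Qed.

Section Homogeneous.
Variables (n k : nat) (psi : mpoly.mpoly k F).
Hypothesis hk : (k + 2 <= n)%N.
Hypothesis hom : forall (a : F) (v : 'I_k -> F), a != 0 ->
  psi.@(fun i => a ^+ (i + 2) * v i) = a ^+ n * psi.@v.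

(** The constant term has weight 0 while [n > 0]: at the origin, [a = 2] gives [c = 2^n c]. *)
Lemma homogeneous_mcoeff0 : mpoly.mcoeff (@mpoly.mnm0 k) psi = 0.
Proof.
have e0 : psi.@(fun=> 0) = mpoly.mcoeff (@mpoly.mnm0 k) psi.
  rewrite mpoly.mevalE -[RHS]msupp_pick; apply: eq_bigr => m _; congr (_ * _).
  have [->|m0] := eqVneq; first by rewrite big1 // => i _; rewrite mpoly.mnm0E.
  have [i hi] : exists i, m i != 0%N.
    apply/existsP; apply/contraT; rewrite negb_exists => /forallP h.
    by case/eqP: m0; apply/mpoly.mnmP => i; rewrite mpoly.mnm0E; apply/eqP; rewrite -[_ == _]negbK.
  by rewrite (bigD1 i) //= expr0n (negPf hi) mul0r.
have n0 : (0 < n)%N by apply: leq_trans hk; rewrite addn2.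
have two0 : (2%:R : F) != 0 by rewrite pnatr_eq0.
have /eqP := hom (fun=> 0) two0.
rewrite (_ : (fun i : 'I_k => 2%:R ^+ (i + 2) * 0) = fun=> 0); last by apply/funext => i; rewrite mulr0.
rewrite e0 -subr_eq0 -{1}[mpoly.mcoeff _ _]mul1r -mulrBl mulf_eq0 => /orP[|/eqP//].
by rewrite subr_eq0 -natrX -[1]/(1%:R) eqr_nat => /eqP E; move: (ltn_expl n (ltnSn 1)); rewrite -E ltnS leqNgt n0.
Qed.

(** A variable has weight [i + 2 < n]. Putting [X^(i+2)] for it and 0 for the others turns [psi]
    into a multiple of [X^n] by homogeneity, whereas the coefficient of [X^(i+2)] is the linear
    coefficient in question. *)
Lemma homogeneous_mcoeff1 i : mpoly.mcoeff (mpoly.mnm1 i) psi = 0.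
Proof.
pose d := (i + 2)%N; pose h (j : 'I_k) : {poly F} := if j == i then 'X^d else 0.
pose G := mhorner h psi.
have GX : G = psi.@(fun j => (j == i)%:R) *: 'X^n.
  apply/eqP; rewrite -subr_eq0; apply/eqP; apply: poly_eq0_neq0 => a a0.
  rewrite hornerD hornerN hornerZ hornerXn mhornerE.
  rewrite (_ : (fun j => (h j).[a]) = fun j : 'I_k => a ^+ (j + 2) * (j == i)%:R).
    by rewrite hom // mulrC subrr.
  apply/funext => j; rewrite /h; case: eqP => [->|_]; first by rewrite hornerXn mulr1.
  by rewrite horner0 mulr0.
have dn : (d < n)%N by rewrite /d; apply: leq_trans hk; rewrite -addSn leq_add2r.
have : G`_d = 0 by rewrite GX coefZ coefXn (ltn_eqF dn) mulr0.
rewrite /G /mhorner coef_sum => E; rewrite -[LHS]msupp_pick -[RHS]E; apply: eq_bigr => m _.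
rewrite coefCM; congr (_ * _).
have [s|s] := boolP [forall j, (j != i) ==> (m j == 0%N)].
  rewrite (bigD1 i) //= big1 ?mulr1; last first.
    by move=> j ji; move/forallP: s => /(_ j); rewrite ji => /eqP ->.
  have hi : h i = 'X^d by rewrite /h eqxx.
  rewrite hi -exprM coefXn; congr (_ %:R); rewrite -{1}[d]muln1 eqn_pmul2l; last by rewrite /d addn2.
  congr (nat_of_bool _); apply/idP/eqP => [/eqP ->|/esym mi]; first by rewrite mpoly.mnm1E eqxx.
  apply/eqP.
  apply/mpoly.mnmP => j; rewrite mpoly.mnm1E; have [<-//|ji] := eqVneq i j.
  by move/forallP: s => /(_ j); rewrite eq_sym ji => /eqP.
move: s; rewrite negb_forall => /existsP[j]; rewrite negb_imply => /andP[ji mj].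
rewrite (bigD1 j) //= /h (negPf ji) expr0n (negPf mj) mul0r coef0.
case: eqP => // E2; move: mj; by rewrite E2 mpoly.mnm1E [i == j]eq_sym (negPf ji).
Qed.

(* No monomial of degree at most one occurs, so psi vanishes to second order at 0. *)
Lemma homogeneous_dvd (d : {poly F}) (h : 'I_k -> {poly F}) :
  (forall i, d %| h i) -> d ^+ 2 %| mhorner h psi.
Proof.
move=> dh; rewrite /mhorner; elim/big_ind: _ => [|x y|m _]; first exact: dvdp0.
  exact: dvdp_add.
have [->|mc] := eqVneq (mpoly.mcoeff m psi) 0; first by rewrite polyC0 mul0r dvdp0.
apply: dvdp_mull; have m2 : (2 <= \sum_j m j)%N.
  rewrite -mpoly.mdegE; move: mc; case E : (mpoly.mdeg m) => [|[|x]] // mc.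
    by move/eqP: E mc; rewrite mpoly.mdeg_eq0 => /eqP ->; rewrite homogeneous_mcoeff0 eqxx.
  by move/eqP: E mc => /mpoly.mdeg1P[i /eqP ->]; rewrite homogeneous_mcoeff1 eqxx.
apply: dvdp_trans (dvdp_exp2l d m2) _.
rewrite expr_sum; apply: (big_ind2 (fun x y => x %| y)) => [|x1 x2 y1 y2|j _].
- exact: dvdpp.
- exact: dvdp_mul.
- exact: dvdp_exp2r.
Qed.
End Homogeneous.

(** The cofactors [q_i] in [(X - z0)^i S^(i) = (X - z0)^K q_i] for [S = (X - z0)^K q]. The factor
    [(X - z0)^i] avoids negative exponents when [i > K], which is also why [K - i] is taken in the
    field; the degree bound of [q] passes to every [q_i]. *)
Fixpoint qder (z0 : F) (K : nat) (q : {poly F}) i : {poly F} :=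
  if i is i'.+1 then (K%:R - i'%:R) *: qder z0 K q i' + ('X - z0%:P) * (qder z0 K q i')^`() else q.

Lemma qderP z0 K q i : ('X - z0%:P) ^+ i * (('X - z0%:P) ^+ K * q)^`(i) = ('X - z0%:P) ^+ K * qder z0 K q i.
Proof.
set x := 'X - z0%:P; set S := x ^+ K * q.
have dx : x^`() = 1 by rewrite derivB derivX derivC subr0.
have dxk k : x * (x ^+ k)^`() = k%:R *: x ^+ k.
  case: k => [|k]; first by rewrite expr0 derivC mulr0 scale0r.
  by rewrite deriv_exp dx mul1r mulrnAr -exprS scaler_nat.
elim: i => [|i IH]; first by rewrite mul1r.
rewrite derivnS /=; set T := S^`(i) in IH *.
have := congr1 (fun p => x * p^`()) IH; rewrite !derivM !mulrDr !mulrA !dxk => E.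
have -> : x ^+ i.+1 * T^`() = x * x ^+ i * T^`() by rewrite exprS.
have -> : x * x ^+ i * T^`() = K%:R *: x ^+ K * qder z0 K q i + x * x ^+ K * (qder z0 K q i)^`() - i%:R *: x ^+ i * T.
  by rewrite -E addrC addKr.
rewrite -scalerAl [i%:R *: _ * _](_ : _ = i%:R *: (x ^+ K * qder z0 K q i)); last by rewrite -IH scalerAl.
rewrite -/x -[x ^+ K * (_ *: _)]scalerAr scalerBl (mulrC (x ^+ K) x).
by rewrite addrAC.
Qed.

Lemma size_qder z0 K (q : {poly F}) i e : (size q <= e.+1)%N -> (size (qder z0 K q i) <= e.+1)%N.
Proof.
move=> sq; elim: i => //= i IH; apply: leq_trans (size_polyD _ _) _; rewrite geq_max.
rewrite (leq_trans (size_scale_leq _ _)) //=.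
set Q := qder _ _ _ i in IH *.
apply: leq_trans (size_polyMleq _ _) _; rewrite size_XsubC /=.
have [->|Q0] := eqVneq Q 0; first by rewrite deriv0 size_poly0.
by apply: leq_trans IH; apply: lt_size_deriv.
Qed.

(** Homogeneity is used with [a = x - z0] at each point [x]: multiplied by [(X - z0)^m], the
    relation becomes one between the polynomials [(X - z0)^(i+2) S^(i) = (X - z0)^(K+2) q_i]. The
    side of [psi] is then divisible by [(X - z0)^(2(K+2))], the other is [(X - z0)^(K+2) q_(m-2)],
    and [q_(m-2)] has degree at most [e < K + 2]. *)
Lemma no_relation (z0 : F) K (q : {poly F}) e m (psi : mpoly.mpoly (m - 2) F) (Z : nat -> F) :
  (size q <= e.+1)%N -> (e < K + 2)%N -> (2 <= m)%N -> injective Z ->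
  (forall (a : F) (v : 'I_(m - 2) -> F), a != 0 ->
    psi.@(fun i => a ^+ (i + 2) * v i) = a ^+ m * psi.@v) ->
  let S := ('X - z0%:P) ^+ K * q in
  (forall k, S^`(m - 2).[Z k] = psi.@(fun i : 'I_(m - 2) => S^`(i).[Z k])) -> S^`(m - 2) = 0.
Proof.
move=> sq eK m2 Zi hom S rel; pose x := 'X - z0%:P.
have hk : (m - 2 + 2 <= m)%N by rewrite subnK.
pose h (i : 'I_(m - 2)) := x ^+ (K + 2) * qder z0 K q i.
have dvd : (x ^+ (K + 2)) ^+ 2 %| mhorner h psi.
  by apply: (homogeneous_dvd hk hom) => i; exact: dvdp_mulIl.
have x0 : x != 0 by rewrite polyXsubC_eq0.
have xE a : x.[a] = a - z0 by rewrite /x hornerXsubC.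
have qE i : x ^+ (i + 2) * S^`(i) = x ^+ (K + 2) * qder z0 K q i.
  have H : x ^+ i * S^`(i) = x ^+ K * qder z0 K q i := qderP z0 K q i.
  by rewrite !exprD (mulrAC _ (x ^+ 2)) H mulrAC.
have E : mhorner h psi = x ^+ (K + 2) * qder z0 K q (m - 2).
  (* Homogeneity holds for nonzero scalars only; the extra factor [x] disposes of a sample point
     equal to [z0]. *)
  apply/eqP; rewrite -subr_eq0; apply/eqP; apply: (mulIf x0); rewrite mul0r.
  apply: (poly_eq0_inj Zi) => k; rewrite hornerM hornerD hornerN.
  have [Zk|Zk] := eqVneq (x.[Z k]) 0; first by rewrite Zk mulr0.
  apply/eqP; rewrite mulf_eq0 (negPf Zk) orbF subr_eq0; apply/eqP.
  rewrite mhornerE -qE subnK // hornerM rel horner_exp -hom //; congr (mpoly.meval _ psi).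
  by apply/funext => i; rewrite /h -qE hornerM horner_exp.
have q0 : qder z0 K q (m - 2) = 0.
  move: dvd; rewrite E expr2 dvdp_mul2l ?expf_neq0 // => dvd.
  apply/eqP; apply/negPn/negP => Q0; have := dvdp_leq Q0 dvd.
  rewrite size_exp_XsubC => /leq_trans/(_ (size_qder z0 K (m - 2) sq)).
  by rewrite ltnS leqNgt eK.
have /eqP := qE (m - 2)%N; rewrite q0 mulr0 mulf_eq0 expf_eq0 (negPf x0) andbF /=.
by move/eqP.
Qed.

End WeightedHomogeneous.

(** * Polynomials with prescribed jets *)

Section ApproximatingPolynomial.
Context {R : realType}.
Implicit Types (b : R[i]) (t : nat -> R[i]) (p : {poly R[i]}).

(** The coefficients of the formal quotient [t(z) / (1 - b z)]. *)
Fixpoint geom_mul b t j : R[i] := if j is j'.+1 then t j + b * geom_mul b t j' else t 0%N.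

Lemma geom_mulK b t j : geom_mul b t j - b * shift_seq (geom_mul b t) j = t j.
Proof. by case: j => [|j] /=; [rewrite mulr0 subr0|rewrite addrK]. Qed.

Lemma coef_1subX b p j : ((1 - b *: 'X) * p)`_j = p`_j - b * shift_seq (fun i => p`_i) j.
Proof.
rewrite mulrBl mul1r coefB -scalerAl coefZ coefXM; by case: j => [|j].
Qed.

Lemma coef_exp_1subX b K e t p : (forall j, (j < e)%N -> p`_j = iter K (geom_mul b) t j) ->
  forall j, (j < e)%N -> ((1 - b *: 'X) ^+ K * p)`_j = t j.
Proof.
elim: K p => [|K IH] p hp j je; first by rewrite mul1r hp.
rewrite exprSr -mulrA; apply: IH je => {}j je; rewrite coef_1subX hp //=.
rewrite -[RHS](geom_mulK b); congr (_ - _ * _).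
by case: j je => [|j] // /ltnW je; rewrite /= hp.
Qed.

Section Bounds.
Variables (A d : R).
Hypotheses (A0 : 0 < A) (d0 : 0 <= d) (d1 : d < 1).
Let b : R[i] := (A * d)%:C.
Let f : R := (1 - d)^-1.

Let f1 : 0 < 1 - d. Proof. by rewrite subr_gt0. Qed.
Let f0 : 0 < f. Proof. by rewrite invr_gt0. Qed.
Let fE : 1 + d * f = f. Proof. by rewrite /f; field; rewrite gt_eqF. Qed.
Let f2 : 1 + d <= f.
Proof. by rewrite -fE lerD2l ler_peMr // /f invf_ge1 // gerBl. Qed.
Let cb : cabs b = A * d. Proof. by rewrite cabs_real ger0_norm // mulr_ge0 // ltW. Qed.

(** Since [|b| = A d], dividing by [1 - b z] sums a geometric series of ratio [d] relative to [A^j],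
    and the constant grows by [1/(1-d)]. Multiplying by [1 - b z] costs [1 + d], which the same
    factor dominates. *)
Lemma geom_mul_bound (C : R) t : 0 <= C -> (forall j, cabs (t j) <= C * A ^+ j) ->
  forall j, cabs (geom_mul b t j) <= C * f * A ^+ j.
Proof.
move=> C0 ht; elim=> [|j IH].
  apply: le_trans (ht 0%N) _; apply: ler_wpM2r; first exact: exprn_ge0 (ltW A0).
  by rewrite ler_peMr // /f invf_ge1 // gerBl.
apply: le_trans (cabsD _ _) _; rewrite cabsM cb.
have -> : C * f * A ^+ j.+1 = C * A ^+ j.+1 + A * d * (C * f * A ^+ j) by rewrite -{1}fE exprS; ring.
by apply: (lerD (ht _)); apply: ler_wpM2l IH; rewrite mulr_ge0 // ltW.
Qed.

Lemma coef_1subX_bound (C : R) p : 0 <= C -> (forall j, cabs p`_j <= C * A ^+ j) ->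
  forall j, cabs ((1 - b *: 'X) * p)`_j <= C * f * A ^+ j.
Proof.
move=> C0 hp j; apply: le_trans (_ : C * (1 + d) * A ^+ j <= _); last first.
  by apply: ler_wpM2r; [exact: exprn_ge0 (ltW A0)|exact: ler_wpM2l].
rewrite coef_1subX; apply: le_trans (cabsB _ _) _; rewrite cabsM cb.
rewrite mulrDr mulr1 mulrDl; apply: (lerD (hp j)).
case: j => [|j] /=; first by rewrite cabs0 mulr0 mulr_ge0 // ?exprn_ge0 ?mulr_ge0 // ltW.
have -> : C * d * A ^+ j.+1 = A * d * (C * A ^+ j) by rewrite exprS; ring.
by apply: ler_wpM2l (hp j); rewrite mulr_ge0 // ltW.
Qed.

Lemma iter_geom_mul_bound K (C : R) t : 0 <= C -> (forall j, cabs (t j) <= C * A ^+ j) ->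
  forall j, cabs (iter K (geom_mul b) t j) <= C * f ^+ K * A ^+ j.
Proof.
move=> C0 ht; elim: K => [|K IH] /=; first by move=> j; rewrite expr0 mulr1.
move=> j; rewrite exprSr mulrA; apply: geom_mul_bound IH j.
by rewrite mulr_ge0 // exprn_ge0 // ltW.
Qed.

Lemma exp_1subX_bound K (C : R) p : 0 <= C -> (forall j, cabs p`_j <= C * A ^+ j) ->
  forall j, cabs ((1 - b *: 'X) ^+ K * p)`_j <= C * f ^+ K * A ^+ j.
Proof.
move=> C0 hp; elim: K => [|K IH]; first by move=> j; rewrite expr0 mulr1 mul1r.
move=> j; rewrite exprS -mulrA exprSr (mulrA C); apply: coef_1subX_bound IH j.
by rewrite mulr_ge0 // exprn_ge0 // ltW.
Qed.
End Bounds.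

Lemma bernoulli_le (d : R) K : 0 <= d -> d <= 1 -> 1 - K%:R * d <= (1 - d) ^+ K.
Proof.
move=> d0 d1; elim: K => [|K IH]; first by rewrite mul0r subr0.
rewrite exprS; apply: le_trans (ler_wpM2l _ IH); last by rewrite subr_ge0.
rewrite -subr_ge0 (_ : _ - _ = K%:R * d ^+ 2); first by rewrite mulr_ge0 // exprn_ge0.
by rewrite -natr1; ring.
Qed.

(** The zero sits at [z0 = 1/b = 2K/A], so [(X - z0)^K] is [(1 - b X)^K] up to a scalar. The first
    [e] coefficients of [t / (1 - b z)^K] are kept, so that multiplying back restores those of [t].
    With [d = 1/(2K)], Bernoulli's inequality gives [(1 - d)^(-K) <= 2]: one factor 2 for the
    division and one for the multiplication, hence [4 C]. *)
Lemma approx_poly (t : nat -> R[i]) (C A : R) K e : 0 < C -> 0 < A -> (forall j, cabs (t j) <= C * A ^+ j) ->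
  exists (z0 : R[i]) (q : {poly R[i]}),
   [/\ size q = e.+1, forall j, cabs ((('X - z0%:P) ^+ K * q)`_j) <= 4%:R * C * A ^+ j
     & forall j, (j < e)%N -> (('X - z0%:P) ^+ K * q)`_j = t j].
Proof.
(* For [K = 0] the convention on inverses makes [d], [b] and [z0] all 0. *)
move=> C0 A0 ht; pose d : R := (2 * K)%:R^-1; pose b : R[i] := (A * d)%:C.
have d0 : 0 <= d by rewrite invr_ge0.
have d1 : d < 1.
  rewrite /d; case: (K) => [|k]; first by rewrite muln0 invr0.
  by rewrite invf_lt1 ?ltr0n ?muln_gt0 // ltr1n mulnS.
have fK : (1 - d)^-1 ^+ K <= 2%:R.
  rewrite exprVn -[2%:R]invrK lef_pV2 ?posrE ?invr_gt0 ?exprn_gt0 ?subr_gt0 //.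
  apply: le_trans (bernoulli_le K d0 (ltW d1)).
  rewrite /d; case: (K) => [|k]; first by rewrite mul0r subr0 invf_le1 // ler1n.
  rewrite natrM invfM mulrCA mulfV ?mulr1 ?pnatr_eq0 //.
  by rewrite {2}[1](splitr 1) mul1r addrK.
(* The extra coefficient of index [e] is nonzero, which fixes the degree at exactly [e], and of a
   size compatible with the geometric bound. *)
pose p : {poly R[i]} := \poly_(j < e.+1) (if (j < e)%N then iter K (geom_mul b) t j else (C * A ^+ e)%:C).
have c0 : 0 < C * A ^+ e by rewrite mulr_gt0 // exprn_gt0.
have sp : size p = e.+1 by rewrite size_poly_eq // ltnn; apply/eqP => /(congr1 (@complex.Re R)) /= /eqP; rewrite gt_eqF.
have bp j : cabs p`_j <= C * 2%:R * A ^+ j.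
  rewrite coef_poly; case: ltnP => [|_]; last by rewrite cabs0 ?mulr_ge0 // ?exprn_ge0 // ltW.
  rewrite ltnS leq_eqVlt => /predU1P[->|je].
    by rewrite ltnn cabs_real ger0_norm ?(ltW c0) // mulrAC ler_peMr ?(ltW c0) // ler1n.
  rewrite je; apply: le_trans (iter_geom_mul_bound A0 d0 d1 K (ltW C0) ht j) _.
  by apply: ler_wpM2r; [exact: exprn_ge0 (ltW A0)|rewrite ler_pM2l].
have bS j : cabs (((1 - b *: 'X) ^+ K * p)`_j) <= 4%:R * C * A ^+ j.
  have C2 : 0 <= C * 2%:R by rewrite mulr_ge0 // ltW.
  apply: le_trans (exp_1subX_bound A0 d0 d1 K C2 bp j) _.
  apply: ler_wpM2r; first exact: exprn_ge0 (ltW A0).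
  have -> : 4%:R * C = C * 2%:R * 2%:R by ring.
  exact: ler_wpM2l.
have eS : forall j, (j < e)%N -> ((1 - b *: 'X) ^+ K * p)`_j = t j.
  by apply: coef_exp_1subX => j je; rewrite coef_poly ltnS (ltnW je) je.
have bK : (- b) ^+ K != 0.
  rewrite expf_eq0 oppr_eq0 negb_and orbC /b /d.
  case: (K) => [|k]; first by rewrite orbT.
  apply/orP; left; apply/eqP => /(congr1 (@complex.Re R)) /= /eqP.
  by rewrite mulf_eq0 invr_eq0 pnatr_eq0 muln_eq0 /= orbF gt_eqF.
have gE : (1 - b *: 'X) ^+ K * p = ('X - (b^-1)%:P) ^+ K * ((- b) ^+ K *: p).
  rewrite -scalerAr scalerAl; congr (_ * _); rewrite -exprZn.
  case: (K) bK => [|k]; first by rewrite !expr0.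
  rewrite expf_eq0 oppr_eq0 /= => b0; congr (_ ^+ _).
  by rewrite scalerBr !scaleNr opprK -[b *: (_)%:P]mul_polyC -polyCM mulfV // addrC.
exists b^-1, ((- b) ^+ K *: p); rewrite -gE; split=> //.
by rewrite size_scale.
Qed.

End ApproximatingPolynomial.

(** * Surfaces in space *)

Section Indices.
Lemma ord3P (P : 'I_3 -> Prop) : P 0 -> P 1 -> P 2 -> forall i, P i.
Proof.
move=> h0 h1 h2 [[|[|[|i]]] hi] //.
- by rewrite (_ : Ordinal hi = 0) //; apply: val_inj.
- by rewrite (_ : Ordinal hi = 1) //; apply: val_inj.
- by rewrite (_ : Ordinal hi = 2) //; apply: val_inj.
Qed.

Lemma sum2E (U : nmodType) (F : 'I_2 -> U) : \sum_i F i = F 0 + F 1.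
Proof. by rewrite !big_ord_recl big_ord0 addr0; congr (F _ + F _); apply: val_inj. Qed.

Lemma sum3E (U : nmodType) (F : 'I_3 -> U) : \sum_i F i = F 0 + F 1 + F 2.
Proof.
by rewrite !big_ord_recl big_ord0 addr0 addrA; congr (F _ + F _ + F _); apply: val_inj.
Qed.

Lemma det2E (K : comPzRingType) (A : 'M[K]_2) : \det A = A 0 0 * A 1 1 - A 0 1 * A 1 0.
Proof.
rewrite (expand_det_row _ 0) sum2E /cofactor !det_mx11 !mxE /= expr0 expr1.
have -> : lift 0 0 = 1 :> 'I_2 by apply: val_inj.
have -> : lift 1 0 = 0 :> 'I_2 by apply: val_inj.
by rewrite mul1r mulN1r mulrN.
Qed.
End Indices.

Section SurfaceGeometry.
Context {R : realType}.
Local Notation V := ('rV[R]_2).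
Implicit Types (Y Z : V -> 'rV[R]_3) (T : V -> V) (w : V) (O : set V).

Lemma cross0 (u v : 'rV[R]_3) : cross u v 0 0 = u 0 1 * v 0 2 - u 0 2 * v 0 1.
Proof. by rewrite mxE; congr (u 0 _ * v 0 _ - u 0 _ * v 0 _); apply: val_inj. Qed.
Lemma cross1 (u v : 'rV[R]_3) : cross u v 0 1 = u 0 2 * v 0 0 - u 0 0 * v 0 2.
Proof. by rewrite mxE; congr (u 0 _ * v 0 _ - u 0 _ * v 0 _); apply: val_inj. Qed.
Lemma cross2 (u v : 'rV[R]_3) : cross u v 0 2 = u 0 0 * v 0 1 - u 0 1 * v 0 0.
Proof. by rewrite mxE; congr (u 0 _ * v 0 _ - u 0 _ * v 0 _); apply: val_inj. Qed.
Definition crossE := (cross0, cross1, cross2).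

Lemma eucl_normE (v : 'rV[R]_3) : eucl_norm v = Num.sqrt (v 0 0 ^+ 2 + v 0 1 ^+ 2 + v 0 2 ^+ 2).
Proof. by rewrite /eucl_norm sum3E. Qed.

Lemma eucl_norm_ge0 (v : 'rV[R]_3) : 0 <= eucl_norm v.
Proof. exact: sqrtr_ge0. Qed.

Lemma eucl_normZ (k : R) (v : 'rV[R]_3) : eucl_norm (k *: v) = `|k| * eucl_norm v.
Proof.
rewrite !eucl_normE !mxE !exprMn -!mulrDr sqrtrM ?sqr_ge0 // sqrtr_sqr //.
Qed.

Lemma eucl_norm_sqr (v : 'rV[R]_3) : eucl_norm v ^+ 2 = v 0 0 ^+ 2 + v 0 1 ^+ 2 + v 0 2 ^+ 2.
Proof. by rewrite eucl_normE sqr_sqrtr // !addr_ge0 // sqr_ge0. Qed.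

Lemma eucl_norm_gt0 (v : 'rV[R]_3) : v != 0 -> 0 < eucl_norm v.
Proof.
move=> v0; rewrite lt_def eucl_norm_ge0 andbT; apply/eqP => h; case/eqP: v0.
have := eucl_norm_sqr v; rewrite h expr0n /= => /esym/eqP.
rewrite !paddr_eq0 ?addr_ge0 ?sqr_ge0 // !sqrf_eq0 => /andP[/andP[/eqP h0 /eqP h1] /eqP h2].
by apply/rowP; apply: ord3P; rewrite mxE.
Qed.

Lemma cross_lin (a b c d : R) (u v : 'rV[R]_3) :
  cross (a *: u + b *: v) (c *: u + d *: v) = (a * d - b * c) *: cross u v.
Proof.
have E (x y : R) k : (x *: u + y *: v) 0 k = x * u 0 k + y * v 0 k by rewrite !mxE.
by apply/rowP; apply: ord3P; rewrite [in RHS]mxE !crossE !E; ring.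
Qed.

Lemma cross_orth (u v : 'rV[R]_3) : \sum_k u 0 k * cross u v 0 k = 0 /\ \sum_k v 0 k * cross u v 0 k = 0.
Proof. by rewrite !sum3E !crossE; split; ring. Qed.

Lemma cross_gram (u v : 'rV[R]_3) : (\sum_k u 0 k * u 0 k) * (\sum_k v 0 k * v 0 k) - (\sum_k u 0 k * v 0 k) * (\sum_k v 0 k * u 0 k) =
  eucl_norm (cross u v) ^+ 2.
Proof. by rewrite eucl_norm_sqr !sum3E !crossE; ring. Qed.

Definition jrow Y (i : 'I_2) w : 'rV[R]_3 := row i (jacobian Y w).
Definition normal Y w := cross (jrow Y 0 w) (jrow Y 1 w).

Lemma jrowE Y i w j : jrow Y i w 0 j = partial i (fun u => Y u 0 j) w.
Proof. by rewrite !mxE. Qed.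

Lemma unit_normalE Y w : unit_normal Y w = (eucl_norm (normal Y w))^-1 *: normal Y w.
Proof. by []. Qed.

Lemma jacobianE k (F : V -> 'rV[R]_k) w i j : jacobian F w i j = partial i (fun u => F u 0 j) w.
Proof. by rewrite mxE. Qed.

Lemma jac_detE T w : \det (jacobian T w) = jac_det T w.
Proof. by rewrite det2E !jacobianE /jac_det [X in _ - X]mulrC. Qed.

Lemma unit_normal_orth Y w i : \sum_k partial i (fun u => Y u 0 k) w * unit_normal Y w 0 k = 0.
Proof.
have N k : unit_normal Y w 0 k = (eucl_norm (normal Y w))^-1 * normal Y w 0 k by rewrite unit_normalE mxE.
have [c0 c1] := cross_orth (jrow Y 0 w) (jrow Y 1 w).
have -> : \sum_k partial i (fun u => Y u 0 k) w * unit_normal Y w 0 k =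
    (eucl_norm (normal Y w))^-1 * \sum_k jrow Y i w 0 k * normal Y w 0 k.
  by rewrite mulr_sumr; apply: eq_bigr => k _; rewrite N jrowE mulrCA.
suff -> : \sum_k jrow Y i w 0 k * normal Y w 0 k = 0 by rewrite mulr0.
by move: i; apply: ord2P.
Qed.

(** The second derivatives [t0, t1] of a change of coordinates multiply tangent vectors [D0, D1], so
    they disappear on pairing with the normal: this is why the second fundamental form is a
    tensor. *)
Lemma second_form_sum (A00 A10 A01 A11 D0 D1 N : 'I_3 -> R) (i0 i1 j0 j1 t0 t1 : R) :
  \sum_k D0 k * N k = 0 -> \sum_k D1 k * N k = 0 ->
  \sum_k ((A00 k * i0 + A10 k * i1) * j0 + D0 k * t0 + ((A01 k * i0 + A11 k * i1) * j1 + D1 k * t1)) * N k =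
  (i0 * \sum_k A00 k * N k + i1 * \sum_k A10 k * N k) * j0 + (i0 * \sum_k A01 k * N k + i1 * \sum_k A11 k * N k) * j1.
Proof.
move=> h0 h1.
transitivity ((i0 * \sum_k A00 k * N k + i1 * \sum_k A10 k * N k) * j0 + (i0 * \sum_k A01 k * N k + i1 * \sum_k A11 k * N k) * j1
  + t0 * (\sum_k D0 k * N k) + t1 * (\sum_k D1 k * N k)); first by rewrite !sum3E; ring.
by rewrite h0 h1 !mulr0 !addr0.
Qed.

Lemma partial2_comp O O' (f : V -> R) T i j w : open O -> open O' -> smooth_on O' f ->
  (forall u, O u -> O' (T u)) -> smooth_map_on O T -> O w ->
  let t a u := T u 0 a in
  partial i (partial j (fun u => f (T u))) w =
   (partial 0 (partial 0 f) (T w) * partial i (t 0) w + partial 1 (partial 0 f) (T w) * partial i (t 1) w) * partial j (t 0) w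
   + partial 0 f (T w) * partial i (partial j (t 0)) w
   + ((partial 0 (partial 1 f) (T w) * partial i (t 0) w + partial 1 (partial 1 f) (T w) * partial i (t 1) w) * partial j (t 1) w
   + partial 1 f (T w) * partial i (partial j (t 1)) w).
Proof.
move=> oO oO' sf OT sT Ow t.
have df u : O u -> differentiable f (T u) by move=> Ou; apply: (smooth_differentiable oO' sf); exact: OT.
have dT u k : O u -> differentiable (fun v => T v 0 k) u by move=> Ou; exact: (smooth_differentiable oO (sT k)).
have E u : O u -> partial j (fun u => f (T u)) u = partial 0 f (T u) * partial j (t 0) u + partial 1 f (T u) * partial j (t 1) u.
  by move=> Ou; rewrite (partial_comp j (df u Ou) (fun k => dT u k Ou)).
rewrite (eq_partial i oO Ow E).
have dp a : differentiable (fun u => partial a f (T u)) w.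
  apply: (differentiable_comp2 (g := partial a f)) (fun k => dT w k Ow).
  by apply: (smooth_differentiable oO' (smooth_partial a sf)); exact: OT.
have dj a : differentiable (partial j (t a)) w.
  exact: (smooth_differentiable oO (smooth_partial j (sT a))).
have C a : partial i (fun u => partial a f (T u)) w =
    partial 0 (partial a f) (T w) * partial i (t 0) w + partial 1 (partial a f) (T w) * partial i (t 1) w.
  apply: (partial_comp (g := partial a f)) (fun k => dT w k Ow).
  by apply: (smooth_differentiable oO' (smooth_partial a sf)); exact: OT.
rewrite partialD; [|exact: differentiableM|exact: differentiableM].
by rewrite (partialM i (dp 0) (dj 0)) (partialM i (dp 1) (dj 1)) (C 0) (C 1).
Qed.

Lemma jacobian_compE k O O' (Y Z : V -> 'rV[R]_k) T w : open O -> open O' -> smooth_map_on O' Y ->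
  (forall u, O u -> O' (T u)) -> smooth_map_on O T -> O w -> (forall u, O u -> Z u = Y (T u)) ->
  jacobian Z w = jacobian T w *m jacobian Y (T w).
Proof.
move=> oO oO' sY OT sT Ow ZE; apply/matrixP => i j; rewrite [in RHS]mxE sum2E !jacobianE.
rewrite (eq_partial i oO Ow (g := fun u => Y (T u) 0 j)); last by move=> u Ou; rewrite ZE.
have dY : differentiable (fun v => Y v 0 j) (T w) by apply: (smooth_differentiable oO' (sY j)); exact: OT.
have dT a : differentiable (fun v => T v 0 a) w by exact: (smooth_differentiable oO (sT a)).
rewrite (partial_comp (g := fun v => Y v 0 j) i dY dT).
by rewrite mulrC [X in _ + X]mulrC.
Qed.

(** Bilinear forms transform by congruence, their quotient by conjugation. Applied to the two
    fundamental forms, this makes trace and determinant of the shape operator invariant. *)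
Lemma conj_mulmx (J A B : 'M[R]_2) : J \in unitmx -> B \in unitmx ->
  J *m A *m J^T = (J *m (A *m invmx B) *m invmx J) *m (J *m B *m J^T).
Proof. by move=> uJ uB; rewrite !mulmxA (mulmxKV uJ) (mulmxKV uB). Qed.

Section ChangeOfChart.
Variables (O O' : set V) (Y Z : V -> 'rV[R]_3) (T : V -> V) (w : V).
Hypotheses (oO : open O) (oO' : open O') (sY : smooth_map_on O' Y)
  (OT : forall u, O u -> O' (T u)) (sT : smooth_map_on O T) (Ow : O w)
  (ZE : forall u, O u -> Z u = Y (T u)).
Let J := jacobian T w.

Lemma jacobian_comp : jacobian Z w = J *m jacobian Y (T w).
Proof. exact: (jacobian_compE oO oO' sY). Qed.

Lemma first_form_comp : first_form Z w = J *m first_form Y (T w) *m J^T.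
Proof. by rewrite /first_form jacobian_comp trmx_mul !mulmxA. Qed.

Lemma normal_comp : normal Z w = \det J *: normal Y (T w).
Proof.
have E i : jrow Z i w = J i 0 *: jrow Y 0 (T w) + J i 1 *: jrow Y 1 (T w).
  by apply/rowP => k; rewrite mxE jacobian_comp mxE sum2E !mxE.
by rewrite /normal !E cross_lin det2E.
Qed.

Hypothesis J0 : 0 < \det J.

Lemma unit_normal_comp : unit_normal Z w = unit_normal Y (T w).
Proof.
rewrite !unit_normalE normal_comp eucl_normZ gtr0_norm // scalerA invfM mulrAC mulVf ?mul1r //.
by rewrite gt_eqF.
Qed.

Lemma second_form_comp : second_form Z w = J *m second_form Y (T w) *m J^T.
Proof.
apply/matrixP => i j; rewrite mxE unit_normal_comp.
have E k : partial i (partial j (fun u => Z u 0 k)) w = partial i (partial j (fun u => Y (T u) 0 k)) w.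
  apply: (eq_partial i oO Ow) => u Ou; apply: (eq_partial j oO Ou) => v Ov; by rewrite ZE.
have orth a := unit_normal_orth Y (T w) a.
rewrite !mxE !sum2E !mxE !sum2E ![second_form Y (T w) _ _]mxE !jacobianE.
have := @second_form_sum (fun k => partial 0 (partial 0 (fun u => Y u 0 k)) (T w)) (fun k => partial 1 (partial 0 (fun u => Y u 0 k)) (T w))
  (fun k => partial 0 (partial 1 (fun u => Y u 0 k)) (T w)) (fun k => partial 1 (partial 1 (fun u => Y u 0 k)) (T w))
  _ _ _ (partial i (fun u => T u 0 0) w) (partial i (fun u => T u 0 1) w) (partial j (fun u => T u 0 0) w) (partial j (fun u => T u 0 1) w)
  (partial i (partial j (fun u => T u 0 0)) w) (partial i (partial j (fun u => T u 0 1)) w) (orth 0) (orth 1).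
move=> <-; apply: eq_bigr => k _; rewrite E; congr (_ * _).
exact: (partial2_comp (f := fun v => Y v 0 k) i j oO oO' (sY k) OT sT Ow).
Qed.

Hypothesis I0 : first_form Y (T w) \in unitmx.

Lemma shape_op_comp : shape_op Z w = J *m shape_op Y (T w) *m invmx J.
Proof.
have uJ : J \in unitmx by rewrite unitmxE unitfE gt_eqF.
have uZ : first_form Z w \in unitmx.
  by rewrite first_form_comp !unitmx_mul unitmx_tr uJ I0.
rewrite /shape_op -[RHS](mulmxK uZ); congr (_ *m _).
by rewrite second_form_comp first_form_comp; apply: conj_mulmx.
Qed.

Lemma det_shape_op_comp : \det (shape_op Z w) = \det (shape_op Y (T w)).
Proof.
have uJ : J \in unitmx by rewrite unitmxE unitfE gt_eqF.
rewrite shape_op_comp; move: (shape_op Y _) => S.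
by rewrite det_mulmx det_mulmx det_inv mulrAC mulfV ?mul1r // gt_eqF.
Qed.

Lemma tr_shape_op_comp : \tr (shape_op Z w) = \tr (shape_op Y (T w)).
Proof.
have uJ : J \in unitmx by rewrite unitmxE unitfE gt_eqF.
by rewrite shape_op_comp mxtrace_mulC mulmxA mulVmx // mul1mx.
Qed.
End ChangeOfChart.

Lemma row_free_normal (A : 'M[R]_(2, 3)) : row_free A -> cross (row 0 A) (row 1 A) != 0.
Proof.
move=> /row_freeP[B AB]; apply/eqP => c0.
have c j : cross (row 0 A) (row 1 A) 0 j = 0 by rewrite c0 mxE.
have := c 0; have := c 1; have := c 2; rewrite !crossE !mxE => c2 c1' c0'.
have : \det (A *m B) = 1 by rewrite AB det1.
rewrite det2E !mxE !sum3E => E; have : (1 : R) != 0 by rewrite oner_eq0.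
case/eqP; rewrite -E.
(* The Cauchy-Binet formula: [det (A B)] is a combination of the components of the cross product of
   the rows of [A]. *)
transitivity ((A 0 1 * A 1 2 - A 0 2 * A 1 1) * (B 1 0 * B 2 1 - B 2 0 * B 1 1)
  + (A 0 2 * A 1 0 - A 0 0 * A 1 2) * (B 2 0 * B 0 1 - B 0 0 * B 2 1)
  + (A 0 0 * A 1 1 - A 0 1 * A 1 0) * (B 0 0 * B 1 1 - B 1 0 * B 0 1)); first by ring.
by rewrite c0' c1' c2 !mul0r !addr0.
Qed.

Lemma det_first_form Y w : \det (first_form Y w) = eucl_norm (normal Y w) ^+ 2.
Proof.
have E i j : first_form Y w i j = \sum_k jrow Y i w 0 k * jrow Y j w 0 k.
  by rewrite mxE; apply: eq_bigr => k _; rewrite !mxE.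
by rewrite det2E !E cross_gram.
Qed.

Lemma row_free_first_form Y w : row_free (jacobian Y w) -> first_form Y w \in unitmx.
Proof.
move=> rf; rewrite unitmxE unitfE det_first_form expf_eq0 /= gt_eqF //.
exact: eucl_norm_gt0 (row_free_normal rf).
Qed.

Lemma first_form_row_free Y w : first_form Y w \in unitmx -> row_free (jacobian Y w).
Proof. by move=> u; apply/row_freeP; exists ((jacobian Y w)^T *m invmx (first_form Y w)); rewrite mulmxA mulmxV. Qed.

Lemma row_free_comp k (A : 'M[R]_2) (B : 'M[R]_(2, k)) : A \in unitmx -> row_free B -> row_free (A *m B).
Proof.
move=> uA /row_freeP[C BC]; apply/row_freeP; exists (C *m invmx A).
by rewrite mulmxA -(mulmxA A) BC mulmx1 mulmxV.
Qed.

Lemma eigenvalue2 (A : 'M[R]_2) (k : R) : \tr A = 0 -> eigenvalue A k = (k ^+ 2 == - \det A).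
Proof.
move=> tA; rewrite eigenvalue_root_char /root /char_poly det2E.
rewrite !mxE /= !mulr1n !mulr0n !sub0r !hornerE /=.
have : A 1 1 = - A 0 0 by apply/eqP; rewrite -addr_eq0 addrC; move: tA; rewrite /mxtrace sum2E => ->.
move=> E; rewrite det2E E -[RHS]subr_eq0; congr (_ == _); ring.
Qed.

End SurfaceGeometry.

(** * Changes of chart and the pointwise invariants of an immersion *)

Section Charts.
Context {R : realType} {M : oriented_surface R}.
Local Notation V := ('rV[R]_2).
Implicit Types (c d e : chart R M) (U : set M) (X : M -> 'rV[R]_3).

Definition chart_part c U : set V := ccod c `&` cinv c @^-1` U.
Definition transition c d : V -> V := fun w => cmap d (cinv c w).

Lemma open_chart_part c U : open U -> open (chart_part c U).
Proof.
move=> oU; rewrite openE => w [cw Uw].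
have n1 : nbhs w (ccod c) by apply: open_nbhs_nbhs; split=> //; exact: ccod_open.
have n2 : nbhs w (cinv c @^-1` U) by apply: (cinv_cts cw); exact: open_nbhs_nbhs.
exact: filterI n1 n2.
Qed.
Arguments open_chart_part c {U}.

Lemma chart_part_map c U p : cdom c p -> U p -> chart_part c U (cmap c p).
Proof. by move=> cp Up; split; [exact: cmap_cod|rewrite /preimage /= cmapK]. Qed.

Lemma transition_part c d U w : chart_part c (cdom d `&` U) w -> chart_part d U (transition c d w).
Proof. by move=> [cw [dw Uw]]; apply: chart_part_map. Qed.

(** The inclusion ensures that the overlap of [c] and [e] lies in the domain of the middle chart, so
    that the transition factors through it. *)
Lemma oriented_transition_trans c d e : (forall q, cdom c q -> cdom e q -> cdom d q) ->
  oriented_transition c d -> oriented_transition d e -> oriented_transition c e.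
Proof.
move=> cde [scd jcd] [sde jde].
have sub w : chart_part c (cdom e) w -> chart_part c (cdom d) w.
  by move=> [cw ew]; split=> //; apply: cde ew; exact: cinv_dom.
have OT u : chart_part c (cdom e) u -> chart_part d (cdom e) (transition c d u).
  by move=> [cu eu]; apply: chart_part_map => //; apply: cde eu; exact: cinv_dom.
have E u : chart_part c (cdom e) u -> transition c e u = transition d e (transition c d u).
  by move=> /sub[cu du]; rewrite /transition cmapK.
have oO := open_chart_part c (cdom_open e); have oO' := open_chart_part d (cdom_open e).
have sT : smooth_map_on (chart_part c (cdom e)) (transition c d).
  by move=> j; apply: smooth_subset (scd j) => w; exact: sub.
split.
  move=> j; apply: (smooth_eq oO (f := fun w => transition d e (transition c d w) 0 j)).
    by move=> u Ou; rewrite -E.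
  exact: (smooth_comp oO oO' (sde j) OT sT).
move=> w Ow; rewrite (jacobian_compE oO oO' sde OT sT Ow E) det_mulmx mulr_gt0 //.
  by apply: jcd; exact: sub.
by apply: jde; exact: OT.
Qed.

(** Unlike [immersion], this concerns a single chart, which may lie outside the atlas. *)
Definition immersed_in U X c := smooth_map_on (chart_part c U) (in_chart X c) /\
  forall w, chart_part c U w -> row_free (jacobian (in_chart X c) w).

Section Change.
Variables (U : set M) (X : M -> 'rV[R]_3) (c d : chart R M).
Hypotheses (oU : open U) (tcd : oriented_transition c d) (Xd : immersed_in U X d).

Let O := chart_part c (cdom d `&` U).
Let O' := chart_part d U.

Let oO : open O. Proof. by apply: open_chart_part; apply: openI => //; exact: cdom_open. Qed.
Let oO' : open O'. Proof. exact: open_chart_part. Qed.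
Let OT u : O u -> O' (transition c d u). Proof. exact: transition_part. Qed.
Let sT : smooth_map_on O (transition c d).
Proof. by move=> j; apply: smooth_subset (proj1 tcd j) => w [cw [dw _]]. Qed.
Let E u : O u -> in_chart X c u = in_chart X d (transition c d u).
Proof. by move=> [cu [du _]]; rewrite /in_chart /transition cmapK. Qed.
Let J0 w : O w -> 0 < \det (jacobian (transition c d) w).
Proof. by move=> [cw [dw _]]; exact: (proj2 tcd). Qed.
Let uI w : O w -> first_form (in_chart X d) (transition c d w) \in unitmx.
Proof. by move=> Ow; apply: row_free_first_form; apply: (proj2 Xd); exact: OT. Qed.

Lemma immersed_in_change : (forall q, cdom c q -> U q -> cdom d q) -> immersed_in U X c.
Proof.
move=> cUd; have sub w : chart_part c U w -> O w.
  by move=> [cw Uw]; split=> //; split=> //; apply: cUd Uw; exact: cinv_dom.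
split=> [j|w /sub Ow].
  apply: smooth_subset sub _; apply: (smooth_eq oO (f := fun w => in_chart X d (transition c d w) 0 j)).
    by move=> u Ou; rewrite E.
  exact: (smooth_comp oO oO' (proj1 Xd j) OT sT).
rewrite (jacobian_compE oO oO' (proj1 Xd) OT sT Ow E); apply: row_free_comp; last by apply: (proj2 Xd); exact: OT.
by rewrite unitmxE unitfE gt_eqF // J0.
Qed.

Lemma unit_normal_change w : O w -> unit_normal (in_chart X c) w = unit_normal (in_chart X d) (transition c d w).
Proof. by move=> Ow; rewrite (unit_normal_comp oO oO' (proj1 Xd) OT sT Ow E (J0 Ow)). Qed.
Lemma first_form_change w : O w -> first_form (in_chart X c) w =
  jacobian (transition c d) w *m first_form (in_chart X d) (transition c d w) *m (jacobian (transition c d) w)^T.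
Proof. by move=> Ow; rewrite (first_form_comp oO oO' (proj1 Xd) OT sT Ow E). Qed.
Lemma det_shape_op_change w : O w -> \det (shape_op (in_chart X c) w) = \det (shape_op (in_chart X d) (transition c d w)).
Proof. by move=> Ow; rewrite (det_shape_op_comp oO oO' (proj1 Xd) OT sT Ow E (J0 Ow) (uI Ow)). Qed.
Lemma tr_shape_op_change w : O w -> \tr (shape_op (in_chart X c) w) = \tr (shape_op (in_chart X d) (transition c d w)).
Proof. by move=> Ow; rewrite (tr_shape_op_comp oO oO' (proj1 Xd) OT sT Ow E (J0 Ow) (uI Ow)). Qed.
End Change.

Lemma chart_at_atlas (p : M) : atlas (chart_at p) /\ cdom (chart_at p) p.
Proof. exact: projT2 (cid (atlas_cover p)). Qed.

Section Pointwise.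
Variables (U : set M) (X : M -> 'rV[R]_3) (d : chart R M) (p : M).
Hypotheses (oU : open U) (td : forall c, atlas c -> oriented_transition c d) (Xd : immersed_in U X d)
  (dp : cdom d p) (Up : U p).

Let c := chart_at p.
Let Op : chart_part c (cdom d `&` U) (cmap c p).
Proof. by apply: chart_part_map; [exact: (proj2 (chart_at_atlas p))|]. Qed.
Let tp : transition c d (cmap c p) = cmap d p.
Proof. by rewrite /transition cmapK //; exact: (proj2 (chart_at_atlas p)). Qed.
Let tcd : oriented_transition c d. Proof. exact: td (proj1 (chart_at_atlas p)). Qed.

(** The Gauss map and the curvatures are defined through the chart selected by [chart_at]; this
    lemma and the next two move them to any chart with oriented transitions from the atlas, in
    particular to the canonical one. *)
Lemma gauss_mapE : gauss_map X p = unit_normal (in_chart X d) (cmap d p).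
Proof. by rewrite /gauss_map (unit_normal_change oU tcd Xd Op) tp. Qed.
Lemma gauss_curvatureE : gauss_curvature X p = \det (shape_op (in_chart X d) (cmap d p)).
Proof. by rewrite /gauss_curvature (det_shape_op_change oU tcd Xd Op) tp. Qed.
Lemma mean_curvatureE : mean_curvature X p = \tr (shape_op (in_chart X d) (cmap d p)) / 2%:R.
Proof. by rewrite /mean_curvature (tr_shape_op_change oU tcd Xd Op) tp. Qed.
End Pointwise.

(** With zero mean curvature the principal curvatures are the roots of [k^2 = - K]. *)
Lemma umbilicP (X : M -> 'rV[R]_3) p : mean_curvature X p = 0 -> ~ umbilic X p <-> gauss_curvature X p < 0.
Proof.
move=> H0; have tS : \tr (shape_op (in_chart X (chart_at p)) (cmap (chart_at p) p)) = 0.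
  by move/eqP: H0; rewrite /mean_curvature mulf_eq0 invr_eq0 pnatr_eq0 orbF => /eqP.
have E k : principal_curvature X p k <-> k ^+ 2 = - gauss_curvature X p.
  by rewrite /principal_curvature /gauss_curvature eigenvalue2 //; split=> /eqP.
split=> [nu|K0 um].
  have [k hk k0] : exists2 k, principal_curvature X p k & k != 0.
    by apply: contrapT => h; apply: nu => k hk; have [//|k0] := eqVneq k 0; case: h; exists k.
  by rewrite -oppr_gt0 -(proj1 (E k) hk) exprn_even_gt0.
have K1 : 0 < - gauss_curvature X p by rewrite oppr_gt0.
have /um/eqP := proj2 (E (Num.sqrt (- gauss_curvature X p))) (sqr_sqrtr (ltW K1)).
by rewrite sqrtr_eq0 leNgt K1.
Qed.

End Charts.

(** * Null curves and the entropy differentials *)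

Section CrossAlgebra.
(** The squared triple product of [v, a, b] is their Gram determinant, expanded here along [v]. *)
Lemma gram_normal (K : comPzRingType) (a0 a1 a2 b0 b1 b2 v0 v1 v2 : K) :
  (v0 * (a1 * b2 - a2 * b1) + v1 * (a2 * b0 - a0 * b2) + v2 * (a0 * b1 - a1 * b0)) ^+ 2 =
  (v0 ^+ 2 + v1 ^+ 2 + v2 ^+ 2) * ((a0 * a0 + a1 * a1 + a2 * a2) * (b0 * b0 + b1 * b1 + b2 * b2) - (a0 * b0 + a1 * b1 + a2 * b2) ^+ 2)
  - (v0 * a0 + v1 * a1 + v2 * a2) ^+ 2 * (b0 * b0 + b1 * b1 + b2 * b2)
  - (v0 * b0 + v1 * b1 + v2 * b2) ^+ 2 * (a0 * a0 + a1 * a1 + a2 * a2)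
  + 2%:R * ((v0 * a0 + v1 * a1 + v2 * a2) * (v0 * b0 + v1 * b1 + v2 * b2) * (a0 * b0 + a1 * b1 + a2 * b2)).
Proof. ring. Qed.

(** Orthogonality to [a - i b] means [v.a = i (v.b)], so [(v.a)^2 + (v.b)^2 = 0] and the tangential
    terms of the Gram determinant cancel. *)
Lemma null_normal_sqr (K : comPzRingType) (i l a0 a1 a2 b0 b1 b2 v0 v1 v2 : K) : i * i = - 1 ->
  a0 * a0 + a1 * a1 + a2 * a2 = l -> b0 * b0 + b1 * b1 + b2 * b2 = l -> a0 * b0 + a1 * b1 + a2 * b2 = 0 ->
  v0 * (a0 - i * b0) + v1 * (a1 - i * b1) + v2 * (a2 - i * b2) = 0 ->
  (v0 * (a1 * b2 - a2 * b1) + v1 * (a2 * b0 - a0 * b2) + v2 * (a0 * b1 - a1 * b0)) ^+ 2 =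
  (v0 ^+ 2 + v1 ^+ 2 + v2 ^+ 2) * l ^+ 2.
Proof.
move=> ii aa bb ab vf; rewrite gram_normal aa bb ab.
set va := v0 * a0 + _ + _; set vb := v0 * b0 + _ + _.
have vE : va = i * vb by apply/eqP; rewrite -subr_eq0 -vf /va /vb; apply/eqP; ring.
have -> : va ^+ 2 = - vb ^+ 2 by rewrite vE exprMn [i ^+ 2]ii mulN1r.
ring.
Qed.

Lemma cross_conformal (K : comPzRingType) (l a0 a1 a2 b0 b1 b2 : K) :
  a0 * a0 + a1 * a1 + a2 * a2 = l -> b0 * b0 + b1 * b1 + b2 * b2 = l -> a0 * b0 + a1 * b1 + a2 * b2 = 0 ->
  let n0 := a1 * b2 - a2 * b1 in let n1 := a2 * b0 - a0 * b2 in let n2 := a0 * b1 - a1 * b0 in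
  [/\ n1 * a2 - n2 * a1 = l * b0, n2 * a0 - n0 * a2 = l * b1, n0 * a1 - n1 * a0 = l * b2 &
   [/\ n1 * b2 - n2 * b1 = - (l * a0), n2 * b0 - n0 * b2 = - (l * a1), n0 * b1 - n1 * b0 = - (l * a2) &
   [/\ n0 * a0 + n1 * a1 + n2 * a2 = 0, n0 * b0 + n1 * b1 + n2 * b2 = 0 & n0 ^+ 2 + n1 ^+ 2 + n2 ^+ 2 = l ^+ 2]]].
Proof.
move=> aa bb ab n0 n1 n2.
have A (x y : K) : l * y = (a0 * a0 + a1 * a1 + a2 * a2) * y - (a0 * b0 + a1 * b1 + a2 * b2) * x by rewrite aa ab; ring.
have B (x y : K) : - (l * x) = (a0 * b0 + a1 * b1 + a2 * b2) * y - (b0 * b0 + b1 * b1 + b2 * b2) * x by rewrite bb ab; ring.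
split; rewrite /n0 /n1 /n2; [rewrite (A a0); ring|rewrite (A a1); ring|rewrite (A a2); ring|].
split; [rewrite (B _ b0); ring|rewrite (B _ b1); ring|rewrite (B _ b2); ring|].
split; [ring|ring|].
transitivity (l * l - 0 ^+ 2); last by ring.
by rewrite -{1}aa -bb -ab; ring.
Qed.
End CrossAlgebra.

Section CanonicalImmersion.
Context {R : realType}.
Local Notation V := ('rV[R]_2).
Local Notation Re := complex.Re.
Local Notation Im := complex.Im.
Local Notation iu := (@iunit R).

Definition vdot (f g : 'I_3 -> V -> R[i]) (u : V) : R[i] := \sum_j f j u * g j u.

(* The Weierstrass data of an immersion in a coordinate where sqrt(-K) g is the flat metric |dz|^2. *)
Definition canonical_on (O : set V) (Y : V -> 'rV[R]_3) (P : 'I_3 -> V -> R[i]) : Prop :=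
  [/\ forall j, hol O (P j),
      forall j u, O u -> partial 0 (fun v => Y v 0 j) u = Re (P j u) /\ partial 1 (fun v => Y v 0 j) u = - Im (P j u),
      forall u, O u -> vdot P P u = 0 &
      forall u, O u -> vdot (fun j => dz (P j)) (fun j => dz (P j)) u = 1].

Lemma norm2c_sum_real (v : 'I_3 -> R[i]) (n : 'I_3 -> R) :
  norm2c (\sum_k v k * (n k)%:C) = (\sum_k Re (v k) * n k) ^+ 2 + (\sum_k Im (v k) * n k) ^+ 2.
Proof. by rewrite /norm2c !sum3E !(ReD,ImD,ReM,ImM) /= !mulr0 !subr0 !add0r. Qed.

Variables (O : set V) (oO : open O).

Lemma dz_vdot (f g : 'I_3 -> V -> R[i]) u : (forall j, csmooth O (f j)) -> (forall j, csmooth O (g j)) -> O u ->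
  dz (vdot f g) u = vdot (fun j => dz (f j)) g u + vdot f (fun j => dz (g j)) u.
Proof.
move=> sf sg Ou; have sm j := csmoothM oO (sf j) (sg j).
rewrite (eq_dz oO Ou (g := fun u => f 0 u * g 0 u + f 1 u * g 1 u + f 2 u * g 2 u)); last first.
  by move=> v _; rewrite /vdot sum3E.
rewrite (dzD oO (csmoothD oO (sm 0) (sm 1)) (sm 2) Ou) (dzD oO (sm 0) (sm 1) Ou).
rewrite (dzM oO (sf 0) (sg 0) Ou) (dzM oO (sf 1) (sg 1) Ou) (dzM oO (sf 2) (sg 2) Ou) /vdot !sum3E.
move: (dz (f 0) u) (dz (f 1) u) (dz (f 2) u) (dz (g 0) u) (dz (g 1) u) (dz (g 2) u).
by move: (f 0 u) (f 1 u) (f 2 u) (g 0 u) (g 1 u) (g 2 u) => *; ring.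
Qed.

Lemma vdotC (f g : 'I_3 -> V -> R[i]) u : vdot f g u = vdot g f u.
Proof. by apply: eq_bigr => j _; rewrite mulrC. Qed.

Variables (Y : V -> 'rV[R]_3) (P : 'I_3 -> V -> R[i]).
Hypothesis cY : canonical_on O Y P.
Let P1 j := dz (P j).
Let P2 j := dz (P1 j).

Let hP j : hol O (P j). Proof. by case: cY. Qed.
Let hP1 j : hol O (P1 j). Proof. exact: hol_dz. Qed.

Lemma vdot00 u : O u -> vdot P P u = 0. Proof. by case: cY => _ _ + _; apply. Qed.
Lemma vdot11 u : O u -> vdot P1 P1 u = 1. Proof. by case: cY => _ _ _; apply. Qed.

Let half (c : R[i]) : c + c = 0 -> c = 0.
Proof. by move/eqP; rewrite -mulr2n mulrn_eq0 => /eqP. Qed.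

(** Differentiating [Phi.Phi = 0] and [Phi'.Phi' = 1] fills in the Gram table of [Phi, Phi', Phi''],
    up to the entry [Phi''.Phi'' = 2 s], which is the free function. *)
Lemma vdot01 u : O u -> vdot P P1 u = 0.
Proof.
move=> Ou; apply: half; rewrite {1}vdotC -(dz_vdot (fun j => proj1 (hP j)) (fun j => proj1 (hP j)) Ou).
by rewrite (eq_dz oO Ou vdot00) dz_cst.
Qed.
Lemma vdot12 u : O u -> vdot P1 P2 u = 0.
Proof.
move=> Ou; apply: half; rewrite {1}vdotC -(dz_vdot (fun j => proj1 (hP1 j)) (fun j => proj1 (hP1 j)) Ou).
by rewrite (eq_dz oO Ou vdot11) dz_cst.
Qed.
Lemma vdot02 u : O u -> vdot P P2 u = -1.
Proof.
move=> Ou; apply/eqP; rewrite -addr_eq0 -(vdot11 Ou) addrC.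
rewrite -(dz_vdot (fun j => proj1 (hP j)) (fun j => proj1 (hP1 j)) Ou).
by rewrite (eq_dz oO Ou vdot01) dz_cst.
Qed.

(** The factor [lambda] of the induced metric [lambda |dz|^2]; the curvature turns out to be
    [- lambda^(-2)], so that [sqrt(-K)] cancels it. *)
Definition conf_factor u : R := Re (P 0 u) ^+ 2 + Re (P 1 u) ^+ 2 + Re (P 2 u) ^+ 2.

Let a j u := Re (P j u).
Let b j u := - Im (P j u).
Lemma canonical_split u : O u ->
  [/\ a 0 u * a 0 u + a 1 u * a 1 u + a 2 u * a 2 u = conf_factor u,
      b 0 u * b 0 u + b 1 u * b 1 u + b 2 u * b 2 u = conf_factor u &
      a 0 u * b 0 u + a 1 u * b 1 u + a 2 u * b 2 u = 0].
Proof.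
move=> Ou; have E := vdot00 Ou; rewrite /vdot sum3E in E.
have hr := congr1 (fun x => Re x) E; have hi := congr1 (fun x => Im x) E; rewrite !(ReD, ImD, ReM, ImM) /= in hr hi.
rewrite /a /b /conf_factor !expr2.
move: hr hi; move: (Re (P 0 u)) (Re (P 1 u)) (Re (P 2 u)) (Im (P 0 u)) (Im (P 1 u)) (Im (P 2 u)).
by move=> a0 a1 a2 b0 b1 b2 h1 h2; split; lra.
Qed.

Lemma P_neq0 u : O u -> exists j, P j u != 0.
Proof.
move=> Ou; apply: contrapT => h.
have z j : P j u = 0 by have [//|hj] := eqVneq (P j u) 0; case: h; exists j.
have := vdot02 Ou; rewrite /vdot big1 => [/eqP|j _]; last by rewrite z mul0r.
by rewrite eq_sym oppr_eq0 oner_eq0.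
Qed.

Lemma conf_factor_gt0 u : O u -> 0 < conf_factor u.
Proof.
move=> Ou; have [aa bb _] := canonical_split Ou.
rewrite lt_def !addr_ge0 ?sqr_ge0 // andbT; apply/eqP => l0.
have [j] := P_neq0 Ou; case/eqP; move: aa bb; rewrite l0.
have sq0 (x y z : R) : x * x + y * y + z * z = 0 -> [/\ x = 0, y = 0 & z = 0].
  move/eqP; rewrite -!expr2 !paddr_eq0 ?addr_ge0 ?sqr_ge0 // !sqrf_eq0.
  by move=> /andP[/andP[/eqP -> /eqP ->] /eqP ->].
move=> /sq0[a0 a1 a2] /sq0[b0 b1 b2].
have E k : a k u = 0 -> b k u = 0 -> P k u = 0.
  by move=> ha hb; apply: complexP => //=; apply/eqP; rewrite -oppr_eq0; apply/eqP.
by move: j; apply: ord3P; apply: E.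
Qed.

Let rowE i j u : O u -> jrow Y i u 0 j = if i == 0 then a j u else b j u.
Proof. by case: cY => _ h _ _ Ou; rewrite jrowE; move: i; apply: ord2P; case: (h j u Ou). Qed.

Lemma canonical_first_form u : O u -> first_form Y u = (conf_factor u)%:M.
Proof.
move=> Ou; have [aa bb ab] := canonical_split Ou.
have E i j : first_form Y u i j = \sum_k jrow Y i u 0 k * jrow Y j u 0 k.
  by rewrite mxE; apply: eq_bigr => k _; rewrite !mxE.
apply/matrixP => i j; rewrite E mxE sum3E !rowE //; move: i j; apply: ord2P; apply: ord2P => //=.
- by rewrite !mulr0n -ab; ring.
Qed.

Lemma canonical_normal u : O u -> eucl_norm (normal Y u) = conf_factor u.
Proof.
move=> Ou; have [aa bb ab] := canonical_split Ou.
have [_ _ _ [_ _ _ [_ _ h]]] := cross_conformal aa bb ab.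
by rewrite eucl_normE /normal !crossE !rowE //= h sqrtr_sqr ger0_norm // ltW // conf_factor_gt0.
Qed.

Let nv u := unit_normal Y u.
Lemma canonical_unit_normal u : O u ->
  [/\ conf_factor u * nv u 0 0 = a 1 u * b 2 u - a 2 u * b 1 u,
      conf_factor u * nv u 0 1 = a 2 u * b 0 u - a 0 u * b 2 u &
      conf_factor u * nv u 0 2 = a 0 u * b 1 u - a 1 u * b 0 u].
Proof.
move=> Ou; have l0 := conf_factor_gt0 Ou.
have E k : conf_factor u * nv u 0 k = normal Y u 0 k.
  by rewrite /nv unit_normalE mxE canonical_normal // mulrA mulfV ?mul1r // gt_eqF.
by rewrite !E /normal !crossE !rowE.
Qed.

Let PE j u : P j u = (a j u)%:C - iu * (b j u)%:C.
Proof. by apply: complexP; rewrite !(ReB,ImB,ReM,ImM) iunitC /= /a /b; ring. Qed.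

(* The complex form of N x (A - iB) = i (A - iB). *)
Lemma canonical_rotation u : O u -> let n k := (nv u 0 k)%:C in
  [/\ n 1 * P 2 u - n 2 * P 1 u = iu * P 0 u, n 2 * P 0 u - n 0 * P 2 u = iu * P 1 u,
      n 0 * P 1 u - n 1 * P 0 u = iu * P 2 u, n 0 * P 0 u + n 1 * P 1 u + n 2 * P 2 u = 0 &
      nv u 0 0 ^+ 2 + nv u 0 1 ^+ 2 + nv u 0 2 ^+ 2 = 1].
Proof.
move=> Ou n; have [aa bb ab] := canonical_split Ou; have l0 := conf_factor_gt0 Ou.
have [n0 n1 n2] := canonical_unit_normal Ou.
have := cross_conformal aa bb ab; rewrite /= -n0 -n1 -n2.
move=> [h1 h2 h3 [h4 h5 h6 [h7 h8 h9]]].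
have lu : conf_factor u != 0 by rewrite gt_eqF.
have cl (x y : R) : conf_factor u * x = conf_factor u * y -> x = y by exact: mulfI.
move: h1 h2 h3 h4 h5 h6 h7 h8 h9; rewrite /n !PE.
move: (nv u 0 0) (nv u 0 1) (nv u 0 2) (a 0 u) (a 1 u) (a 2 u) (b 0 u) (b 1 u) (b 2 u) => m0 m1 m2 a0 a1 a2 b0 b1 b2.
move=> h1 h2 h3 h4 h5 h6 h7 h8 h9.
have g1 : m1 * a2 - m2 * a1 = b0 by apply: cl; rewrite -h1; ring.
have g2 : m2 * a0 - m0 * a2 = b1 by apply: cl; rewrite -h2; ring.
have g3 : m0 * a1 - m1 * a0 = b2 by apply: cl; rewrite -h3; ring.
have g4 : m1 * b2 - m2 * b1 = - a0 by apply: cl; rewrite mulrN -h4; ring.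
have g5 : m2 * b0 - m0 * b2 = - a1 by apply: cl; rewrite mulrN -h5; ring.
have g6 : m0 * b1 - m1 * b0 = - a2 by apply: cl; rewrite mulrN -h6; ring.
have g7 : m0 * a0 + m1 * a1 + m2 * a2 = 0 by apply: cl; rewrite mulr0 -h7; ring.
have g8 : m0 * b0 + m1 * b1 + m2 * b2 = 0 by apply: cl; rewrite mulr0 -h8; ring.
split.
- by apply: complexP; rewrite !(ReD,ImD,ReN,ImN,ReM,ImM) iunitC /=; lra.
- by apply: complexP; rewrite !(ReD,ImD,ReN,ImN,ReM,ImM) iunitC /=; lra.
- by apply: complexP; rewrite !(ReD,ImD,ReN,ImN,ReM,ImM) iunitC /=; lra.
- by apply: complexP; rewrite !(ReD,ImD,ReN,ImN,ReM,ImM) iunitC /=; lra.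
- by apply: (mulfI (expf_neq0 2 lu)); rewrite mulr1 -[RHS]h9; ring.
Qed.

Lemma canonical_partial2 j u : O u ->
  [/\ partial 0 (partial 0 (fun v => Y v 0 j)) u = Re (P1 j u),
      partial 0 (partial 1 (fun v => Y v 0 j)) u = - Im (P1 j u),
      partial 1 (partial 0 (fun v => Y v 0 j)) u = - Im (P1 j u) &
      partial 1 (partial 1 (fun v => Y v 0 j)) u = - Re (P1 j u)].
Proof.
case: cY => _ h _ _ Ou.
have dI : differentiable (fun v => Im (P j v)) u by exact: (smooth_differentiable oO (proj2 (proj1 (hP j)))).
have E i := eq_partial i oO Ou (fun v Ov => proj1 (h j v Ov)).
have F i := eq_partial i oO Ou (fun v Ov => proj2 (h j v Ov)).
have I x : Re (iu * x) = - Im x /\ Im (iu * x) = Re x by rewrite ReM ImM iunitC /= !mul0r !mul1r sub0r add0r.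
have c0 := dz_cp0 (hP j) Ou; have c1 := dz_cp1 (hP j) Ou.
have R0 : partial 0 (fun v => Re (P j v)) u = Re (P1 j u) by rewrite -Re_cpartial c0.
have R1 : partial 1 (fun v => Re (P j v)) u = - Im (P1 j u) by rewrite -Re_cpartial c1 (proj1 (I _)).
have I0 : partial 0 (fun v => Im (P j v)) u = Im (P1 j u) by rewrite -Im_cpartial c0.
have I1 : partial 1 (fun v => Im (P j v)) u = Re (P1 j u) by rewrite -Im_cpartial c1 (proj2 (I _)).
split; [exact: etrans (E 0) R0|exact: etrans (F 0) (etrans (partialN 0 dI) (congr1 -%R I0))|exact: etrans (E 1) R1|].
exact: etrans (F 1) (etrans (partialN 1 dI) (congr1 -%R I1)).
Qed.

(** The second fundamental form has entries [L, -m, -m, -L] with [L + i m = Phi'.N]. Since [Phi'] is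
    orthogonal to the null vector [Phi], [null_normal_sqr] gives [(Phi'.N)^2 = Phi'.Phi' = 1], hence
    [L^2 + m^2 = 1]. *)
Lemma canonical_shape_op u : O u -> \tr (shape_op Y u) = 0 /\ \det (shape_op Y u) = - (conf_factor u) ^- 2.
Proof.
move=> Ou; have l0 := conf_factor_gt0 Ou.
have [l lE] : exists l : R, l = conf_factor u by exists (conf_factor u).
rewrite -lE in l0 *.
pose L : R := \sum_k Re (P1 k u) * nv u 0 k; pose m : R := \sum_k Im (P1 k u) * nv u 0 k.
have E00 : second_form Y u 0 0 = L.
  by rewrite mxE; apply: eq_bigr => k _; have [-> _ _ _] := canonical_partial2 k Ou.
have E01 : second_form Y u 0 1 = - m.
  by rewrite mxE -sumrN; apply: eq_bigr => k _; have [_ -> _ _] := canonical_partial2 k Ou; rewrite mulNr.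
have E10 : second_form Y u 1 0 = - m.
  by rewrite mxE -sumrN; apply: eq_bigr => k _; have [_ _ -> _] := canonical_partial2 k Ou; rewrite mulNr.
have E11 : second_form Y u 1 1 = - L.
  by rewrite mxE -sumrN; apply: eq_bigr => k _; have [_ _ _ ->] := canonical_partial2 k Ou; rewrite mulNr.
have Lm : L ^+ 2 + m ^+ 2 = 1.
  have [aa bb ab] := canonical_split Ou; have [n0 n1 n2] := canonical_unit_normal Ou.
  have N1 : norm2c (\sum_k P1 k u * (nv u 0 k)%:C) = L ^+ 2 + m ^+ 2.
    exact: norm2c_sum_real.
  have v01 := vdot01 Ou; have v11 := vdot11 Ou.
  suff S1 : (\sum_k P1 k u * (nv u 0 k)%:C) ^+ 2 = 1.
    have : norm2c (\sum_k P1 k u * (nv u 0 k)%:C) ^+ 2 = 1 ^+ 2.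
      by rewrite expr2 -norm2cM -expr2 S1 /norm2c /= expr0n addr0 !expr1n.
    by rewrite N1 => /eqP; rewrite eqrXn2 ?ler01 ?addr_ge0 ?sqr_ge0 // => /eqP.
  have lC : (l%:C : R[i]) != 0 by apply/eqP => /(congr1 (fun x => Re x)) /= /eqP; rewrite gt_eqF.
  apply: (mulfI (expf_neq0 2 lC)); rewrite mulr1 -exprMn.
  have C (x y : R) : x = y -> (x%:C : R[i]) = y%:C by move->.
  move: (C _ _ aa) (C _ _ bb) (C _ _ ab) (C _ _ n0) (C _ _ n1) (C _ _ n2); rewrite -lE.
  rewrite !rmorphD !rmorphN !rmorphM /= => caa cbb cab cn0 cn1 cn2.
  have := @null_normal_sqr _ iu l%:C _ _ _ _ _ _ (P1 0 u) (P1 1 u) (P1 2 u) iunitE caa cbb cab.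
  rewrite -!PE -cn0 -cn1 -cn2 => H.
  rewrite sum3E; transitivity ((P1 0 u * (l%:C * (nv u 0 0)%:C) + P1 1 u * (l%:C * (nv u 0 1)%:C) + P1 2 u * (l%:C * (nv u 0 2)%:C)) ^+ 2).
    by congr (_ ^+ 2); ring.
  rewrite H; last by rewrite -v01 /vdot sum3E; ring.
  by rewrite -[RHS]mul1r -v11 /vdot sum3E.
have S i j : shape_op Y u i j = second_form Y u i j / l.
  by rewrite /shape_op canonical_first_form // -lE invmx_scalar mul_mx_scalar mxE mulrC.
split; first by rewrite /mxtrace sum2E !S E00 E11; ring.
rewrite det2E !S E00 E11 E01 E10 -[l ^- 2]mul1r -Lm.
have l1 : l != 0 by rewrite gt_eqF.
by move: (L) (m) l1 => x y l1; field.
Qed.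

Lemma canonical_row_free u : O u -> row_free (jacobian Y u).
Proof.
move=> Ou; apply: first_form_row_free; rewrite canonical_first_form // unitmxE det_scalar unitfE expf_neq0 //.
by rewrite gt_eqF // conf_factor_gt0.
Qed.

End CanonicalImmersion.

Section Frame.
Variable K : fieldType.
Implicit Types (f g h v : 'I_3 -> K).
Let dot f g : K := \sum_j f j * g j.

(** The Gram matrix of [f, g, h] is invertible, so these vectors form a frame; the coefficients are
    the products with the dual frame, read off the explicit inverse [C]. *)
Lemma frame_expand f g h v (s : K) : dot f f = 0 -> dot f g = 0 -> dot f h = -1 -> dot g g = 1 -> dot g h = 0 -> dot h h = 2%:R * s ->
  forall j, v j = (- dot v h - 2%:R * s * dot v f) * f j + dot v g * g j - dot v f * h j.
Proof.
move=> ff fg fh gg gh hh.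
have dC a b : dot a b = dot b a by apply: eq_bigr => j _; rewrite mulrC.
pose r (x y z : K) (i : 'I_3) : K := if i == 0 then x else if i == 1 then y else z.
pose F (i : 'I_3) : 'I_3 -> K := if i == 0 then f else if i == 1 then g else h.
pose A : 'M[K]_3 := \matrix_(i, j) F i j.
pose C : 'M[K]_3 := \matrix_(i, j) r (r (- (2%:R * s)) 0 (-1) j) (r 0 1 0 j) (r (-1) 0 0 j) i.
have gf := etrans (dC g f) fg; have hf := etrans (dC h f) fh; have hg := etrans (dC h g) gh.
have AA i j : (A *m A^T) i j = r (r 0 0 (-1) j) (r 0 1 0 j) (r (-1) 0 (2%:R * s) j) i.
  transitivity (dot (F i) (F j)); first by rewrite mxE; apply: eq_bigr => k _; rewrite !mxE.
  by move: i j; apply: ord3P; apply: ord3P; rewrite /r /F /= ?(ff, fg, fh, gg, gh, hh, gf, hf, hg).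
have AC : A *m (A^T *m C) = 1%:M.
  rewrite mulmxA; apply/matrixP => i j; rewrite mxE sum3E !AA !mxE; move: i j.
  by apply: ord3P; apply: ord3P; rewrite /r /=; ring.
have := mulmx1C AC => CA.
pose w : 'rV[K]_3 := \row_j v j.
have wA i : (w *m A^T) 0 i = r (dot v f) (dot v g) (dot v h) i.
  rewrite mxE; move: i; apply: ord3P; rewrite /r /=; by apply: eq_bigr => k _; rewrite !mxE.
have wC i : (w *m A^T *m C) 0 i = r (- dot v h - 2%:R * s * dot v f) (dot v g) (- dot v f) i.
  by rewrite mxE sum3E !wA; move: i; apply: ord3P; rewrite !mxE /r /=; ring.
move=> j; have E : v j = (w *m A^T *m C *m A) 0 j by rewrite -!mulmxA [A^T *m _]mulmxA CA mulmx1 mxE.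
by rewrite [LHS]E mxE sum3E !wC !mxE /r /F /=; ring.
Qed.
End Frame.

Section CanonicalSchwarzian.
Context {R : realType}.
Local Notation V := ('rV[R]_2).
Local Notation Re := complex.Re.
Local Notation iu := (@iunit R).

Lemma dz_conj (O : set V) f w : open O -> hol O f -> O w -> dz (fun u => conjc (f u)) w = 0.
Proof.
move=> oO hf Ow; rewrite dz_def !(cpartial_conj oO (proj1 hf)) // (dz_cp0 hf Ow) (dz_cp1 hf Ow).
have -> : iu * conjc (iu * dz f w) = conjc (dz f w).
  by rewrite rmorphM mulrA (_ : iu * conjc iu = 1) ?mul1r // -norm2cE iunitC /norm2c /= expr0n expr1n add0r.
by rewrite subrr mul0r.
Qed.

Lemma connection_coeffE (h : V -> 'M[R]_2) w (G : 'I_2 -> 'I_2 -> 'I_2 -> R[i]) :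
  (forall k i j, (christoffel h k i j w)%:C = G k i j) ->
  let N k := (G k 0 0 - G k 1 1 - iu * (G k 0 1 + G k 1 0)) / 4%:R in
  connection_coeff h w = N 0 + iu * N 1.
Proof.
move=> GE; have <- : (fun k i j => (christoffel h k i j w)%:C) = G.
  by apply/funext => k; apply/funext => i; apply/funext => j.
have a11 : - (iu / 2%:R) * - (iu / 2%:R) = - 4%:R^-1 :> R[i].
  by rewrite mulrNN mulrACA iunitE; field.
rewrite /= /connection_coeff /nabla_dz_dz !sum2E /= a11.
have E x00 x01 x10 x11 : 2%:R^-1 * 2%:R^-1 * x00 + 2%:R^-1 * - (iu / 2%:R) * x01 + (- (iu / 2%:R) * 2%:R^-1 * x10 + - 4%:R^-1 * x11) =
  (x00 - x11 - iu * (x01 + x10)) / 4%:R :> R[i] by field.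
by rewrite !E.
Qed.

(** The contraction of the Christoffel symbols of a conformal metric, with [x i] half the
    logarithmic derivative of its factor along [i]. *)
Lemma conn_alg (x : 'I_2 -> R[i]) :
  (x 0 *+ (0 == 0 :> 'I_2) + x 0 *+ (0 == 0 :> 'I_2) - x 0 *+ (0 == 0 :> 'I_2)
   - (x 1 *+ (1 == 0 :> 'I_2) + x 1 *+ (1 == 0 :> 'I_2) - x 0 *+ (1 == 1 :> 'I_2))
   - iu * (x 0 *+ (1 == 0 :> 'I_2) + x 1 *+ (0 == 0 :> 'I_2) - x 0 *+ (0 == 1 :> 'I_2)
     + (x 1 *+ (0 == 0 :> 'I_2) + x 0 *+ (1 == 0 :> 'I_2) - x 0 *+ (1 == 0 :> 'I_2)))) / 4%:R
  + iu * ((x 0 *+ (0 == 1 :> 'I_2) + x 0 *+ (0 == 1 :> 'I_2) - x 1 *+ (0 == 0 :> 'I_2)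
   - (x 1 *+ (1 == 1 :> 'I_2) + x 1 *+ (1 == 1 :> 'I_2) - x 1 *+ (1 == 1 :> 'I_2))
   - iu * (x 0 *+ (1 == 1 :> 'I_2) + x 1 *+ (0 == 1 :> 'I_2) - x 1 *+ (0 == 1 :> 'I_2)
     + (x 1 *+ (0 == 1 :> 'I_2) + x 0 *+ (1 == 1 :> 'I_2) - x 1 *+ (1 == 0 :> 'I_2)))) / 4%:R)
  = x 0 - iu * x 1.
Proof.
move: (x 0) (x 1) => a b; rewrite !eqxx -[0 == 1]/false -[1 == 0]/false !mulr1n !mulr0n.
transitivity (a - iu * b - (iu * iu + 1) * a / 2%:R); first by field.
by rewrite iunitE addNr mul0r mul0r subr0.
Qed.

(** The Christoffel symbols of [m |dz|^2] combine to the [z]-derivative of [log m]; for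
    [m = f conj(f)] the conjugate factor is annihilated by [dz], which leaves [f'/f]. *)
Lemma connection_conformal (Q : set V) (h : V -> 'M[R]_2) (f : V -> R[i]) w : open Q -> hol Q f -> Q w -> f w != 0 ->
  (forall u, Q u -> h u = (norm2c (f u))%:M) -> connection_coeff h w = dz f w / f w.
Proof.
move=> oQ hf Qw f0 hE; pose m u := norm2c (f u); have m0 : m w != 0 by rewrite /m norm2c_eq0.
have sm : smooth_on Q m := smooth_norm2c oQ (proj1 hf).
pose D i := partial i m w.
have dh i j l : partial i (fun u => h u j l) w = D i * (j == l)%:R.
  rewrite (eq_partial i oQ Qw (g := fun u => m u * (j == l)%:R)); last by move=> u Qu; rewrite hE // mxE mulr_natr.
  by case: (j == l); rewrite ?mulr0 ?mulr1; [apply: (eq_partial i oQ Qw) => u _; rewrite mulr1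
    |rewrite -(partial_cst 0 i w); apply: (eq_partial i oQ Qw) => u _; rewrite mulr0].
have chr k i j : christoffel h k i j w = (D i * (j == k)%:R + D j * (i == k)%:R - D k * (i == j)%:R) / (2%:R * m w).
  rewrite /christoffel sum2E hE // invmx_scalar !mxE !dh -/(m w).
  rewrite [RHS]mulrC invfM; move: k; apply: ord2P; rewrite /= mulr0n mulr1n mul0r ?addr0 ?add0r mulrA //.
have -> : dz f w / f w = dz (fun u => (m u)%:C) w / (m w)%:C.
  have sfc := csmooth_conj oQ (proj1 hf).
  rewrite (eq_dz (f := fun u => (m u)%:C) oQ Qw (g := fun u => f u * conjc (f u))); last by move=> u _; rewrite /m norm2cE.
  rewrite (dzM oQ (proj1 hf) sfc Qw) (dz_conj oQ hf Qw) mulr0 addr0 /m norm2cE.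
  have c0 : conjc (f w) != 0 by rewrite conjc_eq0.
  by move: (dz f w) (f w) (conjc (f w)) f0 c0 => x y z y0 z0; field; rewrite y0 z0.
pose e i : R[i] := (D i / (2%:R * m w))%:C.
have G k i j : (christoffel h k i j w)%:C = e i *+ (j == k) + e j *+ (i == k) - e k *+ (i == j) :> R[i].
  have distr (a b c y : R) (p q n : bool) : ((a * p%:R + b * q%:R - c * n%:R) / y)%:C =
      (a / y)%:C *+ p + (b / y)%:C *+ q - (c / y)%:C *+ n :> R[i].
    by rewrite mulrBl mulrDl -!(mulrAC _ _^-1) !mulr_natr rmorphB rmorphD !rmorphMn.
  by rewrite chr; exact: distr.
have mC : ((m w)%:C : R[i]) != 0 by apply/eqP => /(congr1 (fun x => Re x)) /= /eqP; rewrite (negPf m0).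
have eE i : e i = (D i)%:C / (2%:R * (m w)%:C).
  by rewrite /e rmorphM fmorphV rmorphM rmorph_nat.
have -> : dz (fun u => (m u)%:C) w / (m w)%:C = e 0 - iu * e 1.
  rewrite dz_def !(cpartial_real m) -/(D 0) -/(D 1) !eE.
  by move: mC (iu) ((D 0)%:C) ((D 1)%:C); move: ((m w)%:C) => y y0 x d0 d1; field; rewrite y0.
by rewrite (connection_coeffE G); exact: conn_alg.
Qed.

End CanonicalSchwarzian.

(** * The Schwarzian derivative of the Gauss map *)

Section Schwarzian.
Context {R : realType}.
Local Notation V := ('rV[R]_2).
Local Notation Re := complex.Re.
Local Notation iu := (@iunit R).
Implicit Types (f g : V -> R[i]) (w : V).

Lemma open_neq0 (O : set V) f : open O -> csmooth O f -> open (O `&` [set u | f u != 0]).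
Proof.
move=> oO sf; rewrite openE => w [Ow /= fw].
have n1 : nbhs w O by exact: open_nbhs_nbhs.
have c := smooth_continuous (smooth_norm2c oO sf) Ow.
have n2 : nbhs w [set u | 0 < norm2c (f u)].
  apply: (c [set x : R | 0 < x]); apply: open_nbhs_nbhs; split; first exact: open_gt.
  by rewrite /= norm2c_gt0.
have sub : O `&` [set u | 0 < norm2c (f u)] `<=` O `&` [set u | f u != 0].
  by move=> u [Ou /=]; rewrite norm2c_gt0.
exact: (filterS sub (filterI n1 n2)).
Qed.

Lemma hol_exp (O : set V) f n : open O -> hol O f -> hol O (fun u => f u ^+ n).
Proof.
move=> oO hf; elim: n => [|n IH]; first by apply: (hol_eq oO _ (hol_cst oO 1)) => u _; rewrite expr0.
by apply: (hol_eq oO _ (holM oO hf IH)) => u _; rewrite exprS.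
Qed.

Lemma dz_exp (O : set V) f n w : open O -> hol O f -> O w -> dz (fun u => f u ^+ n.+1) w = n.+1%:R * f w ^+ n * dz f w.
Proof.
move=> oO hf Ow; elim: n => [|n IH].
  by rewrite (eq_dz oO Ow (g := f)) ?expr0 ?mul1r // => u _; rewrite expr1.
rewrite (eq_dz oO Ow (g := fun u => f u * f u ^+ n.+1)); last by move=> u _; rewrite exprS.
rewrite (dzM oO (proj1 hf) (proj1 (hol_exp n.+1 oO hf)) Ow) IH -[n.+2%:R]natr1 exprS.
by move: (n.+1%:R : R[i]) (f w ^+ n) (f w) (dz f w) => m x y z; ring.
Qed.

(** With [q = f''/f'] the Schwarzian is [q' - q^2/2], which spares third derivatives of the Gauss
    map once its logarithmic derivative is known. *)
Lemma schwarzian_fin_log (O : set V) f q w : open O -> hol O f -> hol O q -> (forall u, O u -> dz f u != 0) ->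
  (forall u, O u -> dz (dz f) u = q u * dz f u) -> O w -> schwarzian_fin f w = dz q w - q w ^+ 2 / 2%:R.
Proof.
move=> oO hf hq f0 E Ow; have hf1 := hol_dz oO hf.
rewrite /schwarzian_fin (eq_dz oO Ow E) (dzM oO (proj1 hq) (proj1 hf1) Ow) (E w Ow).
have := f0 w Ow; move: (dz f w) (q w) (dz q w) => x y z x0; field; by rewrite x0.
Qed.

Definition stereo_of (N : 'rV[R]_3) : option R[i] :=
  if N 0 2 == 1 then None else Some (((N 0 0)%:C + iu * (N 0 1)%:C) / (1 - N 0 2)%:C).

Section Canonical.
Variables (O Q : set V) (oO : open O) (oQ : open Q).
Variables (Y : V -> 'rV[R]_3) (P : 'I_3 -> V -> R[i]).
Hypothesis cY : canonical_on O Y P.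
Variables (T : V -> V).
Hypotheses (QT : forall u, Q u -> O (T u)) (sT : smooth_map_on Q T).
Let t u := zc (T u).
Hypotheses (ht : hol Q t) (t0 : forall u, Q u -> dz t u != 0).

Let hP j : hol O (P j). Proof. by case: cY. Qed.
Definition potential u : R[i] := vdot (fun j => dz (dz (P j))) (fun j => dz (dz (P j))) u / 2%:R.

Lemma hol_vdot (a b : 'I_3 -> V -> R[i]) : (forall j, hol O (a j)) -> (forall j, hol O (b j)) -> hol O (vdot a b).
Proof.
move=> hf hg; apply: (hol_eq oO (f := fun u => a 0 u * b 0 u + a 1 u * b 1 u + a 2 u * b 2 u)).
  by move=> u _; rewrite /vdot sum3E.
exact: (holD oO (holD oO (holM oO (hf 0) (hg 0)) (holM oO (hf 1) (hg 1))) (holM oO (hf 2) (hg 2))).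
Qed.

Lemma hol_potential : hol O potential.
Proof.
have h j : hol O (dz (dz (P j))) by do 2 apply: hol_dz => //.
by apply: (hol_eq oO _ (holZ oO 2%:R^-1 (hol_vdot h h))) => u _; rewrite mulrC.
Qed.

(** The connection coefficient of the flat metric [|t'|^2 |dz|^2], by [connection_conformal]. *)
Let ga u := dz (dz t) u / dz t u.
Let hga : hol Q ga. Proof. exact: (hol_div oQ t0 (hol_dz oQ (hol_dz oQ ht)) (hol_dz oQ ht)). Qed.

Section Isotropic.
Variables (c nu : R[i]).
Hypotheses (cc : c * c = -1) (nn : nu * nu = 1).
Let al k u := dzn k (P 0) u + c * dzn k (P 1) u.

Let hal k : hol O (al k).
Proof. by apply: holD => //; [exact: hol_dzn|apply: holZ => //; exact: hol_dzn]. Qed.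
Let dal k u : O u -> dz (al k) u = al k.+1 u.
Proof.
move=> Ou; have h j : hol O (dzn k (P j)) by exact: hol_dzn.
by rewrite (dzD oO (proj1 (h 0)) (proj1 (holZ oO c (h 1))) Ou) (dzZ oO (proj1 (h 1)) Ou) -!dznS.
Qed.

Lemma isotropic_potential u : O u -> al 1 u ^+ 2 - 2%:R * (al 0 u * al 2 u) = 2%:R * potential u * al 0 u ^+ 2.
Proof.
move=> Ou; pose a (j : 'I_3) : R[i] := if j == 0 then 1 else if j == 1 then c else 0.
have hh : vdot (fun j => dz (dz (P j))) (fun j => dz (dz (P j))) u = 2%:R * potential u.
  by rewrite /potential mulrCA mulfV ?mulr1 // pnatr_eq0.
have := frame_expand a (vdot00 cY Ou) (vdot01 oO cY Ou) (vdot02 oO cY Ou) (vdot11 cY Ou) (vdot12 oO cY Ou) hh.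
have E k : \sum_j a j * dzn k (P j) u = al k u by rewrite sum3E /a /= mul1r mul0r addr0.
rewrite -/(dzn 1 (P _)) (E 0%N) (E 1%N) (E 2%N) => H.
have : \sum_j a j * a j = 0 by rewrite sum3E /a /= mul1r mul0r addr0 cc addrN.
have -> : \sum_j a j * a j = (- al 2 u - 2%:R * potential u * al 0 u) * al 0 u + al 1 u * al 1 u - al 0 u * al 2 u.
  transitivity (\sum_j ((- al 2 u - 2%:R * potential u * al 0 u) * (a j * P j u) + al 1 u * (a j * dz (P j) u) - al 0 u * (a j * dz (dz (P j)) u))).
    apply: eq_bigr => j _; rewrite {2}(H j).
    by move: (al 0 u) (al 1 u) (al 2 u) (potential u) (a j) (P j u) (dz (P j) u) (dz (dz (P j)) u) => *; ring.
  by rewrite sumrB big_split /= -!mulr_sumr (E 0%N) (E 1%N) (E 2%N).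
move: (al 0 u) (al 1 u) (al 2 u) (potential u) => x y z s H0.
by apply/eqP; rewrite -subr_eq0 -H0; apply/eqP; ring.
Qed.

(** The quotient [Phi_3 / al] has derivative plus or minus [1 / al]. Squaring leaves the sign
    undetermined, which is harmless because only the logarithmic derivative enters later. *)
Lemma isotropic_wronskian u : O u -> (dz (P 2) u * al 0 u - P 2 u * al 1 u) ^+ 2 = al 0 u ^+ 2.
Proof.
move=> Ou; have := vdot00 cY Ou; have := vdot01 oO cY Ou; have := vdot11 cY Ou.
rewrite /vdot !sum3E /al /dzn /=.
move: (P 0 u) (P 1 u) (P 2 u) (dz (P 0) u) (dz (P 1) u) (dz (P 2) u) => x y z x' y' z' h1 h2 h3.
have C : (c * c + 1) = 0 by rewrite cc addNr.
transitivity ((x + c * y) ^+ 2 * (x' * x' + y' * y' + z' * z')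
  + (x' + c * y') ^+ 2 * (x * x + y * y + z * z) - 2%:R * ((x + c * y) * (x' + c * y') * (x * x' + y * y' + z * z'))
  - (c * c + 1) * (x * y' - x' * y) ^+ 2); first by ring.
by rewrite h1 h2 h3 C; ring.
Qed.

Variables (Q' : set V) (F : V -> R[i]).
Hypotheses (oQ' : open Q') (Q'Q : Q' `<=` Q) (al0 : forall u, Q' u -> al 0 (T u) != 0)
  (FE : forall u, Q' u -> F u = nu * (P 2 (T u) / al 0 (T u))).

Let Q'T u : Q' u -> O (T u). Proof. by move=> /Q'Q; exact: QT. Qed.
Let sT' : smooth_map_on Q' T. Proof. by move=> j; apply: smooth_subset Q'Q (sT j). Qed.
Let ht' : hol Q' t. Proof. exact: hol_subset Q'Q ht. Qed.

(** From [(F' A)^2 = t'^2] one gets [F''/F' = t''/t' - A'/A] without choosing a sign. In the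
    Schwarzian the derivatives of [A] then occur only in the combination that [isotropic_potential]
    identifies with [s]. *)
Lemma schwarzian_isotropic w : Q' w ->
  schwarzian_fin F w = potential (T w) * dz t w ^+ 2 + dz ga w - ga w ^+ 2 / 2%:R.
Proof.
move=> Qw.
pose A u := al 0 (T u); pose X u := P 2 (T u).
have hA k : hol Q' (fun u => al k (T u)) := hol_comp oQ' oO (hal k) Q'T sT' ht'.
have hX : hol Q' X := hol_comp oQ' oO (hP 2) Q'T sT' ht'.
have dA k u : Q' u -> dz (fun u => al k (T u)) u = al k.+1 (T u) * dz t u.
  by move=> Qu; rewrite (dz_comp oQ' oO (hal k) Q'T sT' Qu) dal //; exact: Q'T.
have dX u : Q' u -> dz X u = dz (P 2) (T u) * dz t u.
  by move=> Qu; rewrite (dz_comp oQ' oO (hP 2) Q'T sT' Qu).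
have hXA : hol Q' (fun u => X u / A u) := hol_div oQ' al0 hX (hA 0%N).
have hF : hol Q' F by apply: (hol_eq oQ' _ (holZ oQ' nu hXA)) => u Qu; rewrite FE.
have dF u : Q' u -> dz F u = nu * ((dz (P 2) (T u) * al 0 (T u) - P 2 (T u) * al 1 (T u)) * dz t u / A u ^+ 2).
  move=> Qu; rewrite (eq_dz oQ' Qu FE) (dzZ oQ' (proj1 hXA) Qu nu) (dz_div oQ' (proj1 hX) (proj1 (hA 0%N)) al0 Qu) dX // (dA 0%N) //.
  by congr (_ * (_ / _)); rewrite /A /X; ring.
have tn u : Q' u -> dz t u != 0 by move=> /Q'Q; exact: t0.
have An u : Q' u -> A u != 0 := @al0 u.
have sq u : Q' u -> (dz F u * A u) ^+ 2 = dz t u ^+ 2.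
  move=> Qu; rewrite dF // !exprMn [nu ^+ 2]nn mul1r isotropic_wronskian; last exact: Q'T.
  have := An u Qu; rewrite -/(A u); move: (A u) (dz t u) => x y x0; field; by rewrite x0.
have Fn u : Q' u -> dz F u != 0.
  by move=> Qu; apply/eqP => F0; have /eqP := sq u Qu; rewrite F0 mul0r expr0n /= eq_sym expf_eq0 /= (negPf (tn u Qu)).
have hF1 := hol_dz oQ' hF; have ht1 := hol_dz oQ' ht'; have hA1 := hol_dz oQ' (hA 0%N).
pose G u := dz F u * A u; have hG : hol Q' G := holM oQ' hF1 (hA 0%N).
pose q u := ga u - dz A u / A u.
have hga' : hol Q' ga := hol_subset Q'Q hga.
have hdA : hol Q' (fun u => dz A u / A u) := hol_div oQ' al0 hA1 (hA 0%N).
have hq : hol Q' q := holB oQ' hga' hdA.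
have F2 u : Q' u -> dz (dz F) u = q u * dz F u.
  move=> Qu.
  have E : 2%:R * (dz F u * A u) * (dz (dz F) u * A u + dz F u * dz A u) = 2%:R * dz t u * dz (dz t) u.
    have := eq_dz oQ' Qu sq; rewrite (dz_exp 1 oQ' hG Qu) (dz_exp 1 oQ' ht1 Qu) !expr1.
    by rewrite (dzM oQ' (proj1 hF1) (proj1 (hA 0%N)) Qu) => E; exact: E.
  have := sq u Qu; rewrite /q /ga; move: (tn u Qu) (An u Qu) (Fn u Qu) E; rewrite /G.
  move: (dz t u) (dz (dz t) u) (A u) (dz A u) (dz F u) (dz (dz F) u) => t1 t2 a a1 f1 f2 t1n an fn E S.
  have f1a : f1 * a != 0 by rewrite mulf_neq0.
  have two : 2%:R * (f1 * a) != 0 :> R[i] by rewrite mulf_neq0 // pnatr_eq0.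
  have E2 : f2 * a + f1 * a1 = t2 * (f1 * a) / t1.
    apply: (mulfI two); rewrite E.
    transitivity (2%:R * t2 * t1 ^+ 2 / t1); first by field.
    by rewrite -S; field.
  apply: (mulIf an); apply: (addIr (f1 * a1)); rewrite E2; field; by rewrite t1n an.
rewrite (schwarzian_fin_log oQ' hF hq Fn F2 Qw) /q.
rewrite (dzB oQ' (proj1 hga') (proj1 hdA) Qw) (dz_div oQ' (proj1 hA1) (proj1 (hA 0%N)) al0 Qw).
have E1 u : Q' u -> dz A u = al 1 (T u) * dz t u by exact: (dA 0%N).
rewrite (eq_dz oQ' Qw E1) (dzM oQ' (proj1 (hA 1%N)) (proj1 ht1) Qw) (dA 1%N) // E1 //.
have := isotropic_potential (Q'T Qw); have := An w Qw; rewrite -/(A w).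
have gE : dz (dz t) w = ga w * dz t w by rewrite /ga mulfVK // tn.
rewrite gE; move: (A w) (al 1 (T w)) (al 2 (T w)) (potential (T w)) (dz t w) (ga w) (dz ga w) => x x1 x2 s t1 g g1 x0 H.
have -> : s = (x1 ^+ 2 - 2%:R * (x * x2)) / (2%:R * x ^+ 2) by rewrite H; field; rewrite x0.
by field; rewrite x0.
Qed.
End Isotropic.

Variable f : V -> option R[i].
Hypothesis fE : forall u, Q u -> f u = stereo_of (unit_normal Y (T u)).

(** Weierstrass' formula: [G = Phi_3 / (Phi_1 - i Phi_2)] off the north pole, where the denominator
    is nonzero, and [1/G = - Phi_3 / (Phi_1 + i Phi_2)] near the pole, because the two denominators
    have product [- Phi_3^2] and do not vanish together. Both are instances of
    [schwarzian_isotropic], with [(c, nu)] equal to [(-i, 1)] and [(i, -1)]. *)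
Lemma schwarzian_stereo w : Q w -> schwarzian f w = potential (T w) * dz t w ^+ 2 + dz ga w - ga w ^+ 2 / 2%:R.
Proof.
move=> Qw; pose N u k := unit_normal Y (T u) 0 k.
pose al u := P 0 (T u) + - iu * P 1 (T u); pose be u := P 0 (T u) + iu * P 1 (T u); pose x u := P 2 (T u).
have abx u : Q u -> al u * be u = - x u ^+ 2.
  move=> Qu; have := vdot00 cY (QT Qu); rewrite /vdot sum3E /al /be /x => E.
  move: E; move: (P 0 (T u)) (P 1 (T u)) (P 2 (T u)) => p0 p1 p2 E.
  transitivity (p0 * p0 - iu * iu * (p1 * p1)); first by ring.
  rewrite iunitE; transitivity (p0 * p0 + p1 * p1 + p2 * p2 - p2 ^+ 2); first by ring.
  by rewrite E sub0r.
have rot u (Qu : Q u) := canonical_rotation oO cY (QT Qu).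
have C1 (y : R) : ((1 - y)%:C : R[i]) = 1 - y%:C by rewrite rmorphB rmorph1.
have E1 u : Q u -> ((N u 0)%:C + iu * (N u 1)%:C) * al u = (1 - N u 2)%:C * x u.
  move=> /rot[_ _ h3 h4 _]; rewrite C1 mulrBl mul1r /al /x /N.
  move: h3 h4; move: ((unit_normal Y (T u) 0 0)%:C) ((unit_normal Y (T u) 0 1)%:C) ((unit_normal Y (T u) 0 2)%:C) => n0 n1 n2.
  move: (P 0 (T u)) (P 1 (T u)) (P 2 (T u)) => p0 p1 p2 h3 h4.
  transitivity (n0 * p0 + n1 * p1 + n2 * p2 - n2 * p2 - iu * (n0 * p1 - n1 * p0) - (iu * iu + 1) * (n1 * p1)); first by ring.
  rewrite h4 h3; transitivity (- n2 * p2 - iu * iu * p2 - (iu * iu + 1) * (n1 * p1)); first by ring.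
  by rewrite iunitE; ring.
have E2 u : Q u -> ((N u 0)%:C + iu * (N u 1)%:C) * x u = - ((1 - N u 2)%:C * be u).
  move=> /rot[h1 h2 _ _ _]; rewrite C1 mulrBl mul1r /be /x /N.
  move: h1 h2; move: ((unit_normal Y (T u) 0 0)%:C) ((unit_normal Y (T u) 0 1)%:C) ((unit_normal Y (T u) 0 2)%:C) => n0 n1 n2.
  move: (P 0 (T u)) (P 1 (T u)) (P 2 (T u)) => p0 p1 p2 h1 h2.
  transitivity (iu * (n1 * p2 - n2 * p1) - (n2 * p0 - n0 * p2) + n2 * (p0 + iu * p1)); first by ring.
  rewrite h1 h2; transitivity ((iu * iu) * p0 - iu * p1 + n2 * (p0 + iu * p1)); first by ring.
  by rewrite iunitE; ring.
have al_be u : Q u -> al u = 0 -> be u != 0.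
  move=> Qu a0; apply/eqP => b0; have x0 : x u = 0.
    by apply/eqP; rewrite -sqrf_eq0 -oppr_eq0 -abx // a0 mul0r.
  have p0 : P 0 (T u) = 0.
    apply: (mulfI (_ : 2%:R != 0)); first by rewrite pnatr_eq0.
    by rewrite mulr0 -[RHS](addr0 0) -{1}a0 -b0 /al /be; ring.
  have p1 : P 1 (T u) = 0.
    have i0 : iu != 0 by rewrite -sqrf_eq0 [iu ^+ 2]iunitE oppr_eq0 oner_eq0.
    by apply: (mulfI i0); rewrite mulr0 -b0 /be p0 add0r.
  have [j] := P_neq0 oO cY (QT Qu); case/eqP; move: j; apply: ord3P => //.
have N2 u : Q u -> N u 2 = 1 <-> al u = 0.
  move=> Qu; split=> [n2|a0].
    have [h1 _ _ _ hn] := rot u Qu.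
    have n01 : N u 0 ^+ 2 + N u 1 ^+ 2 = 0.
      by move: hn; rewrite -/(N u 0) -/(N u 1) -/(N u 2) n2 expr1n => /eqP; rewrite -subr_eq0 addrK => /eqP.
    move/eqP: n01; rewrite paddr_eq0 ?sqr_ge0 // !sqrf_eq0 => /andP[/eqP n0 /eqP n1].
    move: h1; rewrite -/(N u 1) -/(N u 2) n1 n2 rmorph0 rmorph1 mul0r mul1r sub0r /al => h1.
    have -> : P 1 (T u) = - (iu * P 0 (T u)) by rewrite -h1 opprK.
    by rewrite mulrNN mulrA iunitE mulN1r addrN.
  have := E2 u Qu; have x0 : x u = 0 by apply/eqP; rewrite -sqrf_eq0 -oppr_eq0 -abx // a0 mul0r.
  rewrite x0 mulr0 => /eqP; rewrite eq_sym oppr_eq0 mulf_eq0 (negPf (al_be u Qu a0)) orbF => /eqP.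
  by move=> /(congr1 (fun x => Re x)) /= /eqP; rewrite subr_eq0 => /eqP.
have hc j : csmooth Q (fun u => P j (T u)) := csmooth_comp oQ oO (proj1 (hP j)) QT sT.
have sal : csmooth Q al := csmoothD oQ (hc 0) (csmoothM oQ (csmooth_cst oQ (- iu)) (hc 1)).
have sbe : csmooth Q be := csmoothD oQ (hc 0) (csmoothM oQ (csmooth_cst oQ iu) (hc 1)).
have N2C u : N u 2 != 1 -> ((1 - N u 2)%:C : R[i]) != 0.
  by move=> n2; apply/eqP => /(congr1 (fun x => Re x)) /= /eqP; rewrite subr_eq0 eq_sym (negPf n2).
have quot u : Q u -> N u 2 != 1 -> ((N u 0)%:C + iu * (N u 1)%:C) / (1 - N u 2)%:C = x u / al u.
  move=> Qu n2; have a0 : al u != 0 by apply/eqP => /(proj2 (N2 u Qu)) /eqP; rewrite (negPf n2).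
  by apply/eqP; rewrite eqr_div // ?N2C // E1 // mulrC.
have iN : - iu * - iu = -1 by rewrite mulrNN iunitE.
rewrite /schwarzian fE // /stereo_of -/(N w 2); have [n2|n2] := eqVneq (N w 2) 1.
  have ow := open_neq0 oQ sbe.
  apply: (@schwarzian_isotropic iu (-1) iunitE _ (Q `&` [set u | be u != 0])) => //; first by rewrite mulrNN mulr1.
  - by move=> u [].
  - move=> u [Qu /= b0]; rewrite fE // /stereo_of -/(N u 2) -/(N u 0) -/(N u 1) mulN1r -/(x u) -/(be u).
    case: eqP => [n2u|/eqP n2u].
      have x0 : x u = 0 by apply/eqP; rewrite -sqrf_eq0 -oppr_eq0 -abx // (proj1 (N2 u Qu)) // mul0r.
      by rewrite x0 mul0r oppr0.
    rewrite /recip quot //; have a0 : al u != 0 by apply/eqP => /(proj2 (N2 u Qu)) /eqP; rewrite (negPf n2u).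
    case: eqP => [/eqP|/eqP].
      by rewrite mulf_eq0 invr_eq0 (negPf a0) orbF => /eqP ->; rewrite mul0r oppr0.
    rewrite mulf_eq0 invr_eq0 (negPf a0) orbF => x0 /=; rewrite invf_div.
    apply/eqP; rewrite -mulNr eqr_div // abx // mulNr expr2 //.
  - by split=> //=; apply: al_be => //; exact/N2.
have ow := open_neq0 oQ sal.
apply: (@schwarzian_isotropic (- iu) 1 iN _ (Q `&` [set u | al u != 0])) => //; first by rewrite mulr1.
- by move=> u [].
- move=> u [Qu /= a0]; have n2u : N u 2 != 1 by apply/eqP => /(proj1 (N2 u Qu)) /eqP; rewrite (negPf a0).
  by rewrite fE // /stereo_of -/(N u 2) -/(N u 0) -/(N u 1) (negPf n2u) mul1r /= quot.
- by split=> //=; apply/eqP => /(proj2 (N2 w Qw)) /eqP; rewrite (negPf n2).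
Qed.

(** The term [ga' - ga^2/2] of the Schwarzian is cancelled by the connection terms of order two, and
    at each further step [(k+2) ga] cancels the derivative of [t'^(k+2)]: covariant differentiation
    is plain differentiation in the canonical coordinate. *)
Lemma schwarz_diffE (gam : V -> R[i]) k w : (forall u, Q u -> gam u = ga u) -> Q w ->
  schwarz_diff gam f k w = dzn k potential (T w) * dz t w ^+ k.+2.
Proof.
move=> gE; elim: k w => [|k IH] w Qw.
  by rewrite /= schwarzian_stereo // gE // (eq_dz oQ Qw gE); ring.
rewrite /= -/(dzn k potential) (eq_dz oQ Qw IH) gE // IH //.
have hs : hol O (dzn k potential) := hol_dzn k oO hol_potential.
have ht1 := hol_dz oQ ht.
have hsT := hol_comp oQ oO hs QT sT ht.
rewrite (dzM oQ (proj1 hsT) (proj1 (hol_exp k.+2 oQ ht1)) Qw) (dz_comp oQ oO hs QT sT Qw) (dz_exp _ oQ ht1 Qw).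
rewrite -/t -/(dzn k.+1 potential) /ga; have := t0 Qw.
rewrite [dz t w ^+ k.+3]exprS [dz t w ^+ k.+2]exprS.
move: (dz t w) (dz (dz t) w) (dzn k potential (T w)) (dz (dzn k potential) (T w)) (k.+2%:R) => t1 t2 s s1 m t1n.
by move: (t1 ^+ k.+1) => y; field.
Qed.
End Canonical.
End Schwarzian.

Section ConformalMaps.
Context {R : realType}.
Local Notation V := ('rV[R]_2).

(** Lagrange's identity makes the squared determinant equal to the fourth power of the length of a
    row; the sign fixes the root, and then [(r + q)^2 + (m - p)^2 = 0]. *)
Lemma conformal_entries (p q r m : R) : p * r + q * m = 0 -> p * p + q * q = r * r + m * m -> 0 < p * m - q * r ->
  r = - q /\ m = p.
Proof.
move=> h1 h2 D0.
have E : (p * m - q * r) ^+ 2 = (p * p + q * q) ^+ 2.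
  transitivity ((p * p + q * q) * (r * r + m * m) - (p * r + q * m) ^+ 2); first by ring.
  by rewrite h1 -h2; ring.
have {}E : p * m - q * r = p * p + q * q.
  apply/eqP; rewrite -(eqrXn2 (n := 2)) ?E ?eqxx ?(ltW D0) //.
  by rewrite addr_ge0 // -expr2 sqr_ge0.
have : (r + q) ^+ 2 + (m - p) ^+ 2 = 0.
  transitivity ((r * r + m * m) - (p * p + q * q) + 2%:R * ((p * p + q * q) - (p * m - q * r))); first by ring.
  by rewrite E -h2 !subrr mulr0 addr0.
move/eqP; rewrite paddr_eq0 ?sqr_ge0 // !sqrf_eq0 addr_eq0 subr_eq0.
by move=> /andP[/eqP -> /eqP ->].
Qed.

Lemma conformal_matrix (J : 'M[R]_2) : 0 < \det J -> is_scalar_mx (J *m J^T) ->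
  [/\ J 1 0 = - J 0 1, J 1 1 = J 0 0 & 0 < J 0 0 ^+ 2 + J 0 1 ^+ 2].
Proof.
rewrite det2E => d0 /is_scalar_mxP[a JJ].
have JE i j : J i 0 * J j 0 + J i 1 * J j 1 = (a%:M : 'M[R]_2) i j by rewrite -JJ mxE sum2E !mxE.
have := JE 0 0; have := JE 1 1; have := JE 0 1; rewrite !mxE /= mulr0n mulr1n => h01 h11 h00.
have [e1 e2] := conformal_entries h01 (etrans h00 (esym h11)) d0.
by split=> //; move: d0; rewrite e1 e2 mulrN opprK -!expr2.
Qed.

Lemma conformal_hol (Q : set V) (T : V -> V) : open Q -> smooth_map_on Q T ->
  (forall w, Q w -> 0 < \det (jacobian T w)) ->
  (forall w, Q w -> is_scalar_mx (jacobian T w *m (jacobian T w)^T)) ->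
  [/\ hol Q (fun u => zc (T u)), forall w, Q w -> dz (fun u => zc (T u)) w != 0 &
      forall w, Q w -> jacobian T w *m (jacobian T w)^T = (norm2c (dz (fun u => zc (T u)) w))%:M].
Proof.
move=> oQ sT dT cT; pose t u := zc (T u).
have st : csmooth Q t := csmooth_zc sT.
have E w : Q w -> let J := jacobian T w in [/\ J 1 0 = - J 0 1, J 1 1 = J 0 0 & 0 < J 0 0 ^+ 2 + J 0 1 ^+ 2].
  by move=> Qw; exact: (conformal_matrix (dT w Qw) (cT w Qw)).
have cp i w : cpartial i t w = jacobian T w i 0 +i* jacobian T w i 1 by rewrite cpartial_zc !jacobianE.
have ht : hol Q t.
  split=> // w Qw; have [e1 e2 _] := E w Qw; rewrite !cp e1 e2.
  by apply: complexP; rewrite !(ReM,ImM) iunitC /=; ring.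
have dt w : Q w -> dz t w = jacobian T w 0 0 +i* jacobian T w 0 1 by move=> Qw; rewrite -(dz_cp0 ht Qw) cp.
split=> // w Qw; have [e1 e2 e3] := E w Qw.
  by rewrite -norm2c_gt0 -/t dt.
rewrite -/t dt //; apply/matrixP => i j.
have F i' j' : (jacobian T w)^T i' j' = jacobian T w j' i' by rewrite [LHS]mxE.
rewrite [LHS]mxE sum2E !F [RHS]mxE /norm2c /=.
move: e1 e2; move: (jacobian T w) => J e1 e2.
by move: i j; apply: ord2P; apply: ord2P; rewrite /= ?e1 ?e2 ?mulr1n ?mulr0n; ring.
Qed.
End ConformalMaps.

(** * The degree of an immersion with polynomial potential *)

Section CanonicalChart.
Context {R : realType} {M : oriented_surface R}.
Local Notation V := ('rV[R]_2).
Local Notation Re := complex.Re.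
Variables (d e : chart R M).
Hypotheses (de : cdom e `<=` cdom d) (ad : atlas d) (tde : oriented_transition d e) (ted : oriented_transition e d).

Lemma transition_to (c : chart R M) : oriented_transition c d -> oriented_transition c e.
Proof. by move=> tcd; apply: oriented_transition_trans tcd tde => q _; exact: de. Qed.

Lemma subchart_admissible : admissible e.
Proof.
move=> c ac; split; last exact: transition_to (atlas_compat ac ad).
by apply: oriented_transition_trans ted (atlas_compat ad ac) => q + _; exact: de.
Qed.

Let te c : atlas c -> oriented_transition c e.
Proof. by move=> ac; apply: transition_to; exact: atlas_compat. Qed.

Variables (X : M -> 'rV[R]_3) (P : 'I_3 -> V -> R[i]).
Let O := ccod e.
Let Y := in_chart X e.
Let U := cdom e.
Hypotheses (sY : smooth_map_on O Y) (cY : canonical_on O Y P).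
Let oO : open O. Proof. exact: ccod_open. Qed.
Let oU : open U. Proof. exact: cdom_open. Qed.

Lemma canonical_immersed : immersed_in U X e.
Proof.
split=> [j|w [Ow _]]; first by apply: smooth_subset (sY j) => w [].
exact: (canonical_row_free oO cY).
Qed.

Lemma canonical_minimal : minimal_immersion U X.
Proof.
split=> [c ac|p Up]; first by apply: (immersed_in_change oU (te ac) canonical_immersed) => q _.
rewrite (mean_curvatureE oU te canonical_immersed Up Up).
by have [-> _] := canonical_shape_op oO cY (cmap_cod Up); rewrite mul0r.
Qed.

Lemma canonical_gauss_curvature p : U p -> gauss_curvature X p = - (conf_factor P (cmap e p)) ^- 2.
Proof.
move=> Up; rewrite (gauss_curvatureE oU te canonical_immersed Up Up).
by have [_ ->] := canonical_shape_op oO cY (cmap_cod Up).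
Qed.

Lemma canonical_gauss_lt0 p : U p -> gauss_curvature X p < 0.
Proof.
move=> Up; rewrite canonical_gauss_curvature // oppr_lt0 invr_gt0 exprn_gt0 //.
exact: (conf_factor_gt0 oO cY (cmap_cod Up)).
Qed.

Lemma canonical_non_umbilic : non_umbilic_locus U X = U.
Proof.
apply/seteqP; split=> [p []//|p Up]; split=> //.
by apply/(umbilicP (proj2 canonical_minimal p Up)); exact: canonical_gauss_lt0.
Qed.

Section Coordinate.
Variable c : chart R M.
Hypothesis hc : holomorphic_coordinate U X c.
Let Q := ccod c.
Let T := transition c e.

Let tce : oriented_transition c e.
Proof. by case: hc => ac _ _; apply: transition_to; case: (ac d ad). Qed.
Let cU w : Q w -> U (cinv c w).
Proof. by case: hc => _ sub _ Qw; apply: sub; exact: cinv_dom. Qed.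
Let QO w : Q w -> chart_part c (cdom e) w.
Proof. by move=> Qw; split=> //; exact: cU. Qed.
Let QT w : Q w -> O (T w). Proof. by move=> Qw; apply: cmap_cod; exact: cU. Qed.
Let sT : smooth_map_on Q T.
Proof. by move=> j; apply: smooth_subset (proj1 tce j) => w; exact: QO. Qed.
Let oQ : open Q. Proof. exact: ccod_open. Qed.
Let QOU w : Q w -> chart_part c (cdom e `&` U) w.
Proof. by move=> Qw; split=> //; split; exact: cU. Qed.

Let ffE w : Q w -> first_form (in_chart X c) w = conf_factor P (T w) *: (jacobian T w *m (jacobian T w)^T).
Proof.
move=> Qw; rewrite (first_form_change oU tce canonical_immersed (QOU Qw)).
rewrite (canonical_first_form cY (QT Qw)) mul_mx_scalar -scalemxAl //.
Qed.

Let l0 w : Q w -> conf_factor P (T w) != 0.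
Proof. by move=> Qw; rewrite gt_eqF // (conf_factor_gt0 oO cY (QT Qw)). Qed.

Let conf : [/\ hol Q (fun u => zc (T u)), forall w, Q w -> dz (fun u => zc (T u)) w != 0 &
      forall w, Q w -> jacobian T w *m (jacobian T w)^T = (norm2c (dz (fun u => zc (T u)) w))%:M].
Proof.
apply: conformal_hol oQ sT _ _ => w Qw; first by apply: (proj2 tce); exact: QO.
case: hc => _ _ /(_ w Qw) /is_scalar_mxP[a]; rewrite ffE // => E.
apply/is_scalar_mxP; exists ((conf_factor P (T w))^-1 * a).
by rewrite -scale_scalar_mx -E scalerA mulVf ?scale1r // l0.
Qed.

Let flatE w : Q w -> flat_metric X c w = (norm2c (dz (fun u => zc (T u)) w))%:M.
Proof.
move=> Qw; have [_ _ <-//] := conf; rewrite /flat_metric canonical_gauss_curvature; last exact: cU.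
have lp := conf_factor_gt0 oO cY (QT Qw).
rewrite opprK ffE // scalerA -/(T w) sqrtrV ?exprn_ge0 ?(ltW lp) //.
by rewrite sqrtr_sqr ger0_norm ?(ltW lp) // mulVf ?scale1r // gt_eqF.
Qed.

(** The degree condition quantifies over all holomorphic coordinates [c]. Each differs from the
    canonical one by a conformal, orientation preserving transition, hence by a holomorphic map [t]
    with nonzero derivative, and the flat metric reads [|t'|^2 |dz|^2] in it. *)
Lemma entropy_diffE l w : Q w ->
  entropy_diff X c l w = dzn (l - 2) (potential P) (T w) * dz (fun u => zc (T u)) w ^+ (l - 2).+2.
Proof.
move=> Qw; have [ht t0 _] := conf.
have fE u : Q u -> stereo_gauss X (cinv c u) = stereo_of (unit_normal Y (T u)).
  move=> Qu; have E := gauss_mapE oU te canonical_immersed (cU Qu) (cU Qu).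
  by rewrite /stereo_gauss E.
have gE u : Q u -> connection_coeff (flat_metric X c) u = dz (dz (fun u => zc (T u))) u / dz (fun u => zc (T u)) u.
  move=> Qu; exact: (connection_conformal oQ (hol_dz oQ ht) Qu (t0 u Qu) flatE).
exact: (schwarz_diffE oO oQ cY QT sT ht t0 fE (l - 2) gE Qw).
Qed.
End Coordinate.

Lemma canonical_coordinate : holomorphic_coordinate U X e.
Proof.
split=> [||w Ow]; [exact: subchart_admissible|by []|].
by rewrite (canonical_first_form cY Ow); apply/is_scalar_mxP; exists (conf_factor P w).
Qed.

Lemma canonical_entropy l w : O w -> entropy_diff X e l w = dzn (l - 2) (potential P) w.
Proof.
move=> Ow; rewrite (entropy_diffE canonical_coordinate l Ow).
rewrite {1}/transition cinvK // (eq_dz oO Ow (g := zc)); last by move=> u Ou; rewrite /transition cinvK.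
by rewrite dz_zc expr1n mulr1.
Qed.

Section Degree.
Variable S : {poly R[i]}.
Hypothesis SE : forall u, O u -> potential P u = S.[zc u].

Let dzS k u : O u -> dzn k (potential P) u = S^`(k).[zc u].
Proof.
elim: k u => [|k IH] u Ou; first exact: SE.
by rewrite dznS (eq_dz oO Ou IH) dz_horner derivnS.
Qed.

Lemma degree_condition_poly n : (2 <= n)%N -> (size S <= n - 2)%N -> degree_condition U X n.
Proof.
move=> n2 sS; left; rewrite canonical_non_umbilic => c hc w cw.
rewrite (entropy_diffE hc n cw) dzS; last by apply: cmap_cod; case: hc => _ sub _; apply: sub; exact: cinv_dom.
have -> : S^`(n - 2) = 0.
  by apply/polyP => i; rewrite coef_derivn coef0 nth_default ?mul0rn // (leq_trans sS) // leq_addr.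
by rewrite horner0 mul0r.
Qed.

Lemma infinite_points (w0 : V) : O w0 -> exists Z : nat -> V, (forall k, O (Z k)) /\ injective (fun k => zc (Z k)).
Proof.
move=> Ow; have [r r0 sub] := open_boxP oO Ow.
(* The denominators start at 2 so that the first point stays strictly inside the box. *)
exists (fun k => w0 + (r / k.+2%:R) *: bvec 0); split=> [k|i j /(congr1 (fun x => Re x)) /=].
  apply: sub => i; rewrite !mxE [w0 0 i + _]addrC addrK eqxx /=; move: i; apply: ord2P => /=.
    by rewrite mulr1 ger0_norm ?divr_ge0 ?(ltW r0) // ltr_pdivrMr ?ltr0n // ltr_pMr // ltr1n.
  by rewrite mulr0 normr0.
rewrite !mxE /= !mulr1 => /addrI/(mulfI (lt0r_neq0 r0))/invr_inj/eqP.
by rewrite eqr_nat => /eqP[].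
Qed.

(** Below level [n] the derivative [S^(m-2)] is nonzero because [m - 2 <= n - 3 = deg S]. The first
    alternative of the condition would give it infinitely many zeros, the second is excluded by
    [no_relation]; the canonical coordinate alone suffices to refute both. *)
Lemma not_degree_condition (z0 : R[i]) K (q : {poly R[i]}) eq n m :
  S = ('X - z0%:P) ^+ K * q -> size q = eq.+1 -> (eq < K + 2)%N -> (K + eq + 3 = n)%N ->
  (exists p, U p) -> (2 <= m < n)%N -> ~ degree_condition U X m.
Proof.
move=> SE' sq eK nE [p Up] /andP[m2 mn].
have [Z [OZ Zi]] := infinite_points (cmap_cod Up).
have sS : size S = (K + eq).+1.
  rewrite SE' size_monicM ?monic_exp ?monicXsubC // -?size_poly_eq0 ?sq // size_exp_XsubC.
  by rewrite addSn addnS.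
have Sm : S^`(m - 2) != 0.
  apply/eqP => /polyP /(_ (K + eq - (m - 2))%N); rewrite coef_derivn coef0 subnKC; last by lia.
  move/eqP; rewrite mulrn_eq0 => /orP[|].
    by rewrite -[_ == 0%N]negbK -lt0n ffact_gt0; lia.
  have -> : (K + eq)%N = (size S).-1 by rewrite sS.
  by rewrite -[_`_ _]/(lead_coef S) lead_coef_eq0 -size_poly_eq0 sS.
rewrite /degree_condition canonical_non_umbilic.
move=> [h|[psi [[_ hom] h]]]; case/eqP: Sm.
  apply: (poly_eq0_inj Zi) => k; rewrite -dzS // -canonical_entropy //.
  exact: h canonical_coordinate _ (OZ k).
rewrite SE'; apply: (no_relation _ eK m2 Zi hom); first by rewrite sq.
move=> k; rewrite -SE' -dzS // -canonical_entropy // (h e canonical_coordinate _ (OZ k)).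
congr (mpoly.meval _ psi); apply/funext => i.
by rewrite canonical_entropy // dzS // addnK.
Qed.
End Degree.
End CanonicalChart.

(** * The canonical coordinate of a minimal immersion *)

Section ComplexRoots.
Context {R : realType}.
Local Notation V := ('rV[R]_2).
Local Notation Re := complex.Re.
Local Notation Im := complex.Im.

(** The principal root [(|z| + z) / sqrt(2 (|z| + Re z))], written by real operations so that its
    smoothness on [Re z > 0] is immediate. *)
Definition csqrt (z : R[i]) : R[i] :=
  let m := Num.sqrt (norm2c z) + Re z in m / Num.sqrt (2%:R * m) +i* (Im z / Num.sqrt (2%:R * m)).

Let mod_pos (z : R[i]) : 0 < Re z -> 0 < Num.sqrt (norm2c z) + Re z.
Proof. by move=> z0; rewrite ltr_wpDl // sqrtr_ge0. Qed.

Lemma csqrtE (z : R[i]) : 0 < Re z -> csqrt z ^+ 2 = z.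
Proof.
move=> z0; have m0 := mod_pos z0; rewrite /csqrt; set m := _ + Re z in m0 *.
have D0 : 0 < 2%:R * m by rewrite mulr_gt0.
have DD := sqr_sqrtr (ltW D0); set D := Num.sqrt (2%:R * m) in DD *.
have Dn : D != 0 by rewrite gt_eqF // sqrtr_gt0.
have mE : m * m - Im z * Im z = 2%:R * m * Re z.
  have n0 := norm2c_ge0 z; have := sqr_sqrtr n0; rewrite /m.
  move: (Num.sqrt _) => s; rewrite /norm2c; move: (Re z) (Im z) => x y h.
  transitivity (s ^+ 2 + 2%:R * s * x + x * x - y * y); first by ring.
  by rewrite h; ring.
apply: complexP; rewrite expr2 ?(ReM, ImM) /=.
  transitivity ((m * m - Im z * Im z) / D ^+ 2); first by field.
  by rewrite mE -DD; field.
transitivity (2%:R * m * Im z / D ^+ 2); first by field.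
by rewrite -DD; field.
Qed.

Lemma Re_csqrt (z : R[i]) : 0 < Re z -> 0 < Re (csqrt z).
Proof. by move=> z0; have m0 := mod_pos z0; rewrite /= divr_gt0 // sqrtr_gt0 mulr_gt0. Qed.

Lemma csmooth_csqrt (O : set V) f : open O -> csmooth O f -> (forall u, O u -> 0 < Re (f u)) -> csmooth O (fun u => csqrt (f u)).
Proof.
move=> oO [sr si] f0.
have n0 u : O u -> 0 < norm2c (f u).
  by move=> Ou; rewrite norm2c_gt0; apply/eqP => E; have := f0 u Ou; rewrite E ltxx.
have sm : smooth_on O (fun u => Num.sqrt (norm2c (f u)) + Re (f u)).
  exact: (smoothD oO (smooth_sqrt oO n0 (smooth_norm2c oO (conj sr si))) sr).
have m0 u : O u -> 0 < 2%:R * (Num.sqrt (norm2c (f u)) + Re (f u)).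
  by move=> Ou; rewrite mulr_gt0 // mod_pos // f0.
have sD : smooth_on O (fun u => (Num.sqrt (2%:R * (Num.sqrt (norm2c (f u)) + Re (f u))))^-1).
  have D0 u : O u -> Num.sqrt (2%:R * (Num.sqrt (norm2c (f u)) + Re (f u))) != 0.
    by move=> Ou; rewrite gt_eqF // sqrtr_gt0 m0.
  exact: (smoothV oO D0 (smooth_sqrt oO m0 (smoothM oO (smooth_cst oO 2%:R) sm))).
split; [exact: (smoothM oO sm sD)|exact: (smoothM oO si sD)].
Qed.

Lemma fourth_root (z : R[i]) : exists c : R[i], c ^+ 4 = z.
Proof. by exists (4.-root z); rewrite rootCK. Qed.
End ComplexRoots.

Section Isothermal.
Context {R : realType}.
Local Notation V := ('rV[R]_2).
Local Notation Re := complex.Re.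
Local Notation Im := complex.Im.
Local Notation iu := (@iunit R).

Section ClosedForm.
Variables (O : set V) (oO : open O) (r0 r1 : V -> R[i]).
Hypotheses (s0 : csmooth O r0) (s1 : csmooth O r1) (cl : forall w, O w -> cpartial 1 r0 w = cpartial 0 r1 w)
  (nz : forall w, O w -> r0 w != 0).

(* Holomorphic for the complex structure in which the closed form r0 du + r1 dv is of type (1,0). *)
Definition rhol (f : V -> R[i]) := csmooth O f /\ forall w, O w -> cpartial 0 f w * r1 w = cpartial 1 f w * r0 w.
(** The derivative [df / rho], read off the first components; for [rhol] functions the second ones
    agree by [rder1]. *)
Definition rder (f : V -> R[i]) w := cpartial 0 f w / r0 w.

Lemma rder0 f w : O w -> cpartial 0 f w = rder f w * r0 w.
Proof. by move=> Ow; rewrite /rder mulfVK // nz. Qed.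
Lemma rder1 f w : rhol f -> O w -> cpartial 1 f w = rder f w * r1 w.
Proof.
move=> [_ h] Ow; apply: (mulIf (nz Ow)); rewrite -h // /rder; have := nz Ow.
by move: (cpartial 0 f w) (r0 w) (r1 w) => x y z y0; field.
Qed.

(** As [rho] is closed, [d(f rho)] is the wedge of [df] and [rho], which vanishes exactly when [df]
    is a multiple of [rho]. Applied to the closed form [df = (df/rho) rho], this shows that
    derivatives of such functions are again such functions. *)
Lemma rhol_closed f : csmooth O f -> (forall w, O w -> cpartial 1 (fun u => f u * r0 u) w = cpartial 0 (fun u => f u * r1 u) w) <-> rhol f.
Proof.
move=> sf; have E w : O w -> cpartial 1 (fun u => f u * r0 u) w - cpartial 0 (fun u => f u * r1 u) w =
    cpartial 1 f w * r0 w - cpartial 0 f w * r1 w.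
  by move=> Ow; rewrite (cpartialM oO sf s0 _ Ow) (cpartialM oO sf s1 _ Ow) cl //; ring.
split=> [h|[_ h] w Ow]; last by apply/eqP; rewrite -subr_eq0 E // h // subrr.
by split=> // w Ow; apply/eqP; rewrite eq_sym -subr_eq0 -E // h // subrr.
Qed.

Lemma csmooth_rder f : csmooth O f -> csmooth O (rder f).
Proof. by move=> sf; exact: (csmooth_div oO nz (csmooth_cpartial 0 sf) s0). Qed.

Lemma rhol_rder f : rhol f -> rhol (rder f).
Proof.
move=> hf; have sf := proj1 hf; apply/(rhol_closed (csmooth_rder sf)) => w Ow.
rewrite (eq_cpartial oO 1 Ow (g := cpartial 0 f)); last by move=> u Ou; rewrite -rder0.
rewrite (eq_cpartial oO 0 Ow (g := cpartial 1 f)); last by move=> u Ou; rewrite -rder1.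
exact: (cpartialC 1 0 oO sf Ow).
Qed.

Lemma rholM f g : rhol f -> rhol g -> rhol (fun u => f u * g u).
Proof.
move=> [sf hf] [sg hg]; split=> [|w Ow]; first exact: csmoothM.
rewrite !(cpartialM oO sf sg _ Ow); have := hf w Ow; have := hg w Ow.
move: (cpartial 0 f w) (cpartial 1 f w) (cpartial 0 g w) (cpartial 1 g w) (f w) (g w) (r0 w) (r1 w).
move=> a b c d x y p q h1 h2; transitivity (a * q * y + x * (c * q)); first by ring.
by rewrite h1 h2; ring.
Qed.
Lemma rholD f g : rhol f -> rhol g -> rhol (fun u => f u + g u).
Proof.
move=> [sf hf] [sg hg]; split=> [|w Ow]; first exact: csmoothD.
rewrite (cpartialD oO sf sg 0 Ow) (cpartialD oO sf sg 1 Ow); have := hf w Ow; have := hg w Ow.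
move: (cpartial 0 f w) (cpartial 1 f w) (cpartial 0 g w) (cpartial 1 g w) (r0 w) (r1 w) => a b c d x y h1 h2.
by rewrite !mulrDl h1 h2.
Qed.
Lemma rhol_root f g : csmooth O f -> rhol g -> (forall w, O w -> f w != 0) -> (forall w, O w -> f w ^+ 4 = g w) -> rhol f.
Proof.
move=> sf [sg hg] f0 fg; split=> // w Ow.
have sff := csmoothM oO sf sf.
have E i : cpartial i g w = 4%:R * f w ^+ 3 * cpartial i f w.
  rewrite (eq_cpartial oO i Ow (g := fun u => (f u * f u) * (f u * f u))); last by move=> u Ou; rewrite -fg //; ring.
  by rewrite (cpartialM oO sff sff _ Ow) (cpartialM oO sf sf _ Ow); ring.
have c0 : 4%:R * f w ^+ 3 != 0 by rewrite mulf_neq0 ?pnatr_eq0 // expf_neq0 // f0.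
by have H := hg w Ow; rewrite !E in H; apply: (mulfI c0); rewrite [LHS]mulrA [RHS]mulrA.
Qed.
Lemma rhol_div f g : (forall w, O w -> g w != 0) -> rhol f -> rhol g -> rhol (fun u => f u / g u).
Proof.
move=> g0 [sf hf] [sg hg]; have sv := csmoothV oO g0 sg; split=> [|w Ow]; first exact: csmooth_div.
rewrite !(cpartialM oO sf sv _ Ow) !(cpartialV oO _ g0 sg Ow).
have := hf w Ow; have := hg w Ow; have := g0 w Ow.
move: (cpartial 0 f w) (cpartial 1 f w) (cpartial 0 g w) (cpartial 1 g w) (f w) (g w) (r0 w) (r1 w).
move=> a b c d x y p q y0 h1 h2.
transitivity (a * q / y - x * (c * q) / y ^+ 2); first by field.
by rewrite h1 h2; field.
Qed.
End ClosedForm.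

(* A nowhere vanishing closed form of type (1,0) is locally the differential of a coordinate. *)
Lemma isothermal_coordinate (O : set V) (r0 r1 om : V -> R[i]) w0 : open O -> csmooth O r0 -> csmooth O r1 ->
  (forall w, O w -> cpartial 1 r0 w = cpartial 0 r1 w) -> (forall w, O w -> r0 w != 0) ->
  (forall w, O w -> 0 < Im (conjc (r0 w) * r1 w)) ->
  rhol O r0 r1 om -> (forall w, O w -> om w != 0) -> O w0 ->
  exists (F T : V -> V) (r d : R),
  [/\ [/\ 0 < r, 0 < d, box w0 r `<=` O & F w0 = 0], smooth_map_on (box w0 r) F /\ smooth_map_on (box 0 d) T,
      (forall y, box 0 d y -> box w0 r (T y) /\ F (T y) = y),
      (forall u, box w0 r u -> box 0 d (F u) -> T (F u) = u) &
      [/\ (forall u, box w0 r u -> 0 < jac_det F u),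
      (forall y, box 0 d y -> 0 < jac_det T y) &
      forall f, rhol O r0 r1 f -> forall y, box 0 d y ->
        cpartial 0 (fun v => f (T v)) y = rder r0 f (T y) / om (T y) /\
        cpartial 1 (fun v => f (T v)) y = iu * (rder r0 f (T y) / om (T y))] /\
      forall i y, box 0 d y ->
        r0 (T y) * (partial i (fun v => T v 0 0) y)%:C + r1 (T y) * (partial i (fun v => T v 0 1) y)%:C =
        (if i == 0 then 1 else iu) / om (T y)].
Proof.
move=> oO s0 s1 cl nz pos hom om0 Ow.
have som := proj1 hom.
have sP := csmoothM oO som s0; have sQ := csmoothM oO som s1.
have cl' := proj2 (rhol_closed oO s0 s1 cl som) hom.
have [rr rr0 sub] := open_boxP oO Ow; pose r := rr / 2%:R.
have rp : 0 < r by rewrite divr_gt0.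
have csub (u : V) : (forall i, `|u 0 i - w0 0 i| <= r) -> O u.
  by move=> h; apply: sub => i; apply: le_lt_trans (h i) _; rewrite ltr_pdivrMr // ltr_pMr // ltr1n.
have clr u : O u -> partial 1 (fun v => Re (om v * r0 v)) u = partial 0 (fun v => Re (om v * r1 v)) u.
  by move=> Ou; rewrite -!Re_cpartial cl'.
have cli u : O u -> partial 1 (fun v => Im (om v * r0 v)) u = partial 0 (fun v => Im (om v * r1 v)) u.
  by move=> Ou; rewrite -!Im_cpartial cl'.
have [X [sX X0 X1 X2]] := closed_form_primitive oO (proj1 sP) (proj1 sQ) clr rp csub.
have [Z [sZ Z0 Z1 Z2]] := closed_form_primitive oO (proj2 sP) (proj2 sQ) cli rp csub.
(* A complex primitive of the closed form [om rho], split into real and imaginary parts; it becomes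
   the coordinate [z]. *)
pose F u := pt (X u) (Z u).
have Fx u : F u 0 0 = X u by rewrite pt0.
have Fy u : F u 0 1 = Z u by rewrite pt1.
have bO : box w0 r `<=` O by move=> u h; apply: csub => i; exact: ltW.
have ob : open (box w0 r) by exact: open_box_set.
have bw : box w0 r w0 by exact: box_center.
have FX : (fun u => F u 0 0) = X by apply/funext.
have FZ : (fun u => F u 0 1) = Z by apply/funext.
have sF : smooth_map_on (box w0 r) F by move=> j; move: j; apply: ord2P; rewrite ?FX ?FZ.
(* The determinant is [|om|^2 Im (conj(r0) r1)]. *)
have jF u : box w0 r u -> 0 < jac_det F u.
  move=> bu; rewrite /jac_det FX FZ X1 // X2 // Z1 // Z2 //.
  have := pos u (bO u bu); have := om0 u (bO u bu); rewrite -norm2c_gt0 => h1 h2.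
  have := mulr_gt0 h1 h2; rewrite ImM ReJ ImJ !(ReM,ImM) /norm2c.
  by move: (Re (om u)) (Im (om u)) (Re (r0 u)) (Im (r0 u)) (Re (r1 u)) (Im (r1 u)) => a b p q s t; congr (0 < _); ring.
have F0 : F w0 = 0 by apply: row2P; rewrite ?Fx ?Fy mxE.
have [r' [d [T [r'0 d0 b'b jF' [HT TF sT]]]]] := inverse_function ob sF bw (jF w0 bw).
rewrite F0 in HT TF sT.
have od : open (box (0 : V) d) by exact: open_box_set.
have Tb y : box 0 d y -> box w0 r' (T y) by move=> /HT[].
have TO y : box 0 d y -> O (T y) by move=> /Tb/b'b/bO.
have zF y : box 0 d y -> zc (F (T y)) = zc y by move=> /HT[_ ->].
have sTF : csmooth (box w0 r) (fun u => zc (F u)) := csmooth_zc sF.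
have Tbr y : box 0 d y -> box w0 r (T y) by move=> /Tb/b'b.
have cz i u : box w0 r u -> cpartial i (fun u => zc (F u)) u = om u * (if i == 0 then r0 u else r1 u).
  move=> bu; rewrite cpartial_zc FX FZ; move: i; apply: ord2P => /=; rewrite ?X1 ?X2 ?Z1 ?Z2 //; by rewrite -complex_split.
(* In the new coordinate [om rho = dz], so [rho] has components 1 and [i], divided by [om]. *)
have key i y : box 0 d y ->
    r0 (T y) * (partial i (fun v => T v 0 0) y)%:C + r1 (T y) * (partial i (fun v => T v 0 1) y)%:C =
        (if i == 0 then 1 else iu) / om (T y).
  move=> dy; have on := om0 _ (TO y dy).
  have := cpartial_comp od i ob sTF Tbr sT dy; rewrite (eq_cpartial od i dy zF) (cz 0 _ (Tbr y dy)) (cz 1 _ (Tbr y dy)) /=.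
  have -> : cpartial i zc y = if i == 0 then 1 else iu.
    have hz := hol_zc od; move: i; apply: ord2P => /=; first by rewrite (dz_cp0 hz dy) dz_zc.
    by rewrite (dz_cp1 hz dy) dz_zc mulr1.
  by move=> ->; move: (om (T y)) on (_%:C) (_%:C) (r0 _) (r1 _) => o o0 p q x z; field.
have jT y : box 0 d y -> 0 < jac_det T y.
  move=> dy; have := jacobian_compE od ob sF Tbr sT dy (Z := fun v => v) (fun u du => esym (proj2 (HT u du))).
  move/(congr1 (fun A => \det A)); rewrite det_mulmx !jac_detE => E.
  have E1 : jac_det T y * jac_det F (T y) = 1 by rewrite -E /jac_det !partial_coord /=; ring.
  by rewrite -(pmulr_lgt0 _ (jF _ (Tbr y dy))) E1.
have cf f : rhol O r0 r1 f -> forall y, box 0 d y ->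
        cpartial 0 (fun v => f (T v)) y = rder r0 f (T y) / om (T y) /\
        cpartial 1 (fun v => f (T v)) y = iu * (rder r0 f (T y) / om (T y)).
  move=> hf y dy; have sf := proj1 hf.
  have C i := cpartial_comp od i oO sf TO sT dy.
  have D i : cpartial i (fun v => f (T v)) y = rder r0 f (T y) * ((if i == 0 then 1 else iu) / om (T y)).
    rewrite C (rder0 nz f (TO y dy)) (rder1 nz hf (TO y dy)) -(key i y dy).
    by move: (rder _ _ _) (r0 _) (r1 _) (_%:C) (_%:C) => a b c p q; ring.
  by rewrite !D /= mul1r; split=> //; rewrite mulrCA.
exists F, T, r', d; split.
- by split=> // u /b'b /bO.
- by split=> // j; apply: smooth_subset b'b (sF j).
- exact: HT.
- exact: TF.
- split; last exact: key.
  by split; [move=> u /b'b /jF|exact: jT|exact: cf].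
Qed.

End Isothermal.

Section VectorAlgebra.
(** Here [a, b] are the coordinate tangents and [p, q] the derivatives of the unit normal. The
    vector [v = q x a - p x b] is orthogonal to [a] and [b] because [p] and [q] are tangent, and its
    product with [a x b] is the trace of the shape operator times the Gram determinant; so it
    vanishes with the mean curvature. *)
Lemma codazzi_algebra (K : realDomainType) (a0 a1 a2 b0 b1 b2 p0 p1 p2 q0 q1 q2 n0 n1 n2 E F G s00 s01 s10 s11 : K) :
  n0 = a1 * b2 - a2 * b1 -> n1 = a2 * b0 - a0 * b2 -> n2 = a0 * b1 - a1 * b0 ->
  E = a0 * a0 + a1 * a1 + a2 * a2 -> F = a0 * b0 + a1 * b1 + a2 * b2 -> G = b0 * b0 + b1 * b1 + b2 * b2 ->
  E * G - F ^+ 2 != 0 -> p0 * n0 + p1 * n1 + p2 * n2 = 0 -> q0 * n0 + q1 * n1 + q2 * n2 = 0 ->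
  p0 * a0 + p1 * a1 + p2 * a2 = - s00 -> p0 * b0 + p1 * b1 + p2 * b2 = - s01 ->
  q0 * a0 + q1 * a1 + q2 * a2 = - s10 -> q0 * b0 + q1 * b1 + q2 * b2 = - s11 ->
  s00 * G - s01 * F - s10 * F + s11 * E = 0 ->
  [/\ q1 * a2 - q2 * a1 = p1 * b2 - p2 * b1, q2 * a0 - q0 * a2 = p2 * b0 - p0 * b2 & q0 * a1 - q1 * a0 = p0 * b1 - p1 * b0].
Proof.
move=> n0E n1E n2E EE FE GE D pn qn pa pb qa qb h.
pose v0 := q1 * a2 - q2 * a1 - (p1 * b2 - p2 * b1); pose v1 := q2 * a0 - q0 * a2 - (p2 * b0 - p0 * b2).
pose v2 := q0 * a1 - q1 * a0 - (p0 * b1 - p1 * b0).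
have va : v0 * a0 + v1 * a1 + v2 * a2 = 0 by rewrite -pn /v0 /v1 /v2 n0E n1E n2E; ring.
have vb : v0 * b0 + v1 * b1 + v2 * b2 = 0 by rewrite -qn /v0 /v1 /v2 n0E n1E n2E; ring.
have vn : v0 * n0 + v1 * n1 + v2 * n2 = 0.
  rewrite -h -[s00]opprK -pa -[s01]opprK -pb -[s10]opprK -qa -[s11]opprK -qb.
  by rewrite /v0 /v1 /v2 n0E n1E n2E EE FE GE; ring.
have := gram_normal a0 a1 a2 b0 b1 b2 v0 v1 v2; rewrite -n0E -n1E -n2E vn va vb -EE -FE -GE.
rewrite expr0n /= !(mul0r, mulr0, subr0, addr0) => /esym/eqP; rewrite mulf_eq0 (negPf D) orbF.
rewrite !paddr_eq0 ?addr_ge0 ?sqr_ge0 // !sqrf_eq0 => /andP[/andP[/eqP h0 /eqP h1] /eqP h2].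
by split; apply/eqP; rewrite -subr_eq0; apply/eqP.
Qed.

(** Eigenvectors of the cross product with [N] for the eigenvalue [i] are isotropic, orthogonal to
    [N], and form a line: [x.y = 0] by skew-symmetry of the cross product, proportionality by the
    double cross product formula. *)
Lemma eigen_cross (K : fieldType) (i n0 n1 n2 x0 x1 x2 y0 y1 y2 : K) : i * i = -1 -> 2%:R != 0 :> K ->
  n1 * x2 - n2 * x1 = i * x0 -> n2 * x0 - n0 * x2 = i * x1 -> n0 * x1 - n1 * x0 = i * x2 ->
  n1 * y2 - n2 * y1 = i * y0 -> n2 * y0 - n0 * y2 = i * y1 -> n0 * y1 - n1 * y0 = i * y2 ->
  [/\ x0 * y0 + x1 * y1 + x2 * y2 = 0, n0 * x0 + n1 * x1 + n2 * x2 = 0 &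
   [/\ x1 * y2 = x2 * y1, x2 * y0 = x0 * y2 & x0 * y1 = x1 * y0]].
Proof.
move=> ii two ex0 ex1 ex2 ey0 ey1 ey2.
have i0 : i != 0 by apply/eqP => i0; move: ii; rewrite i0 mul0r => /esym/eqP; rewrite oppr_eq0 oner_eq0.
have nx : n0 * x0 + n1 * x1 + n2 * x2 = 0.
  apply: (mulfI i0); rewrite mulr0.
  transitivity (n0 * (i * x0) + n1 * (i * x1) + n2 * (i * x2)); first by ring.
  by rewrite -ex0 -ex1 -ex2; ring.
have ny : n0 * y0 + n1 * y1 + n2 * y2 = 0.
  apply: (mulfI i0); rewrite mulr0.
  transitivity (n0 * (i * y0) + n1 * (i * y1) + n2 * (i * y2)); first by ring.
  by rewrite -ey0 -ey1 -ey2; ring.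
have xy : x0 * y0 + x1 * y1 + x2 * y2 = 0.
  have i2 : i * 2%:R != 0 by rewrite mulf_neq0.
  apply: (mulfI i2); rewrite mulr0.
  transitivity ((i * x0) * y0 + (i * x1) * y1 + (i * x2) * y2 + (x0 * (i * y0) + x1 * (i * y1) + x2 * (i * y2))); first by ring.
  by rewrite -ex0 -ex1 -ex2 -ey0 -ey1 -ey2; ring.
split=> //; split; apply: (mulfI i0).
- apply/eqP; rewrite -subr_eq0; apply/eqP.
  transitivity ((i * x1) * y2 - (i * x2) * y1); first by ring.
  rewrite -ex1 -ex2; transitivity (x0 * (n0 * y0 + n1 * y1 + n2 * y2) - n0 * (x0 * y0 + x1 * y1 + x2 * y2)); first by ring.
  by rewrite xy ny; ring.
- apply/eqP; rewrite -subr_eq0; apply/eqP.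
  transitivity ((i * x2) * y0 - (i * x0) * y2); first by ring.
  rewrite -ex2 -ex0; transitivity (x1 * (n0 * y0 + n1 * y1 + n2 * y2) - n1 * (x0 * y0 + x1 * y1 + x2 * y2)); first by ring.
  by rewrite xy ny; ring.
- apply/eqP; rewrite -subr_eq0; apply/eqP.
  transitivity ((i * x0) * y1 - (i * x1) * y0); first by ring.
  rewrite -ex0 -ex1; transitivity (x2 * (n0 * y0 + n1 * y1 + n2 * y2) - n2 * (x0 * y0 + x1 * y1 + x2 * y2)); first by ring.
  by rewrite xy ny; ring.
Qed.
End VectorAlgebra.

(** For [k = N x a] the vector [a - i k] is null and [a x k = |a|^2 N]; so [null_normal_sqr] gives
    [(v.N)^2 = v.v = 0]. *)
Lemma isotropic_normal (R : realType) (v0 v1 v2 : R[i]) (k0 k1 k2 a0 a1 a2 n0 n1 n2 : R) :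
  v0 * v0 + v1 * v1 + v2 * v2 = 0 ->
  v0 * (a0%:C - @iunit R * k0%:C) + v1 * (a1%:C - @iunit R * k1%:C) + v2 * (a2%:C - @iunit R * k2%:C) = 0 ->
  k0 = n1 * a2 - n2 * a1 -> k1 = n2 * a0 - n0 * a2 -> k2 = n0 * a1 - n1 * a0 ->
  n0 * n0 + n1 * n1 + n2 * n2 = 1 -> a0 * n0 + a1 * n1 + a2 * n2 = 0 ->
  a0 * a0 + a1 * a1 + a2 * a2 != 0 ->
  v0 * n0%:C + v1 * n1%:C + v2 * n2%:C = 0.
Proof.
move=> vv vt k0E k1E k2E u o; have [l lE] : exists l, l = a0 * a0 + a1 * a1 + a2 * a2 by exists (a0 * a0 + a1 * a1 + a2 * a2).
rewrite -lE => l0.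
have kk : k0 * k0 + k1 * k1 + k2 * k2 = l.
  rewrite k0E k1E k2E; transitivity ((n0 * n0 + n1 * n1 + n2 * n2) * (a0 * a0 + a1 * a1 + a2 * a2) - (a0 * n0 + a1 * n1 + a2 * n2) ^+ 2); first by ring.
  by rewrite u o -lE; ring.
have ak : a0 * k0 + a1 * k1 + a2 * k2 = 0 by rewrite k0E k1E k2E; ring.
have h0 : a1 * k2 - a2 * k1 = l * n0.
  rewrite k1E k2E lE; transitivity (n0 * (a0 * a0 + a1 * a1 + a2 * a2) - a0 * (a0 * n0 + a1 * n1 + a2 * n2)); first by ring.
  by rewrite o; ring.
have h1 : a2 * k0 - a0 * k2 = l * n1.
  rewrite k0E k2E lE; transitivity (n1 * (a0 * a0 + a1 * a1 + a2 * a2) - a1 * (a0 * n0 + a1 * n1 + a2 * n2)); first by ring.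
  by rewrite o; ring.
have h2 : a0 * k1 - a1 * k0 = l * n2.
  rewrite k0E k1E lE; transitivity (n2 * (a0 * a0 + a1 * a1 + a2 * a2) - a2 * (a0 * n0 + a1 * n1 + a2 * n2)); first by ring.
  by rewrite o; ring.
have lC : (l%:C : R[i]) != 0 by apply/eqP => /(congr1 (fun x => complex.Re x)) /= /eqP; rewrite (negPf l0).
have C (x y : R) : x = y -> (x%:C : R[i]) = y%:C by move->.
move: (C _ _ (esym lE)) (C _ _ kk) (C _ _ ak) (C _ _ h0) (C _ _ h1) (C _ _ h2).
rewrite !rmorphD !rmorphN !rmorphM rmorph0 /= => caa cbb cab cn0 cn1 cn2.
have := null_normal_sqr (@iunitE R) caa cbb cab vt; rewrite cn0 cn1 cn2.
have -> : v0 ^+ 2 + v1 ^+ 2 + v2 ^+ 2 = 0 by rewrite -vv; ring.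
rewrite mul0r => /eqP; rewrite sqrf_eq0 => /eqP E.
apply: (mulfI lC); rewrite mulr0 -[RHS]E; ring.
Qed.

(** * The closed vector-valued form of a minimal patch *)

Section MinimalPatch.
Context {R : realType}.
Local Notation V := ('rV[R]_2).
Local Notation Re := complex.Re.
Local Notation Im := complex.Im.
Local Notation iu := (@iunit R).

Variables (O : set V) (oO : open O) (Y : V -> 'rV[R]_3) (w0 : V).
Hypotheses (sY : smooth_map_on O Y) (nY : forall w, O w -> normal Y w != 0)
  (tS : forall w, O w -> \tr (shape_op Y w) = 0) (Ow0 : O w0) (dS : \det (shape_op Y w0) != 0).

Let a i k w : R := partial i (fun u => Y u 0 k) w.
Let N k w : R := unit_normal Y w 0 k.

Let sa i k : smooth_on O (a i k). Proof. exact: smooth_partial. Qed.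
Let aE i w k : jrow Y i w 0 k = a i k w. Proof. exact: jrowE. Qed.

Let nu w : R := eucl_norm (normal Y w).
Let nu0 w : O w -> 0 < nu w. Proof. by move=> Ow; apply: eucl_norm_gt0; exact: nY. Qed.

Let nE w : [/\ normal Y w 0 0 = a 0 1 w * a 1 2 w - a 0 2 w * a 1 1 w,
   normal Y w 0 1 = a 0 2 w * a 1 0 w - a 0 0 w * a 1 2 w & normal Y w 0 2 = a 0 0 w * a 1 1 w - a 0 1 w * a 1 0 w].
Proof. by rewrite /normal !crossE !aE. Qed.

Let NE w k : N k w = (nu w)^-1 * normal Y w 0 k.
Proof. by rewrite /N unit_normalE [LHS]mxE. Qed.
Let nN w k : O w -> normal Y w 0 k = nu w * N k w.
Proof. by move=> Ow; rewrite NE mulrA mulfV ?mul1r // gt_eqF // nu0. Qed.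

Let sn k : smooth_on O (fun w => normal Y w 0 k).
Proof.
have sub (i j i' j' : 'I_3) : smooth_on O (fun w => a 0 i w * a 1 j w - a 0 i' w * a 1 j' w).
  exact: (smoothB oO (smoothM oO (sa 0 i) (sa 1 j)) (smoothM oO (sa 0 i') (sa 1 j'))).
move: k; apply: ord3P.
- by apply: (smooth_eq oO _ (sub 1 2 2 1)) => u _; have [-> _ _] := nE u.
- by apply: (smooth_eq oO _ (sub 2 0 0 2)) => u _; have [_ -> _] := nE u.
- by apply: (smooth_eq oO _ (sub 0 1 1 0)) => u _; have [_ _ ->] := nE u.
Qed.

Let sN k : smooth_on O (N k).
Proof.
have s1 : smooth_on O (fun w => normal Y w 0 0 ^+ 2 + normal Y w 0 1 ^+ 2 + normal Y w 0 2 ^+ 2).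
  apply: (smooth_eq oO (f := fun w => normal Y w 0 0 * normal Y w 0 0 + normal Y w 0 1 * normal Y w 0 1 + normal Y w 0 2 * normal Y w 0 2)).
    by move=> u _; rewrite !expr2.
  exact: (smoothD oO (smoothD oO (smoothM oO (sn 0) (sn 0)) (smoothM oO (sn 1) (sn 1))) (smoothM oO (sn 2) (sn 2))).
have p1 u : O u -> 0 < normal Y u 0 0 ^+ 2 + normal Y u 0 1 ^+ 2 + normal Y u 0 2 ^+ 2.
  by move=> Ou; rewrite -eucl_norm_sqr exprn_gt0 // nu0.
have sq := smooth_sqrt oO p1 s1.
have nz u : O u -> Num.sqrt (normal Y u 0 0 ^+ 2 + normal Y u 0 1 ^+ 2 + normal Y u 0 2 ^+ 2) != 0.
  by move=> Ou; rewrite gt_eqF // sqrtr_gt0 p1.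
apply: (smooth_eq oO _ (smoothM oO (smoothV oO nz sq) (sn k))) => u Ou.
by rewrite NE /nu eucl_normE.
Qed.

Let unitN w : O w -> N 0 w * N 0 w + N 1 w * N 1 w + N 2 w * N 2 w = 1.
Proof.
move=> Ow; have n0 := nu0 Ow; have := eucl_norm_sqr (normal Y w); rewrite !nN // -/(nu w) => E.
have nz : nu w ^+ 2 != 0 by rewrite expf_neq0 // gt_eqF.
by apply: (mulfI nz); rewrite mulr1 [RHS]E; ring.
Qed.

Let orthN i w : a i 0 w * N 0 w + a i 1 w * N 1 w + a i 2 w * N 2 w = 0.
Proof. by have := unit_normal_orth Y w i; rewrite sum3E. Qed.

Let d f w (Ow : O w) (sf : smooth_on O f) : differentiable f w := smooth_differentiable oO sf Ow.

Lemma partial_sum3 i (f g : 'I_3 -> V -> R) w : O w -> (forall k, smooth_on O (f k)) -> (forall k, smooth_on O (g k)) ->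
  partial i (fun u => f 0 u * g 0 u + f 1 u * g 1 u + f 2 u * g 2 u) w =
  \sum_k partial i (f k) w * g k w + \sum_k f k w * partial i (g k) w.
Proof.
move=> Ow sf sg; have dM k := d Ow (smoothM oO (sf k) (sg k)).
have dM2 := d Ow (smoothD oO (smoothM oO (sf 0) (sg 0)) (smoothM oO (sf 1) (sg 1))).
rewrite (partialD i dM2 (dM 2)) (partialD i (dM 0) (dM 1)).
have E k : partial i (fun u => f k u * g k u) w = partial i (f k) w * g k w + f k w * partial i (g k) w.
  exact: (partialM i (d Ow (sf k)) (d Ow (sg k))).
by rewrite !E !sum3E; ring.
Qed.

Let dNN i w : O w -> \sum_k partial i (N k) w * N k w = 0.
Proof.
move=> Ow; have := partial_sum3 i Ow sN sN; rewrite (eq_partial i oO Ow unitN) partial_cst.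
have -> : \sum_k N k w * partial i (N k) w = \sum_k partial i (N k) w * N k w.
  by apply: eq_bigr => k _; rewrite mulrC.
move=> /esym/eqP; rewrite -mulr2n mulrn_eq0 /= => /eqP //.
Qed.

Let dNa i j w : O w -> \sum_k partial i (N k) w * a j k w = - second_form Y w i j.
Proof.
move=> Ow; have := partial_sum3 i Ow (sa j) sN; rewrite (eq_partial i oO Ow (fun u _ => orthN j u)) partial_cst.
move=> /esym/eqP; rewrite addr_eq0 => /eqP E.
have -> : second_form Y w i j = \sum_k partial i (a j k) w * N k w by rewrite mxE.
by rewrite E opprK; apply: eq_bigr => k _; rewrite mulrC.
Qed.

Let ffE i j w : first_form Y w i j = a i 0 w * a j 0 w + a i 1 w * a j 1 w + a i 2 w * a j 2 w.
Proof. by rewrite mxE sum3E !mxE. Qed.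

Let detI w : O w -> first_form Y w 0 0 * first_form Y w 1 1 - first_form Y w 0 1 ^+ 2 != 0.
Proof.
move=> Ow; have -> : first_form Y w 0 0 * first_form Y w 1 1 - first_form Y w 0 1 ^+ 2 = \det (first_form Y w).
  rewrite det2E !ffE; move: (a 0 0 w) (a 0 1 w) (a 0 2 w) (a 1 0 w) (a 1 1 w) (a 1 2 w) => x y z p q r; ring.
by rewrite det_first_form expf_neq0 // gt_eqF // nu0.
Qed.

Let uI w : O w -> first_form Y w \in unitmx.
Proof. by move=> Ow; rewrite unitmxE unitfE det_first_form expf_neq0 // gt_eqF // nu0. Qed.

Let secE w : O w -> second_form Y w = shape_op Y w *m first_form Y w.
Proof. by move=> Ow; rewrite /shape_op mulmxKV // uI. Qed.

Let trace_relation w : O w ->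
  second_form Y w 0 0 * first_form Y w 1 1 - second_form Y w 0 1 * first_form Y w 0 1
  - second_form Y w 1 0 * first_form Y w 0 1 + second_form Y w 1 1 * first_form Y w 0 0 = 0.
Proof.
move=> Ow; have t := tS Ow; rewrite /mxtrace sum2E in t.
have sI : first_form Y w 1 0 = first_form Y w 0 1.
  have : (first_form Y w)^T = first_form Y w by rewrite /first_form trmx_mul trmxK.
  by move=> E; rewrite -{1}E [LHS]mxE.
rewrite secE //; move: t sI; move: (shape_op Y w) (first_form Y w) => S I t sI.
rewrite !mxE !sum2E sI.
transitivity ((S 0 0 + S 1 1) * (I 0 0 * I 1 1 - I 0 1 ^+ 2)); first by ring.
by rewrite t mul0r.
Qed.

Let m i k w : R := cross (unit_normal Y w) (jrow Y i w) 0 k.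
Let mE i w : [/\ m i 0 w = N 1 w * a i 2 w - N 2 w * a i 1 w, m i 1 w = N 2 w * a i 0 w - N 0 w * a i 2 w
  & m i 2 w = N 0 w * a i 1 w - N 1 w * a i 0 w].
Proof. by rewrite /m !crossE !aE. Qed.

Let sm i k : smooth_on O (m i k).
Proof.
have sub (j l j' l' : 'I_3) : smooth_on O (fun w => N j w * a i l w - N j' w * a i l' w).
  exact: (smoothB oO (smoothM oO (sN j) (sa i l)) (smoothM oO (sN j') (sa i l'))).
move: k; apply: ord3P.
- by apply: (smooth_eq oO _ (sub 1 2 2 1)) => u _; have [-> _ _] := mE i u.
- by apply: (smooth_eq oO _ (sub 2 0 0 2)) => u _; have [_ -> _] := mE i u.
- by apply: (smooth_eq oO _ (sub 0 1 1 0)) => u _; have [_ _ ->] := mE i u.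
Qed.

Let dm i j w : O w ->
  [/\ partial j (m i 0) w = partial j (N 1) w * a i 2 w - partial j (N 2) w * a i 1 w + (N 1 w * partial j (a i 2) w - N 2 w * partial j (a i 1) w),
      partial j (m i 1) w = partial j (N 2) w * a i 0 w - partial j (N 0) w * a i 2 w + (N 2 w * partial j (a i 0) w - N 0 w * partial j (a i 2) w) &
      partial j (m i 2) w = partial j (N 0) w * a i 1 w - partial j (N 1) w * a i 0 w + (N 0 w * partial j (a i 1) w - N 1 w * partial j (a i 0) w)].
Proof.
move=> Ow.
have E (k l k' l' : 'I_3) : partial j (fun w => N k w * a i l w - N k' w * a i l' w) w =
   partial j (N k) w * a i l w - partial j (N k') w * a i l' w + (N k w * partial j (a i l) w - N k' w * partial j (a i l') w).
  rewrite (partialB j (d Ow (smoothM oO (sN k) (sa i l))) (d Ow (smoothM oO (sN k') (sa i l')))).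
  rewrite (partialM j (d Ow (sN k)) (d Ow (sa i l))) (partialM j (d Ow (sN k')) (d Ow (sa i l'))).
  by rewrite opprD addrACA.
split.
- by rewrite -E; apply: (eq_partial j oO Ow) => u _; have [-> _ _] := mE i u.
- by rewrite -E; apply: (eq_partial j oO Ow) => u _; have [_ -> _] := mE i u.
- by rewrite -E; apply: (eq_partial j oO Ow) => u _; have [_ _ ->] := mE i u.
Qed.

(* Closedness of *dY is the vanishing of the mean curvature. *)
Let dm_sym k w : O w -> partial 1 (m 0 k) w = partial 0 (m 1 k) w.
Proof.
move=> Ow.
have aC l : partial 1 (a 0 l) w = partial 0 (a 1 l) w by exact: (partialC 1 0 oO (sY l) Ow).
have [n0 n1 n2] := nE w.
have pn i : partial i (N 0) w * normal Y w 0 0 + partial i (N 1) w * normal Y w 0 1 + partial i (N 2) w * normal Y w 0 2 = 0.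
  have := dNN i Ow; rewrite sum3E !nN // => E.
  transitivity (nu w * (partial i (N 0) w * N 0 w + partial i (N 1) w * N 1 w + partial i (N 2) w * N 2 w)); first by ring.
  by rewrite E mulr0.
have Na i j : partial i (N 0) w * a j 0 w + partial i (N 1) w * a j 1 w + partial i (N 2) w * a j 2 w = - second_form Y w i j.
  by rewrite -(dNa i j Ow) sum3E.
have [] := codazzi_algebra n0 n1 n2 (ffE 0 0 w) (ffE 0 1 w) (ffE 1 1 w) (detI Ow) (pn 0) (pn 1)
  (Na 0 0) (Na 0 1) (Na 1 0) (Na 1 1) (trace_relation Ow).
move=> h0 h1 h2; have [d0 d1 d2] := dm 0 1 Ow; have [e0 e1 e2] := dm 1 0 Ow.
move: k; apply: ord3P.
- exact: (etrans d0 (etrans (f_equal2 +%R h0 (f_equal2 (fun x y => N 1 w * x - N 2 w * y) (aC 2) (aC 1))) (esym e0))).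
- exact: (etrans d1 (etrans (f_equal2 +%R h1 (f_equal2 (fun x y => N 2 w * x - N 0 w * y) (aC 0) (aC 2))) (esym e1))).
- exact: (etrans d2 (etrans (f_equal2 +%R h2 (f_equal2 (fun x y => N 0 w * x - N 1 w * y) (aC 1) (aC 0))) (esym e2))).
Qed.

Let th i k w : R[i] := (a i k w)%:C - iu * (m i k w)%:C.
Lemma Re_th i k w : Re (th i k w) = a i k w.
Proof. by rewrite /th ReB ReM iunitC /=; ring. Qed.
Lemma Im_th i k w : Im (th i k w) = - m i k w.
Proof. by rewrite /th ImB ImM iunitC /=; ring. Qed.

Let sth i k : csmooth O (th i k).
Proof.
split; first by apply: (smooth_eq oO _ (sa i k)) => u _; rewrite Re_th.
by apply: (smooth_eq oO _ (smoothN oO (sm i k))) => u _; rewrite Im_th.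
Qed.

Let th_closed k w : O w -> cpartial 1 (th 0 k) w = cpartial 0 (th 1 k) w.
Proof.
move=> Ow; apply: complexP; rewrite ?Re_cpartial ?Im_cpartial.
  rewrite (eq_partial 1 oO Ow (fun u _ => Re_th 0 k u)) (eq_partial 0 oO Ow (fun u _ => Re_th 1 k u)).
  exact: (partialC 1 0 oO (sY k) Ow).
rewrite (eq_partial 1 oO Ow (fun u _ => Im_th 0 k u)) (eq_partial 0 oO Ow (fun u _ => Im_th 1 k u)).
by rewrite (partialN 1 (d Ow (sm 0 k))) (partialN 0 (d Ow (sm 1 k))) dm_sym.
Qed.

Let NC k w : R[i] := (N k w)%:C.
Let th_eigen i w : O w ->
  [/\ NC 1 w * th i 2 w - NC 2 w * th i 1 w = iu * th i 0 w,
      NC 2 w * th i 0 w - NC 0 w * th i 2 w = iu * th i 1 w &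
      NC 0 w * th i 1 w - NC 1 w * th i 0 w = iu * th i 2 w].
Proof.
move=> Ow; have [m0 m1 m2] := mE i w; have u := unitN Ow; have o := orthN i w.
have E (x y : R) : N 0 w * N 0 w + N 1 w * N 1 w + N 2 w * N 2 w = 1 -> x = x * (N 0 w * N 0 w + N 1 w * N 1 w + N 2 w * N 2 w).
  by move=> ->; rewrite mulr1.
have N0 : N 1 w * m i 2 w - N 2 w * m i 1 w = - a i 0 w.
  rewrite m1 m2 [in RHS](E (a i 0 w) 0 u) -[RHS]addr0 -[X in _ = _ + X](mulr0 (N 0 w)) -o; ring.
have N1 : N 2 w * m i 0 w - N 0 w * m i 2 w = - a i 1 w.
  rewrite m0 m2 [in RHS](E (a i 1 w) 0 u) -[RHS]addr0 -[X in _ = _ + X](mulr0 (N 1 w)) -o; ring.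
have N2 : N 0 w * m i 1 w - N 1 w * m i 0 w = - a i 2 w.
  rewrite m0 m1 [in RHS](E (a i 2 w) 0 u) -[RHS]addr0 -[X in _ = _ + X](mulr0 (N 2 w)) -o; ring.
rewrite /NC /th; move: m0 m1 m2 N0 N1 N2.
move: (m i 0 w) (m i 1 w) (m i 2 w) (a i 0 w) (a i 1 w) (a i 2 w) (N 0 w) (N 1 w) (N 2 w) => x y z p q r n0 n1 n2.
move=> h1 h2 h3 h4 h5 h6.
split; apply: complexP; rewrite !(ReB,ImB,ReM,ImM) iunitC /=; lra.
Qed.

Let two0 : 2%:R != 0 :> R[i]. Proof. by rewrite pnatr_eq0. Qed.

Let th_dot i j w : O w -> th i 0 w * th j 0 w + th i 1 w * th j 1 w + th i 2 w * th j 2 w = 0.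
Proof.
move=> Ow; have [x0 x1 x2] := th_eigen i Ow; have [y0 y1 y2] := th_eigen j Ow.
by have [] := eigen_cross iunitE two0 x0 x1 x2 y0 y1 y2.
Qed.
Let th_N i w : O w -> NC 0 w * th i 0 w + NC 1 w * th i 1 w + NC 2 w * th i 2 w = 0.
Proof.
move=> Ow; have [x0 x1 x2] := th_eigen i Ow.
by have [] := eigen_cross iunitE two0 x0 x1 x2 x0 x1 x2.
Qed.
Let th_prop k l w : O w -> th 0 k w * th 1 l w = th 0 l w * th 1 k w.
Proof.
move=> Ow; have [x0 x1 x2] := th_eigen 0 Ow; have [y0 y1 y2] := th_eigen 1 Ow.
have [_ _ [h0 h1 h2]] := eigen_cross iunitE two0 x0 x1 x2 y0 y1 y2.
by move: k l; apply: ord3P; apply: ord3P; rewrite ?h0 ?h1 ?h2 //.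
Qed.

(** Records the orientation through the area element [nu]; this later makes the Jacobian of the new
    coordinate positive. *)
Let th_area w : O w -> \sum_k Im (conjc (th 0 k w) * th 1 k w) = 2%:R * nu w.
Proof.
move=> Ow; have [m0 m1 m2] := mE 0 w; have [k0 k1 k2] := mE 1 w; have [n0 n1 n2] := nE w.
have u := unitN Ow.
rewrite sum3E !ImM !ReJ !ImJ !Re_th !Im_th m0 m1 m2 k0 k1 k2.
transitivity (2%:R * (N 0 w * normal Y w 0 0 + N 1 w * normal Y w 0 1 + N 2 w * normal Y w 0 2)).
  rewrite n0 n1 n2; move: (N 0 w) (N 1 w) (N 2 w) (a 0 0 w) (a 0 1 w) (a 0 2 w) (a 1 0 w) (a 1 1 w) (a 1 2 w).
  by move=> ? ? ? ? ? ? ? ? ?; ring.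
rewrite !nN //; congr (2%:R * _); rewrite -[RHS]mulr1 -u; ring.
Qed.

Let th_normal w (v : 'I_3 -> R[i]) : O w -> v 0 * th 0 0 w + v 1 * th 0 1 w + v 2 * th 0 2 w = 0 ->
  v 0 * v 0 + v 1 * v 1 + v 2 * v 2 = 0 -> v 0 * NC 0 w + v 1 * NC 1 w + v 2 * NC 2 w = 0.
Proof.
move=> Ow vt vv; have [m0 m1 m2] := mE 0 w; have u := unitN Ow; have o := orthN 0 w.
have l0 : a 0 0 w * a 0 0 w + a 0 1 w * a 0 1 w + a 0 2 w * a 0 2 w != 0.
  apply/eqP => E; move/eqP: E; rewrite -!expr2 !paddr_eq0 ?addr_ge0 ?sqr_ge0 // !sqrf_eq0.
  move=> /andP[/andP[/eqP h0 /eqP h1] /eqP h2]; case/eqP: (nY Ow).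
  have [n0 n1 n2] := nE w; apply/rowP; apply: ord3P; rewrite [RHS]mxE; [rewrite n0 h1 h2|rewrite n1 h0 h2|rewrite n2 h0 h1]; ring.
move: vt m0 m1 m2 u o l0; rewrite /th /NC.
move: (v 0) (v 1) (v 2) vv => v0 v1 v2 vv.
move: (m 0 0 w) (m 0 1 w) (m 0 2 w) (a 0 0 w) (a 0 1 w) (a 0 2 w) (N 0 w) (N 1 w) (N 2 w).
move=> k0 k1 k2 a0 a1 a2 n0 n1 n2 vt k0E k1E k2E u o l0.
exact: (isotropic_normal vv vt k0E k1E k2E u o l0).
Qed.

(** Only these properties of [theta] are used afterwards. The last one is the key to the behaviour
    at a non-umbilic point: an isotropic vector orthogonal to [theta] has no normal component. *)
Lemma minimal_forms : exists th : 'I_2 -> 'I_3 -> V -> R[i],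
  [/\ (forall i k, csmooth O (th i k)), (forall k w, O w -> cpartial 1 (th 0 k) w = cpartial 0 (th 1 k) w),
    (forall i k w, O w -> Re (th i k w) = partial i (fun u => Y u 0 k) w),
    (forall k l w, O w -> th 0 k w * th 1 l w = th 0 l w * th 1 k w) &
  [/\ (forall w, O w -> th 0 0 w * th 0 0 w + th 0 1 w * th 0 1 w + th 0 2 w * th 0 2 w = 0),
    (forall w, O w -> 0 < \sum_k Im (conjc (th 0 k w) * th 1 k w)),
    (forall i w, O w -> (unit_normal Y w 0 0)%:C * th i 0 w + (unit_normal Y w 0 1)%:C * th i 1 w + (unit_normal Y w 0 2)%:C * th i 2 w = 0) &
    (forall w (v : 'I_3 -> R[i]), O w -> v 0 * th 0 0 w + v 1 * th 0 1 w + v 2 * th 0 2 w = 0 ->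
      v 0 * v 0 + v 1 * v 1 + v 2 * v 2 = 0 ->
      v 0 * (unit_normal Y w 0 0)%:C + v 1 * (unit_normal Y w 0 1)%:C + v 2 * (unit_normal Y w 0 2)%:C = 0)]].
Proof.
exists th; split; [exact: sth|exact: th_closed|by move=> i k w _; exact: Re_th|by move=> k l w; exact: th_prop|split].
- by move=> w; exact: th_dot.
- by move=> w Ow; rewrite th_area // mulr_gt0 // nu0.
- by move=> i w; exact: th_N.
- by move=> w v; exact: th_normal.
Qed.
End MinimalPatch.

Section MinimalCanonical.
Context {R : realType}.
Local Notation V := ('rV[R]_2).
Local Notation Re := complex.Re.
Local Notation Im := complex.Im.
Local Notation iu := (@iunit R).

Lemma open_Re_gt0 (O : set V) (f : V -> R[i]) : open O -> csmooth O f -> open (O `&` [set u | 0 < Re (f u)]).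
Proof.
move=> oO sf; rewrite openE => w [Ow /= fw].
have n1 : nbhs w O by exact: open_nbhs_nbhs.
have c := smooth_continuous (proj1 sf) Ow.
have n2 : nbhs w [set u | 0 < Re (f u)].
  by apply: (c [set x : R | 0 < x]); apply: open_nbhs_nbhs; split; first exact: open_gt.
exact: (filterI n1 n2).
Qed.

Lemma rhol_subset (O O' : set V) r0 r1 (f : V -> R[i]) : O' `<=` O -> rhol O r0 r1 f -> rhol O' r0 r1 f.
Proof. by move=> sub [sf hf]; split=> [|w /sub]; [exact: csmooth_subset sub sf|exact: hf]. Qed.

Variables (O : set V) (oO : open O) (Y : V -> 'rV[R]_3) (w0 : V).
Hypotheses (sY : smooth_map_on O Y) (nY : forall w, O w -> normal Y w != 0)
  (tS : forall w, O w -> \tr (shape_op Y w) = 0) (Ow0 : O w0) (dS : \det (shape_op Y w0) != 0).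

Theorem minimal_canonical : exists (F T : V -> V) (r d : R) (P : 'I_3 -> V -> R[i]),
  [/\ [/\ 0 < r, 0 < d, box w0 r `<=` O & F w0 = 0], smooth_map_on (box w0 r) F /\ smooth_map_on (box 0 d) T,
      (forall y, box 0 d y -> box w0 r (T y) /\ F (T y) = y),
      (forall u, box w0 r u -> box 0 d (F u) -> T (F u) = u) &
      [/\ (forall u, box w0 r u -> 0 < jac_det F u),
      (forall y, box 0 d y -> 0 < jac_det T y) &
      canonical_on (box 0 d) (fun y => Y (T y)) P]].
Proof.
have [th [sth cth Rth pth [dth ath nth vth]]] := minimal_forms oO sY nY tS.
have [j thj] : exists j, th 0 j w0 != 0.
  apply: contrapT => h.
  have z k : th 0 k w0 = 0 by have [//|hj] := eqVneq (th 0 k w0) 0; case: h; exists k.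
  by have := ath w0 Ow0; rewrite big1 ?ltxx // => k _; rewrite z conjc0 mul0r.
pose r0 := th 0 j; pose r1 := th 1 j.
pose O1 := O `&` [set u | r0 u != 0].
have oO1 : open O1 := open_neq0 oO (sth 0 j).
have O1O : O1 `<=` O by move=> u [].
have nz w : O1 w -> r0 w != 0 by move=> [].
have s1 i k : csmooth O1 (th i k) := csmooth_subset O1O (sth i k).
have cl w : O1 w -> cpartial 1 r0 w = cpartial 0 r1 w by move=> /O1O; exact: cth.
(* All components of [theta] are multiples of the single closed form [rho = (r0, r1)], so these
   quotients are functions, holomorphic in the sense of [rhol]. *)
pose phi k u := th 0 k u / r0 u.
have sphi k : csmooth O1 (phi k) := csmooth_div oO1 nz (s1 0 k) (s1 0 j).
have ph0 k w : O1 w -> phi k w * r0 w = th 0 k w by move=> Ow; rewrite /phi mulfVK // nz.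
have ph1 k w : O1 w -> phi k w * r1 w = th 1 k w.
  move=> Ow; apply: (mulIf (nz w Ow)); rewrite mulrAC ph0 // /r1 /r0 [RHS]mulrC.
  exact: (pth k j w (O1O w Ow)).
have hphi k : rhol O1 r0 r1 (phi k).
  apply/(rhol_closed oO1 (s1 0 j) (s1 1 j) cl (sphi k)) => w Ow.
  rewrite (eq_cpartial oO1 1 Ow (ph0 k)) (eq_cpartial oO1 0 Ow (ph1 k)).
  exact: (cth k w (O1O w Ow)).
pose phi' k := rder r0 (phi k).
have hphi' k : rhol O1 r0 r1 (phi' k) := rhol_rder oO1 (s1 0 j) (s1 1 j) cl nz (hphi k).
have pp w : O1 w -> phi 0 w * phi 0 w + phi 1 w * phi 1 w + phi 2 w * phi 2 w = 0.
  move=> Ow; have n0 := nz w Ow; have n2 : r0 w * r0 w != 0 by rewrite mulf_neq0.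
  apply: (mulfI n2); rewrite mulr0 -[RHS](dth w (O1O w Ow)) -!(ph0 _ w Ow).
  by move: (phi 0 w) (phi 1 w) (phi 2 w) (r0 w) => a b c x; ring.
have pp' w : O1 w -> phi 0 w * phi' 0 w + phi 1 w * phi' 1 w + phi 2 w * phi' 2 w = 0.
  move=> Ow; have sq k := csmoothM oO1 (sphi k) (sphi k).
  have := eq_cpartial oO1 0 Ow pp; rewrite cpartial_cst.
  rewrite (cpartialD oO1 (csmoothD oO1 (sq 0) (sq 1)) (sq 2) 0 Ow) (cpartialD oO1 (sq 0) (sq 1) 0 Ow).
  have E k : cpartial 0 (fun u => phi k u * phi k u) w = phi' k w * r0 w * phi k w + phi k w * (phi' k w * r0 w).
    by rewrite (cpartialM oO1 (sphi k) (sphi k) 0 Ow) (rder0 nz (phi k) Ow).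
  rewrite !E => H; have n2 : 2%:R * r0 w != 0 by rewrite mulf_neq0 ?pnatr_eq0 // nz.
  apply: (mulfI n2); rewrite mulr0 -[RHS]H.
  by move: (phi 0 w) (phi 1 w) (phi 2 w) (phi' 0 w) (phi' 1 w) (phi' 2 w) (r0 w) => a b c x y z t; ring.
pose q u := phi' 0 u * phi' 0 u + phi' 1 u * phi' 1 u + phi' 2 u * phi' 2 u.
have hM k := rholM oO1 (hphi' k) (hphi' k).
have hq : rhol O1 r0 r1 q := rholD oO1 (rholD oO1 (hM 0) (hM 1)) (hM 2).
have O1w : O1 w0 by split.
(* If [phi'.phi' = 0] at the point, [phi'] is isotropic and orthogonal to [theta], hence to the
   normal [N]. Then [N] is orthogonal to all derivatives of [theta = phi rho], whose real parts are
   the second derivatives of the immersion, and the second fundamental form vanishes there. *)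
have q0 : q w0 != 0.
  apply/eqP => q0; pose Nw k : R[i] := (unit_normal Y w0 0 k)%:C.
  have vt : phi' 0 w0 * th 0 0 w0 + phi' 1 w0 * th 0 1 w0 + phi' 2 w0 * th 0 2 w0 = 0.
    rewrite -!(ph0 _ w0 O1w) -[RHS](mulr0 (r0 w0)) -(pp' w0 O1w).
    by move: (phi 0 w0) (phi 1 w0) (phi 2 w0) (phi' 0 w0) (phi' 1 w0) (phi' 2 w0) (r0 w0) => a b c x y z t; ring.
  have vn : phi' 0 w0 * Nw 0 + phi' 1 w0 * Nw 1 + phi' 2 w0 * Nw 2 = 0 := vth w0 (fun k => phi' k w0) Ow0 vt q0.
  have pn : phi 0 w0 * Nw 0 + phi 1 w0 * Nw 1 + phi 2 w0 * Nw 2 = 0.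
    apply: (mulfI (nz w0 O1w)); rewrite mulr0 -[RHS](nth 0 w0 Ow0) -!(ph0 _ w0 O1w) -/(Nw 0) -/(Nw 1) -/(Nw 2).
    by move: (phi 0 w0) (phi 1 w0) (phi 2 w0) (r0 w0) (Nw 0) (Nw 1) (Nw 2) => a b c x y z t; ring.
  pose rr (i : 'I_2) := if i == 0 then r0 else r1.
  have srr i : csmooth O1 (rr i) by move: i; apply: ord2P; [exact: (s1 0 j)|exact: (s1 1 j)].
  have thE i k w : O1 w -> th i k w = phi k w * rr i w.
    by move=> Ow; move: i; apply: ord2P; rewrite /rr /= ?ph0 ?ph1.
  have dphi l k : cpartial l (phi k) w0 = phi' k w0 * rr l w0.
    by move: l; apply: ord2P; rewrite /rr /=; [exact: (rder0 nz (phi k) O1w)|exact: (rder1 nz (hphi k) O1w)].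
  have dth' l i k : cpartial l (th i k) w0 = phi' k w0 * rr l w0 * rr i w0 + phi k w0 * cpartial l (rr i) w0.
    by rewrite (eq_cpartial oO1 l O1w (thE i k)) (cpartialM oO1 (sphi k) (srr i) l O1w) dphi.
  have sec0 l i : second_form Y w0 l i = 0.
    have E : cpartial l (th i 0) w0 * Nw 0 + cpartial l (th i 1) w0 * Nw 1 + cpartial l (th i 2) w0 * Nw 2 = 0.
      rewrite !dth'; transitivity ((phi' 0 w0 * Nw 0 + phi' 1 w0 * Nw 1 + phi' 2 w0 * Nw 2) * (rr l w0 * rr i w0)
        + (phi 0 w0 * Nw 0 + phi 1 w0 * Nw 1 + phi 2 w0 * Nw 2) * cpartial l (rr i) w0).
        by move: (cpartial l (rr i) w0) (phi 0 w0) (phi 1 w0) (phi 2 w0) (phi' 0 w0) (phi' 1 w0) (phi' 2 w0) (rr l w0) (rr i w0) (Nw 0) (Nw 1) (Nw 2) => *; ring.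
      by rewrite vn pn !mul0r addr0.
    have := congr1 (fun x => Re x) E; rewrite !ReD !ReM /= !mulr0 !subr0 => H.
    have sP k : partial l (partial i (fun u => Y u 0 k)) w0 = partial l (fun u => Re (th i k u)) w0.
      by apply: (eq_partial l oO Ow0) => u Ou; rewrite Rth.
    by rewrite mxE sum3E (sP 0) (sP 1) (sP 2).
  case/eqP: dS; have -> : shape_op Y w0 = 0.
    rewrite /shape_op; have -> : second_form Y w0 = 0 by apply/matrixP => l i; rewrite sec0 mxE.
    by rewrite mul0mx.
  by rewrite det0.
(* Dividing by [q w0] moves the values near 1, where the principal square root can be taken twice,
   and [c] restores the constant: this gives a smooth [om] with [om^4 = q]. *)
have [c cE] := fourth_root (q w0).
have c0 : c != 0 by apply/eqP => c0; move: q0; rewrite -cE c0 expr0n eqxx.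
pose qq u := (q w0)^-1 * q u.
have sqq : csmooth O1 qq := csmoothM oO1 (csmooth_cst oO1 _) (proj1 hq).
pose O2 := O1 `&` [set u | 0 < Re (qq u)].
have oO2 : open O2 := open_Re_gt0 oO1 sqq.
have O21 : O2 `<=` O1 by move=> u [].
have O2w : O2 w0 by split=> //=; rewrite /qq mulVf //= ltr01.
have qp u : O2 u -> 0 < Re (qq u) by move=> [].
have sqq2 := csmooth_subset O21 sqq.
have ss1 := csmooth_csqrt oO2 sqq2 qp.
have qp1 u : O2 u -> 0 < Re (csqrt (qq u)) by move=> Ou; apply: Re_csqrt; exact: qp.
have ss2 := csmooth_csqrt oO2 ss1 qp1.
pose om u := c * csqrt (csqrt (qq u)).
have som : csmooth O2 om := csmoothM oO2 (csmooth_cst oO2 c) ss2.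
have om4 u : O2 u -> om u ^+ 4 = q u.
  move=> Ou; have E : csqrt (csqrt (qq u)) ^+ 4 = qq u.
    by rewrite (exprM _ 2 2) (csqrtE (qp1 u Ou)) (csqrtE (qp u Ou)).
  by rewrite /om exprMn cE E; exact: mulVKf q0 (q u).
have om0 u : O2 u -> om u != 0.
  move=> Ou; rewrite mulf_neq0 //; apply/eqP => E; have := Re_csqrt (qp1 u Ou).
  by rewrite E ltxx.
have s2 i k : csmooth O2 (th i k) := csmooth_subset O21 (s1 i k).
have cl2 w : O2 w -> cpartial 1 r0 w = cpartial 0 r1 w by move=> /O21; exact: cl.
have nz2 w : O2 w -> r0 w != 0 by move=> /O21; exact: nz.
have hom : rhol O2 r0 r1 om := rhol_root oO2 som (rhol_subset O21 hq) om0 om4.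
(* Every component satisfies [theta_1 = theta_0 tau] with the same [tau = r1/r0], so the positive
   sum in the area identity is a positive multiple of [Im tau]. *)
have pos w : O2 w -> 0 < Im (conjc (r0 w) * r1 w).
  move=> Ow; have O1w' := O21 w Ow; have n0 := nz w O1w'.
  pose tau := r1 w / r0 w.
  have E k : Im (conjc (th 0 k w) * th 1 k w) = norm2c (th 0 k w) * Im tau.
    have -> : th 1 k w = th 0 k w * tau.
      rewrite -ph1 // -ph0 // /tau; move: (phi k w) (r0 w) (r1 w) n0 => x y z y0; by field.
    rewrite mulrA [conjc _ * _]mulrC -norm2cE; exact: ImZ.
  have := ath w (O1O w O1w'); rewrite (eq_bigr _ (fun k _ => E k)) -mulr_suml.
  rewrite pmulr_rgt0; last first.
    rewrite (bigD1 j) //= ltr_pwDl ?norm2c_gt0 //; apply: sumr_ge0 => k _; exact: norm2c_ge0.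
  by rewrite (E j) => t0; rewrite mulr_gt0 // norm2c_gt0.
have [F [T [r [d [[rp dp bO F0] [sF sT] FT TF [[jF jT cf] key]]]]]] :=
  isothermal_coordinate oO2 (s2 0 j) (s2 1 j) cl2 nz2 pos hom om0 O2w.
(* In the coordinate with [dz = om rho] this is [theta/dz], the null curve. The square of its
   derivative is [phi'.phi' / om^4 = 1], the other terms dropping out by
   [phi.phi = phi.phi' = 0]. *)
pose psi k u := phi k u / om u.
have hpsi k : rhol O2 r0 r1 (psi k) := rhol_div oO2 om0 (rhol_subset O21 (hphi k)) hom.
pose P k y := psi k (T y).
have od : open (box (0 : V) d) by exact: open_box_set.
have TO y : box 0 d y -> O2 (T y) by move=> /FT[/bO].
have dP k y : box 0 d y -> cpartial 0 (P k) y = rder r0 (psi k) (T y) / om (T y) /\ cpartial 1 (P k) y = iu * (rder r0 (psi k) (T y) / om (T y)).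
  by move=> dy; exact: (cf _ (hpsi k) y dy).
exists F, T, r, d, P; split=> //.
  by split=> //; apply: subset_trans bO (subset_trans O21 O1O).
split=> //; split.
- move=> k; apply: holP; first exact: (csmooth_comp od oO2 (proj1 (hpsi k)) TO sT).
  by exists (fun y => rder r0 (psi k) (T y) / om (T y)) => y; exact: dP.
- move=> k y dy; have Oy := TO y dy; have O1y := O21 _ Oy; have OO := O1O _ O1y.
  have E i : partial i (fun v => Y (T v) 0 k) y = Re (phi k (T y) * ((if i == 0 then 1 else iu) / om (T y))).
    have dY : differentiable (fun v => Y v 0 k) (T y) := smooth_differentiable oO (sY k) OO.
    have dT a : differentiable (fun v => T v 0 a) y := smooth_differentiable od (sT a) dy.
    rewrite (partial_comp (g := fun v => Y v 0 k) i dY dT) -(key i y dy) mulrDr !mulrA ph0 // ph1 //.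
    by rewrite ReD ![_ * _%:C]mulrC !ReZ !Rth // mulrC [X in _ + X]mulrC.
  rewrite !E /= /P /psi mul1r; split=> //.
  rewrite mulrCA ReM iunitC /= mul0r mul1r sub0r //.
- move=> y dy; have Oy := TO y dy; rewrite /vdot sum3E /P /psi.
  have := pp _ (O21 _ Oy); have := om0 _ Oy; move: (om (T y)) (phi 0 (T y)) (phi 1 (T y)) (phi 2 (T y)) => o a b e o0 E.
  transitivity ((a * a + b * b + e * e) / o ^+ 2); first by field.
  by rewrite E mul0r.
- move=> y dy; have Oy := TO y dy; have O1y := O21 _ Oy; rewrite /vdot sum3E.
  have D k : dz (P k) y = (phi' k (T y) * om (T y) - phi k (T y) * rder r0 om (T y)) / om (T y) ^+ 3.
    have [h0 h1] := dP k y dy; rewrite (dzE h0 h1) /rder.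
    have sp := csmooth_subset O21 (sphi k); have sv := csmoothV oO2 om0 som.
    rewrite (cpartialM oO2 sp sv 0 Oy) (cpartialV oO2 0 om0 som Oy).
    rewrite /phi' /rder; move: (nz2 _ Oy) (om0 _ Oy).
    move: (cpartial 0 (phi k) (T y)) (cpartial 0 om (T y)) (r0 (T y)) (om (T y)) (phi k (T y)) => a b x o f x0 o0.
    by field; rewrite x0 o0.
  rewrite !D; have := pp _ O1y; have := pp' _ O1y; have := om4 _ Oy; have := om0 _ Oy; rewrite /q.
  move: (rder r0 om (T y)) (om (T y)) (phi 0 (T y)) (phi 1 (T y)) (phi 2 (T y)) (phi' 0 (T y)) (phi' 1 (T y)) (phi' 2 (T y)).
  move=> o' o a b e a' b' e' o0 E4 E01 E00.
  transitivity (((a' * a' + b' * b' + e' * e') * o ^+ 2 - 2%:R * o * o' * (a * a' + b * b' + e * e') + o' ^+ 2 * (a * a + b * b + e * e)) / o ^+ 6).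
    by field.
  rewrite E01 E00 -E4; by field.
Qed.
End MinimalCanonical.

(** * Approximation by immersions with polynomial potential *)

Section WeierstrassODE.
Context {R : realType}.
Local Notation V := ('rV[R]_2).

Variables (a b c : 'I_3 -> R[i]).
Let dot (x y : 'I_3 -> R[i]) := \sum_j x j * y j.
Hypotheses (aa : dot a a = 0) (ab : dot a b = 0) (bb : dot b b = 1) (bc : dot b c = 0) (cc : dot c c = 0)
  (ac : dot a c = - 2%:R^-1).

Variables (y1 y2 e1 e2 s : V -> R[i]).
Hypotheses (h1 : hol [set: V] y1) (h2 : hol [set: V] y2) (he1 : hol [set: V] e1) (he2 : hol [set: V] e2).
Hypotheses (dy1 : forall u, dz y1 u = e1 u) (dy2 : forall u, dz y2 u = e2 u)
  (de1 : forall u, dz e1 u = - s u * y1 u) (de2 : forall u, dz e2 u = - s u * y2 u).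
Hypotheses (y10 : y1 0 = 1) (y20 : y2 0 = 0) (e10 : e1 0 = 0) (e20 : e2 0 = 1).

Let oT : open [set: V]. Proof. exact: openT. Qed.

(** The solutions satisfy [y'' = - s y], so [s] is half of the potential here; [c] and [b] are the
    initial values of the curve and of its derivative. *)
Definition wdata k u : R[i] := c k * (y1 u * y1 u) + b k * (y1 u * y2 u) + a k * (y2 u * y2 u).

Let dzc (f g h : V -> R[i]) (x y z : R[i]) u : hol [set: V] f -> hol [set: V] g -> hol [set: V] h ->
  dz (fun u => x * f u + y * g u + z * h u) u = x * dz f u + y * dz g u + z * dz h u.
Proof.
move=> hf hg hh; have Z (k : R[i]) e : hol [set: V] e -> dz (fun u => k * e u) u = k * dz e u.
  by move=> he; exact: (dzZ oT (proj1 he) I k).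
rewrite (dzD oT (proj1 (holD oT (holZ oT x hf) (holZ oT y hg))) (proj1 (holZ oT z hh)) I).
by rewrite (dzD oT (proj1 (holZ oT x hf)) (proj1 (holZ oT y hg)) I) !Z.
Qed.

Let hM f g : hol [set: V] f -> hol [set: V] g -> hol [set: V] (fun u => f u * g u).
Proof. exact: holM. Qed.
Let dM f g u : hol [set: V] f -> hol [set: V] g -> dz (fun u => f u * g u) u = dz f u * g u + f u * dz g u.
Proof. by move=> hf hg; exact: (dzM oT (proj1 hf) (proj1 hg) I). Qed.

Lemma hol_wdata k : hol [set: V] (wdata k).
Proof. exact: (holD oT (holD oT (holZ oT (c k) (hM h1 h1)) (holZ oT (b k) (hM h1 h2))) (holZ oT (a k) (hM h2 h2))). Qed.

Lemma dz_wdata k u : dz (wdata k) u = c k * (e1 u * y1 u + y1 u * e1 u) + b k * (e1 u * y2 u + y1 u * e2 u) + a k * (e2 u * y2 u + y2 u * e2 u).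
Proof.
rewrite (dzc (c k) (b k) (a k) u (hM h1 h1) (hM h1 h2) (hM h2 h2)).
by rewrite (dM u h1 h1) (dM u h1 h2) (dM u h2 h2) dy1 dy2.
Qed.

Lemma dzdz_wdata k u : dz (dz (wdata k)) u =
  2%:R * (c k * (e1 u * e1 u - s u * (y1 u * y1 u)) + b k * (e1 u * e2 u - s u * (y1 u * y2 u)) + a k * (e2 u * e2 u - s u * (y2 u * y2 u))).
Proof.
have hs f g f' g' : hol [set: V] f -> hol [set: V] g -> hol [set: V] f' -> hol [set: V] g' -> hol [set: V] (fun u => f u * g u + f' u * g' u).
  by move=> hf hg hf' hg'; exact: (holD oT (hM hf hg) (hM hf' hg')).
have ds f g f' g' : hol [set: V] f -> hol [set: V] g -> hol [set: V] f' -> hol [set: V] g' ->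
   dz (fun u => f u * g u + f' u * g' u) u = dz f u * g u + f u * dz g u + (dz f' u * g' u + f' u * dz g' u).
  move=> hf hg hf' hg'; rewrite (dzD oT (proj1 (hM hf hg)) (proj1 (hM hf' hg')) I).
  by rewrite (dM u hf hg) (dM u hf' hg').
rewrite (eq_dz oT I (fun v _ => dz_wdata k v)).
rewrite (dzc (c k) (b k) (a k) u (hs _ _ _ _ he1 h1 h1 he1) (hs _ _ _ _ he1 h2 h1 he2) (hs _ _ _ _ he2 h2 h2 he2)).
rewrite (ds _ _ _ _ he1 h1 h1 he1) (ds _ _ _ _ he1 h2 h1 he2) (ds _ _ _ _ he2 h2 h2 he2).
rewrite de1 de2 dy1 dy2.
by move: (c k) (b k) (a k) (e1 u) (e2 u) (y1 u) (y2 u) (s u) => *; ring.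
Qed.

Lemma wronskian u : y1 u * e2 u - e1 u * y2 u = 1.
Proof.
pose W u := y1 u * e2 u - e1 u * y2 u.
have hW : hol [set: V] W := holB oT (hM h1 he2) (hM he1 h2).
have dW v : dz W v = 0.
  rewrite (dzB oT (proj1 (hM h1 he2)) (proj1 (hM he1 h2)) I) (dM v h1 he2) (dM v he1 h2) de1 de2 dy1 dy2.
  by move: (e1 v) (e2 v) (y1 v) (y2 v) (s v) => *; ring.
have W0 : W 0 = 1 by rewrite /W y10 y20 e20 mulr1 mulr0 subr0.
have r0 : 0 < norm1 u + 1 by rewrite ltr_wpDl // norm1_ge0.
rewrite -W0; apply: (@dz0_const R [set: V] W 0 (norm1 u + 1)) => // i.
by rewrite mxE subr0; apply: le_lt_trans (norm1_coord u i) _; rewrite ltrDl.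
Qed.

(** The polar form of the discriminant [q^2 - p r]. The discriminant vanishes on
    [(y1^2, y1 y2, y2^2)], which gives nullity, and is the squared Wronskian on the derivative of
    this triple, which gives [Phi'.Phi' = 1]. *)
Let quad (p q r p' q' r' : R[i]) :
  \sum_k (c k * p + b k * q + a k * r) * (c k * p' + b k * q' + a k * r') = q * q' - (p * r' + p' * r) / 2%:R.
Proof.
transitivity (p * p' * dot c c + q * q' * dot b b + r * r' * dot a a + (p * q' + p' * q) * dot b c + (p * r' + p' * r) * dot a c + (q * r' + q' * r) * dot a b).
  rewrite /dot !mulr_sumr -!big_split /=; apply: eq_bigr => k _; ring.
by rewrite aa ab bb bc cc ac; field.
Qed.

Lemma wdata_null u : vdot wdata wdata u = 0.
Proof. by rewrite /vdot quad; field. Qed.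

Lemma wdata_unit u : vdot (fun k => dz (wdata k)) (fun k => dz (wdata k)) u = 1.
Proof.
rewrite /vdot (eq_bigr _ (fun k _ => f_equal2 *%R (dz_wdata k u) (dz_wdata k u))) quad.
transitivity ((y1 u * e2 u - e1 u * y2 u) ^+ 2).
  by move: (e1 u) (e2 u) (y1 u) (y2 u) => *; field.
by rewrite wronskian expr1n.
Qed.

Lemma wdata_potential u : potential wdata u = 2%:R * s u.
Proof.
rewrite /potential /vdot (eq_bigr _ (fun k _ => f_equal2 *%R (dzdz_wdata k u) (dzdz_wdata k u))).
transitivity ((\sum_k (4%:R * ((c k * (e1 u * e1 u - s u * (y1 u * y1 u)) + b k * (e1 u * e2 u - s u * (y1 u * y2 u)) + a k * (e2 u * e2 u - s u * (y2 u * y2 u)))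
   * (c k * (e1 u * e1 u - s u * (y1 u * y1 u)) + b k * (e1 u * e2 u - s u * (y1 u * y2 u)) + a k * (e2 u * e2 u - s u * (y2 u * y2 u)))))) / 2%:R).
  by congr (_ / _); apply: eq_bigr => k _; move: (_ + _) => x; ring.
rewrite -mulr_sumr quad.
transitivity (2%:R * s u * (y1 u * e2 u - e1 u * y2 u) ^+ 2).
  by move: (e1 u) (e2 u) (y1 u) (y2 u) (s u) => *; field.
by rewrite wronskian expr1n mulr1.
Qed.

Lemma wdata0 k : wdata k 0 = c k.
Proof. by rewrite /wdata y10 y20 !(mulr1, mulr0, addr0). Qed.
Lemma dz_wdata0 k : dz (wdata k) 0 = b k.
Proof. by rewrite dz_wdata y10 y20 e10 e20 !(mulr1, mulr0, mul0r, addr0, add0r). Qed.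
Lemma dzdz_wdata0 k : dz (dz (wdata k)) 0 = 2%:R * (a k - s 0 * c k).
Proof.
rewrite dzdz_wdata y10 y20 e10 e20.
by move: (s 0) (c k) (b k) (a k) => *; ring.
Qed.

Lemma wdata_bound k u : cabs (y1 u) <= 2%:R -> cabs (y2 u) <= 2%:R ->
  cabs (wdata k u) <= 4%:R * (cabs (c k) + cabs (b k) + cabs (a k)).
Proof.
move=> b1 b2.
have pr x y : cabs x <= 2%:R -> cabs y <= 2%:R -> cabs (x * y) <= 4%:R :> R.
  move=> hx hy; rewrite cabsM; have -> : 4%:R = 2%:R * 2%:R :> R by ring.
  by apply: ler_pM; rewrite ?cabs_ge0.
have tm (z x y : R[i]) : cabs x <= 2%:R -> cabs y <= 2%:R -> cabs (z * (x * y)) <= 4%:R * cabs z.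
  by move=> hx hy; rewrite (cabsM z) mulrC; apply: ler_wpM2r; [exact: cabs_ge0|exact: pr].
rewrite /wdata !mulrDr; apply: le_trans (cabsD _ _) _; apply: lerD; last exact: tm.
by apply: le_trans (cabsD _ _) _; apply: lerD; exact: tm.
Qed.
End WeierstrassODE.

Section PolynomialPotential.
Context {R : realType}.
Local Notation V := ('rV[R]_2).

(** The last clause isolates the uniform estimate: coefficients of both basic solutions bounded by 1
    at radius [r] give solutions bounded by 2 on the half radius, hence a bound on the curve in
    terms of the initial vectors alone. *)
Lemma weierstrass_data (S : {poly R[i]}) (a b c : 'I_3 -> R[i]) :
  \sum_j a j * a j = 0 -> \sum_j a j * b j = 0 -> \sum_j b j * b j = 1 -> \sum_j b j * c j = 0 ->
  \sum_j c j * c j = 0 -> \sum_j a j * c j = - 2%:R^-1 ->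
  exists P : 'I_3 -> V -> R[i],
  [/\ (forall k, hol [set: V] (P k)),
      (forall u, vdot P P u = 0) /\ (forall u, vdot (fun k => dz (P k)) (fun k => dz (P k)) u = 1),
      (forall u, potential P u = S.[zc u]),
      (forall k, [/\ P k 0 = c k, dz (P k) 0 = b k & dz (dz (P k)) 0 = 2%:R * a k - S.[0] * c k]) &
      forall r k u, 0 < r -> r <= 1 ->
        (forall m, cabs (ode_seq S 1 0 m) * r ^+ m <= 1) -> (forall m, cabs (ode_seq S 0 1 m) * r ^+ m <= 1) ->
        cabs (zc u) <= r / 2%:R -> cabs (P k u) <= 4%:R * (cabs (c k) + cabs (b k) + cabs (a k))].
Proof.
move=> aa ab bb bc cc ac.
pose s (u : V) := S.[zc u] / 2%:R.
have oT : open [set: V] := openT.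
have h1 : hol [set: V] (ode_sol S 1 0) := hol_ode_sol S 1 0.
have h2 : hol [set: V] (ode_sol S 0 1) := hol_ode_sol S 0 1.
have he1 : hol [set: V] (dz (ode_sol S 1 0)) := hol_dz oT h1.
have he2 : hol [set: V] (dz (ode_sol S 0 1)) := hol_dz oT h2.
have de1 u : dz (dz (ode_sol S 1 0)) u = - s u * ode_sol S 1 0 u := dzdz_ode_sol S 1 0 u.
have de2 u : dz (dz (ode_sol S 0 1)) u = - s u * ode_sol S 0 1 u := dzdz_ode_sol S 0 1 u.
have y10 : ode_sol S 1 0 0 = 1 := ode_sol0 S 1 0.
have y20 : ode_sol S 0 1 0 = 0 := ode_sol0 S 0 1.
have e10 : dz (ode_sol S 1 0) 0 = 0 := dz_ode_sol0 S 1 0.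
have e20 : dz (ode_sol S 0 1) 0 = 1 := dz_ode_sol0 S 0 1.
have d1 u : dz (ode_sol S 1 0) u = dz (ode_sol S 1 0) u := erefl.
have d2 u : dz (ode_sol S 0 1) u = dz (ode_sol S 0 1) u := erefl.
exists (wdata a b c (ode_sol S 1 0) (ode_sol S 0 1)); split.
- exact: (hol_wdata a b c h1 h2).
- split=> u.
    exact: (wdata_null aa ab bb bc cc ac (ode_sol S 1 0) (ode_sol S 0 1) u).
  exact: (wdata_unit aa ab bb bc cc ac h1 h2 he1 he2 d1 d2 de1 de2 y10 y20 e20).
- move=> u; rewrite (wdata_potential aa ab bb bc cc ac h1 h2 he1 he2 d1 d2 de1 de2 y10 y20 e20).
  by rewrite /s mulrCA mulfV ?mulr1 // pnatr_eq0.
- move=> k; split.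
  + exact: (wdata0 a b c y10 y20).
  + exact: (dz_wdata0 a b c h1 h2 d1 d2 y10 y20 e10 e20).
  + rewrite (dzdz_wdata0 a b c h1 h2 he1 he2 d1 d2 de1 de2 y10 y20 e10 e20) /s zc0.
    by move: (S.[0]) (c k) (a k) => *; field.
- move=> r k u r0 r1 B1 B2 hu; apply: wdata_bound.
    by rewrite -[2%:R]mulr1; exact: (ode_sol_bound r0 ler01 B1 hu).
  by rewrite -[2%:R]mulr1; exact: (ode_sol_bound r0 ler01 B2 hu).
Qed.
End PolynomialPotential.

Section Primitive.
Context {R : realType}.
Local Notation V := ('rV[R]_2).
Local Notation Re := complex.Re.
Local Notation Im := complex.Im.
Local Notation iu := (@iunit R).

(** The form [Re (Phi dz) = Re Phi dx - Im Phi dy] is closed by the Cauchy-Riemann equations. *)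
Lemma weierstrass_primitive (P : 'I_3 -> V -> R[i]) (d : R) (p : 'rV[R]_3) : 0 < d -> (forall k, hol [set: V] (P k)) ->
  (forall u, vdot P P u = 0) -> (forall u, vdot (fun k => dz (P k)) (fun k => dz (P k)) u = 1) ->
  exists Y : V -> 'rV[R]_3, [/\ smooth_map_on (box 0 d) Y, Y 0 = p & canonical_on (box 0 d) Y P].
Proof.
move=> d0 hP nP uP; have oT : open [set: V] := openT.
have G k : exists F : V -> R, [/\ smooth_on (box 0 d) F, F 0 = 0, forall u, box 0 d u -> partial 0 F u = Re (P k u) &
    forall u, box 0 d u -> partial 1 F u = - Im (P k u)].
  have sR := proj1 (proj1 (hP k)); have sI := proj2 (proj1 (hP k)).
  apply: (closed_form_primitive oT sR (smoothN oT sI)) => // u _.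
  have dI : differentiable (fun v => Im (P k v)) u := smooth_differentiable oT sI I.
  rewrite (partialN 0 dI) -Re_cpartial -Im_cpartial (dz_cp0 (hP k) I) (dz_cp1 (hP k) I).
  by rewrite (ReM iu (dz (P k) u)) iunitC /= mul0r mul1r sub0r.
have [F HF] := choice G.
have ob : open (box (0 : V) d) by exact: open_box_set.
have E k : (fun u => (p + \row_j F j u) 0 k) = fun u => p 0 k + F k u.
  by apply/funext => u; rewrite !mxE.
exists (fun u => p + \row_j F j u); split.
- move=> k; rewrite E; case: (HF k) => sF _ _ _.
  exact: (smoothD ob (smooth_cst ob (p 0 k)) sF).
- by apply/rowP => k; rewrite !mxE; case: (HF k) => _ -> _ _; rewrite addr0.
- split=> [k|k u bu|u _|u _] //.
    by apply: hol_subset (hP k).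
  rewrite E; case: (HF k) => sF _ F0 F1.
  have dF := smooth_differentiable ob sF bu.
  have dp := smooth_differentiable ob (smooth_cst ob (p 0 k)) bu.
  by rewrite !(partialD _ dp dF) !partial_cst !add0r F0 // F1.
Qed.
End Primitive.

(** * Jets of solutions of the third-order equation *)

Section Jets.
Context {R : realType}.
Local Notation V := ('rV[R]_2).
Implicit Types (f g : V -> R[i]).

Variables (O : set V) (oO : open O) (w : V) (Ow : O w).

Lemma eq_dzn j f g u : O u -> (forall v, O v -> f v = g v) -> dzn j f u = dzn j g u.
Proof.
elim: j u => [|j IH] u Ou h; first exact: h.
by rewrite !dznS; apply: (eq_dz oO Ou) => v Ov; exact: IH.
Qed.

Definition same_jet J f g := forall j, (j < J)%N -> dzn j f w = dzn j g w.

Lemma same_jet_le J J' f g : (J' <= J)%N -> same_jet J f g -> same_jet J' f g.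
Proof. by move=> h e j jJ; apply: e; exact: leq_trans jJ h. Qed.

Lemma same_jet_dz J f g : same_jet J.+1 f g -> same_jet J (dz f) (dz g).
Proof. by move=> h j jJ; rewrite -!dznSr; exact: h. Qed.

Lemma same_jetS J f g : f w = g w -> same_jet J (dz f) (dz g) -> same_jet J.+1 f g.
Proof. by move=> h0 h [|j] // jJ; rewrite !dznSr; exact: h. Qed.

Lemma same_jet_eq J f g f' g' : (forall u, O u -> f u = f' u) -> (forall u, O u -> g u = g' u) ->
  same_jet J f' g' -> same_jet J f g.
Proof. by move=> hf hg h j jJ; rewrite (eq_dzn j Ow hf) (eq_dzn j Ow hg); exact: h. Qed.

Lemma dzn_add j f g u : hol O f -> hol O g -> O u -> dzn j (fun v => f v + g v) u = dzn j f u + dzn j g u.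
Proof.
elim: j f g => [|j IH] f g hf hg Ou //.
rewrite !dznSr (eq_dzn j Ou (fun v Ov => dzD oO (proj1 hf) (proj1 hg) Ov)).
exact: (IH _ _ (hol_dz oO hf) (hol_dz oO hg) Ou).
Qed.

Lemma dzn_sub j f g u : hol O f -> hol O g -> O u -> dzn j (fun v => f v - g v) u = dzn j f u - dzn j g u.
Proof.
elim: j f g => [|j IH] f g hf hg Ou //.
rewrite !dznSr (eq_dzn j Ou (fun v Ov => dzB oO (proj1 hf) (proj1 hg) Ov)).
exact: (IH _ _ (hol_dz oO hf) (hol_dz oO hg) Ou).
Qed.

Lemma same_jetD J f g f' g' : hol O f -> hol O g -> hol O f' -> hol O g' ->
  same_jet J f f' -> same_jet J g g' -> same_jet J (fun u => f u + g u) (fun u => f' u + g' u).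
Proof.
move=> hf hg hf' hg' e e' j jJ; rewrite (dzn_add j hf hg Ow) (dzn_add j hf' hg' Ow).
by rewrite (e j jJ) (e' j jJ).
Qed.

(** Induction on the order with a single differentiation at each step, so that only the first-order
    product rule is needed. *)
Lemma same_jetM J f g f' g' : hol O f -> hol O g -> hol O f' -> hol O g' ->
  same_jet J f f' -> same_jet J g g' -> same_jet J (fun u => f u * g u) (fun u => f' u * g' u).
Proof.
elim: J f g f' g' => [|J IH] f g f' g' hf hg hf' hg' e e' //.
apply: same_jetS; first by rewrite [f w](e 0%N) // [g w](e' 0%N).
have L : (J <= J.+1)%N by [].
have d x := hol_dz oO (f := x).
apply: (same_jet_eq (fun u Ou => dzM oO (proj1 hf) (proj1 hg) Ou) (fun u Ou => dzM oO (proj1 hf') (proj1 hg') Ou)).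
apply: (same_jetD (holM oO (d _ hf) hg) (holM oO hf (d _ hg)) (holM oO (d _ hf') hg') (holM oO hf' (d _ hg'))).
  exact: (IH _ _ _ _ (d _ hf) hg (d _ hf') hg' (same_jet_dz e) (same_jet_le L e')).
exact: (IH _ _ _ _ hf (d _ hg) hf' (d _ hg') (same_jet_le L e) (same_jet_dz e')).
Qed.

(** The equation expresses every derivative from the third on through lower ones. The derivative of
    [s] of order [e] is consumed by the term [s' f], so agreement of the potentials up to order [e]
    yields agreement of the solutions up to order [e + 2]. *)
Lemma third_order_jet f g s t e : hol O f -> hol O g -> hol O s -> hol O t ->
  (forall u, O u -> dzn 3 f u = - (2%:R * (s u * dz f u) + dz s u * f u)) ->
  (forall u, O u -> dzn 3 g u = - (2%:R * (t u * dz g u) + dz t u * g u)) ->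
  same_jet 3 f g -> same_jet e.+1 s t -> same_jet (e + 3) f g.
Proof.
move=> hf hg hs ht Ef Eg.
have d x := hol_dz oO (f := x).
have fl a b (ha : hol O a) (hb : hol O b) : hol O (fun u => -2%:R * (a u * dz b u)).
  exact: (holZ oO (- 2%:R) (holM oO ha (d _ hb))).
have gl a b (ha : hol O a) (hb : hol O b) : hol O (fun u => (-1) * (dz a u * b u)).
  exact: (holZ oO (-1) (holM oO (d _ ha) hb)).
have cj J c : same_jet J (fun=> c) (fun=> c) by [].
elim: e => [|e IH] e3 st //.
have /IH {}IH := e3.
have st' := same_jet_le (leqnSn e.+1) st.
have {}IH := IH st'.
have Ee x y : - (2%:R * x + y) = -2%:R * x + (-1) * y :> R[i] by ring.
have Ef' u : O u -> dz (dz (dz f)) u = -2%:R * (s u * dz f u) + (-1) * (dz s u * f u).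
  by move=> Ou; rewrite -Ee; exact: (Ef u Ou).
have Eg' u : O u -> dz (dz (dz g)) u = -2%:R * (t u * dz g u) + (-1) * (dz t u * g u).
  by move=> Ou; rewrite -Ee; exact: (Eg u Ou).
rewrite addSn addnS addnS addnS addn0.
have L1 : (e.+1 <= e + 3)%N by rewrite addnS ltnS leq_addr.
have L2 : (e.+2 <= e + 3)%N by rewrite -addn2 leq_add2l.
have f0 : same_jet e.+1 f g := same_jet_le L1 IH.
have f1 : same_jet e.+1 (dz f) (dz g) := same_jet_dz (same_jet_le L2 IH).
apply: same_jetS; first exact: (e3 0%N).
apply: same_jetS; first exact: (e3 1%N).
apply: same_jetS; first exact: (e3 2%N).
apply: (same_jet_eq Ef' Eg').
have c2 := hol_cst oO (- 2%:R : R[i]); have c1 := hol_cst oO (- 1 : R[i]).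
apply: (same_jetD (fl _ _ hs hf) (gl _ _ hs hf) (fl _ _ ht hg) (gl _ _ ht hg)).
  apply: (same_jetM c2 (holM oO hs (d _ hf)) c2 (holM oO ht (d _ hg)) (cj _ _)).
  exact: (same_jetM hs (d _ hf) ht (d _ hg) st' f1).
apply: (same_jetM c1 (holM oO (d _ hs) hf) c1 (holM oO (d _ ht) hg) (cj _ _)).
exact: (same_jetM (d _ hs) hf (d _ ht) hg (same_jet_dz st) f0).
Qed.

(** Differentiating the Gram table once more gives [Phi'''.Phi = 0], [Phi'''.Phi' = - 2 s] and
    [Phi'''.Phi'' = s']; [frame_expand] reads off the coefficients. *)
Lemma canonical_third (Y : V -> 'rV[R]_3) (P : 'I_3 -> V -> R[i]) j u : canonical_on O Y P -> O u ->
  dzn 3 (P j) u = - (2%:R * (potential P u * dz (P j) u) + dz (potential P) u * P j u).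
Proof.
move=> cY Ou.
pose P1 j := dz (P j); pose P2 j := dz (P1 j); pose P3 j := dz (P2 j).
have hP k : hol O (P k) by case: cY.
have h1 k : hol O (P1 k) := hol_dz oO (hP k).
have h2 k : hol O (P2 k) := hol_dz oO (h1 k).
have E22 v : vdot P2 P2 v = 2%:R * potential P v.
  by rewrite /potential mulrCA mulfV ?mulr1 // pnatr_eq0.
have E03 : vdot P3 P u = 0.
  have := dz_vdot oO (fun k => proj1 (hP k)) (fun k => proj1 (h2 k)) Ou.
  rewrite (eq_dz oO Ou (fun v Ov => vdot02 oO cY Ov)) dz_cst (vdot12 oO cY Ou) add0r.
  by rewrite vdotC => <-.
have E13 : vdot P3 P1 u = - (2%:R * potential P u).
  have Z : dz (vdot P1 P2) u = 0 := etrans (eq_dz oO Ou (fun v Ov => vdot12 oO cY Ov)) (dz_cst 0 u).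
  have D : vdot P2 P2 u + vdot P1 P3 u = 0 :=
    etrans (esym (dz_vdot oO (fun k => proj1 (h1 k)) (fun k => proj1 (h2 k)) Ou)) Z.
  have sol (x y : R[i]) : x + y = 0 -> y = - x by move/eqP; rewrite addrC addr_eq0 => /eqP.
  exact: (sol _ _ (etrans (f_equal2 +%R (esym (E22 u)) (vdotC P3 P1 u)) D)).
have E23 : vdot P3 P2 u = dz (potential P) u.
  have hp := hol_potential oO cY.
  have Z : dz (vdot P2 P2) u = 2%:R * dz (potential P) u :=
    etrans (eq_dz oO Ou (fun v _ => E22 v)) (dzZ oO (proj1 hp) Ou 2%:R).
  have D : 2%:R * dz (potential P) u = vdot P3 P2 u + vdot P2 P3 u :=
    etrans (esym Z) (dz_vdot oO (fun k => proj1 (h2 k)) (fun k => proj1 (h2 k)) Ou).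
  have sol (x y : R[i]) : 2%:R * x = y + y -> y = x.
    move=> h; have /mulfI -> // : 2%:R * x = 2%:R * y by rewrite h; ring.
  exact: (sol _ _ (etrans D (f_equal2 (fun x y : R[i] => x + y) (erefl (vdot P3 P2 u)) (vdotC P2 P3 u)))).
have F := @frame_expand R[i] (fun k => P k u) (fun k => P1 k u) (fun k => P2 k u) (fun k => P3 k u) (potential P u)
  (vdot00 cY Ou) (vdot01 oO cY Ou) (vdot02 oO cY Ou) (vdot11 cY Ou) (vdot12 oO cY Ou) (E22 u) j.
transitivity (P3 j u) => //; rewrite F.
have -> : \sum_k P3 k u * P2 k u = dz (potential P) u := E23.
have -> : \sum_k P3 k u * P k u = 0 := E03.
have -> : \sum_k P3 k u * P1 k u = - (2%:R * potential P u) := E13.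
by rewrite -/(P1 j); move: (P1 j u) (P j u) (potential P u) (dz (potential P) u) => *; ring.
Qed.

End Jets.

Section Approximants.
Context {R : realType}.
Local Notation V := ('rV[R]_2).
Local Notation Re := complex.Re.
Local Notation Im := complex.Im.

Lemma dzn_horner (p : {poly R[i]}) j : dzn j (fun u : V => p.[zc u]) = fun u => p^`(j).[zc u].
Proof.
elim: j p => [|j IH] p //.
rewrite dznSr derivSn -IH; congr (dzn j _); apply/funext => u; exact: dz_horner.
Qed.

Lemma dzn_horner0 (p : {poly R[i]}) j : dzn j (fun u : V => p.[zc u]) 0 = (j`!)%:R * p`_j.
Proof. by rewrite dzn_horner zc0 horner_coef0 coef_derivn addn0 ffactnn mulr_natl. Qed.

Lemma hol_bounded_disc (O : set V) (f : V -> R[i]) w (r : R) : open O -> hol O f -> 0 <= r -> cdisc w r `<=` O ->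
  exists2 B : R, 0 <= B & forall u, cdisc w r u -> cabs (f u) <= B.
Proof.
move=> oO hf r0 rO; pose K := [set u | dist2 u w <= r ^+ 2].
have KO u : K u -> O u by move=> Ku; apply: rO; apply/(cdisc_dist2 w u r0).
have Kw : K w by apply/(cdisc_dist2 w w r0); exact: cdisc_center.
have cU : {within K, continuous (fun u => norm2c (f u))}.
  apply: continuous_in_subspaceT => u; rewrite inE => Ku.
  apply: differentiable_continuous; exact: (smooth_differentiable oO (smooth_norm2c oO (proj1 hf)) (KO u Ku)).
have [|||v] := @EVT_max_rV R 2 (fun u => norm2c (f u)) K; [by exists w|exact: compact_disc|exact: cU|].
rewrite inE => Kv vmax; exists (cabs (f v)) => [|u ru]; first exact: cabs_ge0.
rewrite /cabs ler_wsqrtr //; apply: vmax; rewrite inE; exact/(cdisc_dist2 w u r0).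
Qed.

Lemma cdisc0 (r : R) u : cdisc (0 : V) r u <-> cabs (zc u) <= r.
Proof. by rewrite /cdisc /= zc0 subr0. Qed.

Lemma cdisc_box (r d : R) : r < d -> cdisc (0 : V) r `<=` box 0 d.
Proof.
move=> rd u /cdisc0 hu; apply: ord2P; rewrite mxE subr0; apply: le_lt_trans rd; apply: le_trans hu.
  exact: (norm_Re (zc u)).
exact: (norm_Im (zc u)).
Qed.

Lemma box_cdisc (d : R) u : box (0 : V) d u -> cabs (zc u) <= 2%:R * d.
Proof.
move=> bu; apply: le_trans (cabs_ReIm _) _.
have := bu 0; have := bu 1; rewrite /= !mxE !subr0; lra.
Qed.

(** For [n >= 3] the exponents are [e = floor((n-3)/2)] and [K = n - 3 - e >= e], so
    [deg S = K + e = n - 3]. Below that the zero polynomial is taken: degree 2 is the case of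
    vanishing potential. *)
Lemma degree_polynomial (t : nat -> R[i]) (C A : R) n : 0 < C -> 0 < A -> (forall j, cabs (t j) <= C * A ^+ j) ->
  exists S : {poly R[i]}, [/\ (size S <= n - 2)%N, (forall j, cabs S`_j <= 4%:R * C * A ^+ j),
    (forall j, (j < (n - 3)./2)%N -> S`_j = t j) &
    (3 <= n)%N -> exists z0 q e K, [/\ S = ('X - z0%:P) ^+ K * q, size q = e.+1, (e < K + 2)%N & (K + e + 3 = n)%N]].
Proof.
move=> C0 A0 ht; have [n3|n3] := leqP 3 n; last first.
  exists 0; split=> [|j|j|]; rewrite ?size_poly0 //.
    by rewrite coef0 cabs0 !mulr_ge0 ?exprn_ge0 ?ltW.
  by have -> : (n - 3 = 0)%N by apply/eqP; rewrite subn_eq0 ltnW.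
pose e := ((n - 3)./2)%N; pose K := (n - 3 - e)%N.
have en : (e <= n - 3)%N by rewrite /e -divn2 leq_div.
have ee : (e <= K)%N by rewrite /K /e leq_subRL // addnn -{2}(odd_double_half (n - 3)) leq_addl.
have [z0 [q [sq bq cq]]] := approx_poly K e C0 A0 ht.
exists (('X - z0%:P) ^+ K * q); split=> // [|_].
  rewrite size_monicM ?monic_exp ?monicXsubC //; last by rewrite -size_poly_eq0 sq.
  rewrite size_exp_XsubC sq /K; lia.
exists z0, q, e, K; split=> //; rewrite /K; lia.
Qed.

Lemma geometric_small (B ep : R) : 0 <= B -> 0 < ep -> exists N : nat, forall n, (N <= n)%N -> B * 2%:R^-1 ^+ n < ep.
Proof.
move=> B0 e0; exists (Num.bound (B / ep)) => n Nn.
have h : B / ep < n%:R.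
  apply: lt_le_trans (_ : (Num.bound (B / ep))%:R <= _); last by rewrite ler_nat.
  by apply: archi_boundP; rewrite divr_ge0 // ltW.
have h2 : (n%:R : R) < 2%:R ^+ n by rewrite -natrX ltr_nat ltn_expl.
rewrite exprVn ltr_pdivrMr ?exprn_gt0 // mulrC -ltr_pdivrMr //.
exact: lt_trans h h2.
Qed.

Lemma eucl_norm_le (v : 'rV[R]_3) (B : R) : (forall k, `|v 0 k| <= B) -> eucl_norm v <= 2%:R * B.
Proof.
move=> h; have B0 : 0 <= B := le_trans (normr_ge0 _) (h 0).
have s k : v 0 k ^+ 2 <= B ^+ 2 by rewrite -real_normK ?num_real // ler_sqr ?nnegrE.
rewrite -(@ler_pXn2r _ 2) ?nnegrE ?eucl_norm_ge0 ?mulr_ge0 // eucl_norm_sqr exprMn.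
have := s 0; have := s 1; have := s 2; have := sqr_ge0 B; lra.
Qed.

Lemma half_large N n : (2 * N + 5 <= n)%N -> (N <= (n - 3)./2)%N /\ (0 < (n - 3)./2)%N.
Proof. by rewrite half_gt0 geq_half_double -muln2; lia. Qed.

(** For [p, q, v] the values of [Phi, Phi', Phi''] at the point: the correction [s p] makes [a]
    isotropic, the vectors [a, q, p] get the pairing table that [weierstrass_data] asks for, and
    [2 a - s p] recovers [v]. *)
Lemma gram_data (p q v : 'I_3 -> R[i]) (s : R[i]) : \sum_k p k * p k = 0 -> \sum_k p k * q k = 0 ->
  \sum_k p k * v k = -1 -> \sum_k q k * v k = 0 -> \sum_k v k * v k = 2%:R * s ->
  let a k := (v k + s * p k) / 2%:R in
  [/\ \sum_k a k * a k = 0, \sum_k a k * q k = 0 & \sum_k a k * p k = - 2%:R^-1].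
Proof.
move=> E00 E01 E02 E12 E22 a; split.
- transitivity ((\sum_k v k * v k + 2%:R * s * (\sum_k p k * v k) + s ^+ 2 * (\sum_k p k * p k)) / 4%:R).
    rewrite !mulr_sumr -!big_split mulr_suml; apply: eq_bigr => k _ /=.
    by rewrite /a; field.
  by rewrite E22 E02 E00; field.
- transitivity ((\sum_k q k * v k + s * (\sum_k p k * q k)) / 2%:R).
    rewrite !mulr_sumr -!big_split mulr_suml; apply: eq_bigr => k _ /=.
    by rewrite /a; field.
  by rewrite E12 E01; field.
- transitivity ((\sum_k p k * v k + s * (\sum_k p k * p k)) / 2%:R).
    rewrite !mulr_sumr -!big_split mulr_suml; apply: eq_bigr => k _ /=.
    by rewrite /a; field.
  by rewrite E02 E00; field.
Qed.

Lemma canonical_approximants (Y : V -> 'rV[R]_3) (P : 'I_3 -> V -> R[i]) (d : R) : 0 < d ->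
  smooth_map_on (box 0 d) Y -> canonical_on (box 0 d) Y P ->
  exists (r : R) (Yn : nat -> V -> 'rV[R]_3) (Pn : nat -> 'I_3 -> V -> R[i]) (Sn : nat -> {poly R[i]}),
  [/\ 0 < r <= d,
      forall n, [/\ smooth_map_on (box 0 r) (Yn n), canonical_on (box 0 r) (Yn n) (Pn n),
        (forall u, potential (Pn n) u = (Sn n).[zc u]), (size (Sn n) <= n - 2)%N &
        (3 <= n)%N -> exists z0 q e K, [/\ Sn n = ('X - z0%:P) ^+ K * q, size q = e.+1, (e < K + 2)%N & (K + e + 3 = n)%N]] &
      forall ep : R, 0 < ep -> exists N : nat, forall n, (N <= n)%N -> forall u, box 0 r u -> eucl_norm (Yn n u - Y u) < ep].
Proof.
move=> d0 sY cY; set O := box 0 d; have oO : open O by exact: open_box_set.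
have O0 : O 0 by exact: box_center.
pose rho := d / 2%:R; have rho0 : 0 < rho by rewrite divr_gt0.
have rhod : rho < d by rewrite /rho; lra.
have rO := cdisc_box rhod.
pose s := potential P; have hs : hol O s := hol_potential oO cY.
have hP k : hol O (P k) by case: cY.
have [Ms Ms0 hMs] := hol_bounded_disc oO hs (ltW rho0) rO.
have MP k : exists B : R, 0 <= B /\ forall u, cdisc 0 rho u -> cabs (P k u) <= B.
  by have [B B0 hB] := hol_bounded_disc oO (hP k) (ltW rho0) rO; exists B.
have [M HM] := choice MP.
(* Taylor coefficients of the potential, bounded by [C A^j] through the Cauchy estimates; the 12 in
   [A] is theirs, and the 1 in [C] keeps it positive. *)
pose t j := dzn j s 0 / (j`!)%:R.
pose C := Ms + 1; pose A := 12%:R / rho.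
have C0 : 0 < C by rewrite /C; lra.
have A0 : 0 < A by rewrite divr_gt0.
have f0 j : (j`!)%:R != 0 :> R[i] by rewrite pnatr_eq0 -lt0n fact_gt0.
have ht j : cabs (t j) <= C * A ^+ j.
  have f0' : 0 < (j`!)%:R :> R by rewrite ltr0n fact_gt0.
  rewrite /t cabsM cabsV cabs_nat ler_pdivrMr //.
  apply: le_trans (cauchy_iter j oO hs rho0 Ms0 rO hMs) _.
  rewrite -mulrA mulrC [_ * Ms]mulrC; apply: ler_wpM2r; first exact: ltW.
  by apply: ler_wpM2r; [rewrite exprn_ge0 // ltW|rewrite /C; lra].
have [Sn HS] := choice (fun n => degree_polynomial n C0 A0 ht).
pose c k := P k 0; pose b k := dz (P k) 0; pose a k := (dz (dz (P k)) 0 + s 0 * P k 0) / 2%:R.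
have E00 : \sum_k P k 0 * P k 0 = 0 := vdot00 cY O0.
have E01 : \sum_k P k 0 * dz (P k) 0 = 0 := vdot01 oO cY O0.
have E02 : \sum_k P k 0 * dz (dz (P k)) 0 = -1 := vdot02 oO cY O0.
have E11 : \sum_k dz (P k) 0 * dz (P k) 0 = 1 := vdot11 cY O0.
have E12 : \sum_k dz (P k) 0 * dz (dz (P k)) 0 = 0 := vdot12 oO cY O0.
have E22 : \sum_k dz (dz (P k)) 0 * dz (dz (P k)) 0 = 2%:R * s 0.
  by rewrite /s /potential mulrCA mulfV ?mulr1 // pnatr_eq0.
have [aa ab ac] := gram_data E00 E01 E02 E12 E22.
have bc : \sum_k b k * c k = 0 by rewrite -[RHS]E01; apply: eq_bigr => k _; exact: mulrC.
have [Pn HPn] := choice (fun n => weierstrass_data (Sn n) aa ab E11 bc E00 ac).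
have [Yn HYn] := choice (fun n => weierstrass_primitive (Y 0) d0 (let: And5 h _ _ _ _ := HPn n in h)
   (let: And5 _ h _ _ _ := HPn n in proj1 h) (let: And5 _ h _ _ _ := HPn n in proj2 h)).
(* Small enough for [A r <= 1/2], [4 C r <= 1] and [r <= 1] at once; then [ode_bound] applies with
   [N = 2] and [B = 1] to all [n] simultaneously. *)
pose r := (1 + 2%:R * A + 4%:R * C)^-1.
have q0 : 0 < 1 + 2%:R * A + 4%:R * C by lra.
have r0 : 0 < r by rewrite invr_gt0.
have rq : r * (1 + 2%:R * A + 4%:R * C) = 1 by rewrite mulVf // gt_eqF.
have rA : 0 < r * A by rewrite mulr_gt0.
have rC : 0 < r * C by rewrite mulr_gt0.
have r1 : r <= 1 by move: rq rA rC; lra.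
have rA2 : A * r <= 2%:R^-1 by rewrite mulrC; move: rq rA rC; lra.
have rC1 : r * (4%:R * C) <= 1 by move: rq rA rC; lra.
have rrho : r <= rho.
  have : 12%:R * r <= 2%:R^-1 * rho.
    by rewrite -ler_pdivrMr // mulrAC.
  lra.
have pb n : (forall m, cabs (ode_seq (Sn n) 1 0 m) * r ^+ m <= 1) /\ (forall m, cabs (ode_seq (Sn n) 0 1 m) * r ^+ m <= 1).
  have [_ hS _ _] := HS n.
  have B1 j : cabs (Sn n)`_j * r ^+ j <= 4%:R * C * 2%:R^-1 ^+ j.
    apply: le_trans (_ : 4%:R * C * A ^+ j * r ^+ j <= _); first by apply: ler_wpM2r (hS j); rewrite exprn_ge0 // ltW.
    rewrite -mulrA -exprMn; apply: ler_wpM2l; first by rewrite mulr_ge0 // ltW.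
    by rewrite lerXn2r // ?nnegrE ?invr_ge0 // mulr_ge0 // ltW.
  have C4 : 0 <= 4%:R * C by rewrite mulr_ge0 // ltW.
  have B2 : r ^+ 2 * (4%:R * C) <= 2%:R.
    rewrite expr2 -mulrA; have : r * (r * (4%:R * C)) <= r * 1 by rewrite ler_pM2l.
    lra.
  split; apply: (ode_bound (leqnn 2) r0 C4 ler01 B1 B2) => k; case: k => [|[|//]] _.
  - by rewrite ode_seq0 cabs1 expr0 mulr1.
  - by rewrite ode_seq1 cabs0 mul0r ler01.
  - by rewrite ode_seq0 cabs0 mul0r ler01.
  - by rewrite ode_seq1 cabs1 expr1 mul1r.
pose rr := r / 2%:R; have rr0 : 0 < rr by rewrite divr_gt0.
have rrrho : rr <= rho by rewrite /rr; lra.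
have rrO : cdisc 0 rr `<=` O := subset_trans (cdisc_sub rrrho) rO.
pose B := \sum_k (4%:R * (cabs (c k) + cabs (b k) + cabs (a k)) + M k).
have Bk0 k : 0 <= 4%:R * (cabs (c k) + cabs (b k) + cabs (a k)) + M k.
  have [? _] := HM k; rewrite addr_ge0 // mulr_ge0 // !addr_ge0 ?cabs_ge0 //.
have B0 : 0 <= B by apply: sumr_ge0.
have hD n k : hol O (fun u => Pn n k u - P k u).
  by apply: (holB oO _ (hP k)); case: (HPn n) => h _ _ _ _; apply: hol_subset (h k).
have bD n k u : cdisc 0 rr u -> cabs (Pn n k u - P k u) <= B.
  move=> du; apply: le_trans (_ : 4%:R * (cabs (c k) + cabs (b k) + cabs (a k)) + M k <= _); last first.
    by rewrite /B (bigD1 k) //= lerDl; apply: sumr_ge0.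
  apply: le_trans (cabsB _ _) _; apply: lerD.
    have [_ _ _ _ h] := HPn n; have [p1 p2] := pb n.
    exact: (h r k u r0 r1 p1 p2 (iffLR (cdisc0 _ _) du)).
  have [_ h] := HM k; exact: h (cdisc_sub rrrho du).
(* The potentials share [e] Taylor coefficients, that is derivatives up to order [e - 1], which
   gives a jet of length [e + 2]. At least one common coefficient is required, because [S(0) = s(0)]
   is what matches the second derivatives. *)
have jet n k : (0 < (n - 3)./2)%N -> same_jet 0 ((n - 3)./2 + 2) (Pn n k) (P k).
  set e := (n - 3)./2 => e0; have [hPn [Pn0 Pn1] pot ini _] := HPn n.
  have [_ _ cS _] := HS n.
  have cYn : canonical_on O (Yn n) (Pn n) by case: (HYn n).
  have hS : hol O (fun u => (Sn n).[zc u]) := hol_horner oO (Sn n).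
  have potE : potential (Pn n) = fun u => (Sn n).[zc u] by apply/funext.
  have sj : same_jet 0 e (potential (Pn n)) s.
    move=> j je; rewrite potE dzn_horner0 (cS j je) /t mulrCA mulfV ?mulr1 //.
  have S0 : (Sn n).[0] = s 0 by have := sj 0%N e0; rewrite /= pot zc0.
  have [i0 i1 i2] := ini k.
  have j3 : same_jet 0 3 (Pn n k) (P k).
    case=> [_|[_|[_|j h]]]; [exact: i0|exact: i1| |by exfalso; move: h; rewrite !ltnS ltn0].
    transitivity (2%:R * a k - (Sn n).[0] * c k); first exact: i2.
    by rewrite S0 /a /c; transitivity (dz (dz (P k)) 0) => //; move: (dz (dz (P k)) 0) (s 0) (P k 0) => *; field.
  have -> : (e + 2 = e.-1 + 3)%N by move: e0; case: (e) => // m _; rewrite addSnnS.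
  have hpn : hol O (potential (Pn n)) := hol_potential oO cYn.
  have hPnO : hol O (Pn n k) by apply: hol_subset (hPn k).
  apply: (third_order_jet oO O0 hPnO (hP k) hpn hs _ _ j3).
  - by move=> u Ou; exact: (canonical_third oO k cYn Ou).
  - by move=> u Ou; exact: (canonical_third oO k cY Ou).
  - by rewrite prednK.
(* On the box of this radius [|z| <= 2 de], so the ratio [24 |z| / rr] of [vanishing_bound] is at
   most 1/2. *)
pose de := rr / 96%:R.
have de0 : 0 < de by rewrite divr_gt0.
have ded : de <= d by rewrite /de; lra.
have de1 : 2%:R * de <= 1 by rewrite /de /rr; lra.
have sub : box 0 de `<=` O := box_sub ded.
have est n k u : (0 < (n - 3)./2)%N -> box 0 de u -> cabs (Pn n k u - P k u) <= B * 2%:R^-1 ^+ (n - 3)./2.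
  move=> e0 bu; have [hPn _ _ _ _] := HPn n.
  have hPnO : hol O (Pn n k) by apply: hol_subset (hPn k).
  have du : cabs (zc u) <= 2%:R * de := box_cdisc bu.
  have du' : cdisc 0 (rr / 2%:R) u.
    by apply/cdisc0; apply: le_trans du _; rewrite /de; lra.
  have van j : (j < (n - 3)./2 + 2)%N -> dzn j (fun u => Pn n k u - P k u) 0 = 0.
    by move=> jj; rewrite (dzn_sub oO j hPnO (hP k) O0) (jet n k e0 j jj) subrr.
  apply: le_trans (vanishing_bound oO (hD n k) rr0 B0 rrO (bD n k) van du') _.
  apply: ler_wpM2l => //; rewrite zc0 subr0.
  have x0 : 0 <= 24%:R * cabs (zc u) / rr by rewrite !mulr_ge0 ?cabs_ge0 ?invr_ge0 // ltW.
  have x1 : 24%:R * cabs (zc u) / rr <= 2%:R^-1.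
    by rewrite ler_pdivrMr //; move: du; rewrite /de; lra.
  apply: le_trans (_ : 2%:R^-1 ^+ ((n - 3)./2 + 2) <= _).
    by rewrite lerXn2r // nnegrE invr_ge0.
  by apply: ler_wiXn2l; rewrite ?invr_ge0 ?invf_le1 ?ler1n // leq_addr.
exists de, Yn, Pn, Sn; split; first by rewrite de0.
  move=> n; have [sYn Y0 cYn] := HYn n; have [_ _ pot _ _] := HPn n; have [sz _ _ fac] := HS n.
  split=> // [j|].
    exact: smooth_subset sub (sYn j).
  by case: cYn => q1 q2 q3 q4; split=> [k|k u bu|u bu|u bu]; [exact: hol_subset (q1 k)|apply: q2; exact: sub|apply: q3; exact: sub|apply: q4; exact: sub].
move=> ep ep0; have B2 : 0 <= 2%:R * B by rewrite mulr_ge0.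
have [N HN] := geometric_small B2 ep0.
exists (2 * N + 5)%N => n Nn u bu.
have [Ne e0] := half_large Nn.
apply: le_lt_trans (HN _ Ne); rewrite -mulrA; apply: eucl_norm_le => k.
have [sYn Y0 cYn] := HYn n.
have dY v : box 0 de v -> differentiable (fun u => Y u 0 k) v.
  by move=> bv; exact: (smooth_differentiable oO (sY k) (sub _ bv)).
have dYn v : box 0 de v -> differentiable (fun u => Yn n u 0 k) v.
  by move=> bv; exact: (smooth_differentiable oO (sYn k) (sub _ bv)).
have b0 : box (0 : V) de 0 by exact: box_center.
(* The two immersions agree at the origin, so their difference is controlled by that of their
   gradients, whose components are real and imaginary parts of [Phi_n - Phi]. *)
have [x bx] := mvt_box (f := fun u => Yn n u 0 k - Y u 0 k) (fun v bv => differentiableB (dYn v bv) (dY v bv)) b0 bu.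
rewrite Y0 subrr subr0 !mxE !subr0 => ->.
rewrite !(partialB _ (dYn x bx) (dY x bx)).
case: cYn => _ pn _ _; case: (cY) => _ p _ _.
have [-> ->] := pn k x (sub _ bx); have [-> ->] := p k x (sub _ bx).
have b2 := est n k x e0 bx; set D := Pn n k x - P k x in b2.
have -> : Re (Pn n k x) - Re (P k x) = Re D by rewrite /D ReB.
have -> : - Im (Pn n k x) - - Im (P k x) = - Im D by rewrite /D ImB; ring.
have h0 := bu 0; have h1 := bu 1; rewrite !mxE !subr0 in h0 h1.
apply: le_trans (ler_normD _ _) _; rewrite !normrM normrN.
have hR := norm_Re D; have hI := norm_Im D.
apply: le_trans (_ : cabs D * de + cabs D * de <= _).
  by apply: lerD; apply: ler_pM => //; exact: ltW.
rewrite -mulrDr; have -> : de + de = 2%:R * de by ring.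
by apply: le_trans b2; rewrite -[leRHS]mulr1; apply: ler_wpM2l => //; exact: cabs_ge0.
Qed.
End Approximants.

(** * Restriction to a coordinate box, and the theorem *)

Section Subcharts.
Context {R : realType}.
Local Notation V := ('rV[R]_2).

Lemma open_preimage_in (T T' : topologicalType) (A : set T) (B : set T') (f : T -> T') : open A ->
  (forall x, A x -> {for x, continuous f}) -> open B -> open (A `&` f @^-1` B).
Proof.
move=> oA cf oB; rewrite openE => x [Ax Bx].
have n1 : nbhs x A by exact: open_nbhs_nbhs.
have n2 : nbhs x (f @^-1` B) by apply: (cf x Ax); exact: open_nbhs_nbhs.
exact: filterI n1 n2.
Qed.

Lemma smooth_map_continuous (O : set V) (F : V -> V) w : open O -> smooth_map_on O F -> O w -> {for w, continuous F}.
Proof.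
move=> oO sF Ow; apply: differentiable_continuous; apply: differentiable_row2 => k.
exact: (smooth_differentiable oO (sF k) Ow).
Qed.

Lemma connected_box (d : R) : 0 < d -> connected (box (0 : V) d).
Proof.
move=> d0.
have -> : box (0 : V) d = \bigcup_(u in box 0 d) ((fun t : R => t *: u) @` `[0, 1]).
  apply/seteqP; split=> [u bu|_ [u bu [t /= + <-]]].
    by exists u => //; exists 1; rewrite ?scale1r //= in_itv /= ler01 lexx.
  rewrite in_itv /= => /andP[t0 t1] i; rewrite mxE mxE subr0 normrM ger0_norm //.
  have := bu i; rewrite mxE subr0; apply: le_lt_trans; exact: ler_piMl.
apply: bigcup_connected.
  by exists 0 => u _; exists 0; rewrite ?scale0r //= in_itv /= lexx ler01.
move=> u _; apply: connected_continuous_connected.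
  by apply/connected_intervalP; exact: interval_is_interval.
apply: continuous_subspaceT => t; exact: scalel_continuous.
Qed.

Lemma canonical_eq (O : set V) (Y Z : V -> 'rV[R]_3) P : open O -> (forall u, O u -> Y u = Z u) ->
  canonical_on O Y P -> canonical_on O Z P.
Proof.
move=> oO YZ [h1 h2 h3 h4]; split=> // j u Ou; have [<- <-] := h2 j u Ou.
by split; apply: (eq_partial _ oO Ou) => v Ov; rewrite YZ.
Qed.

Variables (M : oriented_surface R) (c : chart R M) (w0 : V) (r de : R) (F T : V -> V).
Hypotheses (sub : box w0 r `<=` ccod c) (sF : smooth_map_on (box w0 r) F) (sT : smooth_map_on (box 0 de) T).
Hypotheses (TP : forall y, box 0 de y -> box w0 r (T y) /\ F (T y) = y)
  (FK : forall u, box w0 r u -> box 0 de (F u) -> T (F u) = u).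

Let ob : open (box w0 r). Proof. exact: open_box_set. Qed.
Let ob' : open (box (0 : V) de). Proof. exact: open_box_set. Qed.

Definition subdom : set M := cdom c `&` cmap c @^-1` (box w0 r `&` F @^-1` box 0 de).

Let subdom_open : open subdom.
Proof.
apply: open_preimage_in; [exact: cdom_open|exact: cmap_cts|].
by apply: open_preimage_in => // w bw; exact: smooth_map_continuous ob sF bw.
Qed.
Let submap_cod q : subdom q -> box 0 de (F (cmap c q)). Proof. by case=> _ []. Qed.
Let subinv_dom w : box 0 de w -> subdom (cinv c (T w)).
Proof.
move=> bw; have [bT FT] := TP bw; have cT := sub bT; split; first exact: cinv_dom.
by rewrite /preimage /= cinvK //; split=> //=; rewrite FT.
Qed.
Let submapK q : subdom q -> cinv c (T (F (cmap c q))) = q.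
Proof. by move=> [cq [bq dq]]; rewrite FK // cmapK. Qed.
Let subinvK w : box 0 de w -> F (cmap c (cinv c (T w))) = w.
Proof. by move=> /TP[/sub cT FT]; rewrite cinvK. Qed.
Let submap_cts q : subdom q -> {for q, continuous (fun q => F (cmap c q))}.
Proof. move=> [cq [bq dq]]; apply: continuous_comp; [exact: cmap_cts|exact: smooth_map_continuous ob sF bq]. Qed.
Let subinv_cts w : box 0 de w -> {for w, continuous (fun w => cinv c (T w))}.
Proof.
move=> bw; have [/sub cT _] := TP bw; apply: continuous_comp; [exact: smooth_map_continuous ob' sT bw|exact: cinv_cts].
Qed.

Definition subchart : chart R M := Chart subdom_open ob' submap_cod subinv_dom submapK subinvK submap_cts subinv_cts.

Lemma subchart_to : (forall u, box w0 r u -> 0 < jac_det F u) -> oriented_transition c subchart.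
Proof.
move=> JF; have oO : open (chart_part c subdom) by exact: open_chart_part.
have bO w : chart_part c subdom w -> box w0 r w by case=> cw [_ []]; rewrite /preimage /= cinvK.
have E w : chart_part c subdom w -> F w = transition c subchart w by case=> cw _; rewrite /transition /= cinvK.
split=> [j|w Ow].
  apply: (smooth_eq oO (f := fun w => F w 0 j)); last exact: smooth_subset bO (sF j).
  by move=> u Ou; rewrite E.
rewrite (_ : jacobian _ w = jacobian F w) ?jac_detE; first exact: JF (bO w Ow).
by apply/matrixP => i j; rewrite !jacobianE; apply: (eq_partial i oO Ow) => u Ou; rewrite E.
Qed.

Lemma subchart_from : (forall y, box 0 de y -> 0 < jac_det T y) -> oriented_transition subchart c.
Proof.
move=> JT; have oO : open (chart_part subchart (cdom c)) by apply: open_chart_part; exact: cdom_open.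
have bO w : chart_part subchart (cdom c) w -> box 0 de w by case.
have E w : chart_part subchart (cdom c) w -> T w = transition subchart c w.
  by case=> /TP[/sub cT _] _; rewrite /transition /= cinvK.
split=> [j|w Ow].
  apply: (smooth_eq oO (f := fun w => T w 0 j)); last exact: smooth_subset bO (sT j).
  by move=> u Ou; rewrite E.
rewrite (_ : jacobian _ w = jacobian T w) ?jac_detE; first exact: JT (bO w Ow).
by apply/matrixP => i j; rewrite !jacobianE; apply: (eq_partial i oO Ow) => u Ou; rewrite E.
Qed.

Lemma connected_subdom : 0 < de -> connected subdom.
Proof.
move=> de0; have -> : subdom = (fun w => cinv c (T w)) @` box 0 de.
  apply/seteqP; split=> [q Uq|_ [w bw <-]]; last exact: subinv_dom.
  by exists (F (cmap c q)); [exact: submap_cod|exact: submapK].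
apply: connected_continuous_connected (connected_box de0) _.
apply: continuous_in_subspaceT => w; rewrite inE; exact: subinv_cts.
Qed.

End Subcharts.

Theorem theorem1p2 (R : realType) (M : oriented_surface R)
    (X : M -> 'rV[R]_3) :
  minimal_immersion [set: M] X -> non_flat [set: M] X ->
  forall p : M, non_umbilic_locus [set: M] X p ->
  exists (U : set M) (Xs : nat -> M -> 'rV[R]_3),
    [/\ open U, U p, connected U,
        forall n, (2 <= n)%N ->
          minimal_immersion U (Xs n) /\ has_degree U (Xs n) n
      & converges_locally_uniformly U Xs X].
Proof.
move=> [iX mX] _ p [_ up].
set c0 := chart_at p; have [ac cp] := chart_at_atlas p.
set Y0 := in_chart X c0; set O := ccod c0.
have oO : open O by exact: ccod_open.
have [sY rY] := iX c0 ac.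
have {}sY : smooth_map_on O Y0 by move=> j; apply: smooth_subset (sY j) => w Ow; split.
have nY w : O w -> normal Y0 w != 0 by move=> Ow; apply: row_free_normal; apply: rY; split.
have tS w : O w -> \tr (shape_op Y0 w) = 0.
  move=> Ow; have td c : atlas c -> oriented_transition c c0 by move=> ca; exact: atlas_compat.
  have := mean_curvatureE openT td (iX c0 ac) (cinv_dom Ow) I.
  rewrite (mX _ I) cinvK // => /esym/eqP.
  by rewrite mulf_eq0 invr_eq0 pnatr_eq0 orbF => /eqP.
have Ow0 : O (cmap c0 p) by exact: cmap_cod.
have K0 : \det (shape_op Y0 (cmap c0 p)) != 0.
  by have /(umbilicP (mX p I)) := up; rewrite lt_neqAle => /andP[].
have [F [T [r [d [P [[r0 d0 bO F0] [sF sT] TP FK [JF JT cY]]]]]]] := minimal_canonical oO sY nY tS Ow0 K0.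
have sYT : smooth_map_on (box 0 d) (fun y => Y0 (T y)).
  have TO u : box 0 d u -> O (T u) by move=> /TP[bu _]; exact: bO.
  have obd : open (box (0 : 'rV[R]_2) d) by exact: open_box_set.
  by move=> j; exact: (smooth_comp obd oO (sY j) TO sT).
have [de [Yn [Pn [Sn [/andP[de0 ded] HY cv]]]]] := canonical_approximants d0 sYT cY.
have bd : box (0 : 'rV[R]_2) de `<=` box 0 d := box_sub ded.
have sT' : smooth_map_on (box 0 de) T by move=> j; exact: smooth_subset bd (sT j).
have TP' y : box 0 de y -> box (cmap c0 p) r (T y) /\ F (T y) = y by move=> /bd; exact: TP.
have FK' u : box (cmap c0 p) r u -> box 0 de (F u) -> T (F u) = u by move=> bu /bd; exact: FK.
(* One chart serves every [n]: its domain corresponds to the box on which all approximants are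
   defined, and it is canonical for each of them. *)
pose e := subchart bO sF sT' TP' FK'.
have tde : oriented_transition c0 e := subchart_to bO sF sT' TP' FK' JF.
have ted : oriented_transition e c0 := subchart_from bO sF sT' TP' FK' (fun y by' => JT y (bd y by')).
have ec : cdom e `<=` cdom c0 by move=> q [].
have Up : cdom e p by split=> //; split; [exact: box_center|rewrite /preimage /= F0; exact: box_center].
pose Xs n q := Yn n (cmap e q).
have ob : open (box (0 : 'rV[R]_2) de) by exact: open_box_set.
have E n u : box 0 de u -> Yn n u = in_chart (Xs n) e u.
  by move=> bu; rewrite /in_chart /Xs (cinvK (c := e)).
exists (cdom e), Xs; split.
- exact: cdom_open.
- exact: Up.
- exact: (connected_subdom bO sT' TP' FK' de0).
- move=> n n2; have [sn cn pot sz fac] := HY n.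
  have sn' : smooth_map_on (ccod e) (in_chart (Xs n) e).
    move=> j; apply: (smooth_eq ob (f := fun u => Yn n u 0 j)) (sn j) => u bu; by rewrite E.
  have cn' : canonical_on (ccod e) (in_chart (Xs n) e) (Pn n) := canonical_eq ob (E n) cn.
  have SE u : ccod e u -> potential (Pn n) u = (Sn n).[zc u] by move=> _; exact: pot.
  split; first exact: (canonical_minimal ec ac tde sn' cn').
  split=> //.
  + exists p; split=> //; apply/eqP; rewrite lt_eqF //.
    exact: (canonical_gauss_lt0 ec ac tde sn' cn' Up).
  + exact: (degree_condition_poly ec ac tde sn' cn' SE n2 sz).
  (* For [n = 2] there is no lower level to exclude; otherwise the factorisation of [Sn n] is
     available. *)
  + move=> m mn; have n3 : (3 <= n)%N by case/andP: (mn) => m2 /(leq_ltn_trans m2).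
    have [z0 [q [k [K [SnE sq kK KE]]]]] := fac n3.
    exact: (not_degree_condition ec ac tde ted sn' cn' SE SnE sq kK KE (ex_intro _ p Up) mn).
(* The convergence is uniform on the whole of [U], so any neighbourhood of [q] will do. *)
- move=> q Uq; exists setT; split; first exact: filterT.
  move=> ep ep0; have [N HN] := cv ep ep0; exists N => n Nn x [Ux _].
  have := HN n Nn (cmap e x) (cmap_cod Ux).
  have -> : Y0 (T (cmap e x)) = X x by rewrite -{2}(cmapK Ux).
  by [].
Qed.
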